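(* Let $0<k<3/2$, $Q(f)=f^{1+1/k}$ for $f\ge0$, and $M>0$. Then the minimizer of $\mathcal H_C$ over $\mathcal F_M$ is unique up to shifts in $x$: if $f_0,f_1\in\mathcal F_M$ both satisfy $\mathcal H_C(f_0)=\mathcal H_C(f_1)=\inf_{\mathcal F_M}\mathcal H_C$, then there is $a\in\mathbb R^3$ with $f_1(x,v)=f_0(x+a,v)$ for a.e. $(x,v)$.
   Context: For measurable $f=f(x,v)\ge0$ on $\mathbb R^3\times\mathbb R^3$: $\rho_f(x)=\int f(x,v)\,dv$, $U_f=-\rho_f*\frac1{|\cdot|}$, $E_{kin}(f)=\frac12\iint|v|^2f\,dv\,dx$, $E_{pot}(f)=-\frac1{8\pi}\int|\nabla U_f|^2dx$, $\mathcal C(f)=\iint Q(f(x,v))\,dv\,dx$, $\mathcal P(f)=\mathcal C(f)+E_{kin}(f)$, $\mathcal H_C(f)=\mathcal P(f)+E_{pot}(f)$. For $M>0$, $\mathcal F_M=\{f\in L^1(\mathbb R^6): f\ge0,\ \iint f\,dv\,dx=M,\ \mathcal P(f)<\infty\}$. *)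

(* Defs.v *)
From HB Require Import structures.
From mathcomp Require Import all_boot all_order all_algebra.
From mathcomp Require Import all_classical all_reals all_analysis.
Set Implicit Arguments. Unset Strict Implicit. Unset Printing Implicit Defensive.
Import Order.TTheory GRing.Theory Num.Theory.
Import numFieldNormedType.Exports.
Local Open Scope classical_set_scope.
Local Open Scope ring_scope.

Section VPdefs.
Variable R : realType.

(* R^3 as the product (R * R) * R, with the product Borel sigma-algebra,
   the product Lebesgue measure, and the product normed-module structure
   (used only to differentiate test functions). *)
Definition R3 := ((R * R) * R)%type.

Definition leb3 := ((@lebesgue_measure R \x @lebesgue_measure R)
                      \x @lebesgue_measure R)%E.
Definition leb6 := (leb3 \x leb3)%E.

Definition sqnorm3 (x : R3) : R := x.1.1 ^+ 2 + x.1.2 ^+ 2 + x.2 ^+ 2.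
Definition enorm3 (x : R3) : R := Num.sqrt (sqnorm3 x).

Definition e3 (i : 'I_3) : R3 :=
  (((i == 0 :> nat)%:R, (i == 1 :> nat)%:R), (i == 2 :> nat)%:R).

(* spatial density  rho_f(x) = int f(x,v) dv  (the real number; it is
   +oo only on a null set, where fine gives 0, which does not affect
   anything below) *)
Definition rho (f : R3 * R3 -> R) (x : R3) : R :=
  fine (\int[leb3]_v (f (x, v))%:E)%E.

Definition Upot (f : R3 * R3 -> R) (x : R3) : R :=
  - fine (\int[leb3]_y (rho f y * (enorm3 (x - y))^-1)%:E)%E.

Definition test_fun (phi : R3 -> R) : Prop :=
  [/\ forall x : R3, differentiable phi x,
      forall i : 'I_3, continuous (fun x => 'D_(e3 i) phi x) &
      compact (closure [set x | phi x != 0])].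

Definition loc_integrable3 (u : R3 -> R) : Prop :=
  measurable_fun setT u /\
  forall K : set R3, compact K -> (\int[leb3]_(x in K) `|u x|%:E < +oo)%E.

Definition weak_gradient (u : R3 -> R) (g : 'I_3 -> R3 -> R) : Prop :=
  loc_integrable3 u /\
  forall i : 'I_3, loc_integrable3 (g i) /\
    forall phi, test_fun phi ->
      (\int[leb3]_x (u x * 'D_(e3 i) phi x)%:E =
       - \int[leb3]_x (g i x * phi x)%:E)%E.

Definition Q (k : R) (s : R) : R := s `^ (1 + k^-1).

Definition Ekin (f : R3 * R3 -> R) : \bar R :=
  (2^-1)%:E * \int[leb6]_z (sqnorm3 z.2 * f z)%:E.

Definition Casimir (k : R) (f : R3 * R3 -> R) : \bar R :=
  \int[leb6]_z (Q k (f z))%:E.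

Definition Pfun (k : R) f : \bar R := (Casimir k f + Ekin f)%E.

(* E_pot(f) = -1/(8 pi) int |grad U_f|^2, grad U_f being the weak gradient
   (unique a.e., so the set below has at most one element; it is empty --
   and then E_pot = +oo -- only if U_f has no weak gradient) *)
Definition Epot (f : R3 * R3 -> R) : \bar R :=
  ereal_inf [set e | exists g, weak_gradient (Upot f) g /\
     e = (- (8 * pi)^-1)%:E *
         \int[leb3]_x (\sum_(i < 3) g i x ^+ 2)%:E]%E.

Definition HC (k : R) f : \bar R := (Pfun k f + Epot f)%E.

Definition FM (k M : R) : set (R3 * R3 -> R) :=
  [set f : R3 * R3 -> R | [/\ measurable_fun setT f, forall z, 0 <= f z,
      (\int[leb6]_z (f z)%:E = M%:E)%E & (Pfun k f < +oo)%E]].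

End VPdefs.

(* Main.v *)
Require Import Defs.
From HB Require Import structures.
From mathcomp Require Import all_boot all_order all_algebra.
From mathcomp Require Import all_classical all_reals all_analysis.
From mathcomp Require Import measurable_realfun interval_inference.
From mathcomp Require Import ring lra.
Import Order.TTheory GRing.Theory Num.Theory.
Import numFieldNormedType.Exports.
Set Implicit Arguments. Unset Strict Implicit. Unset Printing Implicit Defensive.
Local Open Scope classical_set_scope.
Local Open Scope ring_scope.

(**
The potential energy is [- lam] times the Coulomb double integral of the
density, for some constant [lam] whose value plays no role.  A minimizer obeys
the Euler-Lagrange relation [p f^(1/k) = (2 lam V - beta - |v|^2/2)_+], where
[p = 1 + 1/k] and [V] is the convolution of the density with [1/|x|].
Minimality among the dilations of [f] in [x] and in [v] gives two virial
identities; they force [lam > 0] and express [beta] through the minimal energy,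
so that [beta] is positive and common to all minimizers.

After a shift, each coordinate plane bisects the mass of [f].  Two-point
polarization at a plane through the origin preserves mass, Casimir and kinetic
energy, and strictly increases the Coulomb double integral unless it returns [f]
or its mirror image; if the plane bisects the mass, either case makes [f]
symmetric.  The three coordinate reflections thus make [f] even in [x], so every
plane through the origin bisects the mass, [f] is invariant under all reflections
and [V] is radial.  By Newton's theorem [V x = int rho(y) / max(|x|, |y|) dy],
where [rho = G(V)] for a locally Lipschitz [G] that vanishes at small values of
[V], that is, far out.  Both minimizers have mass [M], so subtracting [M / |x|]
bounds [|V0 - V1| (x)] by an integral of [|V0 - V1|] over [|y| > |x|]; a Gronwall
argument with an exponential weight yields [V0 = V1], hence [f0 = f1] up to the
shifts.
*)

(** The range of $k$ enters twice. First, [2 <= 3 * (p - 1)] places the density in $L^{4/3}$, which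
    makes the Coulomb integral of every admissible function finite. Second, the energy of a
    minimizer is $(2k-3)/6$ times [lam * pot f], with a nonzero factor, so the minimal energy
    determines [lam * pot f] and with it [beta].

    The constant [lam] comes from an invariance: the convolution of two Coulomb fields is unchanged
    by reflections and homogeneous of degree $-1$, hence a multiple of $1/|y-z|$. As [Epot] is an
    infimum over weak gradients, their uniqueness has to be established too.

    Polarization is preferred to symmetric decreasing rearrangement because its equality case
    concerns four points at a time: the signed differences of $f$ across the plane have the same
    sign at almost all pairs of points.

    Minimizers are determined up to null sets, while the radial argument wants pointwise identities.
    The potential, being an integral, has a value at every point and inherits each symmetry exactly;
    the density is then redefined from it. *)

(* A named copy of the product measure, to carry the sigma-finite structure. *)
Definition sprod d1 d2 (X : measurableType d1) (Y : measurableType d2) (R : realType)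
    (mX : {sigma_finite_measure set X -> \bar R})
    (mY : {sigma_finite_measure set Y -> \bar R}) := (mX \x mY)%E.

Section sprod_sigma_finite.
Local Open Scope ereal_scope.
Context d1 d2 (X : measurableType d1) (Y : measurableType d2) (R : realType).
Variables (mX : {sigma_finite_measure set X -> \bar R})
  (mY : {sigma_finite_measure set Y -> \bar R}).

Lemma sigma_finite_prod : sigma_finite setT (mX \x mY).
Proof.
have /sigma_finiteP[A [TA ndA Aoo]] := sigma_finiteT mX.
have /sigma_finiteP[B [TB ndB Boo]] := sigma_finiteT mY.
exists (fun n => A n `*` B n).
  apply/seteqP; split => // -[x y] _.
  have : setT x by []. rewrite TA => -[i _ Aix].
  have : setT y by []. rewrite TB => -[j _ Bjy].
  exists (maxn i j) => //; split => /=.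
    by move: Aix; apply/subsetPset/ndA/leq_maxl.
  by move: Bjy; apply/subsetPset/ndB/leq_maxr.
move=> n; have [mA Afin] := Aoo n; have [mB Bfin] := Boo n; split.
  exact: measurableX.
by rewrite product_measure1E// lte_mul_pinfty// ge0_fin_numE.
Qed.

HB.instance Definition _ := Measure.on (sprod mX mY).
HB.instance Definition _ := Measure_isSigmaFinite.Build _ _ _ (sprod mX mY)
  sigma_finite_prod.

End sprod_sigma_finite.

(** * Linear changes of variables *)

Section measure_scaling.
Local Open Scope ereal_scope.
Context {R : realType}.

(* T multiplies volumes by 1/c *)
Definition mscaling d1 d2 (X : measurableType d1) (Y : measurableType d2)
    (mX : set X -> \bar R) (mY : set Y -> \bar R) (c : R) (T : X -> Y) :=
  measurable_fun setT T /\
  forall F : Y -> \bar R, measurable_fun setT F -> (forall y, 0 <= F y) ->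
    \int[mX]_x F (T x) = c%:E * \int[mY]_y F y.

Lemma mscaling_measure d1 d2 (X : measurableType d1) (Y : measurableType d2)
    (mX : {measure set X -> \bar R}) (mY : {measure set Y -> \bar R}) (c : R)
    (T : X -> Y) : mscaling mX mY c T ->
  forall A, measurable A -> mX (T @^-1` A) = c%:E * mY A.
Proof.
move=> [mT h] A mA.
have := h (EFin \o \1_A); rewrite (@integral_indic _ _ _ mY setT) ?setIT// => <-.
- rewrite -(setIT (T @^-1` A)) -(@integral_indic _ _ _ mX setT)//.
  by rewrite -(setTI (_ @^-1` _)); exact: mT.
- by apply/measurable_EFinP; exact: measurable_indic.
- by move=> y; rewrite lee_fin.
Qed.

Lemma mscalingP d1 d2 (X : measurableType d1) (Y : measurableType d2)
    (mX : {measure set X -> \bar R}) (mY : {measure set Y -> \bar R}) (c : R)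
    (T : X -> Y) : (0 <= c)%R -> measurable_fun setT T ->
  (forall A, measurable A -> mX (T @^-1` A) = c%:E * mY A) ->
  mscaling mX mY c T.
Proof.
move=> c0 mT h; split => // F mF F0.
have := @ge0_integral_pushforward _ _ _ _ _ T mT mX setT F measurableT mF.
rewrite preimage_setT => <-; last by move=> y _; exact: F0.
have -> : c%:E * \int[mY]_y F y = \int[mscale (NngNum c0) mY]_y F y.
  by rewrite ge0_integral_mscale.
by apply: eq_measure_integral => A mA _; exact: h.
Qed.

Lemma mscaling_ae d1 d2 (X : measurableType d1) (Y : measurableType d2)
    (mX : {measure set X -> \bar R}) (mY : {measure set Y -> \bar R}) (c : R)
    (T : X -> Y) (P : Y -> Prop) : mscaling mX mY c T ->
  {ae mY, forall y, P y} -> {ae mX, forall x, P (T x)}.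
Proof.
move=> h [N [mN N0 PN]]; exists (T @^-1` N); split.
- by rewrite -(setTI (_ @^-1` _)); exact: h.1.
- by rewrite (mscaling_measure h)// N0 mule0.
- by move=> x /= Px; exact: PN.
Qed.

Lemma mscaling_comp d1 d2 d3 (X : measurableType d1) (Y : measurableType d2)
    (Z : measurableType d3)
    (mX : set X -> \bar R) (mY : set Y -> \bar R) (mZ : set Z -> \bar R)
    (a b : R) (S : X -> Y) (T : Y -> Z) :
  mscaling mX mY a S -> mscaling mY mZ b T -> mscaling mX mZ (a * b) (T \o S).
Proof.
move=> [mS hS] [mT hT]; split; first exact: measurableT_comp.
move=> F mF F0 /=; rewrite (hS (F \o T))//=; last exact: measurableT_comp.
by rewrite hT// muleA -EFinM.
Qed.

Lemma mscaling_id d1 (X : measurableType d1) (mX : set X -> \bar R) :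
  mscaling mX mX 1 id.
Proof. by split => // F _ _; rewrite mul1e. Qed.

Lemma mscaling_prod d1 d2 (X : measurableType d1) (Y : measurableType d2)
    (mX : {sigma_finite_measure set X -> \bar R})
    (mY : {sigma_finite_measure set Y -> \bar R}) (a b : R)
    (S : X -> X) (T : Y -> Y) : (0 <= a)%R -> (0 <= b)%R ->
  mscaling mX mX a S -> mscaling mY mY b T ->
  mscaling (mX \x mY) (mX \x mY) (a * b) (fun z => (S z.1, T z.2)).
Proof.
move=> a0 b0 [mS hS] [mT hT].
have mST : measurable_fun setT (fun z : X * Y => (S z.1, T z.2)).
  by apply/measurable_fun_pair; apply: measurableT_comp.
split => // F mF F0.
rewrite fubini_tonelli1//=; last exact: (measurableT_comp mF).
rewrite (fubini_tonelli1 _ mF)//=.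
rewrite /fubini_F /=.
under eq_integral.
  move=> x _.
  rewrite (hT (fun y => F (S x, y)))//; last first.
    exact: (measurableT_comp mF).
  over.
have mG := @measurable_fun_fubini_tonelli_F _ _ _ _ _ mY F mF F0.
have mGS : measurable_fun setT (fun x => \int[mY]_y F (S x, y)).
  exact: (measurableT_comp mG mS).
rewrite (ge0_integralZl_EFin mX measurableT _ mGS b0); last by move=> x _; exact: integral_ge0.
rewrite (hS (fun x => \int[mY]_y F (x, y)))//; last first.
  by move=> x; exact: integral_ge0.
by rewrite muleA -EFinM mulrC.
Qed.

Lemma mscaling_swap d1 d2 (X : measurableType d1) (Y : measurableType d2)
    (mX : {sigma_finite_measure set X -> \bar R})
    (mY : {sigma_finite_measure set Y -> \bar R}) :
  mscaling (mX \x mY) (mY \x mX) 1 (fun z => (z.2, z.1)).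
Proof.
have mS : measurable_fun setT (fun z : X * Y => (z.2, z.1)).
  by apply/measurable_fun_pair.
split => // F mF F0; rewrite mul1e fubini_tonelli2//=.
  by rewrite (fubini_tonelli1 _ mF).
exact: (measurableT_comp mF).
Qed.

Lemma mscaling_integrable d1 d2 (X : measurableType d1) (Y : measurableType d2)
    (mX : {measure set X -> \bar R}) (mY : {measure set Y -> \bar R}) (c : R)
    (T : X -> Y) (F : Y -> \bar R) : (0 <= c)%R ->
  mscaling mX mY c T -> mY.-integrable setT F ->
  mX.-integrable setT (F \o T) /\ \int[mX]_x F (T x) = c%:E * \int[mY]_y F y.
Proof.
move=> c0 [mT h] iF; have mF := measurable_int _ iF.
split.
  apply/integrableP; split; first exact: measurableT_comp.
  rewrite [X in X < _](h (abse \o F))//=; last exact: measurableT_comp.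
  by apply: lte_mul_pinfty; rewrite ?lee_fin//; case/integrableP : iF.
rewrite [in LHS]integralE [in RHS]integralE.
have -> : \int[mX]_x (fun x => F (T x))^\+ x = c%:E * \int[mY]_x F^\+ x.
  rewrite -(h (F^\+) (measurable_funepos mF) (funepos_ge0 F)).
  by apply: eq_integral => x _; rewrite (funepos_comp F T).
have -> : \int[mX]_x (fun x => F (T x))^\- x = c%:E * \int[mY]_x F^\- x.
  rewrite -(h (F^\-) (measurable_funeneg mF) (funeneg_ge0 F)).
  by apply: eq_integral => x _; rewrite (funeneg_comp F T).
rewrite [RHS]muleBr//.
by rewrite fin_num_adde_defl// fin_numN integrable_neg_fin_num.
Qed.

Lemma mscaling_swap23 d1 d2 d3 (X : measurableType d1) (Y : measurableType d2)
    (Z : measurableType d3)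
    (mX : {sigma_finite_measure set X -> \bar R})
    (mY : {sigma_finite_measure set Y -> \bar R})
    (mZ : {sigma_finite_measure set Z -> \bar R}) :
  mscaling ((mX \x mY) \x mZ) ((mX \x mZ) \x mY) 1
    (fun x => ((x.1.1, x.2), x.1.2)).
Proof.
have mT : measurable_fun setT (fun x : X * Y * Z => ((x.1.1, x.2), x.1.2)).
  apply/measurable_fun_pair; first apply/measurable_fun_pair => //.
  - exact: measurableT_comp measurable_fst measurable_fst.
  - exact: measurableT_comp measurable_snd measurable_fst.
split => // F mF F0; rewrite mul1e.
have mFT := measurableT_comp mF mT.
have F0' x : 0 <= (F \o (fun x : X * Y * Z => ((x.1.1, x.2), x.1.2))) x by exact: F0.
pose mXY := sprod mX mY.
pose mXZ := sprod mX mZ.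
have mG1 := @measurable_fun_fubini_tonelli_F _ _ _ _ _ mZ _ mFT F0'.
have mG2 := @measurable_fun_fubini_tonelli_F _ _ _ _ _ mY _ mF F0.
transitivity (\int[mXY]_z \int[mZ]_t F ((z.1, t), z.2)).
  exact: (@fubini_tonelli1 _ _ _ _ _ mXY mZ _ mFT F0').
transitivity (\int[mX]_x \int[mY]_y \int[mZ]_t F ((x, t), y)).
  by apply: (@fubini_tonelli1 _ _ _ _ _ mX mY _ mG1) => z; exact: integral_ge0.
transitivity (\int[mXZ]_z \int[mY]_t F (z, t)); last first.
  exact/esym/(@fubini_tonelli1 _ _ _ _ _ mXZ mY _ mF F0).
transitivity (\int[mX]_x \int[mZ]_y \int[mY]_t F ((x, y), t)); last first.
  by apply/esym/(@fubini_tonelli1 _ _ _ _ _ mX mZ _ mG2) => z; exact: integral_ge0.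
apply: eq_integral => x _.
have mH : measurable_fun setT (fun z : Y * Z => F ((x, z.2), z.1)).
  apply: (measurableT_comp mF); apply/measurable_fun_pair => //.
  exact/measurable_fun_pair.
exact: (@fubini_tonelli _ _ _ _ _ mY mZ _ mH (fun z => F0 _)).
Qed.

Notation mu := (@lebesgue_measure R).

(** Uniqueness of Lebesgue measure: [|a|] times the image measure has the right value on half-open
    intervals. For negative [a] the preimage of such an interval is open at the other end, with the
    same length. *)
Lemma mscaling_affine (a b : R) : a != 0%R ->
  mscaling mu mu `|a|^-1 (fun x : R => a * x + b)%R.
Proof.
move=> a0.
have mT : measurable_fun setT (fun x : measurableTypeR R => a * x + b : measurableTypeR R)%R.
  apply: measurable_funD => //; exact: measurable_funM.
have na : (0 <= `|a|)%R by [].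
have ha0 : (0 < `|a|)%R by rewrite normr_gt0.
apply: mscalingP => //.
move=> A mA.
have h := @lebesgue_measure_unique R (mscale (NngNum na) (pushforward mu (fun x : measurableTypeR R => a * x + b : measurableTypeR R)%R)).
have hA : mu A = mscale (NngNum na) (pushforward mu (fun x : measurableTypeR R => a * x + b : measurableTypeR R)%R) A; last first.
  rewrite -[X in _ = _ * X]/(mu A) (hA mT).
  by rewrite /mscale/= /pushforward muleA -EFinM mulVf ?gt_eqF// mul1e.
move=> mT'; apply: (h mT') => //.
  move=> _ [[x y]] _ <-.
  rewrite -[RHS]/(`|a|%:E * mu ((fun x0 => a * x0 + b)%R @^-1` [set` `]x, y]])).
  rewrite lebesgue_measure_itv/= lte_fin.
  have [a1|a1] := ltP 0%R a.
    have -> : (fun x0 => a * x0 + b)%R @^-1` [set` `]x, y]] = [set` `]((x - b) / a)%R, ((y - b) / a)%R]].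
      by apply/seteqP; split => t /=; rewrite !in_itv/= ler_pdivlMr// ltr_pdivrMr// ltrBlDr lerBrDr (mulrC t).
    rewrite lebesgue_measure_itv/= lte_fin ltr_pM2r ?invr_gt0// ltrD2r.
    case: ltP => xy; last by rewrite mule0.
    by rewrite -EFinB -EFinM (gtr0_norm a1); congr EFin; field.
  have {}a1 : (a < 0)%R by rewrite lt_neqAle a0.
  have -> : (fun x0 => a * x0 + b)%R @^-1` [set` `]x, y]] = [set` `[((y - b) / a)%R, ((x - b) / a)%R[].
    apply/seteqP; split => t /=; rewrite !in_itv/= ler_ndivrMr// ltr_ndivlMr// ltrBlDr lerBrDr (mulrC t) andbC//.
  rewrite lebesgue_measure_itv/= lte_fin ltr_nM2r ?invr_lt0// ltrD2r.
  case: ltP => xy; last by rewrite mule0.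
  by rewrite -EFinB -EFinM (ltr0_norm a1); congr EFin; field.
Qed.

End measure_scaling.

HB.instance Definition _ (R : realType) := Measure.on (@leb3 R).
HB.instance Definition _ (R : realType) := Measure_isSigmaFinite.Build _ _ _ (@leb3 R)
  (sigma_finite_prod (sprod (@lebesgue_measure R) (@lebesgue_measure R)) (@lebesgue_measure R)).
HB.instance Definition _ (R : realType) := Measure.on (@leb6 R).
HB.instance Definition _ (R : realType) := Measure_isSigmaFinite.Build _ _ _ (@leb6 R)
  (sigma_finite_prod (@leb3 R) (@leb3 R)).

Section euclidean_maps.
Local Open Scope ereal_scope.
Context {R : realType}.
Notation mu := (@lebesgue_measure R).
Notation mu2 := (mu \x mu).
Notation L3 := (@leb3 R).
Notation L6 := (@leb6 R).

(* Each substitution below is one-dimensional and affine. *)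
Lemma mscaling_reflection2 (a b : R) : (a ^+ 2 + b ^+ 2 = 1)%R ->
  mscaling mu2 mu2 1 (fun x : R * R =>
    (x.1 - 2 * a * (a * x.1 + b * x.2), x.2 - 2 * b * (a * x.1 + b * x.2))%R).
Proof.
(* [C] and [S] are the cosine and the sine of a double angle; the reflection has the symmetric
   matrix with rows $(C,S)$ and $(S,-C)$. *)
move=> ab1; pose C := (1 - 2 * a ^+ 2)%R; pose S := (- 2 * a * b)%R.
have b2 : (b ^+ 2 = 1 - a ^+ 2)%R by rewrite -ab1 addrC addKr.
have CS1 : (C ^+ 2 + S ^+ 2 = 1)%R by rewrite /C /S !exprMn b2; ring.
have -> : (fun x : R * R =>
    (x.1 - 2 * a * (a * x.1 + b * x.2), x.2 - 2 * b * (a * x.1 + b * x.2))%R) =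
    (fun x : R * R => (C * x.1 + S * x.2, S * x.1 - C * x.2)%R).
  apply/funext => -[x y] /=; congr pair; rewrite /C /S; first by ring.
  have -> : (2 * b * (a * x + b * y) = 2 * a * b * x + 2 * b ^+ 2 * y)%R by ring.
  by rewrite b2; ring.
move: CS1; move: C S => C S CS1.
have mT : measurable_fun setT (fun x : R * R => (C * x.1 + S * x.2, S * x.1 - C * x.2)%R).
  apply/measurable_fun_pair.
    by apply: measurable_funD; apply: measurable_funM.
  by apply: measurable_funB; apply: measurable_funM.
(* If [S] vanishes the map is a change of signs of the coordinates; otherwise it is possible to
   divide by [S]. *)
have [S0|S0] := eqVneq S 0%R.
  have C0 : C != 0%R.
    by apply/eqP => C0; move: CS1; rewrite S0 C0 expr0n/= addr0 => /eqP; rewrite eq_sym oner_eq0.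
  have nC : `|C|%R = 1%R.
    apply/eqP; rewrite -(@eqrXn2 _ 2)// real_normK ?num_real// expr1n; apply/eqP.
    by move: CS1; rewrite S0 expr0n/= addr0.
  have := @mscaling_prod R _ _ _ _ mu mu _ _ _ _ _ _ (mscaling_affine 0 C0) (@mscaling_affine R (- C) 0 _).
  rewrite normrN nC invr1 => /(_ ler01 ler01); rewrite oppr_eq0 => /(_ C0).
  rewrite mulr1; congr (mscaling _ _ _ _).
  by apply/funext => -[x y] /=; rewrite S0 !mul0r !addr0 add0r mulNr.
split => // F mF F0.
rewrite mul1e (fubini_tonelli1 _ mF F0).
rewrite (@fubini_tonelli1 _ _ _ _ _ mu mu _ (measurableT_comp mF mT) (fun z => F0 _)).
rewrite /fubini_F/=.
have nS : (0 < `|S|)%R by rewrite normr_gt0.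
(* For fixed [x] the new variable is $u=Cx+Sy$; because $C^2+S^2=1$, the second coordinate $Sx-Cy$
   equals $(x-Cu)/S$. *)
transitivity (\int[mu]_x \int[mu]_u (`|S|^-1%:E * F (u, (x - C * u) / S)%R)).
  apply: eq_integral => x _.
  have [_ h] := mscaling_affine (C * x)%R S0.
  have mH : measurable_fun setT (fun u : R => F (u, (x - C * u) / S)%R).
    apply: (measurableT_comp mF); apply/measurable_fun_pair => //.
    by apply: measurable_funM => //; apply: measurable_funB => //; apply: measurable_funM.
  rewrite ge0_integralZl//= ?lee_fin ?invr_ge0//.
  rewrite -[X in X * _]/(`|S|^-1%:E) -(h (fun u : R => F (u, (x - C * u) / S)%R))//.
  apply: eq_integral => y _; congr F; congr pair; first by rewrite addrC.
  apply: (mulIf S0); rewrite divfK//.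
  have S2 : (S ^+ 2 = 1 - C ^+ 2)%R by rewrite -CS1 addrC addKr.
  have -> : ((S * x - C * y) * S = S ^+ 2 * x - C * y * S)%R by ring.
  by rewrite S2; ring.
(* With the order of integration exchanged, the substitution $w=(x-Cu)/S$ in [x] produces the factor
   $|S|$ that cancels the first one. *)
rewrite (@fubini_tonelli _ _ _ _ _ mu mu (fun z : R * R => `|S|^-1%:E * F (z.2, (z.1 - C * z.2) / S)%R))//=; last 2 first.
- apply: emeasurable_funM => //; apply: (measurableT_comp mF).
  apply/measurable_fun_pair => //.
  by apply: measurable_funM => //; apply: measurable_funB => //; apply: measurable_funM.
- by move=> z; rewrite mule_ge0// lee_fin invr_ge0.
apply: eq_integral => u _.
have mFu : measurable_fun setT (fun w : R => F (u, w)) by exact: (measurableT_comp mF).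
have S1 : S^-1%R != 0%R by rewrite invr_eq0.
have [_ h] := mscaling_affine (- (C * u) / S)%R S1.
have := h (fun w => F (u, w)) mFu (fun w => F0 _).
rewrite normfV invrK => {}h.
under eq_integral => x _ do rewrite mulrBl -mulNr (mulrC x).
rewrite ge0_integralZl//= ?lee_fin ?invr_ge0//; last first.
  by apply: (measurableT_comp mFu); apply: measurable_funD.
by rewrite h muleA -EFinM mulVf ?gt_eqF// mul1e.
Qed.

Lemma mscaling_leb3_affine (a : R) (b : R3 R) : (0 < a)%R ->
  mscaling L3 L3 (a ^- 3) (fun x => ((a * x.1.1 + b.1.1, a * x.1.2 + b.1.2), a * x.2 + b.2)%R).
Proof.
move=> a0; have an0 : a != 0%R by rewrite gt_eqF.
have i0 : (0 <= `|a|^-1)%R by rewrite invr_ge0.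
have h2 := @mscaling_prod R _ _ _ _ mu mu _ _ _ _ i0 i0 (mscaling_affine b.1.1 an0) (mscaling_affine b.1.2 an0).
have := @mscaling_prod R _ _ _ _ (sprod mu mu) mu _ _ _ _ (mulr_ge0 i0 i0) i0 h2 (mscaling_affine b.2 an0).
by rewrite gtr0_norm// -!exprVn !exprS expr0 mulr1 -mulrA.
Qed.

Lemma mscaling_leb3_translation (b : R3 R) : mscaling L3 L3 1 (fun x => x + b)%R.
Proof.
have := mscaling_leb3_affine b ltr01; rewrite expr1n invr1.
by congr (mscaling _ _ _ _); apply/funext => -[[x y] z] /=; rewrite !mul1r.
Qed.

Lemma mscaling_leb3_flip (s : R3 R) : `|s.1.1|%R = 1%R -> `|s.1.2|%R = 1%R -> `|s.2|%R = 1%R ->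
  mscaling L3 L3 1 (fun x => ((s.1.1 * x.1.1, s.1.2 * x.1.2), s.2 * x.2)%R).
Proof.
move=> s1 s2 s3.
have n0 (x : R) : `|x|%R = 1%R -> x != 0%R by rewrite -normr_eq0 => ->; rewrite oner_eq0.
have h1 := mscaling_affine 0 (n0 _ s1).
have h2 := mscaling_affine 0 (n0 _ s2).
have h3 := mscaling_affine 0 (n0 _ s3).
rewrite s1 s2 s3 !invr1 in h1 h2 h3.
have h4 := @mscaling_prod R _ _ _ _ mu mu _ _ _ _ ler01 ler01 h1 h2.
rewrite mulr1 in h4.
have := @mscaling_prod R _ _ _ _ (sprod mu mu) mu _ _ _ _ ler01 ler01 h4 h3.
rewrite mulr1; congr (mscaling _ _ _ _).
by apply/funext => -[[x y] z] /=; rewrite !addr0.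
Qed.

Lemma mscaling_leb3_swap23 : mscaling L3 L3 1 (fun x => ((x.1.1, x.2), x.1.2)).
Proof. exact: (mscaling_swap23 mu mu mu). Qed.

Lemma mscaling_leb3_swap12 : mscaling L3 L3 1 (fun x => ((x.1.2, x.1.1), x.2)).
Proof.
have := @mscaling_prod R _ _ _ _ (sprod mu mu) mu _ _ _ _ ler01 ler01 (mscaling_swap mu mu) (mscaling_id mu).
by rewrite mulr1.
Qed.

(** For [a ^+ 2 + b ^+ 2 = 1], the reflection in the plane orthogonal to [((a, b), 0)]. Together
    with [refl13] these reflections reach every direction, so that each computation stays
    two-dimensional. *)
Definition refl12 (a b : R) (x : R3 R) : R3 R := let l := (a * x.1.1 + b * x.1.2)%R in
  (x.1.1 - 2 * a * l, x.1.2 - 2 * b * l, x.2)%R.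

Definition refl13 (a b : R) (x : R3 R) : R3 R := let l := (a * x.1.1 + b * x.2)%R in
  (x.1.1 - 2 * a * l, x.1.2, x.2 - 2 * b * l)%R.

Lemma mscaling_leb3_refl12 (a b : R) : (a ^+ 2 + b ^+ 2 = 1)%R ->
  mscaling L3 L3 1 (refl12 a b).
Proof.
move=> ab1.
have := @mscaling_prod R _ _ _ _ (sprod mu mu) mu _ _ _ _ ler01 ler01 (mscaling_reflection2 ab1) (mscaling_id mu).
by rewrite mulr1.
Qed.

Lemma mscaling_leb3_refl13 (a b : R) : (a ^+ 2 + b ^+ 2 = 1)%R ->
  mscaling L3 L3 1 (refl13 a b).
Proof.
move=> ab1.
have h := mscaling_comp mscaling_leb3_swap23 (mscaling_leb3_refl12 ab1).
by have := mscaling_comp h mscaling_leb3_swap23; rewrite !mulr1.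
Qed.

Lemma mscaling_leb6 (c : R) (T : R3 R -> R3 R) : (0 <= c)%R -> mscaling L3 L3 c T ->
  mscaling L6 L6 c (fun z => (T z.1, z.2)).
Proof.
move=> c0 h.
have := @mscaling_prod R _ _ _ _ L3 L3 _ _ _ _ c0 ler01 h (mscaling_id L3).
by rewrite mulr1.
Qed.

Lemma sqnorm3_ge0 (x : R3 R) : (0 <= sqnorm3 x)%R.
Proof. by rewrite /sqnorm3 !addr_ge0// sqr_ge0. Qed.

Lemma sqnorm3_eq0 (x : R3 R) : (sqnorm3 x == 0)%R = (x == 0%R).
Proof.
apply/eqP/eqP => [|->]; last by rewrite /sqnorm3/= !expr0n/= !addr0.
rewrite /sqnorm3; case: x => -[a b] c /= h.
have ha := sqr_ge0 a; have hb := sqr_ge0 b; have hc := sqr_ge0 c.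
have a0 : (a ^+ 2 = 0)%R by lra.
have b0 : (b ^+ 2 = 0)%R by lra.
have c0 : (c ^+ 2 = 0)%R by lra.
by move/eqP: a0; move/eqP: b0; move/eqP: c0; rewrite !sqrf_eq0 => /eqP -> /eqP -> /eqP ->.
Qed.

Lemma enorm3_sqr (x : R3 R) : (enorm3 x ^+ 2 = sqnorm3 x)%R.
Proof. by rewrite sqr_sqrtr// sqnorm3_ge0. Qed.

Lemma enorm3_ge0 (x : R3 R) : (0 <= enorm3 x)%R.
Proof. exact: sqrtr_ge0. Qed.

Lemma enorm3_gt0 (x : R3 R) : (0 < enorm3 x)%R = (x != 0%R).
Proof. by rewrite sqrtr_gt0 lt_neqAle sqnorm3_ge0 andbT eq_sym sqnorm3_eq0. Qed.

Lemma measurable_sqnorm3 : measurable_fun setT (@sqnorm3 R).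
Proof.
by apply: measurable_funD; [apply: measurable_funD|]; apply: measurable_funX => //; apply: measurableT_comp.
Qed.

Lemma measurable_sqrtr : measurable_fun setT (@Num.sqrt R).
Proof. by apply: continuous_measurable_fun; exact: sqrt_continuous. Qed.

(** The inverse takes the value [0] at [0] and is not continuous there; it is therefore written with
    [powR], and the factor [x] makes both expressions vanish at the origin. *)
Lemma measurable_invr : measurable_fun setT (@GRing.inv R).
Proof.
have -> : (@GRing.inv R) = (fun x => x * (`|x| `^ (-1)) ^+ 2)%R.
  apply/funext => x; case: (eqVneq x 0%R) => [->|x0]; first by rewrite mul0r invr0.
  by rewrite powR_inv1// exprVn real_normK ?num_real//; field.
apply: measurable_funM => //; apply: measurable_funX.
by apply: (measurableT_comp (measurable_powR _)); exact: normr_measurable.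
Qed.

Lemma measurable_enorm3 : measurable_fun setT (@enorm3 R).
Proof. by apply: (measurableT_comp measurable_sqrtr); exact: measurable_sqnorm3. Qed.

End euclidean_maps.

(** * Radial integrals and Newton's theorem *)

Section radial_integrals.
Local Open Scope ereal_scope.
Context {R : realType}.
Notation mu := (@lebesgue_measure R).
Notation mu2 := (mu \x mu).
Notation L3 := (@leb3 R).

Definition disc_area : R := fine (mu2 [set z : R * R | z.1 ^+ 2 + z.2 ^+ 2 <= 1]%R).

Let mdisc (t : R) : measurable [set z : R * R | z.1 ^+ 2 + z.2 ^+ 2 <= t]%R.
Proof.
rewrite -[X in measurable X]setTI; apply: measurable_fun_ler => //.
by apply: measurable_funD; apply: measurable_funX.
Qed.

Lemma disc_area_fin : mu2 [set z : R * R | z.1 ^+ 2 + z.2 ^+ 2 <= 1]%R = disc_area%:E.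
Proof.
rewrite /disc_area fineK// ge0_fin_numE//.
have mI : measurable (`[(-1)%R, 1%R] : set R) by exact: measurable_itv.
apply: (@le_lt_trans _ _ (mu2 (`[(-1)%R, 1%R] `*` `[(-1)%R, 1%R] : set (R * R)))).
  apply: (@le_measure _ _ _ (sprod mu mu)); rewrite ?inE; [exact: mdisc|exact: measurableX|].
  move=> -[x y] /= xy1; rewrite !in_itv/= -!ler_norml; split.
    by rewrite -(@ler_pXn2r _ 2) ?nnegrE// real_normK ?num_real// expr1n; have := sqr_ge0 y; lra.
  by rewrite -(@ler_pXn2r _ 2) ?nnegrE// real_normK ?num_real// expr1n; have := sqr_ge0 x; lra.
have -> : mu2 (`[(-1)%R, 1%R] `*` `[(-1)%R, 1%R] : set (R * R)) = mu `[(-1)%R, 1%R] * mu `[(-1)%R, 1%R].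
  exact: product_measure1E.
rewrite lebesgue_measure_itv/=.
by case: ifPn => _; rewrite -?EFinB -?EFinM ltry.
Qed.

Lemma disc_area_gt0 : (0 < disc_area)%R.
Proof.
rewrite -lte_fin -disc_area_fin.
have mI : measurable (`[0%R, 2^-1%R] : set R) by exact: measurable_itv.
apply: (@lt_le_trans _ _ (mu2 (`[0%R, 2^-1%R] `*` `[0%R, 2^-1%R] : set (R * R)))).
  have -> : mu2 (`[0%R, 2^-1%R] `*` `[0%R, 2^-1%R] : set (R * R)) = mu `[0%R, 2^-1%R] * mu `[0%R, 2^-1%R].
    exact: product_measure1E.
  rewrite lebesgue_measure_itv/= lte_fin invr_gt0 ltr0n.
  by rewrite -EFinB -EFinM lte_fin subr0; lra.
apply: (@le_measure _ _ _ (sprod mu mu)); rewrite ?inE; [exact: measurableX|exact: mdisc|].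
by move=> -[x y] /=; rewrite !in_itv/= => -[/andP[x0 x1] /andP[y0 y1]]; nra.
Qed.

Lemma disc_measure (t : R) : (0 < t)%R ->
  mu2 [set z : R * R | z.1 ^+ 2 + z.2 ^+ 2 <= t]%R = (disc_area * t)%:E.
Proof.
move=> t0; pose r := (Num.sqrt t)^-1%R.
have s0 : (0 < Num.sqrt t)%R by rewrite sqrtr_gt0.
have r0 : (0 < r)%R by rewrite invr_gt0.
have rn0 : r != 0%R by rewrite gt_eqF.
have i0 : (0 <= `|r|^-1)%R by rewrite invr_ge0.
have h := @mscaling_prod R _ _ _ _ mu mu _ _ _ _ i0 i0 (mscaling_affine 0 rn0) (mscaling_affine 0 rn0).
have := @mscaling_measure R _ _ _ _ (sprod mu mu) (sprod mu mu) _ _ h _ (mdisc 1).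
rewrite -[X in _ = _ * X]/(mu2 _) disc_area_fin -EFinM.
rewrite (gtr0_norm r0) /r invrK -expr2 sqr_sqrtr ?ltW// mulrC => <-.
congr (mu2 _); apply/seteqP; split => -[x y] /=; rewrite !addr0 !exprMn -mulrDr exprVn (sqr_sqrtr (ltW t0)) => xy.
  by rewrite mulrC ler_pdivrMr// mul1r.
by move: xy; rewrite mulrC ler_pdivrMr// mul1r.
Qed.

Lemma disc_measure_max (t : R) :
  mu2 [set z : R * R | z.1 ^+ 2 + z.2 ^+ 2 <= t]%R = (disc_area * Num.max t 0)%:E.
Proof.
have [t0|t0] := ltP 0%R t; first by rewrite disc_measure.
rewrite mulr0; apply/eqP; rewrite eq_le measure_ge0 andbT.
have -> : 0%:E = mu2 ([set 0%R] `*` [set 0%R] : set (R * R)).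
  transitivity (mu [set 0%R] * mu [set 0%R]).
    by rewrite lebesgue_measure_set1 mul0e.
  by apply/esym; exact: product_measure1E.
apply: (@le_measure _ _ _ (sprod mu mu)); rewrite ?inE; [exact: mdisc|exact: measurableX|].
move=> -[x y] /= xy; have hx := sqr_ge0 x; have hy := sqr_ge0 y.
have /eqP : (x ^+ 2 = 0)%R by lra.
have /eqP : (y ^+ 2 = 0)%R by lra.
by rewrite !sqrf_eq0 => /eqP -> /eqP ->.
Qed.

(** Polar coordinates without angles: the area of a disc is proportional to its squared radius, so
    the squared norm carries plane measure to [disc_area] times Lebesgue measure on the positive
    half-line. *)
Lemma integral_sqnorm2 (H : R -> \bar R) : measurable_fun setT H -> (forall t, 0 <= H t) ->
  \int[mu2]_z H (z.1 ^+ 2 + z.2 ^+ 2)%R = disc_area%:E * \int[mu]_(t in `]0%R, +oo[) H t.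
Proof.
move=> mH H0; have c0 := disc_area_gt0.
pose T := (fun z : R * R => z.1 ^+ 2 + z.2 ^+ 2 : measurableTypeR R)%R.
have mT : measurable_fun setT T by apply: measurable_funD; apply: measurable_funX.
have mn : measurable (`]-oo, 0%R] : set R) by exact: measurable_itv.
have mp : measurable (`]0%R, +oo[ : set R) by exact: measurable_itv.
have ci0 : (0 <= disc_area^-1)%R by rewrite invr_ge0 ltW.
pose m1 := mscale (NngNum ci0) (pushforward (sprod mu mu) T).
(* The image measure does not charge the negative half-line; adding [mu] there yields a measure that
   can be identified with [mu] through its values on half-open intervals. *)
pose m' := measure_add (m1 mT) (mrestr mu mn).
have mE X : m' X = disc_area^-1%:E * mu2 (T @^-1` X) + mu (X `&` `]-oo, 0%R]%classic).
  by rewrite /m' measure_addE.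
have hm : forall A, measurable A -> mu A = m' A.
  move=> A mA; apply: lebesgue_measure_unique => // _ [[a b]] _ <-.
  rewrite -[RHS]/(m' `]a, b]%classic) mE -[LHS]/(mu `]a, b]%classic).
  have [ab|ba] := ltP a b; last first.
    have -> : `]a, b]%classic = set0 :> set R by apply/seteqP; split => // x /=; rewrite in_itv/= => /andP[/lt_le_trans h /h]; rewrite ltNge ba.
    have e0 : mu2 (T @^-1` set0) = 0 by rewrite preimage_set0 measure0.
    by rewrite e0 set0I measure0 mule0 adde0.
  have -> : T @^-1` `]a, b]%classic = [set z : R * R | z.1 ^+ 2 + z.2 ^+ 2 <= b]%R `\` [set z : R * R | z.1 ^+ 2 + z.2 ^+ 2 <= a]%R.
    apply/seteqP; split => -[x y] /=; rewrite in_itv/= /T/=.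
      by move=> /andP[h1 h2]; split => //; apply/negP; rewrite -ltNge.
    by move=> [-> /negP]; rewrite -ltNge => ->.
  have -> : mu2 ([set z : R * R | z.1 ^+ 2 + z.2 ^+ 2 <= b]%R `\` [set z : R * R | z.1 ^+ 2 + z.2 ^+ 2 <= a]%R) =
      (disc_area * Num.max b 0 - disc_area * Num.max a 0)%:E.
    have mb := mdisc b; have ma := mdisc a.
    rewrite (@measureD _ _ _ (sprod mu mu) _ _ mb ma); last first.
      by rewrite [X in X < _]disc_measure_max ltry.
    rewrite setIidr; first by rewrite [X in X - _]disc_measure_max [X in _ - X]disc_measure_max EFinB.
    by move=> z /= /le_trans; apply; exact: ltW.
  have -> : `]a, b]%classic `&` `]-oo, 0%R]%classic = `]a, (Num.min b 0)%R]%classic :> set R.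
    by apply/seteqP; split => x /=; rewrite !in_itv/= le_min; [move=> [/andP[-> ->] ->]|move=> /and3P[-> -> ->]].
  rewrite !lebesgue_measure_itv/= !lte_fin ab -EFinM -mulrBr mulrA mulVf ?gt_eqF// mul1r.
  case: ifPn => [am|am].
    rewrite -!EFinB -EFinD; congr EFin.
    move: am; rewrite lt_min => /andP[_ a0]; rewrite (max_r (ltW a0)).
    by have := addr_max_min b 0%R; lra.
  rewrite adde0 -EFinB; congr EFin.
  move: am; rewrite lt_min ab/= -leNgt => a0.
  by rewrite !max_l//; lra.
pose G (t : R) := if (0 < t)%R then H t else 0.
have mG : measurable_fun setT G by apply: measurable_fun_ifT => //; exact: measurable_fun_ltr.
have G0 t : 0 <= G t by rewrite /G; case: ifPn.
have -> : \int[mu]_(t in `]0%R, +oo[) H t = \int[mu]_t G t.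
  rewrite [LHS]integral_mkcond; apply: eq_integral => t _.
  by rewrite patchE mem_setE/= in_itv/= andbT.
have -> : \int[mu]_t G t = \int[m']_t G t.
  by apply: eq_measure_integral => A mA _; exact: hm.
rewrite ge0_integral_measure_add//.
have -> : \int[mrestr mu mn]_t G t = 0.
  rewrite -[RHS](@integral0 _ _ _ (mrestr mu mn) setT).
  apply: ge0_ae_eq_integral => //.
  exists `]0%R, +oo[%classic; split => //.
    rewrite -[LHS]/(mu (`]0%R, +oo[%classic `&` `]-oo, 0%R]%classic)).
    have -> : `]0%R, +oo[%classic `&` `]-oo, 0%R]%classic = set0 :> set R.
      by apply/seteqP; split => // x /= []; rewrite !in_itv/= andbT => /lt_le_trans h /h; rewrite ltxx.
    by rewrite measure0.
  move=> t /= h; rewrite in_itv/= andbT ltNge; apply/negP => t0; apply: h => _.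
  by rewrite /G ltNge t0.
rewrite adde0 ge0_integral_mscale// muleA -EFinM mulfV ?gt_eqF// mul1e.
rewrite ge0_integral_pushforward//.
have mHT : measurable_fun setT (H \o T) by exact: measurableT_comp.
have mGT : measurable_fun setT (G \o T) by exact: measurableT_comp.
apply: (@ge0_ae_eq_integral _ _ _ (sprod mu mu)) => //.
  by move=> z _; exact: G0.
exists [set z : R * R | z.1 ^+ 2 + z.2 ^+ 2 <= 0]%R; split; first exact: mdisc.
  by rewrite -[LHS]/(mu2 _) disc_measure_max max_l// mulr0.
move=> z /= h; rewrite leNgt; apply/negP => z0; apply: h => _.
by rewrite /G/= /T z0.
Qed.

(** Archimedes' hat-box theorem: in the coordinates squared radius and height, volume has constant
    density. At fixed height [s], [integral_sqnorm2] handles the two other coordinates, and a shift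
    by [s ^+ 2] turns their squared norm into the squared radius. *)
Lemma integral_archimedes (F : R * R -> \bar R) : measurable_fun setT F -> (forall t, 0 <= F t) ->
  \int[L3]_y F (sqnorm3 y, y.2) =
  disc_area%:E * \int[mu]_q \int[mu]_s (if (s ^+ 2 < q)%R then F (q, s) else 0).
Proof.
move=> mF F0.
have mF1 : measurable_fun setT (fun y : R3 R => F (sqnorm3 y, y.2)).
  by apply: (measurableT_comp mF); apply/measurable_fun_pair => //; exact: measurable_sqnorm3.
rewrite [LHS](@fubini_tonelli2 _ _ _ _ _ (sprod mu mu) mu _ mF1)//=.
have mG : measurable_fun setT (fun z : R * R => if (z.2 ^+ 2 < z.1)%R then F z else 0).
  apply: measurable_fun_ifT => //; apply: measurable_fun_ltr => //.
  exact: measurable_funX.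
rewrite (@fubini_tonelli _ _ _ _ _ mu mu _ mG)/=; last by move=> z; case: ifPn.
rewrite -ge0_integralZl//=; last 3 first.
- apply: (@measurable_fun_fubini_tonelli_G _ _ _ _ _ mu _ mG) => z; by case: ifPn.
- by move=> s _; apply: integral_ge0 => q _; case: ifPn.
- by rewrite lee_fin ltW// disc_area_gt0.
apply: eq_integral => s _; rewrite /fubini_G/=.
have mFs : measurable_fun setT (fun t : R => F (t + s ^+ 2, s)%R).
  apply: (measurableT_comp mF); apply/measurable_fun_pair => //.
  exact: measurable_funD.
rewrite -[LHS]/(\int[mu2]_z F (z.1 ^+ 2 + z.2 ^+ 2 + s ^+ 2, s)%R).
rewrite (integral_sqnorm2 mFs)//; congr (_ * _).
have mp : measurable (`]0%R, +oo[ : set R) by exact: measurable_itv.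
have mFs' : measurable_fun setT (fun t : R => if (s ^+ 2 < t)%R then F (t, s) else 0).
  apply: measurable_fun_ifT => //; first exact: measurable_fun_ltr.
  exact: (measurableT_comp mF).
have [_ h] := @mscaling_affine R 1 (s ^+ 2) (oner_neq0 _).
have := h _ mFs'; rewrite normr1 invr1 mul1e => <-; last by move=> t; case: ifPn.
rewrite [LHS]integral_mkcond; apply: eq_integral => t _.
rewrite patchE; case: ifPn; rewrite ?inE ?notin_setE/= in_itv/= andbT.
  by move=> t0; rewrite mul1r ltrDr t0.
by move=> /negP/negbTE t0; rewrite mul1r ltrDr t0.
Qed.

Lemma integral_cst_oo (c : \bar R) (r : R) : (0 < r)%R ->
  \int[mu]_(s in `](- r)%R, r[) c = c * (2 * r)%:E.
Proof.
move=> r0; rewrite integral_cst// -[X in _ * X]/(mu _) lebesgue_measure_itv/= lte_fin gtrN//.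
by rewrite -EFinB; congr (_ * _%:E); ring.
Qed.

(** The admissible heights at squared radius [q] fill an interval of length [2 * Num.sqrt q]. *)
Lemma integral_radial (H : R -> \bar R) : measurable_fun setT H -> (forall t, 0 <= H t) ->
  \int[L3]_y H (sqnorm3 y) =
  disc_area%:E * \int[mu]_q ((2 * Num.sqrt q)%:E * H q).
Proof.
move=> mH H0.
rewrite (@integral_archimedes (fun z => H z.1))//; last exact: measurableT_comp.
congr (_ * _); apply: eq_integral => q _ /=.
transitivity (\int[mu]_(s in [set s | s ^+ 2 < q]%R) H q).
  rewrite [RHS]integral_mkcond.
  by apply: eq_integral => s _; rewrite patchE mem_setE.
have [q0|q0] := leP q 0%R.
  have -> : [set s | (s ^+ 2 < q)%R] = set0 :> set R.
    by apply/seteqP; split => // s /= sq; have := sqr_ge0 s; rewrite leNgt (lt_le_trans sq).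
  by rewrite integral_set0 ler0_sqrtr// mulr0 mul0e.
have r0 : (0 < Num.sqrt q)%R by rewrite sqrtr_gt0.
have -> : [set s | (s ^+ 2 < q)%R] = `](- Num.sqrt q)%R, (Num.sqrt q)%R[%classic.
  have e s : (s ^+ 2 < q)%R = (`|s| < Num.sqrt q)%R.
    rewrite -[in LHS](sqr_sqrtr (ltW q0)) -[in LHS](real_normK (num_real s)).
    by rewrite ltr_pXn2r// nnegrE// ltW.
  by apply/seteqP; split => s /=; rewrite in_itv/= -ltr_norml e.
by rewrite integral_cst_oo// muleC.
Qed.

End radial_integrals.

Section calculus.
Local Open Scope ring_scope.
Context {R : realType}.
Notation mu := (@lebesgue_measure R).

Lemma is_derive_continuous (f : R -> R) (x df : R) :
  is_derive x 1 f df -> {for x, continuous f}.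
Proof.
move=> h; apply: differentiable_continuous; apply/derivable1_diffP.
exact: ex_derive.
Qed.

Lemma is_derive_affine (a b x : R) : is_derive x (1 : R) (fun t : R => a + b * t : R) b.
Proof.
have -> : (fun t : R => a + b * t : R) = cst a + b \*: (id : R -> R) by [].
apply: (is_derive_eq (is_deriveD (is_derive_cst a x (1 : R)) (is_deriveZ b (is_derive_id x (1 : R))))).
by rewrite add0r /GRing.scale/= mulr1.
Qed.

Lemma FTC2_is_derive (f F : R -> R) (a b : R) : a <= b ->
  (forall s, a <= s <= b -> is_derive s 1 F (f s)) ->
  (forall s, a <= s <= b -> {for s, continuous f}) ->
  (\int[mu]_(x in `[a, b]) (f x)%:E = (F b - F a)%:E)%E.
Proof.
rewrite le_eqVlt => /predU1P[->|ab] dF cf.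
  by rewrite set_itv1 integral_set1 subrr.
have oc s : s \in `]a, b[ -> a <= s <= b.
  by rewrite in_itv/= => /andP[/ltW -> /ltW ->].
have aab : a <= a <= b by rewrite lexx ltW.
have bab : a <= b <= b by rewrite lexx ltW.
rewrite (@continuous_FTC2 _ f F) ?EFinB//.
- apply: continuous_in_subspaceT => s; rewrite inE/= in_itv/=; exact: cf.
- split.
  + move=> s /oc /dF h; exact: ex_derive.
  + apply: cvg_at_right_filter; exact: (is_derive_continuous (dF _ aab)).
  + apply: cvg_at_left_filter; exact: (is_derive_continuous (dF _ bab)).
- by move=> s /oc /dF h; rewrite derive1E; apply: derive_val.
Qed.

End calculus.

Section newton.
Local Open Scope ereal_scope.
Context {R : realType}.
Notation mu := (@lebesgue_measure R).
Notation L3 := (@leb3 R).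

Lemma sqr_lt_itv (q : R) : (0 < q)%R ->
  [set s | (s ^+ 2 < q)%R] = `](- Num.sqrt q)%R, (Num.sqrt q)%R[%classic.
Proof.
move=> q0; have e s : (s ^+ 2 < q)%R = (`|s| < Num.sqrt q)%R.
  rewrite -[in LHS](sqr_sqrtr (ltW q0)) -[in LHS](real_normK (num_real s)).
  by rewrite ltr_pXn2r// nnegrE// sqrtr_ge0.
by apply/seteqP; split => s /=; rewrite in_itv/= -ltr_norml e.
Qed.

(** The integrand is the inverse distance from the point at height [h] on the axis to a point at
    height [s] on the sphere of squared radius [q]. In [s] it has a primitive proportional to the
    distance itself, whose values at the poles are $|r-h|$ and $r+h$. *)
Lemma integral_inv_sqrt (q h : R) : (0 < q)%R -> (0 < h)%R -> q != (h ^+ 2)%R ->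
  \int[mu]_s (if (s ^+ 2 < q)%R then ((Num.sqrt (q + h ^+ 2 - 2 * h * s))^-1)%:E else 0) =
  (2 * Num.sqrt q * Num.min (h^-1) ((Num.sqrt q)^-1))%:E.
Proof.
move=> q0 h0 qh; set r := Num.sqrt q.
have r0 : (0 < r)%R by rewrite sqrtr_gt0.
have qr : q = (r ^+ 2)%R by rewrite sqr_sqrtr ?ltW.
have rh : r != h by apply: contra_neq qh => <-.
have arg_gt0 s : (- r <= s <= r)%R -> (0 < q + h ^+ 2 - 2 * h * s)%R.
  move=> /andP[_ sr]; have : (0 < (r - h) ^+ 2)%R by rewrite exprn_even_gt0//= subr_eq0.
  by rewrite qr; nra.
pose f (s : R) : R := (Num.sqrt (q + h ^+ 2 - 2 * h * s))^-1%R.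
pose F (s : R) : R := (- h^-1 * Num.sqrt (q + h ^+ 2 - 2 * h * s))%R.
have d1 (s : R) : is_derive s (1%R : R) (fun s : R => q + h ^+ 2 - 2 * h * s : R)%R (- (2 * h))%R.
  rewrite (_ : (fun s : R => _) = (fun s : R => (q + h ^+ 2) + (- (2 * h)) * s)%R).
    exact: is_derive_affine.
  by apply/funext => t; rewrite mulNr.
have dF (s : R) : (- r <= s <= r)%R -> is_derive s (1%R : R) F (f s).
  move=> sr; have a0 := arg_gt0 s sr.
  have d2 : is_derive (q + h ^+ 2 - 2 * h * s)%R (1%R : R) (@Num.sqrt R) ((2 * Num.sqrt (q + h ^+ 2 - 2 * h * s))^-1)%R.
    exact: is_derive1_sqrt.
  have := is_deriveZ (- h^-1)%R (@is_derive1_comp _ (@Num.sqrt R) (fun s : R => q + h ^+ 2 - 2 * h * s : R)%R s _ _ d2 (d1 s)).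
  move=> dd; apply: (is_derive_eq dd); rewrite /f /GRing.scale/=.
  by field; rewrite !gt_eqF// sqrtr_gt0.
have cf (s : R) : (- r <= s <= r)%R -> {for s, continuous f}.
  move=> sr; have a0 := arg_gt0 s sr.
  apply: cvgV; first by rewrite gt_eqF// sqrtr_gt0.
  apply: (@continuous_comp _ _ _ (fun s : R => q + h ^+ 2 - 2 * h * s : R)%R (@Num.sqrt R)).
    exact: (is_derive_continuous (d1 s)).
  exact: sqrt_continuous.
transitivity (\int[mu]_(s in `[(- r)%R, r]) (f s)%:E).
  transitivity (\int[mu]_(s in `](- r)%R, r[) (f s)%:E).
    rewrite [RHS]integral_mkcond; apply: eq_integral => s _.
    by rewrite patchE -sqr_lt_itv// mem_setE.
  apply/esym/integral_itv_bndoo; apply/measurable_EFinP.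
  apply: measurable_funTS; apply: (measurableT_comp measurable_invr).
  by apply: (measurableT_comp measurable_sqrtr); apply: measurable_funB => //; apply: measurable_funM.
rewrite (@FTC2_is_derive _ f F)//; last by rewrite -subr_ge0 opprK addr_ge0// ltW.
congr EFin; rewrite /F qr.
have -> : (r ^+ 2 + h ^+ 2 - 2 * h * r = (r - h) ^+ 2)%R by ring.
have -> : (r ^+ 2 + h ^+ 2 - 2 * h * - r = (r + h) ^+ 2)%R by ring.
rewrite !sqrtr_sqr (gtr0_norm (addr_gt0 r0 h0)).
have [hr|hr] := leP h r.
  rewrite ger0_norm ?subr_ge0// min_r; last by rewrite lef_pV2.
  by field; rewrite !gt_eqF.
rewrite ler0_norm ?subr_le0 ?ltW// min_l; last by rewrite lef_pV2// ltW.
by field; rewrite !gt_eqF.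
Qed.

(** In the coordinates of [integral_archimedes], with the third axis through the point, both sides
    have the same integral over almost every sphere: the mean of the inverse distance over a sphere
    is the smaller of $1/h$ and $1/r$. *)
Lemma newton_shell (phi : R -> \bar R) (h : R) : measurable_fun setT phi ->
  (forall t, 0 <= phi t) -> (0 < h)%R ->
  \int[L3]_y (phi (sqnorm3 y) * ((enorm3 (((0, 0), h) - y))^-1)%:E) =
  \int[L3]_y (phi (sqnorm3 y) * (Num.min h^-1 (enorm3 y)^-1)%:E).
Proof.
move=> mphi phi0 h0.
pose F (z : R * R) := phi z.1 * ((Num.sqrt (z.1 + h ^+ 2 - 2 * h * z.2))^-1)%:E.
pose G (z : R * R) := phi z.1 * (Num.min h^-1 (Num.sqrt z.1)^-1)%:E.
have -> : \int[L3]_y (phi (sqnorm3 y) * ((enorm3 (((0, 0), h) - y))^-1)%:E) =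
    \int[L3]_y F (sqnorm3 y, y.2).
  apply: eq_integral => -[[a b] c] _; rewrite /F/=; congr (_ * (_^-1)%:E).
  by rewrite /enorm3 /sqnorm3/=; congr Num.sqrt; ring.
have -> : \int[L3]_y (phi (sqnorm3 y) * (Num.min h^-1 (enorm3 y)^-1)%:E) =
    \int[L3]_y G (sqnorm3 y, y.2) by [].
have mF : measurable_fun setT F.
  apply: emeasurable_funM; first exact: measurableT_comp.
  apply/measurable_EFinP; apply: (measurableT_comp measurable_invr).
  apply: (measurableT_comp measurable_sqrtr); apply: measurable_funB => //.
    exact: measurable_funD.
  exact: measurable_funM.
have mG : measurable_fun setT G.
  apply: emeasurable_funM; first exact: measurableT_comp.
  apply/measurable_EFinP; apply: measurable_minr => //.
  apply: (measurableT_comp measurable_invr); exact: (measurableT_comp measurable_sqrtr).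
rewrite (integral_archimedes mF)/=; last first.
  by move=> z; rewrite mule_ge0// lee_fin invr_ge0.
rewrite (integral_archimedes mG)/=; last first.
  by move=> z; rewrite mule_ge0// lee_fin le_min !invr_ge0 ltW//= sqrtr_ge0.
apply: (f_equal (mule disc_area%:E)).
have mif (H : R * R -> \bar R) : measurable_fun setT H ->
    measurable_fun setT (fun z : R * R => if (z.2 ^+ 2 < z.1)%R then H z else 0).
  move=> mH; apply: measurable_fun_ifT => //; apply: measurable_fun_ltr => //.
  exact: measurable_funX.
have mint (H : R * R -> \bar R) : measurable_fun setT H -> (forall z, 0 <= H z) ->
    measurable_fun setT (fun q : R => \int[mu]_s (if (s ^+ 2 < q)%R then H (q, s) else 0)).
  move=> mH H0; apply: (@measurable_fun_fubini_tonelli_F _ _ _ _ _ mu _ (mif _ mH)).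
  by move=> z; case: ifPn.
apply: ge0_ae_eq_integral => //.
- by apply: mint => // z; rewrite mule_ge0// lee_fin invr_ge0.
- by apply: mint => // z; rewrite mule_ge0// lee_fin le_min !invr_ge0 ltW//= sqrtr_ge0.
- move=> q _; apply: integral_ge0 => s _; case: ifPn => // _.
  by rewrite mule_ge0// lee_fin invr_ge0.
- move=> q _; apply: integral_ge0 => s _; case: ifPn => // _.
  by rewrite mule_ge0// lee_fin le_min !invr_ge0 ltW//= sqrtr_ge0.
(* The exceptional sphere is the one through the point, where the inverse distance is singular at a
   pole; it accounts for a single value of [q]. *)
exists [set (h ^+ 2)%R]; split => //; first exact: lebesgue_measure_set1.
move=> q /= hq; apply/eqP; apply: contra_notT hq => qh _.
have [q0|q0] := leP q 0%R.
  have e (s : R) : (s ^+ 2 < q)%R = false.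
    by apply/negbTE; rewrite -leNgt (le_trans q0)// sqr_ge0.
  by under eq_integral do rewrite e; under [in RHS]eq_integral do rewrite e.
have msq : measurable_fun setT (fun s : R => (s ^+ 2 < q)%R).
  by apply: measurable_fun_ltr => //; exact: measurable_funX.
transitivity (\int[mu]_s (phi q * (if (s ^+ 2 < q)%R then ((Num.sqrt (q + h ^+ 2 - 2 * h * s))^-1)%:E else 0))).
  by apply: eq_integral => s _; rewrite /F/=; case: ifPn => // _; rewrite mule0.
rewrite ge0_integralZl//; last 2 first.
- apply: measurable_fun_ifT => //.
  apply/measurable_EFinP; apply: (measurableT_comp measurable_invr).
  apply: (measurableT_comp measurable_sqrtr); by apply: measurable_funB => //; apply: measurable_funM.
- by move=> s _; case: ifPn => // _; rewrite lee_fin invr_ge0.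
rewrite integral_inv_sqrt// /G/=.
transitivity (\int[mu]_(s in `](- Num.sqrt q)%R, (Num.sqrt q)%R[) (phi q * (Num.min h^-1 (Num.sqrt q)^-1)%:E)); last first.
  rewrite [LHS]integral_mkcond; apply: eq_integral => s _.
  by rewrite patchE -sqr_lt_itv// mem_setE.
have r0 : (0 < Num.sqrt q)%R by rewrite sqrtr_gt0.
by rewrite integral_cst_oo// -muleA -EFinM; congr (_ * _%:E); ring.
Qed.

End newton.

(** * Integrability of the kernels *)

Section kernel_integrability.
Local Open Scope ereal_scope.
Context {R : realType}.
Notation mu := (@lebesgue_measure R).
Notation L3 := (@leb3 R).

Lemma cvgy_powRN (s : R) : (0 < s)%R -> (x `^ (- s))%R @[x --> +oo%R] --> (0%R : R).
Proof.
move=> s0; apply/cvgrPdist_le => /= e e0.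
near=> x.
have x0 : (0 < x)%R by near: x; apply: nbhs_pinfty_gt; rewrite num_real.
rewrite sub0r normrN ger0_norm ?powR_ge0// powRN.
rewrite -[leRHS]invrK lef_pV2 ?posrE ?invr_gt0 ?powR_gt0//.
have -> : e^-1%R = ((e^-1 `^ s^-1) `^ s)%R.
  by rewrite -powRrM mulVf ?gt_eqF// powRr1// invr_ge0 ltW.
apply: ge0_ler_powR; rewrite ?nnegrE ?powR_ge0 ?ltW//.
Unshelve. all: by end_near. Qed.

Lemma integral_powR_tail (s : R) : (1 < s)%R ->
  \int[mu]_(t in `[1%R, +oo[) (t `^ (- s))%:E = ((s - 1)^-1)%:E.
Proof.
move=> s1; have s0 : (0 < s - 1)%R by rewrite subr_gt0.
pose F (t : R) : R := (- (s - 1)^-1 * t `^ (- (s - 1)))%R.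
have dF (t : R) : (0 < t)%R -> is_derive t (1%R : R) F (t `^ (- s))%R.
  move=> t0.
  have dd := is_deriveZ (- (s - 1)^-1)%R (is_derive1_powR (- (s - 1))%R t0).
  apply: (is_derive_eq dd); rewrite /GRing.scale/= mulrA.
  have -> : (- (s - 1) - 1 = - s)%R by ring.
  by rewrite mulNr mulrN opprK mulVf ?gt_eqF// mul1r.
rewrite (@ge0_continuous_FTC2y _ _ F _ 0%R).
- by rewrite /F powR1 mulr1 sub0e -EFinN opprK.
- by move=> x _; rewrite powR_ge0.
- apply: continuous_in_subspaceT => t; rewrite inE/= in_itv/= andbT => t1.
  apply: is_derive_continuous; apply: is_derive1_powR.
  exact: lt_le_trans t1.
- rewrite /F -[X in _ --> X](mulr0 (- (s - 1)^-1)%R).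
  by apply: cvgMr; exact: cvgy_powRN.
- by move=> t t1; have := dF t (lt_trans ltr01 t1) => h; exact: ex_derive.
- apply: cvg_at_right_filter; exact: (is_derive_continuous (dF _ ltr01)).
- move=> t; rewrite in_itv/= andbT => t1.
  have h := dF t (lt_trans ltr01 t1).
  by rewrite derive1E; apply: derive_val.
Qed.

(* Layer-cake: t^(-1/2) is the length of ]0, t^(-1/2)[. *)
Lemma integral_inv_sqrt_01 :
  \int[mu]_(q in `]0%R, 1%R[) ((Num.sqrt q)^-1)%:E < +oo.
Proof.
pose F (z : R * R) : \bar R := if ((0 < z.1) && (z.1 < 1) && (0 < z.2) && (z.2 ^+ 2 * z.1 < 1))%R then 1 else 0.
have mF : measurable_fun setT F.
  apply: measurable_fun_ifT => //; apply: measurable_and; last first.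
    by apply: measurable_fun_ltr => //; apply: measurable_funM => //; apply: measurable_funX.
  apply: measurable_and; last exact: measurable_fun_ltr.
  by apply: measurable_and; exact: measurable_fun_ltr.
have F0 z : 0 <= F z by rewrite /F; case: ifPn.
have -> : \int[mu]_(q in `]0%R, 1%R[) ((Num.sqrt q)^-1)%:E = \int[mu]_q \int[mu]_t F (q, t).
  rewrite [LHS]integral_mkcond; apply: eq_integral => q _.
  rewrite patchE mem_setE/= in_itv/=; case: ifPn => [/andP[q0 q1]|q01]; last first.
    by rewrite /F/= (negbTE q01)/= integral0.
  have s0 : (0 < Num.sqrt q)%R by rewrite sqrtr_gt0.
  transitivity (\int[mu]_(t in `]0%R, (Num.sqrt q)^-1%R[) (1 : \bar R)).
    rewrite integral_cst// mul1e -[RHS]/(mu _) lebesgue_measure_itv/= lte_fin invr_gt0 s0.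
    by rewrite oppr0 adde0.
  rewrite [LHS]integral_mkcond; apply: eq_integral => t _.
  rewrite patchE mem_setE/= in_itv/= /F/= q0 q1/=; congr (if _ then _ else _).
  have [t0|//] := ltP 0%R t; rewrite /=.
  have -> : (t ^+ 2 * q = (t * Num.sqrt q) ^+ 2)%R by rewrite exprMn sqr_sqrtr// ltW.
  rewrite -[X in _ = (_ < X)%R](expr1n _ 2) ltr_pXn2r ?nnegrE ?mulr_ge0 ?ltW//.
  by rewrite -ltr_pdivlMr// mul1r.
rewrite (@fubini_tonelli _ _ _ _ _ mu mu _ mF F0).
apply: (@le_lt_trans _ _ (\int[mu]_t ((if (0 < t < 1)%R then 1 else 0) + (if (1 <= t)%R then (t `^ (-2))%:E else 0)))).
  apply: ge0_le_integral => //.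
  - by move=> t _; apply: integral_ge0.
  - exact: (@measurable_fun_fubini_tonelli_G _ _ _ _ _ mu _ mF F0).
  - apply: emeasurable_funD; apply: measurable_fun_ifT => //.
    + by apply: measurable_and; exact: measurable_fun_ltr.
    + exact: measurable_fun_ler.
    + by apply/measurable_EFinP; exact: measurable_powR.
  move=> t _; have [t0|t0] := leP t 0%R.
    rewrite (_ : \int[mu]_x F (x, t) = 0)/=; last first.
      by rewrite -[RHS](@integral0 _ _ _ mu setT); apply: eq_integral => x _; rewrite /F/= (ltNge 0%R t) t0/= andbF.
    by rewrite adde_ge0//; case: ifPn => // _; rewrite lee_fin powR_ge0.
  have [t1|t1] := ltP t 1%R; rewrite /= ?adde0 ?add0e.
    apply: (@le_trans _ _ (\int[mu]_(x in `]0%R, 1%R[) (1 : \bar R))).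
      rewrite [leRHS]integral_mkcond; apply: ge0_le_integral => //.
      - exact: (measurableT_comp mF).
      - by apply/(measurable_restrictT _ _).1.
      move=> x _; rewrite patchE mem_setE/= in_itv/= /F/=.
      by case: ifPn => [/andP[/andP[-> _] _]//|_]; case: ifPn.
    rewrite integral_cst// mul1e -[leLHS]/(mu _) lebesgue_measure_itv/= lte_fin ltr01.
    by rewrite oppr0 adde0.
  have t2 : (0 < t ^+ 2)%R by rewrite exprn_gt0.
  apply: (@le_trans _ _ (\int[mu]_(x in `]0%R, (t ^- 2)%R[) (1 : \bar R))).
    rewrite [leRHS]integral_mkcond; apply: ge0_le_integral => //.
    - exact: (measurableT_comp mF).
    - by apply/(measurable_restrictT _ _).1.
    move=> x _; rewrite patchE mem_setE/= in_itv/= /F/=.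
    case: ifPn => [/andP[/andP[/andP[-> _] _]]|_]; last by case: ifPn.
    by rewrite mulrC -ltr_pdivlMr// mul1r => ->.
  rewrite integral_cst// mul1e -[leLHS]/(mu _) lebesgue_measure_itv/= lte_fin invr_gt0 t2.
  by rewrite oppr0 adde0 lee_fin (powR_invn 2)// ltW.
have m1 : measurable_fun setT (fun t : R => if (0 < t < 1)%R then 1 : \bar R else 0).
  by apply: measurable_fun_ifT => //; apply: measurable_and; exact: measurable_fun_ltr.
have m2 : measurable_fun setT (fun t : R => if (1 <= t)%R then (t `^ (-2))%:E else 0).
  apply: measurable_fun_ifT => //; first exact: measurable_fun_ler.
  by apply/measurable_EFinP; exact: measurable_powR.
rewrite (@ge0_integralD _ _ _ mu setT measurableT _ _ _ m1 _ m2); last 2 first.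
- by move=> t _; case: ifPn.
- by move=> t _; case: ifPn => // _; rewrite lee_fin powR_ge0.
apply: lte_add_pinfty.
  rewrite (_ : \int[mu]_x _ = \int[mu]_(x in `]0%R, 1%R[) (1 : \bar R)).
    rewrite integral_cst// mul1e -[X in X < _]/(mu _) lebesgue_measure_itv/= lte_fin ltr01.
    by rewrite oppr0 adde0 ltry.
  rewrite [RHS]integral_mkcond; apply: eq_integral => x _.
  by rewrite patchE mem_setE/= in_itv.
rewrite (_ : \int[mu]_x _ = \int[mu]_(t in `[1%R, +oo[) (t `^ (- 2))%:E).
  by rewrite integral_powR_tail ?ltry// ltr1n.
rewrite [RHS]integral_mkcond; apply: eq_integral => x _.
by rewrite patchE mem_setE/= in_itv/= andbT.
Qed.

Lemma integral_sqnorm3V_ball :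
  \int[L3]_x (if (sqnorm3 x < 1)%R then ((sqnorm3 x)^-1)%:E else 0) < +oo.
Proof.
pose H (q : R) : \bar R := if (0 < q < 1)%R then (q^-1)%:E else 0.
have mH : measurable_fun setT H.
  apply: measurable_fun_ifT => //; first by apply: measurable_and; exact: measurable_fun_ltr.
  by apply/measurable_EFinP; exact: measurable_invr.
have H0 q : 0 <= H q.
  by rewrite /H; case: ifPn => // /andP[q0 _]; rewrite lee_fin invr_ge0 ltW.
rewrite (_ : \int[L3]_x _ = \int[L3]_x H (sqnorm3 x)); last first.
  apply: eq_integral => x _; rewrite /H.
  have := sqnorm3_ge0 x; rewrite le_eqVlt => /predU1P[<-|->//].
  by rewrite invr0 ltr01 ltxx.
rewrite (integral_radial mH H0); apply: lte_mul_pinfty => //.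
  by rewrite lee_fin ltW// disc_area_gt0.
rewrite (_ : \int[mu]_q _ = \int[mu]_(q in `]0%R, 1%R[) (2%:E * ((Num.sqrt q)^-1)%:E)).
  rewrite ge0_integralZl//=; try by move=> x _; rewrite lee_fin invr_ge0.
    by apply: lte_mul_pinfty => //; exact: integral_inv_sqrt_01.
  apply: measurable_funTS; apply/measurable_EFinP.
  exact: (measurableT_comp measurable_invr measurable_sqrtr).
rewrite [RHS]integral_mkcond; apply: eq_integral => q _.
rewrite patchE mem_setE/= in_itv/= /H; case: ifPn => [/andP[q0 q1]|_]; last by rewrite mule0.
rewrite -!EFinM; congr EFin; rewrite -{2}(sqr_sqrtr (ltW q0)).
by field; rewrite gt_eqF// sqrtr_gt0.
Qed.

Lemma integral_sqnorm3_tail :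
  \int[L3]_x (if (1 <= sqnorm3 x)%R then ((sqnorm3 x) ^- 2)%:E else 0) < +oo.
Proof.
pose H (q : R) : \bar R := if (1 <= q)%R then (q ^- 2)%:E else 0.
have mH : measurable_fun setT H.
  apply: measurable_fun_ifT => //; first exact: measurable_fun_ler.
  apply/measurable_EFinP; apply: (measurableT_comp measurable_invr).
  exact: measurable_funX.
have H0 q : 0 <= H q.
  by rewrite /H; case: ifPn => // q0; rewrite lee_fin invr_ge0 exprn_ge0// (le_trans _ q0).
rewrite (_ : \int[L3]_x _ = \int[L3]_x H (sqnorm3 x))//.
rewrite (integral_radial mH H0); apply: lte_mul_pinfty => //.
  by rewrite lee_fin ltW// disc_area_gt0.
rewrite (_ : \int[mu]_q _ = \int[mu]_(q in `[1%R, +oo[) (2%:E * (q `^ (- (3 / 2)))%:E)).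
  rewrite ge0_integralZl//=; try by move=> x _; rewrite lee_fin powR_ge0.
    by apply: lte_mul_pinfty => //; rewrite integral_powR_tail ?ltry//; lra.
  by apply: measurable_funTS; apply/measurable_EFinP; exact: measurable_powR.
rewrite [RHS]integral_mkcond; apply: eq_integral => q _.
rewrite patchE mem_setE/= in_itv/= andbT /H; case: ifPn => [q1|_]; last by rewrite mule0.
have q0 : (0 < q)%R by exact: lt_le_trans q1.
rewrite -!EFinM -mulrA; congr (_ * _)%:E.
rewrite -powR12_sqrt ?ltW// -powR_invn ?ltW// -powRD; last by apply/implyP => _; rewrite gt_eqF.
by congr (_ `^ _)%R; lra.
Qed.

End kernel_integrability.

(** * Homogeneous kernels that are invariant under reflections *)

Section homogeneous_kernels.
Local Open Scope ereal_scope.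
Context {R : realType}.
Notation mu := (@lebesgue_measure R).
Notation L3 := (@leb3 R).

Definition scale3 (h : R) (x : R3 R) : R3 R := ((h * x.1.1, h * x.1.2), h * x.2)%R.

(** A Householder reflection: the normal of the mirror is the difference between the point and its
    image, normalized. *)
Lemma reflection_to_axis (x y : R) : exists a b : R, [/\ (a ^+ 2 + b ^+ 2 = 1)%R,
  (x - 2 * a * (a * x + b * y) = Num.sqrt (x ^+ 2 + y ^+ 2))%R &
  (y - 2 * b * (a * x + b * y) = 0)%R].
Proof.
set r := Num.sqrt (x ^+ 2 + y ^+ 2).
have r2 : (r ^+ 2 = x ^+ 2 + y ^+ 2)%R by rewrite sqr_sqrtr// addr_ge0// sqr_ge0.
have r0 : (0 <= r)%R by exact: sqrtr_ge0.
pose N2 := ((x - r) ^+ 2 + y ^+ 2)%R.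
(* A vanishing difference means that the point already lies on the half-axis; the mirror is then
   chosen to contain it. *)
have [N0|N0] := eqVneq N2 0%R.
  have hx := sqr_ge0 (x - r)%R; have hy := sqr_ge0 y.
  have /eqP : ((x - r) ^+ 2 = 0)%R by rewrite /N2 in N0; lra.
  have /eqP : (y ^+ 2 = 0)%R by rewrite /N2 in N0; lra.
  rewrite !sqrf_eq0 subr_eq0 => /eqP y0 /eqP xr.
  exists 0%R, 1%R; split; first by rewrite expr0n/= add0r expr1n.
  - by rewrite mulr0 mul0r subr0.
  - by rewrite y0 mul0r !mulr0 addr0 mulr0 subr0.
have Np : (0 < N2)%R by rewrite lt_neqAle eq_sym N0 addr_ge0// sqr_ge0.
pose N := Num.sqrt N2; have Ngt : (0 < N)%R by rewrite sqrtr_gt0.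
have NN : (N ^+ 2 = N2)%R by rewrite sqr_sqrtr// ltW.
have Nn0 : N != 0%R by rewrite gt_eqF.
have e : ((x - r) / N * x + y / N * y = N / 2)%R.
  apply: (mulIf Nn0); have -> : (N / 2 * N = N ^+ 2 / 2)%R by ring.
  have -> : (((x - r) / N * x + y / N * y) * N = (x - r) * x + y ^+ 2)%R by field.
  rewrite NN /N2.
  have -> : ((x - r) * x + y ^+ 2 = x ^+ 2 + y ^+ 2 - r * x)%R by ring.
  have -> : ((x - r) ^+ 2 + y ^+ 2 = (x ^+ 2 + y ^+ 2) + r ^+ 2 - 2 * (r * x))%R by ring.
  by rewrite r2; field.
exists ((x - r) / N)%R, (y / N)%R; split.
- by rewrite !exprMn -mulrDl exprVn NN -/N2 divff.
- by rewrite e; field.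
- by rewrite e; field.
Qed.

Lemma sqnorm3_refl12 (a b : R) (x : R3 R) : (a ^+ 2 + b ^+ 2 = 1)%R ->
  sqnorm3 (refl12 a b x) = sqnorm3 x.
Proof.
move=> ab; have b2 : (b ^+ 2 = 1 - a ^+ 2)%R by rewrite -ab addrC addKr.
rewrite /sqnorm3 /refl12/=; move: x.1.1 x.1.2 x.2 => p q s.
have -> : ((p - 2 * a * (a * p + b * q)) ^+ 2 + (q - 2 * b * (a * p + b * q)) ^+ 2 + s ^+ 2 =
  p ^+ 2 + q ^+ 2 + s ^+ 2 + 4 * (a * p + b * q) ^+ 2 * (a ^+ 2 + b ^+ 2 - 1))%R by ring.
by rewrite ab subrr mulr0 addr0.
Qed.

Lemma sqnorm3_refl13 (a b : R) (x : R3 R) : (a ^+ 2 + b ^+ 2 = 1)%R ->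
  sqnorm3 (refl13 a b x) = sqnorm3 x.
Proof.
move=> ab; rewrite /sqnorm3 /refl13/=; move: x.1.1 x.1.2 x.2 => p s q.
have -> : ((p - 2 * a * (a * p + b * q)) ^+ 2 + s ^+ 2 + (q - 2 * b * (a * p + b * q)) ^+ 2 =
  p ^+ 2 + s ^+ 2 + q ^+ 2 + 4 * (a * p + b * q) ^+ 2 * (a ^+ 2 + b ^+ 2 - 1))%R by ring.
by rewrite ab subrr mulr0 addr0.
Qed.

(* The group generated by the reflections acts transitively on spheres. *)
Lemma radial_of_reflections (T : Type) (v : R3 R -> T) :
  (forall a b x, (a ^+ 2 + b ^+ 2 = 1)%R -> v (refl12 a b x) = v x) ->
  (forall a b x, (a ^+ 2 + b ^+ 2 = 1)%R -> v (refl13 a b x) = v x) ->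
  forall x, v x = v ((0, 0), enorm3 x)%R.
Proof.
move=> h12 h13 x.
have [a [b [ab e1 e2]]] := reflection_to_axis x.1.1 x.1.2.
have [c [d [cd e3 e4]]] := reflection_to_axis x.2 (Num.sqrt (x.1.1 ^+ 2 + x.1.2 ^+ 2)).
rewrite -(h12 a b)// -(h13 d c); last by rewrite addrC.
congr v; rewrite /refl13 /refl12/= e1 e2; congr (_, _, _).
- by rewrite (addrC (d * _)%R) e4.
- rewrite (addrC (d * _)%R) e3 sqr_sqrtr ?addr_ge0 ?sqr_ge0//.
  by rewrite /enorm3 /sqnorm3; congr Num.sqrt; ring.
Qed.

(** Reflections carry [z] to the positive third axis, and a dilation brings it to the unit vector.
    Degree $-4$ of the kernel and degree $3$ of the volume leave degree $-1$ in [z]. *)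
Lemma integral_homogeneous (P : R3 R -> R3 R -> \bar R) :
  (forall z, measurable_fun setT (P ^~ z)) -> (forall x z, 0 <= P x z) ->
  (forall a b x z, (a ^+ 2 + b ^+ 2 = 1)%R -> P (refl12 a b x) (refl12 a b z) = P x z) ->
  (forall a b x z, (a ^+ 2 + b ^+ 2 = 1)%R -> P (refl13 a b x) (refl13 a b z) = P x z) ->
  (forall h x z, (0 < h)%R -> P (scale3 h x) (scale3 h z) = (h ^- 4)%:E * P x z) ->
  forall z, z != 0%R ->
  \int[L3]_x P x z = ((enorm3 z)^-1)%:E * \int[L3]_x P x ((0, 0), 1)%R.
Proof.
move=> mP P0 P12 P13 Ph z z0.
have -> : \int[L3]_x P x z = \int[L3]_x P x ((0, 0), enorm3 z)%R.
  apply: (@radial_of_reflections _ (fun z => \int[L3]_x P x z)) => a b {z0}z ab.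
  - have [_ h] := mscaling_leb3_refl12 ab.
    have := h _ (mP (refl12 a b z)) (fun x => P0 _ _); rewrite mul1e => <-.
    by apply: eq_integral => x _; rewrite P12.
  - have [_ h] := mscaling_leb3_refl13 ab.
    have := h _ (mP (refl13 a b z)) (fun x => P0 _ _); rewrite mul1e => <-.
    by apply: eq_integral => x _; rewrite P13.
have h0 : (0 < enorm3 z)%R by rewrite enorm3_gt0.
move: (enorm3 z) h0 => h h0.
have [_ hh] := mscaling_leb3_affine (0 : R3 R)%R h0.
have := hh _ (mP ((0, 0), h)%R) (fun x => P0 _ _).
have -> : \int[L3]_x P (h * x.1.1 + (0 : R3 R).1.1, h * x.1.2 + (0 : R3 R).1.2, h * x.2 + (0 : R3 R).2)%R (0, 0, h)%R =
    (h ^- 4)%:E * \int[L3]_x P x ((0, 0), 1)%R.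
  rewrite -ge0_integralZl//; last by rewrite lee_fin invr_ge0 exprn_ge0// ltW.
    apply: eq_integral => x _; rewrite -Ph//; congr P.
      by rewrite /scale3 !addr0.
    by rewrite /scale3/= !mulr0 mulr1.
  exact: mP.
move=> /(congr1 (mule (h ^+ 3)%:E)); rewrite !muleA -!EFinM.
rewrite mulfV ?gt_eqF ?exprn_gt0// mul1e => <-; congr (_%:E * _).
by field; rewrite gt_eqF.
Qed.

Lemma sqnorm3_scale3 (h : R) (x : R3 R) : sqnorm3 (scale3 h x) = (h ^+ 2 * sqnorm3 x)%R.
Proof. by rewrite /sqnorm3 /scale3/=; ring. Qed.

Lemma enorm3_scale3 (h : R) (x : R3 R) : (0 <= h)%R -> enorm3 (scale3 h x) = (h * enorm3 x)%R.
Proof.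
by move=> h0; rewrite /enorm3 sqnorm3_scale3 sqrtrM ?sqr_ge0// sqrtr_sqr ger0_norm.
Qed.

Lemma scale3B (h : R) (x y : R3 R) : (scale3 h x - scale3 h y = scale3 h (x - y))%R.
Proof. by rewrite /scale3/=; congr (_, _, _) => /=; rewrite mulrBr. Qed.

Lemma refl12B (a b : R) (x y : R3 R) : (refl12 a b x - refl12 a b y = refl12 a b (x - y))%R.
Proof. by rewrite /refl12/=; congr (_, _, _) => /=; ring. Qed.

Lemma refl13B (a b : R) (x y : R3 R) : (refl13 a b x - refl13 a b y = refl13 a b (x - y))%R.
Proof. by rewrite /refl13/=; congr (_, _, _) => /=; ring. Qed.

Lemma measurable_sub3 d (T : measurableType d) (f g : T -> R3 R) :
  measurable_fun setT f -> measurable_fun setT g ->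
  measurable_fun setT (fun t => f t - g t)%R.
Proof.
move=> mf mg.
have m11 (u : T -> R3 R) : measurable_fun setT u -> measurable_fun setT (fun t => (u t).1.1).
  move=> mu; apply: (measurableT_comp measurable_fst); exact: (measurableT_comp measurable_fst).
have m12 (u : T -> R3 R) : measurable_fun setT u -> measurable_fun setT (fun t => (u t).1.2).
  move=> mu; apply: (measurableT_comp measurable_snd); exact: (measurableT_comp measurable_fst).
have m2 (u : T -> R3 R) : measurable_fun setT u -> measurable_fun setT (fun t => (u t).2).
  move=> mu; exact: (measurableT_comp measurable_snd).
rewrite (_ : (fun t => _) = (fun t => (((f t).1.1 - (g t).1.1, (f t).1.2 - (g t).1.2), (f t).2 - (g t).2)%R)).
  apply/measurable_fun_pair; first apply/measurable_fun_pair.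
  - by apply: measurable_funB; exact: m11.
  - by apply: measurable_funB; exact: m12.
  - by apply: measurable_funB; exact: m2.
by apply/funext => t; case: (f t) => -[? ?] ?; case: (g t) => -[? ?] ?.
Qed.

(** The size $1/|x|^2$ of the Coulomb field, with the value [0] at the origin. *)
Definition sqK (x : R3 R) : R := (sqnorm3 x)^-1%R.

Lemma sqK_ge0 x : (0 <= sqK x)%R.
Proof. by rewrite invr_ge0 sqnorm3_ge0. Qed.

Lemma measurable_sqK : measurable_fun setT sqK.
Proof. exact: (measurableT_comp measurable_invr measurable_sqnorm3). Qed.

(** The larger of the squared distances to the two singularities is at least $1/4$. If the smaller
    one, [s], is below [1], the product is at most $4/s$; otherwise it is at most $s^{-2}$. Both
    bounds are integrable in three dimensions. *)
Lemma sqK_conv_e_fin :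
  \int[L3]_x (sqK x * sqK (x - ((0, 0), 1)))%:E < +oo.
Proof.
pose e : R3 R := ((0, 0), 1)%R.
pose A (x : R3 R) : \bar R := if (sqnorm3 x < 1)%R then ((sqnorm3 x)^-1)%:E else 0.
pose B (x : R3 R) : \bar R := if (1 <= sqnorm3 x)%R then ((sqnorm3 x) ^- 2)%:E else 0.
have mA : measurable_fun setT A.
  apply: measurable_fun_ifT => //; first exact: (measurable_fun_ltr measurable_sqnorm3).
  by apply/measurable_EFinP; exact: measurable_sqK.
have mB : measurable_fun setT B.
  apply: measurable_fun_ifT => //; first exact: (measurable_fun_ler _ measurable_sqnorm3).
  apply/measurable_EFinP; apply: (measurableT_comp measurable_invr).
  by apply: measurable_funX; exact: measurable_sqnorm3.
have A0 x : 0 <= A x by rewrite /A; case: ifPn => // _; rewrite lee_fin sqK_ge0.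
have B0 x : 0 <= B x by rewrite /B; case: ifPn => // _; rewrite lee_fin invr_ge0 exprn_ge0// sqnorm3_ge0.
have mt : measurable_fun setT (fun x : R3 R => x - e)%R by apply: measurable_sub3.
have tr (F : R3 R -> \bar R) : measurable_fun setT F -> (forall x, 0 <= F x) ->
    \int[L3]_x F (x - e)%R = \int[L3]_x F x.
  by move=> mF F0; have [_ h] := @mscaling_leb3_translation R (- e)%R; rewrite (h F mF F0) mul1e.
have tri x : (1 <= 2 * (sqnorm3 x + sqnorm3 (x - e)))%R.
  case: x => -[a b] c; rewrite /sqnorm3/=.
  by have := sqr_ge0 (2 * c - 1)%R; have := sqr_ge0 a; have := sqr_ge0 b; lra.
have key x : (sqK x * sqK (x - e))%:E <= (4%:E * A x + 4%:E * A (x - e)%R) + (B x + B (x - e)%R).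
  have aux (s t : R) : (0 <= s)%R -> (s <= t)%R -> (1 <= 2 * (s + t))%R ->
      (s^-1 * t^-1)%:E <= 4%:E * (if (s < 1)%R then s^-1%:E else 0) + (if (1 <= s)%R then (s ^- 2)%:E else 0).
    move=> s0 st st1; have t4 : (4^-1 <= t)%R by lra.
    have t0 : (0 < t)%R by lra.
    have ti : (t^-1 <= 4)%R by rewrite -[leRHS]invrK lef_pV2// posrE invr_gt0.
    have [s1|s1] := ltP s 1%R.
      rewrite adde0 -EFinM lee_fin mulrC ler_wpM2r// invr_ge0//.
    rewrite mule0 add0e lee_fin expr2 invfM ler_wpM2l ?invr_ge0// lef_pV2// posrE; lra.
  have := tri x; rewrite /A /B /sqK; move: (sqnorm3 x) (sqnorm3 (x - e)%R) (sqnorm3_ge0 x) (sqnorm3_ge0 (x - e)%R) => s t s0 t0 st.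
  have [le_st|/ltW le_ts] := leP s t.
    apply: (le_trans (aux s t s0 le_st st)); rewrite addeACA.
    by rewrite leeDl// adde_ge0//; [rewrite mule_ge0//|]; case: ifPn => // _; rewrite lee_fin invr_ge0// exprn_ge0.
  rewrite mulrC; apply: (le_trans (aux t s t0 le_ts _)); first by rewrite addrC.
  rewrite addeACA leeDr// adde_ge0//; [rewrite mule_ge0//|]; case: ifPn => // _; rewrite lee_fin invr_ge0// exprn_ge0//.
have m4A : measurable_fun setT (fun x => 4%:E * A x) by exact: emeasurable_funM.
have m4Ae : measurable_fun setT (fun x : R3 R => 4%:E * A (x - e)%R).
  by apply: emeasurable_funM => //; exact: (measurableT_comp mA mt).
have mBe : measurable_fun setT (fun x : R3 R => B (x - e)%R) by exact: (measurableT_comp mB mt).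
apply: (@le_lt_trans _ _ (\int[L3]_x ((4%:E * A x + 4%:E * A (x - e)%R) + (B x + B (x - e)%R)))).
  apply: ge0_le_integral => //.
  - by move=> x _; rewrite lee_fin mulr_ge0// sqK_ge0.
  - apply/measurable_EFinP; apply: measurable_funM; first exact: measurable_sqK.
    exact: (measurableT_comp measurable_sqK mt).
  - by apply: emeasurable_funD; apply: emeasurable_funD.
have i4A : 4%:E * \int[L3]_x A x < +oo by apply: lte_mul_pinfty => //; exact: integral_sqnorm3V_ball.
rewrite ge0_integralD//; try (by move=> x _; rewrite adde_ge0// mule_ge0//); try (by move=> x _; rewrite adde_ge0//);
  try exact: emeasurable_funD.
apply: lte_add_pinfty.
  rewrite ge0_integralD//; try (by move=> x _; rewrite mule_ge0//).
  rewrite ge0_integralZl// ge0_integralZl//; last exact: (measurableT_comp mA mt).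
  by rewrite tr//; apply: lte_add_pinfty.
rewrite ge0_integralD// tr//.
by apply: lte_add_pinfty; exact: integral_sqnorm3_tail.
Qed.

Lemma sqK_conv (y z : R3 R) : y != z ->
  \int[L3]_x (sqK (x - y) * sqK (x - z))%:E =
  ((enorm3 (y - z))^-1)%:E * \int[L3]_x (sqK x * sqK (x - ((0, 0), 1)))%:E.
Proof.
move=> yz.
have mt (b : R3 R) : measurable_fun setT (fun x : R3 R => x - b)%R by apply: measurable_sub3.
have mP (b : R3 R) : measurable_fun setT (fun x => (sqK x * sqK (x - b))%:E).
  apply/measurable_EFinP; apply: measurable_funM; first exact: measurable_sqK.
  exact: (measurableT_comp measurable_sqK (mt b)).
have -> : \int[L3]_x (sqK (x - y) * sqK (x - z))%:E = \int[L3]_x (sqK x * sqK (x - (z - y)))%:E.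
  have [_ h] := @mscaling_leb3_translation R (- y)%R.
  have := h _ (mP (z - y)%R) (fun x => _); rewrite mul1e => <-.
    by apply: eq_integral => x _; rewrite opprB addrA subrK.
  by move=> x; rewrite lee_fin mulr_ge0// sqK_ge0.
have -> : enorm3 (y - z)%R = enorm3 (z - y)%R.
  by rewrite /enorm3 /sqnorm3/=; congr Num.sqrt; ring.
apply: (@integral_homogeneous (fun x b => (sqK x * sqK (x - b))%:E)) => //.
- by move=> x b; rewrite lee_fin mulr_ge0// sqK_ge0.
- by move=> a b x c ab; rewrite refl12B /sqK !sqnorm3_refl12.
- by move=> a b x c ab; rewrite refl13B /sqK !sqnorm3_refl13.
- move=> h x b h0; rewrite scale3B /sqK !sqnorm3_scale3 -EFinM; congr EFin.
  have -> : (h ^- 4 = (h ^+ 2)^-1 * (h ^+ 2)^-1)%R by rewrite -invfM -exprD.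
  by rewrite !invfM mulrACA.
- by rewrite subr_eq0 eq_sym.
Qed.

End homogeneous_kernels.

(** * Borel sets and test functions in three-space *)

Section borel_R3.
Context {R : realType}.
Notation mu := (@lebesgue_measure R).
Notation L3 := (@leb3 R).

(** The measurable structure is that of the product, while openness refers to the product norm; an
    open set is a countable union of cubes with rational centres, and these are measurable
    rectangles. *)
Lemma open_measurable3 (U : set (R3 R)) : open U -> measurable U.
Proof.
move=> oU.
pose B (p q r : rat) (n : nat) : set (R3 R) :=
  [set y | `|y.1.1 - ratr p| < n.+1%:R^-1] `&` [set y | `|y.1.2 - ratr q| < n.+1%:R^-1] `&`
  [set y | `|y.2 - ratr r| < n.+1%:R^-1].
pose F p q r n := if `[< B p q r n `<=` U >] then B p q r n else set0.
have -> : U = \bigcup_p \bigcup_q \bigcup_r \bigcup_n F p q r n.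
  apply/seteqP; split => [x Ux|x [p _ [q _ [r _ [n _]]]]]; last first.
    by rewrite /F; case: asboolP => // BU Bx; exact: BU.
  have /nbhs_ballP[e /= e0 xeU] : nbhs x U by rewrite nbhsE; exists U.
  have [n n2] : exists n, 2 * n.+1%:R^-1 < e.
    have e20 : 0 < e / 2 by lra.
    have := @near_infty_natSinv_lt R (PosNum e20) => -[n _ /(_ n (leqnn n))] /= hn.
    by exists n; rewrite mulrC -ltr_pdivlMr.
  have n0 : 0 < n.+1%:R^-1 :> R by rewrite invr_gt0.
  have rat_near (d t : R) : 0 < d -> exists q : rat, `|t - ratr q| < d.
    move=> d0; have [|q] := @rat_in_itvoo R (t - d) (t + d); first by lra.
    rewrite in_itv/= => /andP[q1 q2]; exists q.
    by rewrite ltr_norml; apply/andP; split; lra.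
  have [p hp] := rat_near _ x.1.1 n0; have [q hq] := rat_near _ x.1.2 n0; have [r hr] := rat_near _ x.2 n0.
  exists p => //; exists q => //; exists r => //; exists n => //; rewrite /F.
  case: asboolP => // -[] y [[/= y1 y2] y3]; apply: xeU.
  have tri (a b c : R) : `|a - c| < n.+1%:R^-1 -> `|b - c| < n.+1%:R^-1 -> ball a e b.
    move: n2; move: (n.+1%:R^-1) => d n2 h1 h2; rewrite /ball/= (_ : a - b = (a - c) - (b - c)); last by ring.
    by rewrite (le_lt_trans (ler_normB _ _))//; lra.
  by split; [split|]; [exact: tri hp y1|exact: tri hq y2|exact: tri hr y3].
have mB p q r n : measurable (B p q r n).
  have mc (g : R3 R -> R) (c : rat) : measurable_fun setT g ->
      measurable [set y | `|g y - ratr c| < n.+1%:R^-1].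
    move=> mg; rewrite -[X in measurable X]setTI; apply: measurable_fun_ltr => //.
    by apply: measurableT_comp => //; exact: measurable_funB.
  by apply: measurableI; [apply: measurableI|]; apply: mc => //; apply: measurableT_comp.
apply: bigcupT_measurable_rat => p; apply: bigcupT_measurable_rat => q.
apply: bigcupT_measurable_rat => r; apply: bigcupT_measurable => n.
by rewrite /F; case: asboolP.
Qed.

Lemma continuous_measurable3 (phi : R3 R -> R) : continuous phi -> measurable_fun setT phi.
Proof.
move=> /continuousP cphi; apply: (measurability _ (RGenOpens.measurableE R)).
move=> _ [_ [a [b ->] <-]]; rewrite setTI; apply: open_measurable3.
exact/cphi/interval_open.
Qed.

Lemma norm3_le (x : R3 R) (B : R) :
  (`|x| <= B) = [&& `|x.1.1| <= B, `|x.1.2| <= B & `|x.2| <= B].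
Proof. by rewrite prod_normE/= prod_normE/= !ge_max andbA. Qed.

Lemma bounded_of_compact_support (psi : R3 R -> R) (A : set (R3 R)) : continuous psi ->
  compact A -> (forall x, ~ A x -> psi x = 0) -> exists C : R, 0 <= C /\ forall x, `|psi x| <= C.
Proof.
move=> cpsi cA psi0.
have /compact_bounded[C [_ hC]] := continuous_compact (continuous_subspaceT cpsi) cA.
exists (`|C| + 1); split; first by rewrite addr_ge0.
move=> x; have [Ax|nAx] := pselect (A x); last by rewrite psi0// normr0 addr_ge0.
by apply: (hC (`|C| + 1)); [rewrite (le_lt_trans (ler_norm C))// ltrDl|exists x].
Qed.

Lemma test_fun_continuous (phi : R3 R -> R) : test_fun phi -> continuous phi.
Proof. by move=> [dphi _ _] x; exact: differentiable_continuous. Qed.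

Lemma test_fun_derive_support (phi : R3 R -> R) (i : 'I_3) (x : R3 R) :
  ~ closure [set x | phi x != 0] x -> 'D_(e3 R i) phi x = 0.
Proof.
move=> nx.
have e0 : e3 R i != 0.
  by case: i => -[|[|[|//]]] ?; rewrite /e3/=; apply/eqP => -[] //;
    do ?[move=> /eqP; rewrite oner_eq0//]; move=> _ /eqP; rewrite oner_eq0.
rewrite (@near_eq_derive _ _ _ _ (cst 0))//; first exact: derive_cst.
have /closed_openC oc := @closed_closure _ [set x | phi x != 0].
have : nbhs x (~` closure [set x | phi x != 0]) by rewrite nbhsE; exists (~` closure [set x | phi x != 0]).
apply: filterS => y ny /=.
by apply/eqP; apply: contra_notT ny => ny; exact: subset_closure.
Qed.

Lemma test_fun_bounds (phi : R3 R -> R) : test_fun phi -> exists B C : R,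
  [/\ 0 < B, 0 <= C,
    forall x, B < `|x| -> phi x = 0 /\ forall i : 'I_3, 'D_(e3 R i) phi x = 0 &
    forall x, `|phi x| <= C /\ forall i : 'I_3, `|'D_(e3 R i) phi x| <= C].
Proof.
move=> tphi; have [_ cD cA] := tphi; set A := closure _ in cA.
have nA x : ~ A x -> phi x = 0.
  by move=> nx; apply/eqP; apply: contra_notT nx => nx; exact: subset_closure.
have [B [_ hB]] := compact_bounded cA.
have [C [C0 hC]] := bounded_of_compact_support (test_fun_continuous tphi) cA nA.
have hD (i : 'I_3) := bounded_of_compact_support (cD i) cA (@test_fun_derive_support phi i).
have [C1 [C10 hC1]] := hD ord0.
have [C2 [C20 hC2]] := hD (inord 1).
have [C3 [C30 hC3]] := hD (inord 2).
exists (`|B| + 1), (C + C1 + C2 + C3); split; [by rewrite ltr_wpDl|lra| |].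
- move=> x xB; have nx : ~ A x.
    move=> Ax; have := hB (`|B| + 1); rewrite (le_lt_trans (ler_norm B)) ?ltrDl// => /(_ isT x Ax) /=.
    by rewrite leNgt xB.
  by split; [exact: nA|move=> i; exact: test_fun_derive_support].
- move=> x; split; first by have := hC x; lra.
  case=> -[|[|[|//]]] i3.
  + by rewrite (_ : Ordinal i3 = ord0); [have := hC1 x; lra|exact/val_inj].
  + by rewrite (_ : Ordinal i3 = inord 1); [have := hC2 x; lra|apply/val_inj; rewrite /= inordK].
  + by rewrite (_ : Ordinal i3 = inord 2); [have := hC3 x; lra|apply/val_inj; rewrite /= inordK].
Qed.

End borel_R3.

(** * The weak gradient of the potential *)

Section integration_by_parts_lines.
Context {R : realType}.
Notation mu := (@lebesgue_measure R).
Notation L3 := (@leb3 R).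

Definition coord3 (i : 'I_3) (x : R3 R) : R :=
  match val i with 0%N => x.1.1 | 1%N => x.1.2 | _ => x.2 end.

(* junk value [K3 0 = 0] *)
Definition K3 (x : R3 R) : R := (enorm3 x)^-1.

(** The component $x_i/|x|^3$, which is minus the [i]-th partial derivative of $1/|x|$ away from the
    origin. *)
Definition gK (i : 'I_3) (x : R3 R) : R := coord3 i x * K3 x ^+ 3.

(* the point of the line parallel to the i-th axis through p at abscissa t *)
Definition line3 (i : 'I_3) (z : (R * R) * R) : R3 R :=
  match val i with 0%N => ((z.2, z.1.1), z.1.2) | 1%N => ((z.1.1, z.2), z.1.2) | _ => z end.

Lemma mscaling_line3 i : mscaling L3 L3 1 (line3 i).
Proof.
case: i => -[|[|[|//]]] i3; rewrite /line3/=.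
- by have := mscaling_comp (@mscaling_leb3_swap23 R) (@mscaling_leb3_swap12 R); rewrite mulr1.
- exact: mscaling_leb3_swap23.
- exact: mscaling_id.
Qed.

Lemma add3E (x y : R3 R) : x + y = ((x.1.1 + y.1.1, x.1.2 + y.1.2), x.2 + y.2).
Proof. by case: x y => -[? ?] ? [[? ?] ?]. Qed.

Lemma scale3E (h : R) (x : R3 R) : h *: x = ((h * x.1.1, h * x.1.2), h * x.2).
Proof. by case: x => -[? ?] ?. Qed.

Lemma line3D i (p : R * R) (h t : R) : line3 i (p, h + t) = h *: e3 R i + line3 i (p, t).
Proof.
rewrite scale3E add3E; case: p => p1 p2; case: i => -[|[|[|//]]] i3; rewrite /line3 /e3/=;
  by rewrite ?mulr1 ?mulr0 ?add0r.
Qed.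

Lemma is_derive_line3 i (phi : R3 R -> R) (p : R * R) (t : R) :
  differentiable phi (line3 i (p, t)) ->
  is_derive t (1 : R) (fun t : R => phi (line3 i (p, t))) ('D_(e3 R i) phi (line3 i (p, t))).
Proof.
move=> dphi; have dv := @diff_derivable _ _ _ _ _ (e3 R i) dphi.
have e : (fun h : R => h^-1 *: (((fun t : R => phi (line3 i (p, t))) \o shift t) (h *: (1 : R)) - phi (line3 i (p, t)))) =
   (fun h : R => h^-1 *: ((phi \o shift (line3 i (p, t))) (h *: e3 R i) - phi (line3 i (p, t)))).
  apply/funext => h /=; congr (_ *: (phi _ - _)).
  by rewrite /shift/= -line3D /GRing.scale/= mulr1.
apply: DeriveDef; first by rewrite /derivable e.
by rewrite /derive e.
Qed.

Lemma sqnorm3_line3 i (p : R * R) (t : R) (y : R3 R) :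
  sqnorm3 (line3 i (p, t) - y) =
  sqnorm3 (line3 i (p, coord3 i y) - y) + (t - coord3 i y) ^+ 2.
Proof.
case: i => -[|[|[|//]]] i3; case: p y => p q [[y1 y2] y3]; rewrite /line3 /coord3 /sqnorm3/=; ring.
Qed.

Lemma coord3_line3 i (p : R * R) (t : R) (y : R3 R) :
  coord3 i (line3 i (p, t) - y) = t - coord3 i y.
Proof. by case: i => -[|[|[|//]]] i3; case: p y => p q [[y1 y2] y3]; rewrite /line3 /coord3/=. Qed.

(** Positivity of the squared distance at the foot point means that the line misses [y], the only
    singularity of the kernel. *)
Lemma is_derive_K3_line i (p : R * R) (t : R) (y : R3 R) :
  0 < sqnorm3 (line3 i (p, coord3 i y) - y) ->
  is_derive t (1 : R) (fun t : R => K3 (line3 i (p, t) - y)) (- gK i (line3 i (p, t) - y)).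
Proof.
set m := sqnorm3 _ => m0; set c := coord3 i y.
have -> : (fun t : R => K3 (line3 i (p, t) - y)) = (fun t : R => (Num.sqrt (m + (t - c) ^+ 2))^-1).
  by apply/funext => s; rewrite /K3 /enorm3 sqnorm3_line3.
have h0 : 0 < m + (t - c) ^+ 2 by rewrite ltr_wpDr// sqr_ge0.
have d1 : is_derive t (1 : R) (fun t : R => m + (t - c) ^+ 2 : R) (2 * (t - c)).
  have -> : (fun t : R => m + (t - c) ^+ 2 : R) = cst m + ((id : R -> R) - cst c) ^+ 2 by [].
  have h1 := is_deriveB (is_derive_id t (1 : R)) (is_derive_cst c t (1 : R)).
  have h2 := is_deriveD (is_derive_cst m t (1 : R)) (is_deriveX 2 h1).
  by apply: (is_derive_eq h2); rewrite add0r subr0 expr1 /GRing.scale/= mulr1.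
have d2 : is_derive (m + (t - c) ^+ 2) (1 : R) (@Num.sqrt R) ((2 * Num.sqrt (m + (t - c) ^+ 2))^-1).
  exact: is_derive1_sqrt.
have d3 := @is_derive1_comp _ (@Num.sqrt R) (fun t : R => m + (t - c) ^+ 2 : R) t _ _ d2 d1.
have n0 : (Num.sqrt \o (fun t : R => m + (t - c) ^+ 2 : R)) t != 0 by rewrite /= gt_eqF// sqrtr_gt0.
have d4 := is_deriveV n0 d3.
apply: (is_derive_eq d4); rewrite /gK coord3_line3 /K3 /enorm3 sqnorm3_line3 -/m -/c /GRing.scale/=.
by field; rewrite gt_eqF// sqrtr_gt0.
Qed.

End integration_by_parts_lines.

Section integration_by_parts.
Context {R : realType}.
Notation mu := (@lebesgue_measure R).
Notation L3 := (@leb3 R).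

Lemma K3_ge0 (x : R3 R) : 0 <= K3 x.
Proof. by rewrite invr_ge0 enorm3_ge0. Qed.

Lemma K3_sqr (x : R3 R) : K3 x ^+ 2 = sqK x.
Proof. by rewrite /K3 exprVn enorm3_sqr. Qed.

Lemma K3_le (x : R3 R) : K3 x <= 1 + sqK x.
Proof. by rewrite -K3_sqr; have := sqr_ge0 (K3 x - 1); nra. Qed.

Lemma coord3_le (i : 'I_3) (x : R3 R) : `|coord3 i x| <= enorm3 x.
Proof.
rewrite /enorm3 -sqrtr_sqr ler_wsqrtr// /sqnorm3.
have h1 := sqr_ge0 x.1.1; have h2 := sqr_ge0 x.1.2; have h3 := sqr_ge0 x.2.
by case: i => -[|[|[|//]]] i3; rewrite /coord3/=; lra.
Qed.

Lemma gK_le (i : 'I_3) (x : R3 R) : `|gK i x| <= sqK x.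
Proof.
rewrite /gK normrM normrX (ger0_norm (K3_ge0 x)) -K3_sqr exprS mulrA.
rewrite ler_piMl ?exprn_ge0 ?K3_ge0//.
apply: (le_trans (ler_wpM2r (K3_ge0 x) (coord3_le i x))).
rewrite /K3; have [->|n0] := eqVneq (enorm3 x) 0; first by rewrite mul0r.
by rewrite divff.
Qed.

Lemma measurable_K3 : measurable_fun setT (@K3 R).
Proof. exact: (measurableT_comp measurable_invr measurable_enorm3). Qed.

Lemma measurable_coord3 i : measurable_fun setT (@coord3 R i).
Proof. by case: i => -[|[|[|//]]] i3; rewrite /coord3/=; apply: measurableT_comp. Qed.

Lemma measurable_gK i : measurable_fun setT (@gK R i).
Proof.
apply: measurable_funM; first exact: measurable_coord3.
by apply: measurable_funX; exact: measurable_K3.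
Qed.

Definition cube3 (B : R) : set (R3 R) := [set x | `|x| <= B].

Lemma cube3E (B : R) : cube3 B = (`[- B, B] `*` `[- B, B]) `*` `[- B, B].
Proof.
by apply/seteqP; split => x /=; rewrite /cube3/= norm3_le !in_itv/= -!ler_norml; [move=> /and3P[-> -> ->]|move=> [[-> ->] ->]].
Qed.

Lemma measurable_cube3 (B : R) : measurable (cube3 B).
Proof. by rewrite cube3E; apply: measurableX => //; exact: measurableX. Qed.

Lemma cube3_fin (B : R) : (L3 (cube3 B) < +oo)%E.
Proof.
rewrite cube3E.
set I := `[- B, B]%classic.
have mI : measurable I by exact: measurable_itv.
have fI : (mu I < +oo)%E.
  by rewrite lebesgue_measure_itv/=; case: ifPn => _; rewrite -?EFinB ?ltry.
have -> : L3 ((I `*` I) `*` I) = (mu I * mu I * mu I)%E.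
  transitivity ((mu \x mu)%E (I `*` I) * mu I)%E.
    by apply: (@product_measure1E _ _ _ _ _ (sprod mu mu) mu) => //; exact: measurableX.
  by congr (_ * _)%E; exact: product_measure1E.
by rewrite !lte_mul_pinfty ?mule_ge0// fin_numM// ge0_fin_numE.
Qed.

Lemma measurable_translate3 (y : R3 R) : measurable_fun setT (fun x : R3 R => x - y).
Proof. by apply: measurable_sub3. Qed.

(** The kernel is split at distance [1] from its singularity: the near part has the same integral
    for every [y] by translation, and the far part is at most [1] on [B]. *)
Lemma integral_sqK_le : exists C : R, 0 <= C /\
  forall (B : set (R3 R)) (y : R3 R), measurable B ->
  (\int[L3]_(x in B) (sqK (x - y))%:E <= C%:E + L3 B)%E.
Proof.
pose A (x : R3 R) : \bar R := if sqnorm3 x < 1 then ((sqnorm3 x)^-1)%:E else 0%E.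
have mA : measurable_fun setT A.
  apply: measurable_fun_ifT => //; first exact: (measurable_fun_ltr measurable_sqnorm3).
  by apply/measurable_EFinP; exact: measurable_sqK.
have A0 x : (0 <= A x)%E by rewrite /A; case: ifPn => // _; rewrite lee_fin sqK_ge0.
have iA0 : (0 <= \int[L3]_x A x)%E by apply: integral_ge0.
have iA : (\int[L3]_x A x)%E \is a fin_num by rewrite ge0_fin_numE//; exact: integral_sqnorm3V_ball.
exists (fine (\int[L3]_x A x)%E); split; first exact: fine_ge0.
move=> B y mB; rewrite fineK//.
have mAy : measurable_fun setT (fun x : R3 R => A (x - y)) by exact: (measurableT_comp mA (measurable_translate3 y)).
have -> : (\int[L3]_x A x = \int[L3]_x A (x - y)%R)%E.
  by have [_ h] := @mscaling_leb3_translation R (- y); rewrite (h A mA A0) mul1e.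
apply: (@le_trans _ _ (\int[L3]_(x in B) (A (x - y)%R + 1%:E))%E).
  apply: ge0_le_integral => //.
  - by move=> x _; rewrite lee_fin sqK_ge0.
  - apply: measurable_funTS; apply/measurable_EFinP.
    exact: (measurableT_comp measurable_sqK (measurable_translate3 y)).
  - by apply: emeasurable_funD => //; exact: measurable_funTS.
  move=> x _; rewrite /A /sqK; case: ltP => [_|h]; first by rewrite leeDl.
  by rewrite add0e lee_fin invf_le1// (lt_le_trans _ h).
rewrite ge0_integralD//; last exact: measurable_funTS.
rewrite integral_cst// mul1e leeD2r//.
by apply: ge0_subset_integral.
Qed.

Lemma integrable_cube3 (psi : R3 R -> R) (y : R3 R) (B C : R) :
  measurable_fun setT psi -> (forall x, `|psi x| <= C * (1 + sqK (x - y))) ->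
  (forall x, B < `|x| -> psi x = 0) -> 0 <= C ->
  L3.-integrable setT (EFin \o psi).
Proof.
move=> mpsi hC hB C0; apply/integrableP; split; first exact/measurable_EFinP.
have [C' [C'0 hC']] := integral_sqK_le.
have ms : measurable_fun setT (fun x : R3 R => sqK (x - y)).
  exact: (measurableT_comp measurable_sqK (measurable_translate3 y)).
apply: (@le_lt_trans _ _ (\int[L3]_(x in cube3 B) (C%:E * (1 + (sqK (x - y))%:E)))%E).
  rewrite [leRHS]integral_mkcond; apply: ge0_le_integral => //.
  - by apply: measurableT_comp => //; exact/measurable_EFinP.
  - apply/(measurable_restrictT _ _).1; first exact: measurable_cube3.
    apply: measurable_funTS; apply: emeasurable_funM => //; apply: emeasurable_funD => //.
    exact/measurable_EFinP.
  move=> x _; rewrite patchE; case: ifPn => [_|].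
    by rewrite -EFinD -EFinM abse_EFin lee_fin.
  by rewrite notin_setE /cube3/= => /negP; rewrite -ltNge => h; rewrite hB// normr0.
have mcube := measurable_cube3 B.
have msB : measurable_fun (cube3 B) (fun x => (sqK (x - y))%:E).
  by apply: measurable_funTS; exact/measurable_EFinP.
rewrite ge0_integralZl//; last 2 first.
- by apply: emeasurable_funD.
- by move=> x _; rewrite adde_ge0// lee_fin sqK_ge0.
apply: lte_mul_pinfty => //; rewrite ge0_integralD//; last by move=> x _; rewrite lee_fin sqK_ge0.
rewrite integral_cst// mul1e; apply: lte_add_pinfty; first exact: cube3_fin.
by apply: (le_lt_trans (hC' _ _ mcube)); apply: lte_add_pinfty => //; [exact: ltry|exact: cube3_fin].
Qed.

Lemma continuous_line3 i (p : R * R) : continuous (fun t : R => line3 i (p, t)).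
Proof.
have -> : (fun t : R => line3 i (p, t)) = (fun t : R => t *: e3 R i + line3 i (p, 0)).
  by apply/funext => t; rewrite -line3D addr0.
move=> t; apply: cvgD; last exact: cvg_cst.
by apply: cvgZ; [exact: cvg_id|exact: cvg_cst].
Qed.

Lemma norm_line3_ge i (p : R * R) (t : R) : `|t| <= `|line3 i (p, t)|.
Proof.
have := lexx `|line3 i (p, t)|; rewrite {1}norm3_le.
by case: i => -[|[|[|//]]] i3 /and3P[h1 h2 h3].
Qed.

(** The integrand is the derivative along the line of [K3] times [phi], which is smooth enough there
    and vanishes outside a bounded interval. *)
Lemma integral_div_line i (phi : R3 R -> R) (y : R3 R) (p : R * R) : test_fun phi ->
  0 < sqnorm3 (line3 i (p, coord3 i y) - y) ->
  (\int[mu]_t (K3 (line3 i (p, t) - y) * 'D_(e3 R i) phi (line3 i (p, t)) -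
     gK i (line3 i (p, t) - y) * phi (line3 i (p, t)))%:E = 0)%E.
Proof.
move=> tphi m0; have [dphi cD _] := tphi.
have [B [C [B0 C0 hB hC]]] := test_fun_bounds tphi.
pose W (t : R) : R := K3 (line3 i (p, t) - y) * phi (line3 i (p, t)).
pose w (t : R) : R := K3 (line3 i (p, t) - y) * 'D_(e3 R i) phi (line3 i (p, t)) -
     gK i (line3 i (p, t) - y) * phi (line3 i (p, t)).
have dK (t : R) := @is_derive_K3_line R i p t y m0.
have dp (t : R) := @is_derive_line3 R i phi p t (dphi _).
have dW (t : R) : is_derive t (1 : R) W (w t).
  have dd := is_deriveM (dK t) (dp t).
  by apply: (is_derive_eq dd); rewrite /w /GRing.scale/= mulrN (mulrC (phi _)).
have cK (t : R) := is_derive_continuous (dK t).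
have cp (t : R) := is_derive_continuous (dp t).
have cw (t : R) : {for t, continuous w}.
  apply: cvgB; apply: cvgM.
  - exact: cK.
  - apply: (@continuous_comp _ _ _ (fun t : R => line3 i (p, t)) (fun x => 'D_(e3 R i) phi x)).
      exact: continuous_line3.
    exact: cD.
  - have -> : (fun t : R => gK i (line3 i (p, t) - y)) =
        (fun t : R => (t - coord3 i y) * K3 (line3 i (p, t) - y) ^+ 3).
      by apply/funext => s; rewrite /gK coord3_line3.
    rewrite /gK coord3_line3; apply: cvgM; first by apply: cvgB; [exact: cvg_id|exact: cvg_cst].
    by apply: (@continuous_comp _ _ _ (fun t : R => K3 (line3 i (p, t) - y)) (fun u : R => u ^+ 3)); [exact: cK|exact: exprn_continuous].
  - exact: cp.
have out (t : R) : B < `|t| -> phi (line3 i (p, t)) = 0 /\ 'D_(e3 R i) phi (line3 i (p, t)) = 0.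
  move=> Bt; have [h1 h2] := hB _ (lt_le_trans Bt (norm_line3_ge i p t)); split => //; exact: h2.
transitivity (\int[mu]_(t in `[(- (B + 1))%R, (B + 1)%R]) (w t)%:E)%E.
  rewrite [RHS]integral_mkcond; apply: eq_integral => t _; rewrite patchE mem_setE/= in_itv/= -ler_norml.
  case: (leP `|t| (B + 1)) => // tB; have [h1 h2] := out t (lt_trans (ltr_pwDr ltr01 (lexx B)) tB).
  by rewrite h1 h2 !mulr0 subrr.
rewrite (@FTC2_is_derive _ w W)//; last by lra.
have oB : B < `|B + 1| by rewrite ger0_norm; lra.
have oB' : B < `|- (B + 1)| by rewrite normrN.
by rewrite /W (out _ oB).1 (out _ oB').1 !mulr0 subrr.
Qed.

Definition drop3 (i : 'I_3) (y : R3 R) : R * R :=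
  match val i with 0%N => (y.1.2, y.2) | 1%N => (y.1.1, y.2) | _ => y.1 end.

Lemma line3_drop3 i (p : R * R) (y : R3 R) : line3 i (p, coord3 i y) = y -> p = drop3 i y.
Proof.
by case: i => -[|[|[|//]]] i3; case: y => -[y1 y2] y3; case: p => p1 p2 /=; rewrite /line3 /drop3 /coord3/= => -[-> ->].
Qed.

(** Integrating along the lines parallel to the [i]-th axis avoids a boundary term around the
    singularity: only one of these lines meets [y], so the base points with a singular line form a
    null set. *)
Lemma integral_K3_derive i (phi : R3 R -> R) (y : R3 R) : test_fun phi ->
  [/\ L3.-integrable setT (fun x => (K3 (x - y) * 'D_(e3 R i) phi x)%:E),
      L3.-integrable setT (fun x => (gK i (x - y) * phi x)%:E) &
  (\int[L3]_x (K3 (x - y) * 'D_(e3 R i) phi x)%:E = \int[L3]_x (gK i (x - y) * phi x)%:E)%E].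
Proof.
move=> tphi; have [dphi cD _] := tphi.
have [B [C [B0 C0 hB hC]]] := test_fun_bounds tphi.
have mK : measurable_fun setT (fun x : R3 R => K3 (x - y)).
  exact: (measurableT_comp measurable_K3 (measurable_translate3 y)).
have mg : measurable_fun setT (fun x : R3 R => gK i (x - y)).
  exact: (measurableT_comp (measurable_gK i) (measurable_translate3 y)).
have mphi : measurable_fun setT phi by apply: continuous_measurable3; exact: test_fun_continuous.
have mD : measurable_fun setT (fun x => 'D_(e3 R i) phi x) by exact: continuous_measurable3.
have i1 : L3.-integrable setT (EFin \o (fun x => K3 (x - y) * 'D_(e3 R i) phi x)).
  apply: (@integrable_cube3 _ y B C) => //.
  - exact: measurable_funM.
  - move=> x; rewrite normrM mulrC (ger0_norm (K3_ge0 _)).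
    by apply: ler_pM => //; [exact: K3_ge0|exact: (hC x).2|exact: K3_le].
  - by move=> x /hB[_ ->]; rewrite mulr0.
have i2 : L3.-integrable setT (EFin \o (fun x => gK i (x - y) * phi x)).
  apply: (@integrable_cube3 _ y B C) => //.
  - exact: measurable_funM.
  - move=> x; rewrite normrM mulrC.
    apply: ler_pM => //; first exact: (hC x).1.
    by apply: (le_trans (gK_le i (x - y))); rewrite lerDr.
  - by move=> x /hB[-> _]; rewrite mulr0.
split => //.
have i12 := integrableB measurableT i1 i2.
pose h (x : R3 R) := (K3 (x - y) * 'D_(e3 R i) phi x - gK i (x - y) * phi x)%:E.
have ih : L3.-integrable setT h by exact: i12.
suff h0 : (\int[L3]_x h x = 0)%E.
  have := integralB measurableT i1 i2; rewrite -[X in (X = _)%E]/(\int[L3]_x h x)%E h0.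
  move/esym/eqP; rewrite sube_eq; first by rewrite add0e => /eqP.
  - exact: integrable_fin_num.
  - by rewrite fin_num_adde_defl//; exact: integrable_fin_num.
have [ihl hl] := mscaling_integrable ler01 (mscaling_line3 i) ih.
move: hl; rewrite mul1e => <-.
have := @integral12_prod_meas1 _ _ _ _ _ (sprod mu mu) mu _ ihl.
rewrite -[X in (_ = X)%E -> _]/(\int[L3]_x h (line3 i x))%E => <-.
rewrite /fubini_F/=.
pose y' := drop3 i y.
rewrite -[RHS](@integral0 _ _ _ (sprod mu mu) setT).
apply: ae_eq_integral => //.
  exact: (@measurable_fubini_F _ _ _ _ _ (sprod mu mu) mu _ ihl).
exists ([set y'.1] `*` [set y'.2]); split.
- exact: measurableX.
- transitivity (mu [set y'.1] * mu [set y'.2])%E; first exact: product_measure1E.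
  by rewrite lebesgue_measure_set1 mul0e.
move=> p hp.
have m0 : sqnorm3 (line3 i (p, coord3 i y) - y) = 0.
  apply/eqP; apply: contra_notT hp => m0 _ /=; apply: integral_div_line => //.
  by rewrite lt_neqAle eq_sym m0 sqnorm3_ge0.
by move/eqP : m0; rewrite sqnorm3_eq0 subr_eq0 => /eqP/line3_drop3 ->.
Qed.

End integration_by_parts.

Section almost_everywhere.
Context d (T : measurableType d) (R : realType) (m : {measure set T -> \bar R}).
Implicit Types P Q : T -> Prop.

Lemma ae_imp P Q : (forall x, P x -> Q x) -> {ae m, forall x, P x} -> {ae m, forall x, Q x}.
Proof. by move=> PQ; apply: filterS. Qed.

Lemma ae_imp2 P1 P2 Q : (forall x, P1 x -> P2 x -> Q x) ->
  {ae m, forall x, P1 x} -> {ae m, forall x, P2 x} -> {ae m, forall x, Q x}.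
Proof. by move=> PQ; apply: filterS2. Qed.

End almost_everywhere.

(** * Fields generated by an integrable function and a dominated kernel *)

Section kernel_field.
Context d1 d2 (X : measurableType d1) (Z : measurableType d2) (R : realType).
Variables (mX : {sigma_finite_measure set X -> \bar R}).
Variables (mZ : {sigma_finite_measure set Z -> \bar R}).
Variables (f : Z -> R) (s : X * Z -> R).
Hypotheses (mf : measurable_fun setT f) (f0 : forall z, 0 <= f z).
Hypothesis ffin : (\int[mZ]_z (f z)%:E < +oo)%E.
Hypotheses (ms : measurable_fun setT s) (s0 : forall w, 0 <= s w).

Lemma measurable_kfield_integrand (k : X * Z -> R) : measurable_fun setT k ->
  measurable_fun setT (fun w : X * Z => f w.2 * k w).
Proof. by move=> mk; apply: measurable_funM => //; exact: measurableT_comp. Qed.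

Lemma measurable_kfield_section (k : X * Z -> R) x : measurable_fun setT k ->
  measurable_fun setT (fun z => f z * k (x, z)).
Proof.
by move=> mk; apply: measurable_funM => //; exact: (measurableT_comp mk (pair1_measurable x)).
Qed.

Lemma kfield_ge0 x z : (0 <= (f z * s (x, z))%:E :> \bar R)%E.
Proof. by rewrite lee_fin mulr_ge0. Qed.

Lemma integral_kfield_ge0 x : (0 <= \int[mZ]_z (f z * s (x, z))%:E)%E.
Proof. by apply: integral_ge0 => z _; exact: kfield_ge0. Qed.

Lemma measurable_ge0_kfield : measurable_fun setT (fun x => \int[mZ]_z (f z * s (x, z))%:E)%E.
Proof.
have mF : measurable_fun setT (fun w : X * Z => (f w.2 * s w)%:E).
  by apply/measurable_EFinP; exact: measurable_kfield_integrand.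
by apply: (@measurable_fun_fubini_tonelli_F _ _ _ _ _ mZ _ mF) => -[x z]; exact: kfield_ge0.
Qed.

Lemma kfield_fin (B : set X) (C : R) : measurable B ->
  (forall z, (\int[mX]_(x in B) (s (x, z))%:E <= C%:E)%E) ->
  (\int[mX]_(x in B) \int[mZ]_z (f z * s (x, z))%:E < +oo)%E.
Proof.
move=> mB hC.
pose F (w : X * Z) : \bar R := (f w.2 * s w * \1_B w.1)%:E.
have mF : measurable_fun setT F.
  apply/measurable_EFinP; apply: measurable_funM; first exact: measurable_kfield_integrand.
  by apply: (measurableT_comp _ measurable_fst); exact: measurable_indic.
have F0 w : (0 <= F w)%E by rewrite lee_fin !mulr_ge0.
have -> : (\int[mX]_(x in B) \int[mZ]_z (f z * s (x, z))%:E = \int[mX]_x \int[mZ]_z F (x, z))%E.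
  rewrite [LHS]integral_mkcond; apply: eq_integral => x _; rewrite patchE /F/= indicE.
  case: ifPn => _; first by apply: eq_integral => z _; rewrite mulr1.
  by under eq_integral do rewrite mulr0; rewrite integral0.
rewrite (@fubini_tonelli _ _ _ _ _ mX mZ _ mF F0).
apply: (@le_lt_trans _ _ (\int[mZ]_z ((f z)%:E * `|C|%:E))%E).
  apply: ge0_le_integral => //.
  - by move=> z _; apply: integral_ge0.
  - exact: (@measurable_fun_fubini_tonelli_G _ _ _ _ _ mX _ mF F0).
  - by apply: emeasurable_funM => //; exact/measurable_EFinP.
  move=> z _; rewrite /F/=.
  have msz : measurable_fun B (fun x => (s (x, z))%:E).
    apply: measurable_funTS; apply/measurable_EFinP.
    exact: (measurableT_comp ms (pair2_measurable z)).
  have -> : (\int[mX]_x (f z * s (x, z) * \1_B x)%:E =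
      \int[mX]_(x in B) ((f z)%:E * (s (x, z))%:E))%E.
    rewrite [RHS]integral_mkcond; apply: eq_integral => x _; rewrite patchE indicE.
    by case: ifPn => _; rewrite ?mulr1 ?mulr0.
  rewrite (ge0_integralZl_EFin _ mB) //; last by move=> x _; rewrite lee_fin.
  apply: lee_wpmul2l; rewrite ?lee_fin//; apply: (le_trans (hC z)).
  by rewrite lee_fin ler_norm.
under eq_integral do rewrite muleC.
rewrite (ge0_integralZl_EFin _ measurableT)//; last 2 first.
- by move=> z _; rewrite lee_fin.
- exact/measurable_EFinP.
by apply: lte_mul_pinfty => //; rewrite lee_fin.
Qed.

Definition kfield (k : X * Z -> R) (x : X) : \bar R := (\int[mZ]_z (f z * k (x, z))%:E)%E.

Variable k : X * Z -> R.
Hypothesis mk : measurable_fun setT k.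
Hypothesis kle : forall w, `|k w| <= s w.

Lemma measurable_kfield : measurable_fun setT (kfield k).
Proof.
pose F := (fun w : X * Z => (f w.2 * k w)%:E).
have mF : measurable_fun setT F by apply/measurable_EFinP; exact: measurable_kfield_integrand.
have -> : kfield k = (fun x => \int[mZ]_z (F^\+ (x, z)) - \int[mZ]_z (F^\- (x, z)))%E.
  apply/funext => x; rewrite /kfield integralE; congr (_ - _)%E; apply: eq_integral => z _.
    by have := congr1 (@^~ z) (funepos_comp F (pair x)).
  by have := congr1 (@^~ z) (funeneg_comp F (pair x)).
apply: emeasurable_funB.
- by apply: (@measurable_fun_fubini_tonelli_F _ _ _ _ _ mZ (F^\+)%E) => //; exact: measurable_funepos.
- by apply: (@measurable_fun_fubini_tonelli_F _ _ _ _ _ mZ (F^\-)%E) => //; exact: measurable_funeneg.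
Qed.

Lemma kfield_integrand_le x z : `|f z * k (x, z)| <= f z * s (x, z).
Proof. by rewrite normrM ger0_norm// ler_wpM2l. Qed.

Lemma kfield_abs_le x :
  (\int[mZ]_z `|(f z * k (x, z))%:E| <= \int[mZ]_z (f z * s (x, z))%:E)%E.
Proof.
apply: ge0_le_integral => //.
- by apply: measurableT_comp => //; apply/measurable_EFinP; exact: measurable_kfield_section.
- by apply/measurable_EFinP; exact: measurable_kfield_section.
- by move=> z _; rewrite lee_fin kfield_integrand_le.
Qed.

Lemma kfield_integrable x : (\int[mZ]_z (f z * s (x, z))%:E < +oo)%E ->
  mZ.-integrable setT (fun z => (f z * k (x, z))%:E).
Proof.
move=> hx; apply/integrableP; split.
  by apply/measurable_EFinP; exact: measurable_kfield_section.
exact: (le_lt_trans (kfield_abs_le x)).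
Qed.

Lemma fine_kfield_le x :
  ((`|fine (kfield k x)|%:E : \bar R) <= \int[mZ]_z (f z * s (x, z))%:E)%E.
Proof.
apply: (@le_trans _ _ `|kfield k x|%E).
  by case: (kfield k x) => [r| |] //=; rewrite normr0 leey.
apply: (le_trans _ (kfield_abs_le x)); apply: le_abse_integral => //.
by apply/measurable_EFinP; exact: measurable_kfield_section.
Qed.

Lemma measurable_fine_kfield : measurable_fun setT (fun x => fine (kfield k x)).
Proof. by apply: measurableT_comp => //; exact: measurable_kfield. Qed.

Lemma kfield_loc (A B : set X) (C : R) : measurable A -> measurable B -> A `<=` B ->
  (forall z, (\int[mX]_(x in B) (s (x, z))%:E <= C%:E)%E) ->
  (\int[mX]_(x in A) `|fine (kfield k x)|%:E < +oo)%E.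
Proof.
move=> mA mB AB hC; apply: le_lt_trans (kfield_fin mB hC).
have mI := measurable_ge0_kfield.
apply: (@le_trans _ _ (\int[mX]_(x in A) \int[mZ]_z (f z * s (x, z))%:E)%E).
  apply: ge0_le_integral => //.
  - apply: measurable_funTS; apply/measurable_EFinP.
    by apply: measurableT_comp => //; exact: measurable_fine_kfield.
  - exact: measurable_funTS.
  - by move=> x _; exact: fine_kfield_le.
apply: ge0_subset_integral => //; first exact: measurable_funTS.
by move=> x _; exact: integral_kfield_ge0.
Qed.

Hypothesis aefin : {ae mX, forall x, (\int[mZ]_z (f z * s (x, z))%:E < +oo)%E}.

Lemma kfield_pairing (psi : X -> R) (B : set X) (C C' : R) : measurable_fun setT psi ->
  measurable B -> (forall z, (\int[mX]_(x in B) (s (x, z))%:E <= C'%:E)%E) ->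
  0 <= C -> (forall x, `|psi x| <= C) -> (forall x, ~ B x -> psi x = 0) ->
  (\int[mX]_x (fine (kfield k x) * psi x)%:E =
   \int[mZ]_z ((f z)%:E * \int[mX]_x (k (x, z) * psi x)%:E))%E.
Proof.
move=> mpsi mB hC' C0 hC hB.
pose H (w : X * Z) : \bar R := (f w.2 * k w * psi w.1)%:E.
have mH : measurable_fun setT H.
  apply/measurable_EFinP; apply: measurable_funM; first exact: measurable_kfield_integrand.
  exact: measurableT_comp.
have mI := measurable_ge0_kfield.
have mH' : measurable_fun setT (abse \o H) by apply: measurableT_comp mH.
have iH : (mX \x mZ)%E.-integrable setT H.
  apply/(@integrable12ltyP _ _ _ _ _ mX mZ _ mH).
  apply: (@le_lt_trans _ _ (C%:E * \int[mX]_(x in B) \int[mZ]_z (f z * s (x, z))%:E)%E); last first.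
    by apply: lte_mul_pinfty => //; exact: kfield_fin hC'.
  rewrite -(ge0_integralZl_EFin _ mB)//; last 2 first.
  - by move=> x _; exact: integral_kfield_ge0.
  - exact: measurable_funTS.
  rewrite [leRHS]integral_mkcond; apply: ge0_le_integral => //.
  - by move=> x _; apply: integral_ge0.
  - by apply: (@measurable_fun_fubini_tonelli_F _ _ _ _ _ mZ _ mH') => w; exact: abse_ge0.
  - apply/(measurable_restrictT _ _).1 => //.
    by apply: measurable_funTS; apply: emeasurable_funM.
  move=> x _; rewrite patchE; case: ifPn => [_|]; last first.
    rewrite notin_setE => xB.
    by under eq_integral do rewrite /H/= hB// mulr0 normr0; rewrite integral0.
  rewrite -(ge0_integralZl_EFin _ measurableT)//; last 2 first.
  - by move=> z _; exact: kfield_ge0.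
  - by apply/measurable_EFinP; exact: measurable_kfield_section.
  apply: ge0_le_integral => //.
  - exact: (measurableT_comp mH' (pair1_measurable x)).
  - apply: emeasurable_funM => //; apply/measurable_EFinP.
    exact: measurable_kfield_section.
  move=> z _; rewrite /H/= lee_fin normrM mulrC.
  by apply: ler_pM => //; exact: kfield_integrand_le.
(* The truncation [fine] is harmless wherever the majorant [s] has a finite integral against [f],
   hence almost everywhere. *)
transitivity (\int[mX]_x \int[mZ]_z H (x, z))%E.
  apply: ae_eq_integral => //.
  - by apply/measurable_EFinP; apply: measurable_funM => //; exact: measurable_fine_kfield.
  - exact: (@measurable_fubini_F _ _ _ _ _ mX mZ _ iH).
  apply: ae_imp aefin => x hx _; have ix := kfield_integrable hx; rewrite /H/=.
  have h := integralZr measurableT ix (psi x).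
  rewrite (_ : \int[mZ]_z _ = \int[mZ]_z ((f z * k (x, z))%:E * (psi x)%:E))%E//.
  by rewrite h EFinM fineK// -/(kfield k x); exact: integrable_fin_num.
rewrite (@Fubini _ _ _ _ _ mX mZ _ iH); apply: eq_integral => z _; rewrite /H/=.
have mkz : measurable_fun setT (fun x => k (x, z)) by exact: (measurableT_comp mk (pair2_measurable z)).
have ik : mX.-integrable setT (fun x => (k (x, z) * psi x)%:E).
  apply/integrableP; split; first by apply/measurable_EFinP; exact: measurable_funM.
  have msz : measurable_fun B (fun x => (s (x, z))%:E).
    apply: measurable_funTS; apply/measurable_EFinP.
    exact: (measurableT_comp ms (pair2_measurable z)).
  apply: (@le_lt_trans _ _ (C%:E * \int[mX]_(x in B) (s (x, z))%:E)%E); last first.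
    by apply: lte_mul_pinfty => //; rewrite (le_lt_trans (hC' z))// ltry.
  rewrite -(ge0_integralZl_EFin _ mB)//; last by move=> x _; rewrite lee_fin.
  rewrite [leRHS]integral_mkcond; apply: ge0_le_integral => //.
  - apply: measurableT_comp => //; apply/measurable_EFinP; exact: measurable_funM.
  - apply/(measurable_restrictT _ _).1 => //.
    by apply: emeasurable_funM.
  move=> x _; rewrite patchE; case: ifPn => [_|].
    by rewrite /= lee_fin normrM mulrC; apply: ler_pM => //; exact: kle.
  by rewrite notin_setE => xB; rewrite hB// mulr0 /= normr0.
rewrite -(integralZl measurableT ik); apply: eq_integral => x _.
by rewrite -EFinM mulrA.
Qed.

End kernel_field.

Section potential_field.
Context {R : realType}.
Notation mu := (@lebesgue_measure R).
Notation L3 := (@leb3 R).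
Notation L6 := (@leb6 R).
Variable f : R3 R * R3 R -> R.
Hypothesis mf : measurable_fun setT f.
Hypothesis f0 : forall z, 0 <= f z.
Hypothesis ffin : (\int[L6]_z (f z)%:E < +oo)%E.

Lemma measurable_kernel (k : R3 R -> R) : measurable_fun setT k ->
  measurable_fun setT (fun w : R3 R * (R3 R * R3 R) => k (w.1 - w.2.1)).
Proof.
move=> mk; apply: (measurableT_comp mk); apply: measurable_sub3 => //.
exact: (measurableT_comp measurable_fst measurable_snd).
Qed.

(** A common majorant of [K3] and of all [gK i], whose integral over a cube is bounded uniformly in
    the position of the singularity. *)
Definition ksq (w : R3 R * (R3 R * R3 R)) : R := 1 + sqK (w.1 - w.2.1).

Lemma measurable_ksq : measurable_fun setT ksq.
Proof. by apply: measurable_funD => //; apply: measurable_kernel; exact: measurable_sqK. Qed.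

Lemma ksq_ge0 w : 0 <= ksq w.
Proof. by rewrite addr_ge0// sqK_ge0. Qed.

Lemma ksq_cube3 (B : R) : exists C : R, forall z, (\int[L3]_(x in cube3 B) (ksq (x, z))%:E <= C%:E)%E.
Proof.
have [C [C0 hC]] := @integral_sqK_le R.
have mB := @measurable_cube3 R B; have fB := @cube3_fin R B.
have nB : L3 (cube3 B) \is a fin_num by rewrite ge0_fin_numE.
exists (C + fine (L3 (cube3 B)) + fine (L3 (cube3 B))) => z; rewrite /ksq/=.
have mz : measurable_fun (cube3 B) (fun x : R3 R => (sqK (x - z.1))%:E).
  apply: measurable_funTS; apply/measurable_EFinP.
  exact: (measurableT_comp measurable_sqK (measurable_translate3 z.1)).
have -> : (\int[L3]_(x in cube3 B) (1 + sqK (x - z.1))%:E =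
    L3 (cube3 B) + \int[L3]_(x in cube3 B) (sqK (x - z.1))%:E)%E.
  rewrite -[X in (_ = X + _)%E]mul1e -(integral_cst L3 mB 1%E) -(ge0_integralD L3 mB)//.
  by move=> x _; rewrite lee_fin sqK_ge0.
by rewrite addeC !EFinD !fineK// leeD2r// hC.
Qed.

Lemma field_ae_fin :
  {ae L3, forall x, (\int[L6]_z (f z * ksq (x, z))%:E < +oo)%E}.
Proof.
have mI := measurable_ge0_kfield L6 mf f0 measurable_ksq ksq_ge0.
have I0 x := integral_kfield_ge0 L6 f0 ksq_ge0 x.
have hn (n : nat) : {ae L3, forall x, cube3 n%:R x -> (\int[L6]_z (f z * ksq (x, z))%:E)%E \is a fin_num}.
  apply: integrable_ae; first exact: measurable_cube3.
  apply/integrableP; split; first exact: measurable_funTS.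
  under eq_integral do rewrite gee0_abs//.
  have [C hC] := ksq_cube3 n%:R.
  exact: (kfield_fin (mX := L3) (mZ := L6) mf f0 ffin measurable_ksq ksq_ge0 (@measurable_cube3 R _) hC).
have := ae_foralln hn.
apply: ae_imp => x hx; rewrite -ge0_fin_numE//.
have [n xn] : exists n : nat, `|x| <= n%:R.
  by exists (Num.Def.archi_bound `|x|); rewrite ltW// archi_boundP.
exact: (hx n xn).
Qed.

Definition field (k : R3 R -> R) (x : R3 R) : \bar R := (\int[L6]_z (f z * k (x - z.1))%:E)%E.

Variable k : R3 R -> R.
Hypothesis mk : measurable_fun setT k.
Hypothesis kle : forall x, `|k x| <= 1 + sqK x.

Let kk (w : R3 R * (R3 R * R3 R)) : R := k (w.1 - w.2.1).

Let mkk : measurable_fun setT kk. Proof. exact: measurable_kernel. Qed.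

Let kkle w : `|kk w| <= ksq w. Proof. exact: kle. Qed.

Lemma measurable_fine_field : measurable_fun setT (fun x => fine (field k x)).
Proof. exact: (measurable_fine_kfield L6 mf mkk). Qed.

Lemma field_loc_integrable : loc_integrable3 (fun x => fine (field k x)).
Proof.
split; first exact: measurable_fine_field.
move=> A cA; have [B [_ hB]] := compact_bounded cA.
have mA : measurable A.
  have /closed_openC/open_measurable3/measurableC := compact_closed (@norm_hausdorff _ _) cA.
  by rewrite setCK.
have [C hC] := ksq_cube3 (`|B| + 1).
apply: (kfield_loc (mX := L3) (mZ := L6) mf f0 ffin measurable_ksq ksq_ge0 mkk kkle mA (@measurable_cube3 R _) _ hC).
move=> x Ax; apply: (hB (`|B| + 1)) => //.
by rewrite (le_lt_trans (ler_norm B))// ltrDl.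
Qed.

Lemma field_pairing (psi : R3 R -> R) (B C : R) : measurable_fun setT psi ->
  0 <= C -> (forall x, `|psi x| <= C) -> (forall x, B < `|x| -> psi x = 0) ->
  (\int[L3]_x (fine (field k x) * psi x)%:E =
   \int[L6]_z ((f z)%:E * \int[L3]_x (k (x - z.1) * psi x)%:E))%E.
Proof.
move=> mpsi C0 hC hB; have [C' hC'] := ksq_cube3 B.
apply: (kfield_pairing (mX := L3) (mZ := L6) mf f0 ffin measurable_ksq ksq_ge0 mkk kkle field_ae_fin mpsi (@measurable_cube3 R B) hC' C0 hC).
by move=> x /negP; rewrite -ltNge; exact: hB.
Qed.

End potential_field.

Section marginal.
Context d1 d2 (X : measurableType d1) (Y : measurableType d2) (R : realType).
Variables (mX : {sigma_finite_measure set X -> \bar R}).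
Variables (mY : {sigma_finite_measure set Y -> \bar R}).
Variable f : X * Y -> R.
Hypotheses (mf : measurable_fun setT f) (f0 : forall z, 0 <= f z).

Let F x := (\int[mY]_y (f (x, y))%:E)%E.

Let mfE : measurable_fun setT (EFin \o f). Proof. exact/measurable_EFinP. Qed.

Let f0E z : (0 <= (EFin \o f) z)%E. Proof. by rewrite lee_fin. Qed.

Let mF : measurable_fun setT F.
Proof. exact: (@measurable_fun_fubini_tonelli_F _ _ _ _ _ mY _ mfE f0E). Qed.

Lemma measurable_marginal : measurable_fun setT (fun x => fine (\int[mY]_y (f (x, y))%:E)%E).
Proof. by apply: measurableT_comp => //; exact: mF. Qed.

Hypothesis ffin : (\int[(mX \x mY)%E]_z (f z)%:E < +oo)%E.

Lemma marginal_ae_fin : {ae mX, forall x, (\int[mY]_y (f (x, y))%:E)%E \is a fin_num}.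
Proof.
have : {ae mX, forall x, setT x -> F x \is a fin_num}.
  apply: integrable_ae => //; apply/integrableP; split => //.
  have F0 x : (0 <= F x)%E by apply: integral_ge0 => y _; rewrite lee_fin.
  under eq_integral do rewrite gee0_abs//.
  by rewrite -(@fubini_tonelli1 _ _ _ _ _ mX mY _ mfE f0E).
by apply: ae_imp => x /(_ I).
Qed.

Lemma integral_marginal (g : X -> R) : measurable_fun setT g -> (forall x, 0 <= g x) ->
  (\int[(mX \x mY)%E]_z (f z * g z.1)%:E =
   \int[mX]_x (fine (\int[mY]_y (f (x, y))%:E) * g x)%:E)%E.
Proof.
move=> mg g0.
have mfg : measurable_fun setT (fun z : X * Y => (f z * g z.1)%:E).
  by apply/measurable_EFinP; apply: measurable_funM => //; exact: measurableT_comp.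
have fg0 (z : X * Y) : (0 <= (f z * g z.1)%:E :> \bar R)%E by rewrite lee_fin mulr_ge0.
rewrite (@fubini_tonelli1 _ _ _ _ _ mX mY _ mfg fg0); apply: ge0_ae_eq_integral => //.
- exact: (@measurable_fun_fubini_tonelli_F _ _ _ _ _ mY _ mfg fg0).
- by apply/measurable_EFinP; apply: measurable_funM => //; exact: measurable_marginal.
- by move=> x _; apply: integral_ge0 => y _; exact: (fg0 (x, y)).
- by move=> x _; rewrite lee_fin mulr_ge0// fine_ge0// integral_ge0// => y _; rewrite lee_fin.
apply: ae_imp marginal_ae_fin => x Fx _ /=; rewrite /fubini_F/= EFinM fineK//.
under eq_integral do rewrite EFinM muleC.
rewrite (ge0_integralZl_EFin _ measurableT)//; last 2 first.
- by move=> y _; rewrite lee_fin.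
- by apply/measurable_EFinP; exact: (measurableT_comp mf (pair1_measurable x)).
by rewrite muleC.
Qed.

End marginal.

Section newtonian_potential.
Context {R : realType}.
Notation mu := (@lebesgue_measure R).
Notation L3 := (@leb3 R).
Notation L6 := (@leb6 R).
Variable f : R3 R * R3 R -> R.
Hypothesis mf : measurable_fun setT f.
Hypothesis f0 : forall z, 0 <= f z.
Hypothesis ffin : (\int[L6]_z (f z)%:E < +oo)%E.

Lemma integral_rho (g : R3 R -> R) : measurable_fun setT g -> (forall x, 0 <= g x) ->
  (\int[L6]_z (f z * g z.1)%:E = \int[L3]_x (rho f x * g x)%:E)%E.
Proof. by move=> mg g0; exact: (@integral_marginal _ _ _ _ R L3 L3 f mf f0 ffin g mg g0). Qed.

Lemma measurable_rho : measurable_fun setT (rho f).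
Proof. exact: (measurable_marginal L3 mf f0). Qed.

Lemma rho_ge0 x : 0 <= rho f x.
Proof. by apply: fine_ge0; apply: integral_ge0 => v _; rewrite lee_fin. Qed.

(** Over phase space the potential depends on [f] linearly, without the intermediate truncation in
    [rho]; this is the form to which the Fubini arguments on fields apply. *)
Lemma Upot_field x : Upot f x = - fine (field f (@K3 R) x).
Proof.
rewrite /Upot /field (integral_rho (g := fun y => K3 (x - y)))//.
- by apply: (measurableT_comp measurable_K3); apply: measurable_sub3.
- by move=> y; exact: K3_ge0.
Qed.

Lemma K3_bound (x : R3 R) : `|K3 x| <= 1 + sqK x.
Proof. by rewrite ger0_norm ?K3_ge0// K3_le. Qed.

Lemma gK_bound (i : 'I_3) (x : R3 R) : `|gK i x| <= 1 + sqK x.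
Proof. by apply: (le_trans (gK_le i x)); rewrite lerDr. Qed.

Lemma loc_integrable_pairing (u psi : R3 R -> R) (B C : R) : loc_integrable3 u ->
  measurable_fun setT psi -> (forall x, `|psi x| <= C) -> (forall x, B < `|x| -> psi x = 0) ->
  L3.-integrable setT (fun x => (u x * psi x)%:E).
Proof.
move=> [mu_ iu] mpsi hC hB.
have C0 : 0 <= C by exact: (le_trans _ (hC 0)).
apply/integrableP; split; first by apply/measurable_EFinP; exact: measurable_funM.
have mB := @measurable_cube3 R B.
have cB : compact (@cube3 R B).
  rewrite cube3E; apply: compact_setX; last exact: segment_compact.
  by apply: compact_setX; exact: segment_compact.
apply: (@le_lt_trans _ _ (C%:E * \int[L3]_(x in cube3 B) `|u x|%:E)%E); last first.
  by apply: lte_mul_pinfty => //; exact: iu.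
have mau : measurable_fun setT (fun x => `|u x|%:E).
  by apply/measurable_EFinP; exact: measurableT_comp.
rewrite -(ge0_integralZl_EFin L3 mB)//; last exact: measurable_funTS.
rewrite [leRHS]integral_mkcond; apply: ge0_le_integral; first exact: measurableT.
- by move=> x _; exact: abse_ge0.
- by apply: measurableT_comp => //; apply/measurable_EFinP; exact: measurable_funM.
- apply/(measurable_restrictT _ _).1 => //; apply: measurable_funTS.
  exact: (measurable_funeM _ mau).
move=> x _; rewrite patchE; case: ifPn => [_|].
  by rewrite -EFinM abse_EFin lee_fin normrM mulrC ler_wpM2r.
by rewrite notin_setE /cube3/= => /negP; rewrite -ltNge => h; rewrite hB// mulr0 /= normr0.
Qed.

(** Fubini transfers the test function to the kernel, where [integral_K3_derive] integrates by
    parts. The minus sign of [Upot] cancels the one in the gradient of $1/|x|$. *)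
Lemma weak_gradient_Upot : weak_gradient (Upot f) (fun i x => fine (field f (gK i) x)).
Proof.
have mK := @measurable_K3 R; have mg i := @measurable_gK R i.
have lK := field_loc_integrable mf f0 ffin mK K3_bound.
have lg i := field_loc_integrable mf f0 ffin (mg i) (gK_bound i).
have UE : Upot f = (fun x => - fine (field f (@K3 R) x)) by apply/funext => x; exact: Upot_field.
split.
  rewrite UE; split; first exact: (measurableT_comp (@oppr_measurable R setT) lK.1).
  by move=> A cA; under eq_integral do rewrite normrN; exact: lK.2.
move=> i; split; first exact: lg.
move=> phi tphi; have [_ cD _] := tphi.
have [B [C [B0 C0 hB hC]]] := test_fun_bounds tphi.
have mphi : measurable_fun setT phi by apply: continuous_measurable3; exact: test_fun_continuous.
have mD : measurable_fun setT (fun x => 'D_(e3 R i) phi x) by exact: continuous_measurable3.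
have iK := loc_integrable_pairing lK mD (fun x => (hC x).2 i) (fun x h => (hB x h).2 i).
rewrite UE; under eq_integral do rewrite mulNr EFinN.
rewrite integralN; last by apply: integrable_add_def.
congr (- _)%E.
rewrite (field_pairing mf f0 ffin mK K3_bound mD C0 (fun x => (hC x).2 i) (fun x h => (hB x h).2 i)).
rewrite (field_pairing mf f0 ffin (mg i) (gK_bound i) mphi C0 (fun x => (hC x).1) (fun x h => (hB x h).1)).
apply: eq_integral => z _.
have [_ _ h] := integral_K3_derive i z.1 tphi.
exact: (f_equal (mule _) h).
Qed.

End newtonian_potential.

(** * Uniqueness of weak gradients *)

Section bump.
Context {R : realType}.

(** A quadratic remainder treats the squared positive part uniformly, including the point where its
    formula changes. *)
Lemma is_derive_quadratic (g : R -> R) (t c : R) :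
  (forall h, `|g (h + t) - g t - c * h| <= h ^+ 2) -> is_derive t (1 : R) g c.
Proof.
move=> hg.
have cv : (fun h : R => h^-1 *: ((g \o shift t) (h *: (1 : R)) - g t)) @ 0^' --> c.
  apply/cvgrPdist_lt => e e0; near=> h.
  have h0 : h != 0 by near: h; exact: nbhs_dnbhs_neq.
  rewrite /= /GRing.scale/= mulr1.
  rewrite (_ : c - _ = - (h^-1 * (g (h + t) - g t - c * h))); last by field.
  rewrite normrN normrM normfV ltr_pdivrMl ?normr_gt0//.
  apply: (le_lt_trans (hg h)); rewrite -real_normK ?num_real// expr2 ltr_pM2l ?normr_gt0//.
  near: h; apply: dnbhs0_lt => //.
apply: DeriveDef; first by apply/cvg_ex; exists c.
exact: cvg_lim.
Unshelve. all: by end_near.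
Qed.

Definition possq (t : R) : R := Num.max t 0 ^+ 2.

Lemma possq_ge0 t : 0 <= possq t. Proof. exact: sqr_ge0. Qed.

Lemma is_derive_possq (t : R) : is_derive t (1 : R) possq (2 * Num.max t 0).
Proof.
apply: is_derive_quadratic => h; rewrite /possq ler_norml.
have [a0|a0] := leP (h + t) 0; have [b0|b0] := leP t 0; apply/andP; split; nra.
Qed.

Lemma continuous_max0 : continuous (fun t : R => Num.max t 0).
Proof. by move=> t; apply: continuous_max; [exact: cvg_id|exact: cvg_cst]. Qed.

Variables (a b : R).

Definition bump0 (t : R) : R := possq (t - a) * possq (b - t).

Definition dbump0 (t : R) : R :=
  possq (t - a) * (- (2 * Num.max (b - t) 0)) + possq (b - t) * (2 * Num.max (t - a) 0).

Lemma bump0_ge0 t : 0 <= bump0 t. Proof. by rewrite mulr_ge0 ?possq_ge0. Qed.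

Lemma bump0_gt0 t : (0 < bump0 t) = (a < t < b).
Proof.
rewrite /bump0 /possq; have [h1|h1] := leP (t - a) 0.
  by rewrite expr0n mul0r ltxx; apply/esym/negbTE; rewrite negb_and -leNgt; lra.
have [h2|h2] := leP (b - t) 0.
  by rewrite expr0n mulr0 ltxx; apply/esym/negbTE; rewrite negb_and -!leNgt; apply/orP; right; lra.
by rewrite mulr_gt0 ?exprn_gt0//; apply/esym/andP; split; lra.
Qed.

Lemma is_derive_bump0 t : is_derive t (1 : R) bump0 (dbump0 t).
Proof.
have d1 : is_derive t (1 : R) (fun s => possq (s - a)) (2 * Num.max (t - a) 0).
  apply: is_derive_quadratic => h; rewrite /possq ler_norml.
  have [a0|a0] := leP (h + t - a) 0; have [b0|b0] := leP (t - a) 0; apply/andP; split; nra.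
have d2 : is_derive t (1 : R) (fun s => possq (b - s)) (- (2 * Num.max (b - t) 0)).
  apply: is_derive_quadratic => h; rewrite /possq ler_norml.
  have [a0|a0] := leP (b - (h + t)) 0; have [b0|b0] := leP (b - t) 0; apply/andP; split; nra.
exact: (is_deriveM d1 d2).
Qed.

Variable n : nat.

(** As [n] grows this tends to the indicator of []a, b[], the set where [bump0] is positive. Its
    derivative is continuous, which is the regularity that [test_fun] asks for. *)
Definition bump (t : R) : R := 1 - (1 + n%:R * bump0 t)^-1.

Definition dbump (t : R) : R := (1 + n%:R * bump0 t) ^- 2 * (n%:R * dbump0 t).

Lemma bump_den t : 1 <= 1 + n%:R * bump0 t.
Proof. by rewrite lerDl mulr_ge0 ?bump0_ge0. Qed.

Lemma bump_ge0 t : 0 <= bump t.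
Proof.
rewrite subr_ge0 invf_le1; first exact: bump_den.
exact: (lt_le_trans ltr01 (bump_den t)).
Qed.

Lemma bump_le1 t : bump t <= 1.
Proof. by rewrite gerBl invr_ge0 (le_trans ler01 (bump_den t)). Qed.

Lemma bump_out t : ~~ (a < t < b) -> bump t = 0.
Proof.
rewrite -bump0_gt0 -leNgt => h; have /eqP e0 : bump0 t == 0 by rewrite eq_le h bump0_ge0.
by rewrite /bump e0 mulr0 addr0 invr1 subrr.
Qed.

Lemma is_derive_bump t : is_derive t (1 : R) bump (dbump t).
Proof.
have d0 := is_derive_bump0 t.
have c0 : is_derive t (1 : R) (fun s => 1 + n%:R * bump0 s) (n%:R * dbump0 t).
  have dd := is_deriveD (is_derive_cst (1 : R) t (1 : R)) (is_deriveZ n%:R d0).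
  by apply: (is_derive_eq dd); rewrite add0r.
have den0 : 1 + n%:R * bump0 t != 0 by rewrite gt_eqF// (lt_le_trans ltr01 (bump_den t)).
have dV := @is_deriveV R (fun s => 1 + n%:R * bump0 s) t _ 1 den0 c0.
have dd := is_deriveB (is_derive_cst (1 : R) t (1 : R)) dV.
by apply: (is_derive_eq dd); rewrite sub0r /dbump /GRing.scale/= mulNr opprK.
Qed.

Lemma continuous_dbump : continuous dbump.
Proof.
move=> t; have cb0 (s : R) := is_derive_continuous (is_derive_bump0 s).
have cp (s : R) := is_derive_continuous (is_derive_possq s).
apply: cvgM.
  apply: cvgV; first by rewrite expf_neq0// gt_eqF// (lt_le_trans ltr01 (bump_den t)).
  apply: (@continuous_comp _ _ _ (fun t => 1 + n%:R * bump0 t) (fun u : R => u ^+ 2)); last exact: exprn_continuous.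
  by apply: cvgD; [exact: cvg_cst|apply: cvgM; [exact: cvg_cst|exact: cb0]].
have ca : {for t, continuous (fun s : R => s - a)} by apply: cvgB; [exact: cvg_id|exact: cvg_cst].
have cb : {for t, continuous (fun s : R => b - s)} by apply: cvgB; [exact: cvg_cst|exact: cvg_id].
apply: cvgM; first exact: cvg_cst.
apply: cvgD; apply: cvgM.
- exact: (continuous_comp ca (cp _)).
- apply: cvgN; apply: cvgM; first exact: cvg_cst.
  by apply: (@continuous_comp _ _ _ (fun s : R => b - s) (fun t : R => Num.max t 0)); [exact: cb|exact: continuous_max0].
- exact: (continuous_comp cb (cp _)).
- apply: cvgM; first exact: cvg_cst.
  by apply: (@continuous_comp _ _ _ (fun s : R => s - a) (fun t : R => Num.max t 0)); [exact: ca|exact: continuous_max0].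
Qed.

End bump.

Section box_test_functions.
Context {R : realType}.
Notation L3 := (@leb3 R).

Lemma bump_cvg (a b t : R) : (fun n => bump a b n t) @ \oo --> (\1_(`]a, b[%classic) t : R).
Proof.
have [tab|tab] := boolP (a < t < b); last first.
  rewrite indicE memNset ?/=; last by rewrite in_itv/=; exact/negP.
  by under eq_fun do rewrite bump_out//; exact: cvg_cst.
rewrite indicE mem_set/=; last by rewrite in_itv.
have w0 : 0 < bump0 a b t by rewrite bump0_gt0.
rewrite -[X in _ --> X]subr0; apply: cvgB; first exact: cvg_cst.
apply/cvgrPdist_lt => e e0; near=> n.
have d0 := lt_le_trans ltr01 (bump_den a b n t).
rewrite sub0r normrN ger0_norm ?invr_ge0 ?ltW// invf_plt ?posrE//.
rewrite ltr_pwDl// -ler_pdivrMr//.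
by near: n; exact: nbhs_infty_ger.
Unshelve. all: by end_near.
Qed.

Lemma continuous_coord3 (j : 'I_3) : continuous (@coord3 R j).
Proof.
move=> u; case: j => -[|[|[|//]]] j3 /=; rewrite /coord3/=.
- by apply: (@continuous_comp _ _ _ fst fst); [exact: cvg_fst|exact: cvg_fst].
- by apply: (@continuous_comp _ _ _ fst snd); [exact: cvg_fst|exact: cvg_snd].
- exact: cvg_snd.
Qed.

Lemma derive_prod3 (V : normedModType R) (f g h : V -> R) (x v : V) (df dg dh : R) :
  is_derive x v f df -> is_derive x v g dg -> is_derive x v h dh ->
  'D_v (f * g * h) x = (f x * g x) * dh + h x * (f x * dg + g x * df).
Proof.
move=> d1 d2 d3; have d := is_deriveM (is_deriveM d1 d2) d3.
exact: derive_val.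
Qed.

Lemma coord3_differentiable (g dg : R -> R) (j : 'I_3) (x : R3 R) :
  (forall t, is_derive t (1 : R) g (dg t)) ->
  differentiable (g \o coord3 j) x /\
  forall v, 'D_v (g \o coord3 j) x = coord3 j v * dg (coord3 j x).
Proof.
move=> dgE.
have linc : linear (@coord3 R j) by move=> c u v; case: j => -[|[|[|//]]] j3.
pose cL : {linear R3 R -> R} := HB.pack (@coord3 R j) (GRing.isLinear.Build _ _ _ _ _ linc).
have cc : continuous cL by exact: continuous_coord3.
have dc : differentiable cL x by apply: linear_differentiable; exact: cc.
have dg1 : differentiable g (cL x) by apply/derivable1_diffP; have [] := dgE (cL x).
have dgc : differentiable (g \o cL) x by exact: differentiable_comp.
split => [//|v].
rewrite -[coord3 j]/(cL : R3 R -> R) (deriveE _ dgc) diff_comp// (diff_lin _ cc) /=.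
by rewrite diff1E//= derive1E (@derive_val _ _ _ _ _ _ _ (dgE (cL x))).
Qed.

Definition box_bump (a b : R3 R) (n : nat) (x : R3 R) : R :=
  bump a.1.1 b.1.1 n x.1.1 * bump a.1.2 b.1.2 n x.1.2 * bump a.2 b.2 n x.2.

Lemma box_bump_out (a b : R3 R) n (x : R3 R) :
  ~~ [&& a.1.1 < x.1.1 < b.1.1, a.1.2 < x.1.2 < b.1.2 & a.2 < x.2 < b.2] -> box_bump a b n x = 0.
Proof.
rewrite /box_bump !negb_and => /or3P[]; rewrite -?negb_and => /bump_out ->.
- by rewrite !mul0r.
- by rewrite mulr0 mul0r.
- by rewrite mulr0.
Qed.

Lemma box_bump_test (a b : R3 R) n : test_fun (box_bump a b n).
Proof.
pose i0 : 'I_3 := Ordinal (isT : (0 < 3)%N); pose i1 : 'I_3 := Ordinal (isT : (1 < 3)%N).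
pose i2 : 'I_3 := Ordinal (isT : (2 < 3)%N).
pose g1 := bump a.1.1 b.1.1 n; pose g2 := bump a.1.2 b.1.2 n; pose g3 := bump a.2 b.2 n.
pose h1 := dbump a.1.1 b.1.1 n; pose h2 := dbump a.1.2 b.1.2 n; pose h3 := dbump a.2 b.2 n.
have D1 x := coord3_differentiable i0 x (is_derive_bump a.1.1 b.1.1 n).
have D2 x := coord3_differentiable i1 x (is_derive_bump a.1.2 b.1.2 n).
have D3 x := coord3_differentiable i2 x (is_derive_bump a.2 b.2 n).
have E : box_bump a b n = (g1 \o coord3 i0) * (g2 \o coord3 i1) * (g3 \o coord3 i2) by [].
have cc := continuous_coord3.
have cg (c d : R) (j : 'I_3) : continuous (bump c d n \o coord3 j).
  move=> x; apply: continuous_comp; first exact: cc.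
  exact: (is_derive_continuous (is_derive_bump c d n _)).
have ch (c d : R) (j : 'I_3) : continuous (dbump c d n \o coord3 j).
  by move=> x; apply: continuous_comp; [exact: cc|exact: continuous_dbump].
split.
- move=> x; rewrite E; apply: differentiableM; last exact: (D3 x).1.
  by apply: differentiableM; [exact: (D1 x).1|exact: (D2 x).1].
- move=> i.
  have -> : (fun x => 'D_(e3 R i) (box_bump a b n) x) =
    (fun x => (g1 (coord3 i0 x) * g2 (coord3 i1 x)) * (coord3 i2 (e3 R i) * h3 (coord3 i2 x)) +
     g3 (coord3 i2 x) * (g1 (coord3 i0 x) * (coord3 i1 (e3 R i) * h2 (coord3 i1 x)) +
       g2 (coord3 i1 x) * (coord3 i0 (e3 R i) * h1 (coord3 i0 x)))).
    apply/funext => x; rewrite E.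
    have dd1 := DeriveDef (@diff_derivable _ _ _ _ _ (e3 R i) (D1 x).1) ((D1 x).2 (e3 R i)).
    have dd2 := DeriveDef (@diff_derivable _ _ _ _ _ (e3 R i) (D2 x).1) ((D2 x).2 (e3 R i)).
    have dd3 := DeriveDef (@diff_derivable _ _ _ _ _ (e3 R i) (D3 x).1) ((D3 x).2 (e3 R i)).
    exact: (derive_prod3 dd1 dd2 dd3).
  move=> x; apply: cvgD.
    apply: cvgM; first by apply: cvgM; exact: cg.
    by apply: cvgM; [exact: cvg_cst|exact: ch].
  apply: cvgM; first exact: cg.
  apply: cvgD; (apply: cvgM; first exact: cg); (apply: cvgM; [exact: cvg_cst|exact: ch]).
pose A := (`[a.1.1, b.1.1] `*` `[a.1.2, b.1.2]) `*` `[a.2, b.2].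
have cA : compact A.
  apply: compact_setX; last exact: segment_compact.
  by apply: compact_setX; exact: segment_compact.
apply: (subclosed_compact _ cA); first exact: closed_closure.
have clA : closed A := compact_closed (@norm_hausdorff _ _) cA.
rewrite [X in _ `<=` X]((closure_id A).1 clA).
apply: closureS => x /=; apply: contra_neqP => nA.
apply: box_bump_out; apply/negP => /and3P[/andP[t1 t2] /andP[t3 t4] /andP[t5 t6]].
by apply: nA; rewrite /A/= !in_itv/= !ltW.
Qed.

End box_test_functions.

(** * Integrals that vanish on a generating family of sets *)

Section dynkin_integral.
Context d d' (T : measurableType d) (Y : measurableType d') (R : realType).
Variables (m : {measure set T -> \bar R}) (h : T -> \bar R) (D : set T) (p : T -> Y).
Hypotheses (ih : m.-integrable setT h) (mD : measurable D) (mp : measurable_fun setT p).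

Let mpA (A : set Y) : measurable A -> measurable (p @^-1` A).
Proof. by move=> mA; rewrite -[X in measurable X]setTI; exact: mp. Qed.

Let mh : measurable_fun setT h. Proof. exact: (measurable_int _ ih). Qed.

Lemma dynkin_integral0 (G : set (set Y)) : @measurable _ Y = <<s G >> -> setI_closed G ->
  (\int[m]_(x in D) h x = 0)%E ->
  (forall A, G A -> \int[m]_(x in D `&` p @^-1` A) h x = 0)%E ->
  (forall A, measurable A -> \int[m]_(x in D `&` p @^-1` A) h x = 0)%E.
Proof.
move=> GE GI hD hG A mA.
have sA : <<s G >> A by rewrite -GE.
apply: (@dynkin_induction _ _ G (fun A => (\int[m]_(x in D `&` p @^-1` A) h x)%E = 0%E) GE GI _ _ _ _ A sA).
- by rewrite preimage_setT setIT.
- by move=> B GB /=; exact: hG.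
- move=> B mB hB; move: hD.
  rewrite -[in X in (X -> _)](setIT D) -(setUv (p @^-1` B)) setIUr integral_setU.
  + by rewrite hB add0e preimage_setC.
  + exact: measurableI (mpA mB).
  + by apply: measurableI => //; apply: measurableC; exact: mpA.
  + exact: measurable_funTS.
  + by apply/disj_setPS => x [[_ Bx] [_ nBx]].
- move=> F mF tF hF; rewrite preimage_bigcup setI_bigcupr integral_bigcup.
  + by apply: eseries0 => i _ _; exact: hF.
  + apply/trivIsetP => i j _ _ ij; move/trivIsetP : tF => /(_ i j I I ij) Fij.
    apply/seteqP; split => // x [[_ Fi] [_ Fj]].
    by have : (F i `&` F j) (p x) by []; rewrite Fij.
  + by move=> k; apply: measurableI => //; exact: mpA.
  + apply: (integrableS measurableT) => //.
    by apply: bigcup_measurable => k _; apply: measurableI => //; exact: mpA.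
Qed.

End dynkin_integral.

Section ray_integral.
Context d (T : measurableType d) (R : realType).
Variables (m : {measure set T -> \bar R}) (h : T -> \bar R).
Hypothesis ih : m.-integrable setT h.

(** Open half-lines generate the Borel sets. The integral over the whole of [D] vanishes too, since
    [D] differs from its part above [c] only where [h] is zero. *)
Lemma dynkin_ray (D : set T) (p : T -> R) (c : R) : measurable D -> measurable_fun setT p ->
  (forall x, p x <= c -> h x = 0%E) ->
  (forall r, \int[m]_(x in D `&` [set x | r < p x]%R) h x = 0)%E ->
  (forall A, measurable A -> \int[m]_(x in D `&` p @^-1` A) h x = 0)%E.
Proof.
move=> mD mp hc hr.
pose G : set (set R) := [set A | exists r, A = `]r, +oo[%classic].
have GE : @measurable _ (measurableTypeR R) = <<s G >> by exact: (RGenOInfty.measurableE R).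
apply: (dynkin_integral0 ih mD mp GE).
- move=> _ _ [r ->] [s ->]; exists (Num.max r s); apply/seteqP; split => x /=; rewrite !in_itv/= !andbT gt_max.
    by move=> [-> ->].
  by move=> /andP[].
- rewrite -[RHS](hr c) [LHS]integral_mkcond [RHS]integral_mkcond; apply: eq_integral => x _.
  rewrite !patchE in_setI; case: ifPn => //= _; case: ifPn => // /negP; rewrite inE/= => /negP.
  by rewrite -leNgt => /hc.
- move=> _ [r ->]; rewrite -[RHS](hr r); congr (integral _ (_ `&` _) _).
  by apply/seteqP; split => x /=; rewrite in_itv/= andbT.
Qed.

End ray_integral.

Section weak_gradient_uniqueness.
Context {R : realType}.
Notation L3 := (@leb3 R).

Section octants.
Variables (h : R3 R -> \bar R) (c : R).
Hypothesis ih : L3.-integrable setT h.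
Hypothesis hc : forall x, [|| x.1.1 <= c, x.1.2 <= c | x.2 <= c] -> h x = 0%E.
Hypothesis hoct : forall r : R3 R,
  (\int[L3]_(x in [set x : R3 R | [&& r.1.1 < x.1.1, r.1.2 < x.1.2 & r.2 < x.2]]%R) h x = 0)%E.

Let p1 (x : R3 R) : R := x.1.1.
Let p2 (x : R3 R) : R := x.1.2.
Let p3 (x : R3 R) : R := x.2.

Let mp1 : measurable_fun setT p1. Proof. exact: measurableT_comp. Qed.
Let mp2 : measurable_fun setT p2. Proof. exact: measurableT_comp. Qed.
Let mp3 : measurable_fun setT p3. Proof. exact: measurable_snd. Qed.

Let mray (p : R3 R -> R) (r : R) : measurable_fun setT p -> measurable [set x | r < p x].
Proof. by move=> mp; rewrite -[X in measurable X]setTI; exact: measurable_fun_ltr. Qed.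

Let mpre (p : R3 R -> R) (A : set R) : measurable_fun setT p -> measurable A -> measurable (p @^-1` A).
Proof. by move=> mp mA; rewrite -[X in measurable X]setTI; exact: mp. Qed.

(** The half-lines that define an octant are replaced by arbitrary measurable sets one coordinate at
    a time, here and in [H2] and [H3]; products of such sets then generate the measurable sets of
    three-space. *)
Let H1 (r s : R) A : measurable A ->
  (\int[L3]_(x in [set x | r < p2 x]%R `&` [set x | s < p3 x]%R `&` p1 @^-1` A) h x = 0)%E.
Proof.
apply: (@dynkin_ray _ _ R L3 h ih _ p1 c) => //.
- by apply: measurableI; exact: mray.
- by move=> x xc; apply: hc; rewrite xc.
move=> t; rewrite -[RHS](hoct ((t, r), s)); congr (integral _ _ _).
apply/seteqP; split => x /=; first by move=> [[-> ->] ->].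
by move=> /and3P[-> -> ->].
Qed.

Let H2 (s : R) A B : measurable A -> measurable B ->
  (\int[L3]_(x in [set x | s < p3 x]%R `&` p1 @^-1` A `&` p2 @^-1` B) h x = 0)%E.
Proof.
move=> mA mB; apply: (@dynkin_ray _ _ R L3 h ih _ p2 c) => //.
- by apply: measurableI; [exact: mray|exact: mpre].
- by move=> x xc; apply: hc; rewrite xc orbT.
move=> t; rewrite -[RHS](H1 t s mA); congr (integral _ _ _).
by apply/seteqP; split => x /= [[]].
Qed.

Let H3 A B C : measurable A -> measurable B -> measurable C ->
  (\int[L3]_(x in p1 @^-1` A `&` p2 @^-1` B `&` p3 @^-1` C) h x = 0)%E.
Proof.
move=> mA mB mC; apply: (@dynkin_ray _ _ R L3 h ih _ p3 c) => //.
- by apply: measurableI; exact: mpre.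
- by move=> x xc; apply: hc; rewrite xc !orbT.
move=> t; rewrite -[RHS](H2 t mA mB); congr (integral _ _ _).
by apply/seteqP; split => x /= [[]].
Qed.

Let rectI d1 d2 (T1 : measurableType d1) (T2 : measurableType d2) :
  setI_closed [set A `*` B | A in @measurable _ T1 & B in @measurable _ T2].
Proof.
move=> _ _ [A mA [B mB <-]] [A' mA' [B' mB' <-]]; exists (A `&` A'); first exact: measurableI.
by exists (B `&` B'); [exact: measurableI|rewrite setXI].
Qed.

Let H4 (E : set (R * R)) C : measurable E -> measurable C ->
  (\int[L3]_(x in p3 @^-1` C `&` fst @^-1` E) h x = 0)%E.
Proof.
move=> mE mC; move: E mE.
apply: (dynkin_integral0 (m := L3) ih (mpre mp3 mC) measurable_fst (measurable_prod_measurableType _ _)).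
- exact: rectI.
- rewrite -[RHS](H3 measurableT measurableT mC); congr (integral _ _ _).
  by rewrite !preimage_setT !setTI.
- move=> _ [A mA [B mB <-]]; rewrite -[RHS](H3 mA mB mC); congr (integral _ _ _).
  by apply/seteqP; split => x /= [].
Qed.

Lemma octant_integral0 (E : set (R3 R)) : measurable E -> (\int[L3]_(x in E) h x = 0)%E.
Proof.
move=> mE; rewrite -[E]setTI; move: E mE.
apply: (dynkin_integral0 (m := L3) (p := id) ih measurableT (@measurable_id _ _ _) (measurable_prod_measurableType _ _)).
- exact: rectI.
- rewrite -[RHS](H4 measurableT measurableT); congr (integral _ _ _).
  by rewrite !preimage_setT setTI.
- move=> _ [A mA [B mB <-]]; rewrite -[RHS](H4 mA mB); congr (integral _ _ _).
  by apply/seteqP; split => x /=; [move=> [_ [? ?]]|move=> [? ?]].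
Qed.

End octants.

(** Products of bumps tend boundedly to indicators of boxes, so by dominated convergence [u]
    integrates to zero over every box, and then over every measurable subset of a cube. *)
Lemma test_null_ae (u : R3 R -> R) : loc_integrable3 u ->
  (forall phi, test_fun phi -> \int[L3]_x (u x * phi x)%:E = 0)%E ->
  {ae L3, forall x, u x = 0}.
Proof.
move=> lu u0; have [mu_ iu] := lu.
suff hN (n : nat) : {ae L3, forall x, [&& - n%:R < x.1.1 < n%:R, - n%:R < x.1.2 < n%:R & - n%:R < x.2 < n%:R] -> u x = 0}.
  apply: ae_imp (ae_foralln hN) => x hx; apply: (hx (Num.Def.archi_bound `|x|)).
  have := archi_boundP (normr_ge0 x); set N := (_ %:R) => xN.
  have := lexx `|x|; rewrite {1}norm3_le => /and3P[h1 h2 h3].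
  by rewrite -!ltr_norml !(le_lt_trans _ xN).
set N : R := n%:R.
pose C : set (R3 R) := [set x | [&& - N < x.1.1 < N, - N < x.1.2 < N & - N < x.2 < N]].
have mC : measurable C.
  have -> : C = (`]-N, N[ `*` `]-N, N[) `*` `]-N, N[.
    apply/seteqP; split => x /=; rewrite !in_itv/=; first by move=> /and3P[].
    by move=> [[h1 h2] h3]; apply/and3P.
  by apply: measurableX => //; exact: measurableX.
pose g (x : R3 R) : R := u x * \1_C x.
have ig : L3.-integrable setT (EFin \o g).
  apply: (loc_integrable_pairing (B := N) (C := 1) lu).
  - exact: measurable_indic.
  - by move=> x; rewrite indicE; case: (_ \in _); rewrite ?normr1 ?normr0.
  - move=> x Nx; rewrite indicE memNset//= => /and3P[h1 h2 h3].
    move: Nx; rewrite ltNge norm3_le.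
    by rewrite !ltW ?ltr_norml.
have mg : measurable_fun setT (EFin \o g) by exact: (measurable_int _ ig).
have g0 x : ~ C x -> g x = 0 by move=> nC; rewrite /g indicE memNset// mulr0.
have key : {ae L3, forall x, setT x -> (EFin \o g) x = cst 0%E x}.
  apply: integral_ae_eq => // E _ mE; rewrite integral0.
  apply: (@octant_integral0 (EFin \o g) (- N)) => //.
    move=> x xN /=; rewrite g0// => /and3P[/andP[h1 _] /andP[h2 _] /andP[h3 _]].
    by move: xN; rewrite !leNgt h1 h2 h3.
  move=> r.
  (* The open box between [a] and [b] is the part of the octant inside the cube, possibly empty. *)
  pose a : R3 R := ((Num.max r.1.1 (- N), Num.max r.1.2 (- N)), Num.max r.2 (- N)).
  pose b : R3 R := ((N, N), N).
  pose O : set (R3 R) := [set x | [&& r.1.1 < x.1.1, r.1.2 < x.1.2 & r.2 < x.2]].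
  have mO : measurable O.
    have -> : O = (`]r.1.1, +oo[ `*` `]r.1.2, +oo[) `*` `]r.2, +oo[.
      apply/seteqP; split => x /=; rewrite !in_itv/= !andbT; first by move=> /and3P[].
      by move=> [[h1 h2] h3]; apply/and3P.
    by apply: measurableX => //; exact: measurableX.
  pose F n (x : R3 R) : \bar R := (u x * box_bump a b n x)%:E.
  have mbb k : measurable_fun setT (box_bump a b k).
    by apply: continuous_measurable3; apply: test_fun_continuous; exact: box_bump_test.
  have bb0 k x : 0 <= box_bump a b k x by rewrite !mulr_ge0 ?bump_ge0.
  have bb1 k x : box_bump a b k x <= 1.
    by rewrite !mulr_ile1 ?mulr_ge0 ?bump_ge0 ?bump_le1.
  have F_cvg x : F ^~ x @ \oo --> ((EFin \o g) \_ O) x.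
    have -> : ((EFin \o g) \_ O) x = (u x * (\1_(`]a.1.1, b.1.1[%classic) x.1.1 *
        \1_(`]a.1.2, b.1.2[%classic) x.1.2 * \1_(`]a.2, b.2[%classic) x.2))%:E.
      rewrite !indicE -!natrM !mulnb !mem_setE/= !in_itv/= !gt_max.
      have -> : ((EFin \o g) \_ O) x = (u x * ((x \in O) && (x \in C))%:R)%:E.
        by rewrite patchE; case: (x \in O); rewrite ?mulr0//= /g indicE.
      congr (u x * (nat_of_bool _)%:R)%:E; apply/idP/idP.
        move=> /andP[/set_mem + /set_mem]; rewrite /O /C/=.
        by move=> /and3P[-> -> ->] /and3P[/andP[-> ->] /andP[-> ->] /andP[-> ->]].
      move=> /andP[/andP[/andP[/andP[h1 h2] h3] /andP[/andP[h4 h5] h6]] /andP[/andP[h7 h8] h9]].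
      by apply/andP; split; apply/mem_set; rewrite /O /C/= ?h1 ?h2 ?h3 ?h4 ?h5 ?h6 ?h7 ?h8 ?h9.
    apply: cvg_EFin; first by near=> k.
    apply: cvgM; first exact: cvg_cst.
    by apply: cvgM; [apply: cvgM|]; exact: bump_cvg.
  have F_le x k : (`|F k x| <= `|g x|%:E)%E.
    rewrite abse_EFin lee_fin; have [xC|xC] := pselect (C x).
      by rewrite /g indicE mem_set// mulr1 normrM (ger0_norm (bb0 k x)) ler_piMr.
    rewrite box_bump_out ?mulr0 ?normr0//; apply/negP => h; apply: xC; move: h; rewrite /C/= !gt_max.
    by move=> /and3P[/andP[/andP[_ ->] ->] /andP[/andP[_ ->] ->] /andP[/andP[_ ->] ->]].
  have mF k : measurable_fun setT (F k).
    by apply/measurable_EFinP; apply: measurable_funM.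
  have mgO : measurable_fun setT ((EFin \o g) \_ O).
    by apply/(measurable_restrictT _ _).1 => //; exact: measurable_funTS.
  have ga : L3.-integrable setT (fun x => `|g x|%:E) by exact: (integrable_abse ig).
  have ae1 : {ae L3, forall x, setT x -> F ^~ x @ \oo --> ((EFin \o g) \_ O) x}.
    by apply: aeW => x _; exact: F_cvg.
  have ae2 : {ae L3, forall x k, setT x -> (`|F k x| <= `|g x|%:E)%E}.
    by apply: aeW => x k _; exact: F_le.
  have [_ _] := @dominated_convergence _ _ R L3 setT measurableT F ((EFin \o g) \_ O) (fun x => `|g x|%:E) mF mgO ae1 ga ae2.
  rewrite -integral_mkcond => cv.
  have F0 k : (\int[L3]_x F k x = 0)%E by apply: u0; exact: box_bump_test.
  apply: (cvg_unique _ cv) => //.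
  by rewrite (_ : [sequence _]_n = cst 0%E); [exact: cvg_cst|apply/funext => k; exact: F0].
apply: ae_imp key => x /(_ I)/= [h] xC; move: h.
by rewrite /g indicE mem_set// mulr1.
Unshelve. all: by end_near.
Qed.

Lemma weak_gradient_unique (u : R3 R -> R) (g g' : 'I_3 -> R3 R -> R) :
  weak_gradient u g -> weak_gradient u g' ->
  (\int[L3]_x (\sum_(i < 3) g i x ^+ 2)%:E = \int[L3]_x (\sum_(i < 3) g' i x ^+ 2)%:E)%E.
Proof.
move=> [_ wg] [_ wg'].
have ms (k : 'I_3 -> R3 R -> R) : (forall i, loc_integrable3 (k i)) ->
    measurable_fun setT (fun x => (\sum_(i < 3) k i x ^+ 2)%:E).
  move=> mk; apply/measurable_EFinP; apply: measurable_sum => i.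
  by apply: measurable_funX; exact: (mk i).1.
apply: ge0_ae_eq_integral => //.
- by apply: ms => i; exact: (wg i).1.
- by apply: ms => i; exact: (wg' i).1.
- by move=> x _; rewrite lee_fin sumr_ge0// => i _; exact: sqr_ge0.
- by move=> x _; rewrite lee_fin sumr_ge0// => i _; exact: sqr_ge0.
have ae_i i : {ae L3, forall x, g i x - g' i x = 0}.
  have [lg hg] := wg i; have [lg' hg'] := wg' i.
  apply: test_null_ae.
    split; first by apply: measurable_funB; [exact: lg.1|exact: lg'.1].
    move=> A cA.
    have mA : measurable A.
      have /closed_openC/open_measurable3/measurableC := compact_closed (@norm_hausdorff _ _) cA.
      by rewrite setCK.
    have mgA (k : R3 R -> R) : measurable_fun setT k -> measurable_fun A (fun x => `|k x|%:E).
      by move=> mk; apply: measurable_funTS; apply/measurable_EFinP; exact: measurableT_comp.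
    apply: (@le_lt_trans _ _ (\int[L3]_(x in A) (`|g i x|%:E + `|g' i x|%:E))%E).
      apply: ge0_le_integral => //.
      + by apply: mgA; apply: measurable_funB; [exact: lg.1|exact: lg'.1].
      + by apply: emeasurable_funD; apply: mgA; [exact: lg.1|exact: lg'.1].
      + by move=> x _; rewrite -EFinD lee_fin ler_normB.
    rewrite (ge0_integralD L3 mA)//; [|exact: (mgA _ lg.1)|exact: (mgA _ lg'.1)].
    by apply: lte_add_pinfty; [exact: lg.2|exact: lg'.2].
  move=> phi tphi.
  have [B [C [B0 C0 hB hC]]] := test_fun_bounds tphi.
  have mphi : measurable_fun setT phi by apply: continuous_measurable3; exact: test_fun_continuous.
  have i1 := loc_integrable_pairing lg mphi (fun x => (hC x).1) (fun x h => (hB x h).1).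
  have i2 := loc_integrable_pairing lg' mphi (fun x => (hC x).1) (fun x h => (hB x h).1).
  under eq_integral do rewrite mulrBl EFinB.
  rewrite integralB//.
  have := hg phi tphi; rewrite (hg' phi tphi) => /eqP; rewrite eqe_opp => /eqP ->.
  by rewrite subee//; exact: integrable_fin_num.
(* The quantifier over three indices is encoded as one over [nat], to which the countable
   intersection of sets of full measure applies. *)
have hn (n : nat) : {ae L3, forall x, forall i : 'I_3, i = n :> nat -> g i x = g' i x}.
  have [n3|n3] := ltnP n 3.
    apply: ae_imp (ae_i (Ordinal n3)) => x h i ei.
    have -> : i = Ordinal n3 by exact: val_inj.
    by apply/eqP; rewrite -subr_eq0 h.
  by apply: aeW => x i ei; move: (ltn_ord i); rewrite ei ltnNge n3.
apply: ae_imp (ae_foralln hn) => x h _; congr (_%:E).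
by apply: eq_bigr => i _; rewrite (h _ i erefl).
Qed.

End weak_gradient_uniqueness.

(** * The potential energy as a double integral *)

Section tensor.
Context d1 d2 (X : measurableType d1) (Y : measurableType d2) (R : realType).
Variables (mX : {sigma_finite_measure set X -> \bar R}).
Variables (mY : {sigma_finite_measure set Y -> \bar R}).

Lemma integral_tensor (a : X -> R) (b : Y -> R) :
  mX.-integrable setT (EFin \o a) -> mY.-integrable setT (EFin \o b) ->
  (mX \x mY)%E.-integrable setT (fun w => (a w.1 * b w.2)%:E) /\
  (\int[(mX \x mY)%E]_w (a w.1 * b w.2)%:E = \int[mX]_x (a x)%:E * \int[mY]_y (b y)%:E)%E.
Proof.
move=> ia ib.
have ma : measurable_fun setT a by apply/measurable_EFinP; exact: (measurable_int _ ia).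
have mb : measurable_fun setT b by apply/measurable_EFinP; exact: (measurable_int _ ib).
have mab : measurable_fun setT (fun w : X * Y => (a w.1 * b w.2)%:E).
  by apply/measurable_EFinP; apply: measurable_funM; exact: measurableT_comp.
have fb : (\int[mY]_y (b y)%:E)%E \is a fin_num by exact: integrable_fin_num.
have fB : (\int[mY]_y `|b y|%:E)%E \is a fin_num.
  by rewrite ge0_fin_numE ?integral_ge0//; case/integrableP : ib.
have iab : (mX \x mY)%E.-integrable setT (fun w : X * Y => (a w.1 * b w.2)%:E).
  apply/(@integrable12ltyP _ _ _ _ _ mX mY _ mab).
  under eq_integral => x _.
    under eq_integral do rewrite /= normrM EFinM.
    rewrite (ge0_integralZl_EFin _ measurableT)//; last first.
      by apply/measurable_EFinP; exact: measurableT_comp.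
    over.
  under eq_integral do rewrite muleC.
  rewrite -(fineK fB) (ge0_integralZl_EFin _ measurableT)//.
  - rewrite lte_mul_pinfty ?lee_fin ?fine_ge0 ?integral_ge0//.
    by case/integrableP : ia.
  - by apply/measurable_EFinP; exact: measurableT_comp.
  - by rewrite fine_ge0// integral_ge0.
split => //.
rewrite -(@integral12_prod_meas1 _ _ _ _ _ mX mY _ iab) /fubini_F/=.
under eq_integral => x _.
  under eq_integral do rewrite EFinM.
  rewrite integralZl//.
  over.
under eq_integral do rewrite muleC.
by rewrite -(fineK fb) integralZl// fineK// muleC.
Qed.

End tensor.

Section kernel_square.
Context d1 d2 (X : measurableType d1) (Z : measurableType d2) (R : realType).
Variables (mX : {sigma_finite_measure set X -> \bar R}).
Variables (mZ : {sigma_finite_measure set Z -> \bar R}).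
Variables (f : Z -> R) (s : X * Z -> R) (n : nat) (k : 'I_n -> X * Z -> R).
Hypotheses (mf : measurable_fun setT f) (f0 : forall z, 0 <= f z).
Hypotheses (ms : measurable_fun setT s) (s0 : forall w, 0 <= s w).
Hypotheses (mk : forall i, measurable_fun setT (k i)) (kle : forall i w, `|k i w| <= s w).
Hypothesis aefin : {ae mX, forall x, (\int[mZ]_z (f z * s (x, z))%:E < +oo)%E}.
Variables (q : Z * Z -> R) (C c : R).
Hypotheses (mq : measurable_fun setT q) (q0 : forall w, 0 <= q w) (C0 : 0 <= C).
Hypothesis sconv : {ae sprod mZ mZ, forall w,
  (\int[mX]_x (s (x, w.1) * s (x, w.2))%:E = (C * q w)%:E)%E}.
Hypothesis kconv : {ae sprod mZ mZ, forall w,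
  mX.-integrable setT (fun x => (\sum_(i < n) k i (x, w.1) * k i (x, w.2))%:E) /\
  (\int[mX]_x (\sum_(i < n) k i (x, w.1) * k i (x, w.2))%:E = (c * q w)%:E)%E}.
Hypothesis qfin : (\int[sprod mZ mZ]_w (f w.1 * f w.2 * q w)%:E < +oo)%E.

(** The square expands into a double integral over [Z * Z], in which [x] is integrated first. The
    nonnegative kernel [s] provides the absolute bound that licenses Fubini; the sum over [i], in
    which terms may cancel, is integrated only afterwards. *)
Lemma kfield_square :
  (\int[mX]_x (\sum_(i < n) fine (kfield mZ f (k i) x) ^+ 2)%:E =
   c%:E * \int[sprod mZ mZ]_w (f w.1 * f w.2 * q w)%:E)%E.
Proof.
have mffq : measurable_fun setT (fun w : Z * Z => (f w.1 * f w.2 * q w)%:E).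
  apply/measurable_EFinP; apply: measurable_funM => //.
  by apply: measurable_funM; exact: measurableT_comp.
have ffq0 (w : Z * Z) : (0 <= (f w.1 * f w.2 * q w)%:E :> \bar R)%E by rewrite lee_fin !mulr_ge0.
pose A (g : X * Z -> R) (g' : X * Z -> R) (t : X * (Z * Z)) : R := g (t.1, t.2.1) * g' (t.1, t.2.2).
have mA g g' : measurable_fun setT g -> measurable_fun setT g' -> measurable_fun setT (A g g').
  move=> mg mg'; apply: measurable_funM.
    apply: (measurableT_comp mg); apply: measurable_fun_pair => //.
    exact: (measurableT_comp measurable_fst measurable_snd).
  apply: (measurableT_comp mg'); apply: measurable_fun_pair => //.
  exact: (measurableT_comp measurable_snd measurable_snd).
have mff : measurable_fun setT (fun t : X * (Z * Z) => f t.2.1 * f t.2.2).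
  apply: measurable_funM.
    exact: (measurableT_comp mf (measurableT_comp measurable_fst measurable_snd)).
  exact: (measurableT_comp mf (measurableT_comp measurable_snd measurable_snd)).
pose H (t : X * (Z * Z)) : \bar R := (f t.2.1 * f t.2.2 * \sum_(i < n) A (k i) (k i) t)%:E.
have mH : measurable_fun setT H.
  apply/measurable_EFinP; apply: measurable_funM => //.
  by apply: measurable_sum => i; exact: mA.
have mS : measurable_fun setT (fun t : X * (Z * Z) => (f t.2.1 * f t.2.2 * A s s t)%:E).
  by apply/measurable_EFinP; apply: measurable_funM => //; exact: mA.
have S0 (t : X * (Z * Z)) : (0 <= (f t.2.1 * f t.2.2 * A s s t)%:E :> \bar R)%E.
  by rewrite lee_fin !mulr_ge0.
have efin : (\int[sprod mZ mZ]_w \int[mX]_x (f w.1 * f w.2 * A s s (x, w))%:E < +oo)%E.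
  apply: (@le_lt_trans _ _ (C%:E * \int[sprod mZ mZ]_w (f w.1 * f w.2 * q w)%:E)%E); last first.
    exact: lte_mul_pinfty.
  rewrite -(ge0_integralZl_EFin _ measurableT)//.
  rewrite le_eqVlt; apply/orP; left; apply/eqP; apply: ge0_ae_eq_integral => //.
  - exact: (@measurable_fun_fubini_tonelli_G _ _ _ _ _ mX _ mS S0).
  - exact: measurable_funeM.
  - by move=> w _; apply: integral_ge0 => x _; exact: (S0 (x, w)).
  - by move=> w _; rewrite mule_ge0.
  apply: ae_imp sconv => w hw _; rewrite /A/=.
  under eq_integral do rewrite EFinM.
  rewrite (ge0_integralZl_EFin _ measurableT)//.
  - by rewrite hw -!EFinM; congr (_%:E); ring.
  - by move=> x _; rewrite lee_fin mulr_ge0.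
  - apply/measurable_EFinP; apply: measurable_funM.
      exact: (measurableT_comp ms (pair2_measurable _)).
    exact: (measurableT_comp ms (pair2_measurable _)).
  - by rewrite mulr_ge0.
have Hle t : (`|H t| <= n%:R%:E * (f t.2.1 * f t.2.2 * A s s t)%:E)%E.
  rewrite abse_EFin -EFinM lee_fin normrM ger0_norm ?mulr_ge0// mulrCA ler_wpM2l ?mulr_ge0//.
  apply: (le_trans (ler_norm_sum _ _ _)).
  rewrite mulr_natl -[X in _ *+ X]card_ord -sumr_const; apply: ler_sum => i _.
  by rewrite normrM ler_pM.
have iH : (mX \x sprod mZ mZ)%E.-integrable setT H.
  apply/(@integrable21ltyP _ _ _ _ _ mX (sprod mZ mZ) _ mH).
  apply: (@le_lt_trans _ _ (n%:R%:E * \int[sprod mZ mZ]_w \int[mX]_x (f w.1 * f w.2 * A s s (x, w))%:E)%E); last first.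
    by apply: lte_mul_pinfty.
  have mG := @measurable_fun_fubini_tonelli_G _ _ _ _ _ mX _ mS S0.
  rewrite -(ge0_integralZl_EFin _ measurableT)//; last first.
    by move=> w _; apply: integral_ge0 => x _; exact: (S0 (x, w)).
  apply: ge0_le_integral => //.
  - by move=> w _; apply: integral_ge0.
  - have mH' : measurable_fun setT (abse \o H) by exact: measurableT_comp.
    by apply: (@measurable_fun_fubini_tonelli_G _ _ _ _ _ mX _ mH') => t; exact: abse_ge0.
  - exact: measurable_funeM.
  move=> w _; rewrite -(ge0_integralZl_EFin _ measurableT)//; last 2 first.
  - by move=> x _; exact: (S0 (x, w)).
  - exact: (measurableT_comp mS (pair2_measurable w)).
  apply: ge0_le_integral => //.
  - have mH' : measurable_fun setT (abse \o H) by exact: measurableT_comp.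
    exact: (measurableT_comp mH' (pair2_measurable w)).
  - by apply: measurable_funeM; exact: (measurableT_comp mS (pair2_measurable w)).
have iq : (sprod mZ mZ).-integrable setT (fun w : Z * Z => (f w.1 * f w.2 * q w)%:E).
  apply/integrableP; split => //.
  by under eq_integral do rewrite gee0_abs//.
have -> : (c%:E * \int[sprod mZ mZ]_w (f w.1 * f w.2 * q w)%:E =
    \int[sprod mZ mZ]_w \int[mX]_x H (x, w))%E.
  rewrite -(integralZl measurableT iq); apply: ae_eq_integral => //.
  - exact: measurable_funeM.
  - exact: (@measurable_fubini_G _ _ _ _ _ mX (sprod mZ mZ) _ iH).
  apply: ae_imp kconv => w [iw hw] _; rewrite /H /A/=.
  under [RHS]eq_integral do rewrite EFinM.
  by rewrite integralZl// hw -!EFinM; congr (_%:E); ring.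
rewrite -(@Fubini _ _ _ _ _ mX (sprod mZ mZ) _ iH).
apply: ae_eq_integral => //.
- apply/measurable_EFinP; apply: measurable_sum => i; apply: measurable_funX.
  by apply: measurable_fine_kfield.
- exact: (@measurable_fubini_F _ _ _ _ _ mX (sprod mZ mZ) _ iH).
apply: ae_imp aefin => x hx _.
have ia i : mZ.-integrable setT (EFin \o (fun z => f z * k i (x, z))).
  by apply: (kfield_integrable mf f0 ms (mk i) (kle i) hx).
have tens i := integral_tensor (ia i) (ia i).
have -> : (\int[sprod mZ mZ]_w H (x, w) =
    \int[sprod mZ mZ]_w (\sum_(i < n) (f w.1 * k i (x, w.1) * (f w.2 * k i (x, w.2)))%:E))%E.
  apply: eq_integral => w _; rewrite sumEFin /H mulr_sumr; congr (_%:E).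
  by apply: eq_bigr => i _; rewrite /A/=; ring.
rewrite integral_sum//; last by move=> i; exact: (tens i).1.
rewrite -sumEFin; apply: eq_bigr => i _; rewrite (tens i).2 -/(kfield _ _ _ _).
by rewrite expr2 EFinM fineK//; exact: (integrable_fin_num _ (ia i)).
Qed.

End kernel_square.

Section field_energy.
Context {R : realType}.
Notation mu := (@lebesgue_measure R).
Notation L3 := (@leb3 R).
Notation L6 := (@leb6 R).
Notation L66 := (sprod L6 L6).

Definition gdot (x z : R3 R) : R := \sum_(i < 3) gK i x * gK i (x - z).

(* polarization: x . (x - z) = (|x|^2 + |x - z|^2 - |z|^2) / 2 *)
Lemma gdotE x z : gdot x z =
  (sqnorm3 x + sqnorm3 (x - z) - sqnorm3 z) / 2 * (K3 x ^+ 3 * K3 (x - z) ^+ 3).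
Proof.
rewrite /gdot !big_ord_recl big_ord0 /gK /coord3 /sqnorm3/=.
by move: (K3 _) (K3 _) => p q; field.
Qed.

Lemma gdot_le x z : `|gdot x z| <= 3 * (sqK x * sqK (x - z)).
Proof.
apply: (le_trans (ler_norm_sum _ _ _)).
rewrite mulr_natl -[X in _ *+ X]card_ord -sumr_const; apply: ler_sum => i _.
by rewrite normrM ler_pM// gK_le.
Qed.

Lemma measurable_gdot z : measurable_fun setT (gdot ^~ z).
Proof.
apply: measurable_sum => i; apply: measurable_funM; first exact: measurable_gK.
exact: (measurableT_comp (measurable_gK i) (measurable_translate3 z)).
Qed.

Lemma gdot_homogeneous (h : R) x z : 0 < h -> gdot (scale3 h x) (scale3 h z) = h ^- 4 * gdot x z.
Proof.
move=> h0; rewrite !gdotE scale3B !sqnorm3_scale3 /K3 !enorm3_scale3 ?ltW// !invfM !exprMn.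
move: (sqnorm3 x) (sqnorm3 z) (sqnorm3 (x - z)) ((enorm3 x)^-1) ((enorm3 (x - z))^-1) => p q r s t.
by field; rewrite gt_eqF.
Qed.

Lemma gdot_refl12 a b x z : a ^+ 2 + b ^+ 2 = 1 -> gdot (refl12 a b x) (refl12 a b z) = gdot x z.
Proof. by move=> ab; rewrite !gdotE refl12B /K3 /enorm3 !sqnorm3_refl12. Qed.

Lemma gdot_refl13 a b x z : a ^+ 2 + b ^+ 2 = 1 -> gdot (refl13 a b x) (refl13 a b z) = gdot x z.
Proof. by move=> ab; rewrite !gdotE refl13B /K3 /enorm3 !sqnorm3_refl13. Qed.

Let e : R3 R := ((0, 0), 1).

Let Ce := (\int[L3]_x (sqK x * sqK (x - e))%:E)%E.

Let Ce0 : (0 <= Ce)%E.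
Proof. by apply: integral_ge0 => x _; rewrite lee_fin mulr_ge0 ?sqK_ge0. Qed.

Let Cefin : Ce \is a fin_num.
Proof. by rewrite ge0_fin_numE//; exact: sqK_conv_e_fin. Qed.

(** The scalar product [gdot] changes sign, whereas [integral_homogeneous] concerns nonnegative
    kernels; the function [g] will be the positive part and then the negative part. *)
Lemma integral_gdot_part (g : R -> R) : measurable_fun setT g -> (forall t, 0 <= g t <= `|t|) ->
  (forall h t, 0 < h -> g (h * t) = h * g t) ->
  exists c : R, forall z, z != 0 -> (\int[L3]_x (g (gdot x z))%:E = (c * K3 z)%:E)%E.
Proof.
move=> mg g0 gh.
pose P (x z : R3 R) : \bar R := (g (gdot x z))%:E.
have mP z : measurable_fun setT (P ^~ z).
  by apply/measurable_EFinP; exact: (measurableT_comp mg (measurable_gdot z)).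
have P0 x z : (0 <= P x z)%E by rewrite lee_fin; have /andP[] := g0 (gdot x z).
have h12 a b x z : a ^+ 2 + b ^+ 2 = 1 -> P (refl12 a b x) (refl12 a b z) = P x z.
  by move=> ab; rewrite /P gdot_refl12.
have h13 a b x z : a ^+ 2 + b ^+ 2 = 1 -> P (refl13 a b x) (refl13 a b z) = P x z.
  by move=> ab; rewrite /P gdot_refl13.
have hh h x z : 0 < h -> P (scale3 h x) (scale3 h z) = ((h ^- 4)%:E * P x z)%E.
  by move=> h0; rewrite /P gdot_homogeneous// gh ?invr_gt0 ?exprn_gt0.
have key z := integral_homogeneous mP P0 h12 h13 hh (z := z).
have Pfin : (\int[L3]_x P x e)%E \is a fin_num.
  rewrite ge0_fin_numE; last by apply: integral_ge0.
  apply: (@le_lt_trans _ _ (\int[L3]_x (3%:E * (sqK x * sqK (x - e))%:E))%E).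
    apply: ge0_le_integral; first exact: measurableT.
    - by move=> x _; exact: P0.
    - exact: mP.
    - apply: measurable_funeM; apply/measurable_EFinP; apply: measurable_funM; first exact: measurable_sqK.
      exact: (measurableT_comp measurable_sqK (measurable_translate3 e)).
    - move=> x _; rewrite -EFinM lee_fin; apply: le_trans (gdot_le x e).
      by have /andP[] := g0 (gdot x e).
  rewrite (ge0_integralZl_EFin _ measurableT)//.
  - by apply: lte_mul_pinfty => //; exact: sqK_conv_e_fin.
  - by move=> x _; rewrite lee_fin mulr_ge0 ?sqK_ge0.
  - apply/measurable_EFinP; apply: measurable_funM; first exact: measurable_sqK.
    exact: (measurableT_comp measurable_sqK (measurable_translate3 e)).
exists (fine (\int[L3]_x P x e)%E) => z z0.
by rewrite -[LHS]/(\int[L3]_x P x z)%E (key z z0) mulrC EFinM fineK.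
Qed.

(** The constant is the difference of those of the positive and the negative part, both finite by
    comparison with the convolution of [sqK] with itself. *)
Lemma gK_conv : exists c : R, forall y z : R3 R, y != z ->
  L3.-integrable setT (fun x => (\sum_(i < 3) gK i (x - y) * gK i (x - z))%:E) /\
  (\int[L3]_x (\sum_(i < 3) gK i (x - y) * gK i (x - z))%:E = (c * K3 (y - z))%:E)%E.
Proof.
have mmax : measurable_fun setT (fun t : R => Num.max t 0).
  exact: (measurable_maxr (@measurable_id _ _ _) (measurable_cst _)).
have [cp hp] : exists c : R, forall z, z != 0 -> (\int[L3]_x (Num.max (gdot x z) 0)%:E = (c * K3 z)%:E)%E.
  apply: (integral_gdot_part mmax).
    by move=> t; rewrite le_max lexx orbT ge_max ler_norm normr_ge0.
  by move=> h t h0; rewrite -[X in Num.max _ X](mulr0 h) -maxr_pMr// ltW.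
have [cm hm] : exists c : R, forall z, z != 0 -> (\int[L3]_x (Num.max (- gdot x z) 0)%:E = (c * K3 z)%:E)%E.
  apply: (@integral_gdot_part (fun t => Num.max (- t) 0)).
  - exact: (measurableT_comp mmax (measurable_funN (@measurable_id _ _ _))).
  - by move=> t; rewrite le_max lexx orbT ge_max -normrN ler_norm normr_ge0.
  - by move=> h t h0; rewrite -mulrN -[X in Num.max _ X](mulr0 h) -maxr_pMr// ltW.
exists (cp - cm) => y z yz.
have zy0 : z - y != 0 by rewrite subr_eq0 eq_sym.
pose F (x : R3 R) : \bar R := (gdot x (z - y))%:E.
have FE : (fun x : R3 R => (\sum_(i < 3) gK i (x - y) * gK i (x - z))%:E) = (fun x => F (x - y)).
  apply/funext => x; rewrite /F /gdot; congr (_%:E); apply: eq_bigr => i _.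
  by rewrite opprB addrA subrK.
have mF : measurable_fun setT F by apply/measurable_EFinP; exact: measurable_gdot.
have FpE : (\int[L3]_x F^\+ x = (cp * K3 (z - y))%:E)%E.
  rewrite -(hp _ zy0); apply: eq_integral => x _.
  by rewrite funeposE /F -EFin_max.
have FmE : (\int[L3]_x F^\- x = (cm * K3 (z - y))%:E)%E.
  rewrite -(hm _ zy0); apply: eq_integral => x _.
  by rewrite funenegE /F -EFinN -EFin_max.
have iF : L3.-integrable setT F.
  apply/integrableP; split => //.
  rewrite (_ : (\int[L3]_x `|F x| = \int[L3]_x (F^\+ x + F^\- x))%E).
    rewrite ge0_integralD//; [by rewrite FpE FmE -EFinD ltry|exact: measurable_funepos|exact: measurable_funeneg].
  by apply: eq_integral => x _; rewrite -[LHS]/((abse \o F) x) fune_abse.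
have [iFy eFy] := mscaling_integrable ler01 (mscaling_leb3_translation (- y)) iF.
rewrite FE; split; first exact: iFy.
rewrite -[LHS]/(\int[L3]_x F (x + (- y))%R)%E eFy mul1e integralE FpE FmE -EFinB -mulrBl.
by rewrite /K3 /enorm3 -opprB; congr (_ * (Num.sqrt _)^-1)%:E; rewrite /sqnorm3/=; ring.
Qed.

(** The Coulomb double integral of the density, written over pairs of points of phase space;
    [integral_rho2] returns to the density. *)
Definition DD (f : R3 R * R3 R -> R) : \bar R :=
  (\int[L66]_w (f w.1 * f w.2 * K3 (w.1.1 - w.2.1))%:E)%E.

Lemma diagonal_null : {ae L66, forall w : (R3 R * R3 R) * (R3 R * R3 R), w.1.1 != w.2.1}.
Proof.
pose A : set ((R3 R * R3 R) * (R3 R * R3 R)) := [set w | sqnorm3 (w.1.1 - w.2.1) = 0].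
have mA : measurable A.
  have mg : measurable_fun setT (fun w : (R3 R * R3 R) * (R3 R * R3 R) => sqnorm3 (w.1.1 - w.2.1)).
    apply: (measurableT_comp measurable_sqnorm3); apply: measurable_sub3.
      exact: (measurableT_comp measurable_fst measurable_fst).
    exact: (measurableT_comp measurable_fst measurable_snd).
  by rewrite -[A]setTI; exact: (mg measurableT [set 0]).
exists A; split => //; last first.
  move=> w /= /negP; rewrite negbK => /eqP h; rewrite /A/= h subrr.
  by rewrite /sqnorm3/= expr0n/= !addr0.
rewrite -[LHS]/((L6 \x L6)%E A).
rewrite /product_measure1/= integral0_eq// => z _.
have -> : xsection A z = [set z.1] `*` setT.
  apply/seteqP; split => z'; rewrite /xsection/= inE/= /A/=.
    by move=> /eqP; rewrite sqnorm3_eq0 subr_eq0 => /eqP ->.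
  by move=> [-> _]; rewrite subrr /sqnorm3/= expr0n/= !addr0.
have m1 (x : R) : measurable [set x] by exact: measurable_set1.
have z1 : [set z.1] = ([set z.1.1.1] `*` [set z.1.1.2]) `*` [set z.1.2].
  apply/seteqP; split => x /=; first by move=> ->.
  by case: x z => [[x1 x2] x3] [[[y1 y2] y3] w] /= [[-> ->] ->].
have mz : measurable [set z.1] by rewrite z1; apply: measurableX => //; exact: measurableX.
have -> : L6 ([set z.1] `*` setT) = (L3 [set z.1] * L3 setT)%E.
  by apply: (@product_measure1E _ _ _ _ _ L3 L3).
have -> : L3 [set z.1] = 0%E; last by rewrite mul0e.
rewrite z1.
have -> : L3 (([set z.1.1.1] `*` [set z.1.1.2]) `*` [set z.1.2]) =
    ((mu \x mu)%E ([set z.1.1.1] `*` [set z.1.1.2]) * mu [set z.1.2])%E.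
  by apply: (@product_measure1E _ _ _ _ _ (sprod mu mu) mu) => //; exact: measurableX.
by rewrite lebesgue_measure_set1 mule0.
Qed.

Variable f : R3 R * R3 R -> R.
Hypothesis mf : measurable_fun setT f.
Hypothesis f0 : forall z, 0 <= f z.
Hypothesis ffin : (\int[L6]_z (f z)%:E < +oo)%E.

Lemma measurable_DD_integrand :
  measurable_fun setT (fun w : (R3 R * R3 R) * (R3 R * R3 R) => (f w.1 * f w.2 * K3 (w.1.1 - w.2.1))%:E).
Proof.
apply/measurable_EFinP; apply: measurable_funM.
  by apply: measurable_funM; exact: measurableT_comp.
apply: (measurableT_comp measurable_K3); apply: measurable_sub3.
  exact: (measurableT_comp measurable_fst measurable_fst).
exact: (measurableT_comp measurable_fst measurable_snd).
Qed.

Lemma DD_integrand_ge0 w : (0 <= (f w.1 * f w.2 * K3 (w.1.1 - w.2.1))%:E :> \bar R)%E.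
Proof. by rewrite lee_fin !mulr_ge0// K3_ge0. Qed.

Hypothesis Dfin : (DD f < +oo)%E.

Lemma field_energy (c : R) : (forall y z : R3 R, y != z ->
    L3.-integrable setT (fun x => (\sum_(i < 3) gK i (x - y) * gK i (x - z))%:E) /\
    (\int[L3]_x (\sum_(i < 3) gK i (x - y) * gK i (x - z))%:E = (c * K3 (y - z))%:E)%E) ->
  (\int[L3]_x (\sum_(i < 3) fine (field f (gK i) x) ^+ 2)%:E = c%:E * DD f)%E.
Proof.
move=> hc.
pose s (w : R3 R * (R3 R * R3 R)) : R := sqK (w.1 - w.2.1).
have ms : measurable_fun setT s by exact: (measurable_kernel (@measurable_sqK R)).
have s0 w : 0 <= s w by exact: sqK_ge0.
pose k (i : 'I_3) (w : R3 R * (R3 R * R3 R)) : R := gK i (w.1 - w.2.1).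
have mk i : measurable_fun setT (k i) by exact: (measurable_kernel (@measurable_gK R i)).
have kle i w : `|k i w| <= s w by exact: gK_le.
have aefin : {ae L3, forall x, (\int[L6]_z (f z * s (x, z))%:E < +oo)%E}.
  apply: ae_imp (field_ae_fin mf f0 ffin) => x hx; apply: le_lt_trans hx.
  apply: ge0_le_integral; first exact: measurableT.
  - by move=> z _; rewrite lee_fin mulr_ge0.
  - by apply/measurable_EFinP; exact: (measurable_kfield_section mf x ms).
  - by apply/measurable_EFinP; exact: (measurable_kfield_section mf x (@measurable_ksq R)).
  - by move=> z _; rewrite lee_fin ler_wpM2l// /ksq /s lerDr.
have mq : measurable_fun setT (fun w : (R3 R * R3 R) * (R3 R * R3 R) => K3 (w.1.1 - w.2.1)).
  apply: (measurableT_comp measurable_K3); apply: measurable_sub3.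
    exact: (measurableT_comp measurable_fst measurable_fst).
  exact: (measurableT_comp measurable_fst measurable_snd).
have hS : {ae L66, forall w, (\int[L3]_x (s (x, w.1) * s (x, w.2))%:E = (fine Ce * K3 (w.1.1 - w.2.1))%:E)%E}.
  apply: ae_imp diagonal_null => w hw; rewrite /s/= mulrC EFinM fineK//.
  exact: sqK_conv.
have hk : {ae L66, forall w,
  L3.-integrable setT (fun x => (\sum_(i < 3) k i (x, w.1) * k i (x, w.2))%:E) /\
  (\int[L3]_x (\sum_(i < 3) k i (x, w.1) * k i (x, w.2))%:E = (c * K3 (w.1.1 - w.2.1))%:E)%E}.
  by apply: ae_imp diagonal_null => w hw; exact: hc.
exact: (@kfield_square _ _ _ _ R L3 L6 f s 3 k mf f0 ms s0 mk kle aefin _ _ _ mq (fun w => K3_ge0 _)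
  (fine_ge0 Ce0) hS hk Dfin).
Qed.

End field_energy.

Section potential_energy.
Context {R : realType}.
Notation L3 := (@leb3 R).
Notation L6 := (@leb6 R).

(** The set whose infimum defines [Epot] is a singleton, because weak gradients agree almost
    everywhere and one of them is explicit. As [lam] is chosen before [f], it is common to all
    competitors. *)
Lemma Epot_DD : exists lam : R, forall f : R3 R * R3 R -> R, measurable_fun setT f ->
  (forall z, 0 <= f z) -> (\int[L6]_z (f z)%:E < +oo)%E -> (DD f < +oo)%E ->
  Epot f = ((- lam)%:E * DD f)%E.
Proof.
have [c hc] := @gK_conv R; exists ((8 * pi)^-1 * c) => f mf f0 ffin Dfin.
pose G (i : 'I_3) (x : R3 R) := fine (field f (gK i) x).
have wG : weak_gradient (Upot f) G by exact: weak_gradient_Upot.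
have eG : (\int[L3]_x (\sum_(i < 3) G i x ^+ 2)%:E = c%:E * DD f)%E by exact: field_energy.
rewrite /Epot; have -> : [set e | exists g, weak_gradient (Upot f) g /\
     e = ((- (8 * pi)^-1)%:E * \int[L3]_x (\sum_(i < 3) g i x ^+ 2)%:E)%E] =
   [set ((- (8 * pi)^-1)%:E * (c%:E * DD f))%E].
  apply/seteqP; split => e /=.
    by move=> [g [wg ->]]; rewrite (weak_gradient_unique wg wG) eG.
  by move=> ->; exists G; rewrite eG.
by rewrite ereal_inf1 muleA -EFinM mulNr.
Qed.

End potential_energy.

(** * Finiteness of the potential energy *)

Section kernel_bound.
Context d (X : measurableType d) (R : realType) (m : {sigma_finite_measure set X -> \bar R}).

(** Each term of the majorant is integrable: two are tensor products, and in the two others the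
    kernel [kap] can be integrated first in the variable that does not occur in the weight. *)
Lemma kernel_bound (r w : X -> R) (kap G : X * X -> R) (c : R) :
  m.-integrable setT (EFin \o r) -> m.-integrable setT (EFin \o w) -> (forall x, 0 <= w x) ->
  measurable_fun setT kap -> (forall t, 0 <= kap t) ->
  (forall x, \int[m]_y (kap (x, y))%:E <= c%:E)%E ->
  (forall y, \int[m]_x (kap (x, y))%:E <= c%:E)%E ->
  measurable_fun setT G -> (forall t, 0 <= G t) ->
  (forall t, G t <= r t.1 * r t.2 + (w t.1 * kap t + w t.2 * kap t + w t.1 * w t.2)) ->
  (\int[(m \x m)%E]_t (G t)%:E < +oo)%E.
Proof.
move=> ir iw w0 mk k0 kx ky mG G0 GE.
have mw : measurable_fun setT w by apply/measurable_EFinP; exact: (measurable_int _ iw).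
have [irr _] := integral_tensor ir ir; have [iww _] := integral_tensor iw iw.
have m1 : measurable_fun setT (fun t : X * X => (w t.1 * kap t)%:E).
  by apply/measurable_EFinP; apply: measurable_funM => //; exact: measurableT_comp.
have m2 : measurable_fun setT (fun t : X * X => (w t.2 * kap t)%:E).
  by apply/measurable_EFinP; apply: measurable_funM => //; exact: measurableT_comp.
have fin (a : R) (h : X -> R) : 0 <= a -> measurable_fun setT h -> (forall x, 0 <= h x) ->
    (\int[m]_x (h x)%:E <= c%:E)%E -> (\int[m]_x `|(a * h x)%:E| <= `|c|%:E * a%:E)%E.
  move=> a0 mh h0 hc.
  have -> : (\int[m]_x `|(a * h x)%:E| = a%:E * \int[m]_x (h x)%:E)%E.
    rewrite -(ge0_integralZl_EFin m measurableT)//.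
    - by apply: eq_integral => x _; rewrite gee0_abs ?lee_fin ?mulr_ge0// EFinM.
    - by move=> x _; rewrite lee_fin.
    - exact/measurable_EFinP.
  rewrite muleC; apply: lee_wpmul2r; first by rewrite lee_fin.
  by apply: (le_trans hc); rewrite lee_fin ler_norm.
have fin8 : (\int[m]_x (`|c|%:E * (w x)%:E) < +oo)%E.
  rewrite (ge0_integralZl_EFin m measurableT)//.
  - apply: lte_mul_pinfty => //.
    case/integrableP : iw => _; apply: le_lt_trans; rewrite le_eqVlt; apply/orP; left; apply/eqP.
    by apply: eq_integral => x _; rewrite gee0_abs// lee_fin.
  - by move=> x _; rewrite lee_fin.
  - exact/measurable_EFinP.
have mabs (h : X * X -> \bar R) : measurable_fun setT h -> measurable_fun setT (abse \o h).
  by move=> mh; exact: measurableT_comp.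
have mcw : measurable_fun setT (fun x => `|c|%:E * (w x)%:E)%E.
  by apply: measurable_funeM; exact/measurable_EFinP.
have i1 : (m \x m)%E.-integrable setT (fun t : X * X => (w t.1 * kap t)%:E).
  apply/(@integrable12ltyP _ _ _ _ _ m m _ m1); apply: le_lt_trans fin8.
  apply: ge0_le_integral => //.
  - by move=> x _; apply: integral_ge0.
  - by apply: (@measurable_fun_fubini_tonelli_F _ _ _ _ _ m _ (mabs _ m1)) => t; exact: abse_ge0.
  - move=> x _; apply: (fin (w x) (fun y => kap (x, y))) => //.
    exact: (measurableT_comp mk (pair1_measurable x)).
have i2 : (m \x m)%E.-integrable setT (fun t : X * X => (w t.2 * kap t)%:E).
  apply/(@integrable21ltyP _ _ _ _ _ m m _ m2); apply: le_lt_trans fin8.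
  apply: ge0_le_integral => //.
  - by move=> x _; apply: integral_ge0.
  - by apply: (@measurable_fun_fubini_tonelli_G _ _ _ _ _ m _ (mabs _ m2)) => t; exact: abse_ge0.
  - move=> y _; apply: (fin (w y) (fun x => kap (x, y))) => //.
    exact: (measurableT_comp mk (pair2_measurable y)).
have isum := integrableD measurableT irr (integrableD measurableT (integrableD measurableT i1 i2) iww).
have mGE : measurable_fun setT (fun t : X * X => (G t)%:E) by exact/measurable_EFinP.
have : (m \x m)%E.-integrable setT (fun t : X * X => (G t)%:E).
  apply: (le_integrable measurableT mGE _ isum) => t _ /=.
  rewrite lee_fin ger0_norm//; apply: (le_trans (GE t)).
  exact: ler_norm.
move=> /integrableP[_]; apply: le_lt_trans.
by rewrite le_eqVlt; apply/orP; left; apply/eqP; apply: eq_integral => t _; rewrite gee0_abs// lee_fin.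
Qed.

End kernel_bound.

Section density_bound.
Context {R : realType}.
Notation mu := (@lebesgue_measure R).
Notation L3 := (@leb3 R).
Notation L6 := (@leb6 R).

Lemma cube3_volume (B : R) : 0 <= B -> L3 (cube3 B) = (8 * B ^+ 3)%:E.
Proof.
move=> B0; rewrite cube3E.
set I := `[- B, B]%classic.
have mI : measurable I by exact: measurable_itv.
have fI : mu I = (2 * B)%:E.
  rewrite lebesgue_measure_itv/= lte_fin; case: ltP => h.
    by rewrite -EFinB; congr (_%:E); ring.
  have B00 : B = 0 by lra.
  by rewrite B00 mulr0.
have -> : L3 ((I `*` I) `*` I) = (mu I * mu I * mu I)%E.
  transitivity ((mu \x mu)%E (I `*` I) * mu I)%E.
    by apply: (@product_measure1E _ _ _ _ _ (sprod mu mu) mu) => //; exact: measurableX.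
  by congr (_ * _)%E; exact: product_measure1E.
by rewrite fI -!EFinM; congr (_%:E); ring.
Qed.

(** Above the level [t] the factor $(s/t)^{p-1}$ is at least one. *)
Lemma powR_ge_tangent (p s t : R) : 1 < p -> 0 < t -> t <= s -> s <= t `^ (1 - p) * s `^ p.
Proof.
move=> p1 t0 ts; have s0 : 0 < s by lra.
have -> : s `^ p = s `^ (p - 1) * s.
  by rewrite -{3}(powRr1 (ltW s0)) -powRD ?subrK// (gt_eqF s0) implybT.
rewrite mulrA; apply: ler_peMl; first exact: ltW.
rewrite (_ : 1 - p = - (p - 1)); last by ring.
rewrite powRN mulrC -[leLHS](@divff _ (t `^ (p - 1))) ?gt_eqF ?powR_gt0//.
by rewrite ler_pM2r ?invr_gt0 ?powR_gt0// ge0_ler_powR ?nnegrE; lra.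
Qed.

(** Three regimes: inside the cube of half-width [b], values of [g] up to [t] contribute at most [t]
    times the volume and larger ones are absorbed by the power [p]; outside the cube $|v|^2\ge b^2$
    and the second moment takes over. *)
Lemma velocity_moment (g : R3 R -> R) (p t b : R) : 1 < p -> 0 < t -> 0 < b ->
  measurable_fun setT g -> (forall v, 0 <= g v) ->
  (\int[L3]_v (g v)%:E <= (8 * t * b ^+ 3)%:E + (t `^ (1 - p))%:E * \int[L3]_v (g v `^ p)%:E
    + (b ^- 2)%:E * \int[L3]_v (sqnorm3 v * g v)%:E)%E.
Proof.
move=> p1 t0 b0 mg g0.
have mgp : measurable_fun setT (fun v => (g v `^ p)%:E).
  by apply/measurable_EFinP; exact: (measurableT_comp (measurable_powR _)).
have mvg : measurable_fun setT (fun v : R3 R => (sqnorm3 v * g v)%:E).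
  by apply/measurable_EFinP; apply: measurable_funM => //; exact: measurable_sqnorm3.
have vg0 (v : R3 R) : (0 <= (sqnorm3 v * g v)%:E :> \bar R)%E by rewrite lee_fin mulr_ge0 ?sqnorm3_ge0.
have gp0 v : (0 <= (g v `^ p)%:E :> \bar R)%E by rewrite lee_fin powR_ge0.
have mc := @measurable_cube3 R b.
have mi : measurable_fun setT (fun v => (t * \1_(cube3 b) v)%:E).
  by apply/measurable_EFinP; apply: measurable_funM => //; exact: measurable_indic.
have i0 v : (0 <= (t * \1_(cube3 b) v)%:E :> \bar R)%E by rewrite lee_fin indicE mulr_ge0// ltW.
have tp : 0 <= t `^ (1 - p) by exact: powR_ge0.
have bp : 0 <= b ^- 2 by rewrite invr_ge0 exprn_ge0// ltW.
have -> : ((8 * t * b ^+ 3)%:E = \int[L3]_v (t * \1_(cube3 b) v)%:E)%E.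
  under eq_integral do rewrite EFinM.
  rewrite (ge0_integralZl_EFin _ measurableT)//; last exact: ltW.
    rewrite -[X in (_ * X)%E](_ : L3 (cube3 b) = _); last by rewrite integral_indic// setIT.
    by rewrite cube3_volume ?ltW// -EFinM; congr (_%:E); ring.
  by apply/measurable_EFinP; exact: measurable_indic.
rewrite -(ge0_integralZl_EFin _ measurableT)// -(ge0_integralZl_EFin _ measurableT)//.
rewrite -ge0_integralD//; last 2 first.
- by move=> v _; apply: mule_ge0 => //; rewrite lee_fin.
- exact: measurable_funeM.
rewrite -ge0_integralD//; last 4 first.
- by move=> v _; apply: adde_ge0 => //; apply: mule_ge0 => //; rewrite lee_fin.
- by apply: emeasurable_funD => //; exact: measurable_funeM.
- by move=> v _; apply: mule_ge0 => //; rewrite lee_fin.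
- exact: measurable_funeM.
apply: ge0_le_integral => //.
- by move=> v _; rewrite lee_fin.
- exact/measurable_EFinP.
- by apply: emeasurable_funD; [apply: emeasurable_funD => //|]; exact: measurable_funeM.
move=> v _; rewrite -!EFinM -!EFinD lee_fin indicE.
have h1 : 0 <= t `^ (1 - p) * g v `^ p by rewrite mulr_ge0 ?powR_ge0.
have h2 : 0 <= b ^- 2 * (sqnorm3 v * g v) by rewrite mulr_ge0// mulr_ge0 ?sqnorm3_ge0.
case: (boolP (v \in cube3 b)) => [_|]; last first.
  rewrite notin_setE /cube3/= => /negP; rewrite norm3_le !negb_and -!ltNge => hv.
  have bv : b ^+ 2 <= sqnorm3 v.
    have sq (y : R) : b < `|y| -> b ^+ 2 <= y ^+ 2.
      by move=> h; rewrite -(real_normK (num_real y)); apply: lerXn2r; rewrite ?nnegrE//; exact: ltW.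
    have q1 := sqr_ge0 v.1.1; have q2 := sqr_ge0 v.1.2; have q3 := sqr_ge0 v.2.
    by rewrite /sqnorm3; case/or3P : hv => /sq; lra.
  have : g v <= b ^- 2 * (sqnorm3 v * g v).
    by rewrite mulrA ler_peMl// ler_pdivlMl ?exprn_gt0// mulr1.
  by rewrite mulr0; lra.
rewrite mulr1; case: (leP (g v) t) => gt; first lra.
by have := powR_ge_tangent p1 t0 (ltW gt); lra.
Qed.

(* AM-GM twice: u^3 v^3 q = (u^2 v^2) (u v q), with u = r^(1/3) and v = s^(1/3) *)
Lemma powR_amgm (r s q : R) : 0 <= r -> 0 <= s -> 0 <= q ->
  r * s * q <= (r `^ 6^-1) ^+ 8 * q ^+ 2 + (s `^ 6^-1) ^+ 8 * q ^+ 2 + (r `^ 6^-1) ^+ 8 * (s `^ 6^-1) ^+ 8.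
Proof.
have hw (t : R) : 0 <= t -> exists u, [/\ 0 <= u, t = u ^+ 3 & (t `^ 6^-1) ^+ 8 = u ^+ 4].
  move=> t0; exists ((t `^ 6^-1) ^+ 2); rewrite -!exprM exprn_ge0 ?powR_ge0//; split => //.
  by rewrite -powR_mulrn ?powR_ge0// -powRrM mulVf// powRr1.
move=> r0 s0 q0; have [u [u0 eu ->]] := hw _ r0; have [v [v0 ev ->]] := hw _ s0.
rewrite eu ev.
have uv4 : 0 <= u ^+ 4 * v ^+ 4 by rewrite mulr_ge0 ?exprn_ge0.
have h1 := sqr_ge0 (u ^+ 2 * v ^+ 2 - u * v * q).
have h2 := sqr_ge0 (u ^+ 2 * q - v ^+ 2 * q).
have p1' : 0 <= u ^+ 4 * q ^+ 2 by rewrite mulr_ge0 ?exprn_ge0.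
have p2' : 0 <= v ^+ 4 * q ^+ 2 by rewrite mulr_ge0 ?exprn_ge0.
have e1 : (u ^+ 2 * v ^+ 2 - u * v * q) ^+ 2 =
  u ^+ 4 * v ^+ 4 - 2 * (u ^+ 3 * v ^+ 3 * q) + u ^+ 2 * v ^+ 2 * q ^+ 2 by ring.
have e2 : (u ^+ 2 * q - v ^+ 2 * q) ^+ 2 =
  u ^+ 4 * q ^+ 2 + v ^+ 4 * q ^+ 2 - 2 * (u ^+ 2 * v ^+ 2 * q ^+ 2) by ring.
lra.
Qed.

(** The left side is $r^{4/3}$, the power produced by a suitable choice of the cut-offs in
    [velocity_moment]; the sixth root [w] of [r] makes all exponents integral. For $w\ge1$ the
    condition on [p] bounds $(w^3)^{1-p}$ by $w^{-2}$, and for $w<1$ already $w^8\le w^6=r$. *)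
Lemma density_moment (p : R) : 1 < p -> 2 <= 3 * (p - 1) -> exists C : R, 0 <= C /\
  forall (g : R3 R -> R) (r : R), measurable_fun setT g -> (forall v, 0 <= g v) ->
  (\int[L3]_v (g v)%:E = r%:E)%E ->
  (((r `^ 6^-1) ^+ 8)%:E <= r%:E + C%:E * \int[L3]_v (g v `^ p)%:E + \int[L3]_v (sqnorm3 v * g v)%:E)%E.
Proof.
move=> p1 p2; exists (2 * (128 `^ (p - 1))); split; first by rewrite mulr_ge0 ?powR_ge0.
move=> g r mg g0 gr.
set A := (\int[L3]_v (g v `^ p)%:E)%E; set B := (\int[L3]_v (sqnorm3 v * g v)%:E)%E.
have A0 : (0 <= A)%E by apply: integral_ge0 => v _; rewrite lee_fin powR_ge0.
have B0 : (0 <= B)%E by apply: integral_ge0 => v _; rewrite lee_fin mulr_ge0 ?sqnorm3_ge0.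
have r0 : 0 <= r by rewrite -lee_fin -gr; apply: integral_ge0 => v _; rewrite lee_fin.
set w := r `^ 6^-1; have w0 : 0 <= w by exact: powR_ge0.
have w6 : w ^+ 6 = r by rewrite -powR_mulrn// /w -powRrM mulVf// powRr1.
have [w1|w1] := ltP w 1.
  apply: (@le_trans _ _ r%:E).
    rewrite lee_fin -w6 (exprD w 6 2) ler_piMr ?exprn_ge0// exprn_ile1//; exact: ltW.
  rewrite -addeA leeDl// adde_ge0// mule_ge0// lee_fin mulr_ge0 ?powR_ge0//.
have wp : 0 < w by lra.
case EA : A A0 => [a||] A0 //; last first.
  by rewrite gt0_muley ?lte_fin ?mulr_gt0 ?powR_gt0// addey// ?addye ?leey// -ltNye (lt_le_trans _ B0).
case EB : B B0 => [b||] B0 //; last by rewrite addey ?leey.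
(* With these cut-offs the volume term is exactly [w ^+ 6 / 2], half of the mass [r], and can be
   absorbed on the left. *)
have := @velocity_moment g p (w ^+ 3 / 128) (2 * w) p1 _ _ mg g0.
rewrite gr -/A -/B EA EB => /(_ _ _).
have tp : 0 < w ^+ 3 / 128 by rewrite divr_gt0 ?exprn_gt0.
have bp : 0 < 2 * w by lra.
move=> /(_ tp bp); rewrite -!EFinM -!EFinD !lee_fin => key.
have e1 : (w ^+ 3 / 128) `^ (1 - p) <= 128 `^ (p - 1) * w ^- 2.
  rewrite powRM ?exprn_ge0// (_ : 1 - p = - (p - 1)); last by ring.
  have -> : 128^-1 `^ (- (p - 1)) = 128 `^ (p - 1) :> R.
    by rewrite -powR_inv1// -powRrM mulN1r opprK.
  rewrite powRN mulrC ler_wpM2l ?powR_ge0// lef_pV2 ?posrE ?powR_gt0 ?exprn_gt0//.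
  by rewrite -(powR_mulrn 2 w0) -(powR_mulrn 3 w0) -powRrM; apply: ler_powR.
rewrite lee_fin in A0; rewrite lee_fin in B0.
have e2 : w ^+ 6 / 2 <= 128 `^ (p - 1) * w ^- 2 * a + (2 * w) ^- 2 * b.
  have := ler_wpM2r A0 e1.
  have : 8 * (w ^+ 3 / 128) * (2 * w) ^+ 3 = w ^+ 6 / 2 by field.
  by move: key; rewrite -w6; lra.
have e3 : w ^+ 8 <= 2 * 128 `^ (p - 1) * a + b / 2.
  have w2 : 0 < w ^+ 2 by rewrite exprn_gt0.
  have := ler_wpM2l (ltW w2) e2.
  have -> : w ^+ 2 * (w ^+ 6 / 2) = w ^+ 8 / 2 by rewrite mulrA -exprD.
  have -> : w ^+ 2 * (128 `^ (p - 1) * w ^- 2 * a + (2 * w) ^- 2 * b) = 128 `^ (p - 1) * a + b / 4.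
    by move: (128 `^ _) => c; field; rewrite gt_eqF.
  by lra.
by move: e3; lra.
Qed.

Section finite_energy.
Variables (f : R3 R * R3 R -> R) (p : R).
Hypotheses (mf : measurable_fun setT f) (f0 : forall z, 0 <= f z).
Hypothesis ffin : (\int[L6]_z (f z)%:E < +oo)%E.
Hypotheses (p1 : 1 < p) (p2 : 2 <= 3 * (p - 1)).
Hypothesis Cfin : (\int[L6]_z (f z `^ p)%:E < +oo)%E.
Hypothesis Kfin : (\int[L6]_z (sqnorm3 z.2 * f z)%:E < +oo)%E.

Let w8 (x : R3 R) : R := (rho f x `^ 6^-1) ^+ 8.

Let mw8 : measurable_fun setT w8.
Proof.
apply: measurable_funX; apply: (measurableT_comp (measurable_powR _)).
exact: measurable_rho.
Qed.

Let w80 x : 0 <= w8 x. Proof. by rewrite exprn_ge0 ?powR_ge0. Qed.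

Let mfp : measurable_fun setT (fun z => (f z `^ p)%:E).
Proof. by apply/measurable_EFinP; exact: (measurableT_comp (measurable_powR _)). Qed.

Let mvf : measurable_fun setT (fun z : R3 R * R3 R => (sqnorm3 z.2 * f z)%:E).
Proof.
apply/measurable_EFinP; apply: measurable_funM => //.
exact: (measurableT_comp (@measurable_sqnorm3 R) measurable_snd).
Qed.

Lemma integral_rho1 : (\int[L3]_x (rho f x)%:E = \int[L6]_z (f z)%:E)%E.
Proof.
have := integral_rho mf f0 ffin (measurable_cst (1 : R)) (fun=> ler01).
under eq_integral do rewrite mulr1.
by under [X in (_ = X)%E -> _]eq_integral do rewrite mulr1.
Qed.

Lemma density_power_fin : (\int[L3]_x (w8 x)%:E < +oo)%E.
Proof.
have [C [C0 hC]] := density_moment p1 p2.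
have mff : measurable_fun setT (EFin \o f) by exact/measurable_EFinP.
have fE0 z : (0 <= (EFin \o f) z)%E by rewrite lee_fin.
have fp0 z : (0 <= (f z `^ p)%:E :> \bar R)%E by rewrite lee_fin powR_ge0.
have vf0 (z : R3 R * R3 R) : (0 <= (sqnorm3 z.2 * f z)%:E :> \bar R)%E.
  by rewrite lee_fin mulr_ge0 ?sqnorm3_ge0.
pose A (x : R3 R) := (\int[L3]_v (f (x, v) `^ p)%:E)%E.
pose B (x : R3 R) := (\int[L3]_v (sqnorm3 v * f (x, v))%:E)%E.
have mA : measurable_fun setT A by exact: (@measurable_fun_fubini_tonelli_F _ _ _ _ _ L3 _ mfp fp0).
have mB : measurable_fun setT B by exact: (@measurable_fun_fubini_tonelli_F _ _ _ _ _ L3 _ mvf vf0).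
have A0 x : (0 <= A x)%E by apply: integral_ge0 => v _; exact: (fp0 (x, v)).
have B0 x : (0 <= B x)%E by apply: integral_ge0 => v _; exact: (vf0 (x, v)).
have mr : measurable_fun setT (fun x => (rho f x)%:E) by apply/measurable_EFinP; exact: measurable_rho.
have r0 x : (0 <= (rho f x)%:E :> \bar R)%E by rewrite lee_fin rho_ge0.
apply: (@le_lt_trans _ _ (\int[L3]_x ((rho f x)%:E + C%:E * A x + B x))%E).
  apply: ae_ge0_le_integral; first exact: measurableT.
  - by move=> x _; rewrite lee_fin.
  - exact/measurable_EFinP.
  - by move=> x _; apply: adde_ge0 => //; apply: adde_ge0 => //; apply: mule_ge0 => //; rewrite lee_fin.
  - exact: (emeasurable_funD (emeasurable_funD mr (measurable_funeM C%:E mA)) mB).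
  apply: ae_imp (@marginal_ae_fin _ _ _ _ R L3 L3 f mf f0 ffin) => x fx _.
  apply: (hC (fun v => f (x, v))) => //.
    exact: (measurableT_comp mf (pair1_measurable x)).
  by rewrite /rho fineK.
rewrite (ge0_integralD L3 measurableT); [|by move=> x _; apply: adde_ge0 => //; apply: mule_ge0 => //; rewrite lee_fin|exact: (emeasurable_funD mr (measurable_funeM C%:E mA))|by move=> x _; exact: B0|exact: mB].
rewrite (ge0_integralD L3 measurableT); [|by move=> x _; exact: r0|exact: mr|by move=> x _; apply: mule_ge0 => //; rewrite lee_fin|exact: measurable_funeM].
rewrite (ge0_integralZl_EFin L3 measurableT)//.
have -> : (\int[L3]_x A x = \int[L6]_z (f z `^ p)%:E)%E.
  by rewrite -(@fubini_tonelli1 _ _ _ _ _ L3 L3 _ mfp fp0).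
have -> : (\int[L3]_x B x = \int[L6]_z (sqnorm3 z.2 * f z)%:E)%E.
  by rewrite -(@fubini_tonelli1 _ _ _ _ _ L3 L3 _ mvf vf0).
rewrite integral_rho1; apply: lte_add_pinfty => //; apply: lte_add_pinfty => //.
exact: lte_mul_pinfty.
Qed.

Let kap (x : R3 R) : R := if sqnorm3 x < 1 then sqK x else 0.

Let mkap : measurable_fun setT kap.
Proof.
apply: measurable_fun_ifT => //; first exact: (measurable_fun_ltr measurable_sqnorm3).
exact: measurable_sqK.
Qed.

Let kap0 x : 0 <= kap x. Proof. by rewrite /kap; case: ifP => // _; exact: sqK_ge0. Qed.

Let kapfin : (\int[L3]_x (kap x)%:E < +oo)%E.
Proof.
have := @integral_sqnorm3V_ball R.
rewrite (_ : \int[L3]_x _ = \int[L3]_x (kap x)%:E)%E//.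
by apply: eq_integral => x _; rewrite /kap; case: ifP.
Qed.

(** Near the diagonal [powR_amgm] trades the kernel for its square, which is still locally
    integrable, against the power $4/3$ of the density; at distance at least one the kernel is
    bounded by [1]. *)
Lemma rho_K3_le x y : rho f x * rho f y * K3 (x - y) <=
  rho f x * rho f y + (w8 x * kap (x - y) + w8 y * kap (x - y) + w8 x * w8 y).
Proof.
rewrite /w8 /kap; have k0 := K3_ge0 (x - y); have rx := rho_ge0 f0 x; have ry := rho_ge0 f0 y.
case: ifPn => [_|].
  by rewrite -K3_sqr; exact: (le_trans (powR_amgm rx ry k0) (ler_wpDl (mulr_ge0 rx ry) (lexx _))).
rewrite -leNgt => h; have k1 : K3 (x - y) <= 1.
  have s1 : 1 <= enorm3 (x - y) by rewrite -[leLHS]sqrtr1 ler_wsqrtr.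
  by rewrite invf_le1// (lt_le_trans ltr01 s1).
have key (r s q A B : R) : 0 <= r -> 0 <= s -> q <= 1 -> 0 <= A -> 0 <= B ->
    r * s * q <= r * s + (A * 0 + B * 0 + A * B).
  move=> r0 s0 q1 A0 B0; rewrite !mulr0 !add0r; apply: (@le_trans _ _ (r * s)).
    by rewrite ler_piMr// mulr_ge0.
  by rewrite lerDl mulr_ge0.
by apply: key => //; rewrite exprn_ge0// powR_ge0.
Qed.

Lemma integral_rho2 : (DD f = \int[(L3 \x L3)%E]_t (rho f t.1 * rho f t.2 * K3 (t.1 - t.2))%:E)%E.
Proof.
have mK (x : R3 R) : measurable_fun setT (fun y : R3 R => K3 (x - y)).
  by apply: (measurableT_comp measurable_K3); apply: measurable_sub3.
have mK' (y : R3 R) : measurable_fun setT (fun x : R3 R => K3 (x - y)).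
  exact: (measurableT_comp measurable_K3 (measurable_translate3 y)).
have mr := measurable_rho mf f0; have r0 := rho_ge0 f0.
have D1 := @fubini_tonelli1 _ _ _ _ _ L6 L6 _ (measurable_DD_integrand mf) (DD_integrand_ge0 f0).
rewrite -[LHS]/(\int[(L6 \x L6)%E]_w (f w.1 * f w.2 * K3 (w.1.1 - w.2.1))%:E)%E D1 /fubini_F/=.
transitivity (\int[L6]_z \int[L3]_y (rho f y * (f z * K3 (z.1 - y)))%:E)%E.
  apply: eq_integral => z _.
  have := integral_rho mf f0 ffin (g := fun y => f z * K3 (z.1 - y)).
  move=> /(_ _ _) => <- //.
  - by apply: eq_integral => z' _; congr (_%:E); ring.
  - by apply: measurable_funM => //; exact: mK.
  - by move=> y; rewrite mulr_ge0// K3_ge0.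
pose F (w : (R3 R * R3 R) * R3 R) : \bar R := (rho f w.2 * (f w.1 * K3 (w.1.1 - w.2)))%:E.
have mF : measurable_fun setT F.
  apply/measurable_EFinP; apply: measurable_funM; first exact: measurableT_comp.
  apply: measurable_funM; first exact: measurableT_comp.
  apply: (measurableT_comp measurable_K3); apply: measurable_sub3 => //.
  exact: (measurableT_comp measurable_fst measurable_fst).
have F0 w : (0 <= F w)%E by rewrite lee_fin mulr_ge0// mulr_ge0// K3_ge0.
rewrite (@fubini_tonelli _ _ _ _ _ L6 L3 _ mF F0).
pose G (t : R3 R * R3 R) : \bar R := (rho f t.1 * rho f t.2 * K3 (t.1 - t.2))%:E.
have mG : measurable_fun setT G.
  apply/measurable_EFinP; apply: measurable_funM; first by apply: measurable_funM; exact: measurableT_comp.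
  by apply: (measurableT_comp measurable_K3); apply: measurable_sub3.
have G0 t : (0 <= G t)%E by rewrite lee_fin mulr_ge0 ?K3_ge0// mulr_ge0.
rewrite -[RHS]/(\int[(L3 \x L3)%E]_t G t)%E (@fubini_tonelli2 _ _ _ _ _ L3 L3 _ mG G0).
apply: eq_integral => y _; rewrite /F/= /fubini_G /G/=.
have := integral_rho mf f0 ffin (g := fun x => rho f y * K3 (x - y)).
move=> /(_ _ _) h; transitivity (\int[L6]_z (f z * (rho f y * K3 (z.1 - y)))%:E)%E.
  by apply: eq_integral => z _; congr (_%:E); ring.
rewrite h.
- by apply: eq_integral => x _; congr (_%:E); ring.
- by apply: measurable_funM => //; exact: mK'.
- by move=> x; rewrite mulr_ge0// K3_ge0.
Qed.

(** An elementary substitute for the Hardy-Littlewood-Sobolev inequality, based on the integrability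
    of [rho f] and of its power $4/3$. *)
Lemma DD_fin : (DD f < +oo)%E.
Proof.
rewrite integral_rho2.
have mr := measurable_rho mf f0; have r0 := rho_ge0 f0.
have ir : L3.-integrable setT (EFin \o rho f).
  apply/integrableP; split; first exact/measurable_EFinP.
  have -> : (\int[L3]_x `|(EFin \o rho f) x| = \int[L6]_z (f z)%:E)%E.
    by rewrite -integral_rho1; apply: eq_integral => x _; rewrite gee0_abs ?lee_fin.
  exact: ffin.
have iw : L3.-integrable setT (EFin \o w8).
  apply/integrableP; split; first exact/measurable_EFinP.
  have -> : (\int[L3]_x `|(EFin \o w8) x| = \int[L3]_x (w8 x)%:E)%E.
    by apply: eq_integral => x _; rewrite gee0_abs ?lee_fin.
  exact: density_power_fin.
have kE0 x : (0 <= (kap x)%:E :> \bar R)%E by rewrite lee_fin kap0.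
have kE : measurable_fun setT (fun x => (kap x)%:E) by exact/measurable_EFinP.
have nK : (\int[L3]_x (kap x)%:E)%E \is a fin_num by rewrite ge0_fin_numE ?integral_ge0.
have ty y : (\int[L3]_x (kap (x - y)%R)%:E = \int[L3]_x (kap x)%:E)%E.
  by have [_ h] := @mscaling_leb3_translation R (- y); rewrite (h _ kE kE0) mul1e.
have tx x : (\int[L3]_y (kap (x - y)%R)%:E = \int[L3]_x (kap x)%:E)%E.
  rewrite -(ty x); apply: eq_integral => y _; rewrite /kap /sqK.
  by have -> : sqnorm3 (x - y) = sqnorm3 (y - x) by rewrite /sqnorm3/=; ring.
have mkd : measurable_fun setT (fun t : R3 R * R3 R => kap (t.1 - t.2)).
  by apply: (measurableT_comp mkap); apply: measurable_sub3.
have mG : measurable_fun setT (fun t : R3 R * R3 R => rho f t.1 * rho f t.2 * K3 (t.1 - t.2)).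
  apply: measurable_funM.
    by apply: measurable_funM; [exact: (measurableT_comp mr measurable_fst)|exact: (measurableT_comp mr measurable_snd)].
  by apply: (measurableT_comp measurable_K3); apply: measurable_sub3.
apply: (@kernel_bound _ _ R L3 _ _ (fun t => kap (t.1 - t.2)) _ (fine (\int[L3]_x (kap x)%:E)%E) ir iw
  w80 mkd (fun t => kap0 _) _ _ mG).
- by move=> x; rewrite fineK// tx.
- by move=> y; rewrite fineK// ty.
- by move=> t; rewrite mulr_ge0 ?K3_ge0// mulr_ge0.
- by move=> t; exact: rho_K3_le.
Qed.

End finite_energy.

End density_bound.

(** * Two-point polarization *)

Section two_point_polarization.
Context {R : realDomainType}.

Lemma two_point_polarize_same (S a b u v p : R) : b < a -> u * v <= p -> 0 <= p ->
  S + u * v * (a - b) <= S + p * (a - b) /\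
  (S + u * v * (a - b) = S + p * (a - b) -> 0 <= u * v).
Proof.
move=> ab h p0; split; first by rewrite lerD2l ler_wpM2r// subr_ge0 ltW.
by move=> /addrI /mulIf; rewrite subr_eq0 gt_eqF// => /(_ isT) ->.
Qed.

End two_point_polarization.

Section two_point_polarization_real.
Context {R : realFieldType}.

(** Here [u] and [v] stand for the differences of a function between two points and their mirror
    images, [u'] and [v'] for the same after polarization, [a] and [b] for the kernel at the direct
    and at the crossed pair. The product [u * v] becomes its absolute value for points on the same
    side, and minus that for points on opposite sides, where [a - b] is negative. On the mirror the
    differences vanish. *)
Lemma two_point_polarize (l1 l2 a b u v u' v' S : R) :
  (0 < l1 * l2 -> b < a) -> (l1 * l2 < 0 -> a < b) ->
  (0 <= l1 -> u' = `|u|) -> (l1 <= 0 -> u' = - `|u|) ->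
  (0 <= l2 -> v' = `|v|) -> (l2 <= 0 -> v' = - `|v|) ->
  S + u * v * (a - b) / 2 <= S + u' * v' * (a - b) / 2 /\
  (S + u * v * (a - b) / 2 = S + u' * v' * (a - b) / 2 -> 0 <= (Num.sg l1 * u) * (Num.sg l2 * v)).
Proof.
move=> hp hn p1 n1 p2 n2.
have Huv : u * v <= `|u| * `|v| by rewrite -normrM ler_norm.
have Huv' : - u * v <= `|u| * `|v| by rewrite mulNr -normrM -normrN ler_norm.
have P0 : 0 <= `|u| * `|v| by rewrite mulr_ge0.
rewrite -!(mulrA _ (a - b)).
have -> : (a - b) / 2 = a / 2 - b / 2 by rewrite mulrBl.
have half (x y : R) : x < y -> x / 2 < y / 2 by move=> h; lra.
have [l10|l10|l10] := ltgtP l1 0.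
- have [l20|l20|l20] := ltgtP l2 0.
  + rewrite (ltr0_sg l10) (ltr0_sg l20) (n1 (ltW l10)) (n2 (ltW l20)) mulrNN !mulN1r mulrNN.
    by apply: two_point_polarize_same => //; apply/half/hp; rewrite nmulr_rgt0.
  + rewrite (ltr0_sg l10) (gtr0_sg l20) (n1 (ltW l10)) (p2 (ltW l20)) mulN1r mul1r.
    have := @two_point_polarize_same _ S (b / 2) (a / 2) (- u) v (`|u| * `|v|).
    have E (t : R) : t * (b / 2 - a / 2) = - t * (a / 2 - b / 2) by ring.
    by rewrite !E !mulNr opprK; apply => //; [apply/half/hn; rewrite nmulr_rlt0|rewrite -mulNr].
  + have v0 : v = 0.
      by apply/eqP; rewrite -normr_eq0; have := p2; have := n2; rewrite l20 lexx => /(_ isT) -> /(_ isT); lra.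
    have v'0 : v' = 0 by rewrite p2 ?l20// v0 normr0.
    by rewrite v0 v'0 !mulr0.
- have [l20|l20|l20] := ltgtP l2 0.
  + rewrite (gtr0_sg l10) (ltr0_sg l20) (p1 (ltW l10)) (n2 (ltW l20)) mulN1r mul1r.
    have := @two_point_polarize_same _ S (b / 2) (a / 2) (- u) v (`|u| * `|v|).
    have E (t : R) : t * (b / 2 - a / 2) = - t * (a / 2 - b / 2) by ring.
    by rewrite (mulrN u v) (mulrN `|u| `|v|) !E !mulNr opprK; apply => //; [apply/half/hn; rewrite pmulr_rlt0|rewrite -mulNr].
  + rewrite (gtr0_sg l10) (gtr0_sg l20) (p1 (ltW l10)) (p2 (ltW l20)) !mul1r.
    by apply: two_point_polarize_same => //; apply/half/hp; rewrite mulr_gt0.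
  + have v0 : v = 0.
      by apply/eqP; rewrite -normr_eq0; have := p2; have := n2; rewrite l20 lexx => /(_ isT) -> /(_ isT); lra.
    have v'0 : v' = 0 by rewrite p2 ?l20// v0 normr0.
    by rewrite v0 v'0 !mulr0.
have u0 : u = 0.
  by apply/eqP; rewrite -normr_eq0; have := p1; have := n1; rewrite l10 lexx => /(_ isT) -> /(_ isT); lra.
have u'0 : u' = 0 by rewrite p1 ?l10// u0 normr0.
by rewrite u0 u'0 !mul0r !mulr0 !mul0r.
Qed.

End two_point_polarization_real.

Section polarization.
Context d (Z : measurableType d) (R : realType) (m : {sigma_finite_measure set Z -> \bar R}).
Variables (T : Z -> Z) (l : Z -> R) (q : Z * Z -> R).
Hypotheses (mT : mscaling m m 1 T) (TT : involutive T).
Hypotheses (ml : measurable_fun setT l) (lT : forall z, l (T z) = - l z).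
Hypothesis l0 : forall z, l z = 0 -> T z = z.
Hypotheses (mq : measurable_fun setT q) (q0 : forall w, 0 <= q w).
Hypothesis qTT : forall z z', q (T z, T z') = q (z, z').

Definition polarize (f : Z -> R) (z : Z) : R :=
  if 0 <= l z then Num.max (f z) (f (T z)) else Num.min (f z) (f (T z)).

Lemma polarize_pair (f : Z -> R) z :
  (0 <= l z -> polarize f z = Num.max (f z) (f (T z)) /\ polarize f (T z) = Num.min (f z) (f (T z))) /\
  (l z <= 0 -> polarize f z = Num.min (f z) (f (T z)) /\ polarize f (T z) = Num.max (f z) (f (T z))).
Proof.
rewrite /polarize lT TT oppr_ge0; have [h|h|h] := ltgtP (l z) 0; split => // _.
- by rewrite maxC.
- by rewrite minC.
- by rewrite (l0 h) maxxx minxx.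
- by rewrite (l0 h) maxxx minxx.
Qed.

(** Polarization merely permutes the two values of [f] on each orbit of [T]. *)
Lemma polarize_sym (F : R -> R) (f : Z -> R) z :
  F (polarize f z) + F (polarize f (T z)) = F (f z) + F (f (T z)).
Proof.
have [h1 h2] := polarize_pair f z.
case: (leP 0 (l z)) => [/h1|/ltW/h2] [-> ->]; case: (leP (f z) (f (T z))) => // _; exact: addrC.
Qed.

Lemma measurable_polarize (f : Z -> R) : measurable_fun setT f -> measurable_fun setT (polarize f).
Proof.
have [mT1 _] := mT; move=> mf.
have mfT : measurable_fun setT (fun z => f (T z)) by exact: (measurableT_comp mf mT1).
apply: measurable_fun_ifT.
- exact: (measurable_fun_ler (measurable_cst _) ml).
- exact: measurable_maxr.
- exact: measurable_minr.
Qed.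

Lemma polarize_ge0 (f : Z -> R) : (forall z, 0 <= f z) -> forall z, 0 <= polarize f z.
Proof. by move=> f0 z; rewrite /polarize; case: ifP => _; rewrite ?le_max ?le_min !f0. Qed.

Lemma adde_self_inj (x y : \bar R) : (0 <= x -> 0 <= y -> x + x = y + y -> x = y)%E.
Proof.
case: x => [x| |] //; case: y => [y| |] // x0 y0; rewrite ?addye -?EFinD//.
by move=> [h]; congr (_%:E); lra.
Qed.

(** Since [T] preserves [m], twice an integral is the integral of the sum over the orbit. The final
    cancellation of the factor two is also valid for infinite values. *)
Lemma integral_sym (g h : Z -> R) : measurable_fun setT g -> measurable_fun setT h ->
  (forall z, 0 <= g z) -> (forall z, 0 <= h z) ->
  (forall z, g z + g (T z) = h z + h (T z)) -> (\int[m]_z (g z)%:E = \int[m]_z (h z)%:E)%E.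
Proof.
have [mT1 iT] := mT; move=> mg mh g0 h0 gh.
have dbl (u : Z -> R) : measurable_fun setT u -> (forall z, 0 <= u z) ->
    (\int[m]_z (u z)%:E + \int[m]_z (u z)%:E = \int[m]_z (u z + u (T z))%:E)%E.
  move=> mu u0; have mE : measurable_fun setT (EFin \o u) by exact/measurable_EFinP.
  under [RHS]eq_integral do rewrite EFinD.
  rewrite ge0_integralD//; last 3 first.
  - by move=> z _; rewrite lee_fin.
  - by move=> z _; rewrite lee_fin.
  - by apply: (measurableT_comp mE).
  congr (_ + _)%E; have := iT (EFin \o u) mE; rewrite mul1e => -> // z; by rewrite lee_fin.
apply: adde_self_inj.
- by apply: integral_ge0 => z _; rewrite lee_fin.
- by apply: integral_ge0 => z _; rewrite lee_fin.
by rewrite !dbl//; apply: eq_integral => z _; rewrite gh.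
Qed.

Lemma integral_polarize (F : R -> R) (e f : Z -> R) : measurable_fun setT F ->
  (forall t, 0 <= t -> 0 <= F t) -> measurable_fun setT e -> (forall z, 0 <= e z) ->
  (forall z, e (T z) = e z) -> measurable_fun setT f -> (forall z, 0 <= f z) ->
  (\int[m]_z (e z * F (polarize f z))%:E = \int[m]_z (e z * F (f z))%:E)%E.
Proof.
move=> mF F0 me e0 eT mf f0.
have mp := measurable_polarize mf; have p0 := polarize_ge0 f0.
apply: integral_sym.
- by apply: measurable_funM => //; exact: measurableT_comp.
- by apply: measurable_funM => //; exact: measurableT_comp.
- by move=> z; rewrite mulr_ge0// F0.
- by move=> z; rewrite mulr_ge0// F0.
- by move=> z; rewrite !eT -!mulrDr polarize_sym.
Qed.

Let mTT1 : mscaling (sprod m m) (sprod m m) 1 (fun w => (T w.1, T w.2)).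
Proof. by have := mscaling_prod ler01 ler01 mT mT; rewrite mul1r. Qed.

Let mTT2 : mscaling (sprod m m) (sprod m m) 1 (fun w => (w.1, T w.2)).
Proof. by have := mscaling_prod ler01 ler01 (mscaling_id m) mT; rewrite mul1r. Qed.

Let mTT3 : mscaling (sprod m m) (sprod m m) 1 (fun w => (T w.1, w.2)).
Proof. by have := mscaling_prod ler01 ler01 mT (mscaling_id m); rewrite mul1r. Qed.

(** The Coulomb integrand summed over the four pairs formed from the orbits of two points, grouped
    by the two values of the kernel that occur. *)
Definition pairS (f : Z -> R) (w : Z * Z) : R :=
  (f w.1 * f w.2 + f (T w.1) * f (T w.2)) * q w +
  (f w.1 * f (T w.2) + f (T w.1) * f w.2) * q (w.1, T w.2).

Let Dint (f : Z -> R) (w : Z * Z) : R := f w.1 * f w.2 * q w.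

Let mDint f : measurable_fun setT f -> measurable_fun setT (Dint f).
Proof.
by move=> mf; apply: measurable_funM => //; apply: measurable_funM; exact: measurableT_comp.
Qed.

Lemma pairSE f w : pairS f w = Dint f w + Dint f (T w.1, T w.2) + Dint f (w.1, T w.2) + Dint f (T w.1, w.2).
Proof.
have e1 : q (T w.1, w.2) = q (w.1, T w.2) by rewrite -{1}(TT w.2) qTT.
by rewrite /pairS /Dint/= qTT e1; case: w e1 => z z' _ /=; ring.
Qed.

Lemma measurable_pairS f : measurable_fun setT f -> measurable_fun setT (pairS f).
Proof.
move=> mf; have mD := mDint mf.
rewrite (_ : pairS f = fun w => Dint f w + Dint f (T w.1, T w.2) + Dint f (w.1, T w.2) + Dint f (T w.1, w.2)).
  apply: measurable_funD; last exact: (measurableT_comp mD mTT3.1).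
  apply: measurable_funD; last exact: (measurableT_comp mD mTT2.1).
  by apply: measurable_funD => //; exact: (measurableT_comp mD mTT1.1).
by apply/funext => w; exact: pairSE.
Qed.

Lemma pairS_ge0 (f : Z -> R) : (forall z, 0 <= f z) -> forall w, 0 <= pairS f w.
Proof. by move=> f0 w; rewrite addr_ge0// mulr_ge0// addr_ge0// mulr_ge0. Qed.

Lemma integral_pairS (f : Z -> R) : measurable_fun setT f -> (forall z, 0 <= f z) ->
  (\int[sprod m m]_w (pairS f w)%:E = 4%:E * \int[sprod m m]_w (f w.1 * f w.2 * q w)%:E)%E.
Proof.
move=> mf f0; have mD := mDint mf.
have mE : measurable_fun setT (EFin \o Dint f) by exact/measurable_EFinP.
have D0 w : (0 <= (EFin \o Dint f) w)%E by rewrite lee_fin !mulr_ge0.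
under eq_integral do rewrite pairSE !EFinD.
have D1 := mTT1.2 _ mE D0; have D2 := mTT2.2 _ mE D0; have D3 := mTT3.2 _ mE D0.
have n1 := measurableT_comp mE mTT1.1; have n2 := measurableT_comp mE mTT2.1; have n3 := measurableT_comp mE mTT3.1.
have nn1 w : (0 <= (Dint f w)%:E + (Dint f (T w.1, T w.2))%:E)%E by apply: adde_ge0; exact: D0.
have nn2 w : (0 <= (Dint f w)%:E + (Dint f (T w.1, T w.2))%:E + (Dint f (w.1, T w.2))%:E)%E.
  by apply: adde_ge0 => //; exact: D0.
have m1 := emeasurable_funD mE n1; have m2 := emeasurable_funD m1 n2.
rewrite (ge0_integralD (sprod m m) measurableT); [|by move=> w _; exact: nn2|exact: m2|by move=> w _; exact: D0|exact: n3].
rewrite (ge0_integralD (sprod m m) measurableT); [|by move=> w _; exact: nn1|exact: m1|by move=> w _; exact: D0|exact: n2].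
rewrite (ge0_integralD (sprod m m) measurableT); [|by move=> w _; exact: D0|exact: mE|by move=> w _; exact: D0|exact: n1].
rewrite mul1e in D1; rewrite mul1e in D2; rewrite mul1e in D3.
rewrite [X in (_ + X + _ + _)%E]D1 [X in (_ + X + _)%E]D2 [X in (_ + X)%E]D3.
set I := integral _ _ _.
have I0 : (0 <= I)%E by apply: integral_ge0 => w _; exact: D0.
rewrite -[X in (_ = _ * X)%E]/I; case: I I0 => [r| |] //= _.
  by rewrite -!EFinD -EFinM; congr (_%:E); ring.
by rewrite !addye// gt0_muley// lte_fin.
Qed.

Hypothesis qcmp : {ae sprod m m, forall w,
  (0 < l w.1 * l w.2 -> q (w.1, T w.2) < q w) /\ (l w.1 * l w.2 < 0 -> q w < q (w.1, T w.2))}.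

Let dif (f : Z -> R) z := f z - f (T z).

(** Separating sums and differences over orbits isolates what polarization can change: the sums are
    invariant by [polarize_sym], so only the second term varies. *)
Lemma pairS_diff f w : pairS f w = (f w.1 + f (T w.1)) * (f w.2 + f (T w.2)) * (q w + q (w.1, T w.2)) / 2
  + dif f w.1 * dif f w.2 * (q w - q (w.1, T w.2)) / 2.
Proof. by rewrite /pairS /dif; move: (q w) (q _) => a b; field. Qed.

Lemma dif_polarize f z : (0 <= l z -> dif (polarize f) z = `|dif f z|) /\ (l z <= 0 -> dif (polarize f) z = - `|dif f z|).
Proof.
have [h1 h2] := polarize_pair f z; rewrite /dif; split => [/h1|/h2] [-> ->].
  case: (leP (f z) (f (T z))) => h; first by rewrite ler0_norm ?opprB// subr_le0.
  by rewrite gtr0_norm// subr_gt0.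
case: (leP (f z) (f (T z))) => h; first by rewrite ler0_norm ?opprK// subr_le0.
by rewrite gtr0_norm ?opprB// subr_gt0.
Qed.

Lemma pairS_polarize f w :
  (0 < l w.1 * l w.2 -> q (w.1, T w.2) < q w) -> (l w.1 * l w.2 < 0 -> q w < q (w.1, T w.2)) ->
  pairS f w <= pairS (polarize f) w /\
  (pairS f w = pairS (polarize f) w -> 0 <= (Num.sg (l w.1) * dif f w.1) * (Num.sg (l w.2) * dif f w.2)).
Proof.
move=> hp hn; rewrite !pairS_diff !(polarize_sym id).
have [p1 n1] := dif_polarize f w.1; have [p2 n2] := dif_polarize f w.2.
exact: (@two_point_polarize R (l w.1) (l w.2) (q w) (q (w.1, T w.2)) (dif f w.1) (dif f w.2)
  (dif (polarize f) w.1) (dif (polarize f) w.2) _ hp hn p1 n1 p2 n2).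
Qed.

Lemma integral_ae_le_eq (g h : Z * Z -> R) : measurable_fun setT g -> measurable_fun setT h ->
  (forall w, 0 <= g w) -> {ae sprod m m, forall w, g w <= h w} ->
  (\int[sprod m m]_w (g w)%:E < +oo)%E ->
  (\int[sprod m m]_w (h w)%:E <= \int[sprod m m]_w (g w)%:E)%E -> {ae sprod m m, forall w, g w = h w}.
Proof.
move=> mg mh g0 gh gfin hg.
(* A version of [h] that dominates [g] at every point, so that [k - g] is nonnegative everywhere. *)
pose k w := Num.max (h w) (g w).
have mk : measurable_fun setT k by exact: measurable_maxr.
have k0 w : 0 <= k w by rewrite le_max g0 orbT.
have kh : {ae sprod m m, forall w, k w = h w} by apply: ae_imp gh => w hw; exact: max_l.
have kE : (\int[sprod m m]_w (k w)%:E = \int[sprod m m]_w (h w)%:E)%E.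
  apply: ae_eq_integral; first exact: measurableT.
  - exact/measurable_EFinP.
  - exact/measurable_EFinP.
  - by apply: ae_imp kh => w -> _.
have ig : (sprod m m).-integrable setT (EFin \o g).
  apply/integrableP; split; first exact/measurable_EFinP.
  by under eq_integral do rewrite gee0_abs ?lee_fin//.
have ik : (sprod m m).-integrable setT (EFin \o k).
  apply/integrableP; split; first exact/measurable_EFinP.
  under eq_integral do rewrite gee0_abs ?lee_fin//.
  by rewrite kE (le_lt_trans hg).
have ikg := integrableB measurableT ik ig.
have d0 : (\int[sprod m m]_w `|((EFin \o k) \- (EFin \o g)) w| = 0)%E.
  transitivity (\int[sprod m m]_w ((EFin \o k) \- (EFin \o g)) w)%E.
    by apply: eq_integral => w _; rewrite gee0_abs//= lee_fin subr_ge0 le_max lexx orbT.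
  rewrite integralB// kE.
  have e : (\int[sprod m m]_w (h w)%:E = \int[sprod m m]_w (g w)%:E)%E.
    apply/eqP; rewrite eq_le hg -kE; apply: ge0_le_integral => //.
    - by move=> w _; rewrite lee_fin.
    - exact/measurable_EFinP.
    - exact/measurable_EFinP.
    - by move=> w _; rewrite lee_fin le_max lexx orbT.
  by rewrite e subee//; exact: integrable_fin_num.
have := ae_eq_integral_abs (sprod m m) measurableT (measurable_int _ ikg).
move=> [/(_ d0) + _]; apply: ae_imp2 kh => w kw /(_ I) /=.
by rewrite -EFinB => -[/eqP]; rewrite subr_eq0 kw => /eqP ->.
Qed.

Variables (f : Z -> R).
Hypotheses (mf : measurable_fun setT f) (f0 : forall z, 0 <= f z).
Hypothesis ifin : (\int[m]_z (f z)%:E < +oo)%E.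

Let D (g : Z -> R) := (\int[sprod m m]_w (g w.1 * g w.2 * q w)%:E)%E.

Hypothesis Dfin : (D f < +oo)%E.
Hypothesis Dmax : (D (polarize f) <= D f)%E.
Hypothesis bisect : (\int[m]_z (Num.sg (l z) * f z)%:E = 0)%E.

(** Equality of the Coulomb integrals makes the signed difference [e] satisfy $e(z)e(z')\ge0$ for
    almost all pairs, whence $(\int|e|)^2=(\int e)^2$. The bisection of the mass gives $\int e=0$,
    and so [e] vanishes. *)
Lemma polarization_rigidity : {ae m, forall z, f (T z) = f z}.
Proof.
have mp := measurable_polarize mf; have p0 := polarize_ge0 f0.
have SS : {ae sprod m m, forall w, pairS f w = pairS (polarize f) w}.
  apply: integral_ae_le_eq.
  - exact: measurable_pairS.
  - exact: measurable_pairS.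
  - exact: pairS_ge0.
  - by apply: ae_imp qcmp => w [h1 h2]; exact: (pairS_polarize f h1 h2).1.
  - by rewrite integral_pairS// lte_mul_pinfty.
  - by rewrite !integral_pairS// lee_wpmul2l.
pose e z := Num.sg (l z) * dif f z.
have ee : {ae sprod m m, forall w, 0 <= e w.1 * e w.2}.
  by apply: ae_imp2 qcmp SS => w [h1 h2]; exact: (pairS_polarize f h1 h2).2.
have i_f : m.-integrable setT (EFin \o f).
  apply/integrableP; split; first exact/measurable_EFinP.
  by under eq_integral do rewrite gee0_abs ?lee_fin//.
have msg : measurable_fun setT (fun z => Num.sg (l z)).
  rewrite (_ : (fun z => _) = fun z => if 0 < l z then 1 else if l z < 0 then -1 else 0).
    by apply: measurable_fun_ifT => //; [exact: measurable_fun_ltr|apply: measurable_fun_ifT => //; exact: measurable_fun_ltr].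
  by apply/funext => z; case: sgrP.
have sg1 t : `|Num.sg t : R| <= 1 by rewrite normr_sg lern1 leq_b1.
pose sf z := Num.sg (l z) * f z.
have isf : m.-integrable setT (EFin \o sf).
  apply: (le_integrable measurableT _ _ i_f).
    by apply/measurable_EFinP; exact: measurable_funM.
  by move=> z _; rewrite !abse_EFin lee_fin normrM ler_piMl.
have [isfT esfT] := mscaling_integrable ler01 mT isf.
(* The sign of [l] is odd under [T], so both terms have the same integral, which [bisect] makes
   zero. *)
have eE : EFin \o e = ((EFin \o sf) \+ ((EFin \o sf) \o T))%E.
  apply/funext => z; rewrite /= -EFinD /e /dif /sf lT sgrN; congr (_%:E); ring.
have ie : m.-integrable setT (EFin \o e) by rewrite eE; exact: integrableD.
have e0 : (\int[m]_z (e z)%:E = 0)%E.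
  rewrite -[LHS]/(\int[m]_z (EFin \o e) z)%E eE integralD// -[X in (_ + X)%E]/(\int[m]_z (EFin \o sf) (T z))%E.
  by rewrite esfT mul1e bisect adde0.
have [_ t1] := integral_tensor ie ie.
have iae : m.-integrable setT (EFin \o (fun z => `|e z|)) by exact: (integrable_abse ie).
have [i2 t2] := integral_tensor iae iae.
have : (\int[m]_z `|e z|%:E * \int[m]_z `|e z|%:E = 0)%E.
  rewrite -t2 -[RHS](mule0 0%E) -{1}e0 -e0 -t1.
  apply: ae_eq_integral; first exact: measurableT.
  - exact: (measurable_int _ i2).
  - exact: (measurable_int _ (integral_tensor ie ie).1).
  - by apply: ae_imp ee => w hw _; rewrite -normrM ger0_norm.
move/eqP; rewrite mule_eq0 orbb => /eqP ae0.
have := ae_eq_integral_abs m measurableT (measurable_int _ ie).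
move=> [/(_ ae0) + _]; apply: ae_imp => z /(_ I) /= [ez].
have [lz|lz] := eqVneq (l z) 0; first by rewrite (l0 lz).
move/eqP : ez; rewrite mulf_eq0 sgr_eq0 (negbTE lz)/= subr_eq0 => /eqP ->//.
Qed.

End polarization.

(** * The Euler-Lagrange equation *)

Section real_integral.
Context d (T : measurableType d) (R : realType) (m : {measure set T -> \bar R}).
Implicit Types g h : T -> R.

Definition rint g : R := fine (\int[m]_x (g x)%:E)%E.
Definition rintegrable g := m.-integrable setT (EFin \o g).

Lemma rintE g : rintegrable g -> (\int[m]_x (g x)%:E = (rint g)%:E)%E.
Proof. by move=> ig; rewrite fineK//; exact: integrable_fin_num. Qed.

Lemma rintegrable_meas g : rintegrable g -> measurable_fun setT g.
Proof. by move=> ig; apply/measurable_EFinP; exact: (measurable_int _ ig). Qed.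

Lemma rintegrable_ge0 g : measurable_fun setT g -> (forall x, 0 <= g x) ->
  (\int[m]_x (g x)%:E < +oo)%E -> rintegrable g.
Proof.
move=> mg g0 gfin; apply/integrableP; split; first exact/measurable_EFinP.
have -> : (\int[m]_x `|(EFin \o g) x| = \int[m]_x (g x)%:E)%E.
  by apply: eq_integral => x _; rewrite gee0_abs ?lee_fin.
exact: gfin.
Qed.

Lemma rintegrable_lty g : (forall x, 0 <= g x) -> rintegrable g -> (\int[m]_x (g x)%:E < +oo)%E.
Proof. by move=> g0 ig; rewrite rintE// ltry. Qed.

Lemma rintegrable_le g h : measurable_fun setT g -> (forall x, `|g x| <= h x) ->
  rintegrable h -> rintegrable g.
Proof.
move=> mg gh ih; apply: (le_integrable measurableT _ _ ih); first exact/measurable_EFinP.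
by move=> x _; rewrite !abse_EFin lee_fin (le_trans (gh x))// ler_norm.
Qed.

Lemma rintegrableD g h : rintegrable g -> rintegrable h -> rintegrable (fun x => g x + h x).
Proof. by move=> ig ih; have := integrableD measurableT ig ih. Qed.

Lemma rintegrableB g h : rintegrable g -> rintegrable h -> rintegrable (fun x => g x - h x).
Proof. by move=> ig ih; have := integrableB measurableT ig ih. Qed.

Lemma rintegrableZ c g : rintegrable g -> rintegrable (fun x => c * g x).
Proof. by move=> ig; have := integrableZl measurableT c ig. Qed.

Lemma rintD g h : rintegrable g -> rintegrable h -> rint (fun x => g x + h x) = rint g + rint h.
Proof.
move=> ig ih; rewrite /rint; have := integralD measurableT ig ih => /= ->.
by rewrite fineD//; exact: integrable_fin_num.
Qed.

Lemma rintB g h : rintegrable g -> rintegrable h -> rint (fun x => g x - h x) = rint g - rint h.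
Proof.
move=> ig ih; rewrite /rint; have := integralB measurableT ig ih => /= ->.
by rewrite fineB//; exact: integrable_fin_num.
Qed.

Lemma rintZ c g : rintegrable g -> rint (fun x => c * g x) = c * rint g.
Proof.
move=> ig; rewrite /rint; have := integralZl measurableT ig c => /= ->.
by rewrite fineM//; exact: integrable_fin_num.
Qed.

Lemma rint_le g h : rintegrable g -> rintegrable h -> (forall x, g x <= h x) -> rint g <= rint h.
Proof.
move=> ig ih gh; rewrite -lee_fin -!rintE//; apply: le_integral => // x _.
by rewrite lee_fin.
Qed.

Lemma rint_ae_eq g h : measurable_fun setT g -> measurable_fun setT h ->
  {ae m, forall x, g x = h x} -> rint g = rint h.
Proof.
move=> mg mh gh; congr fine; apply: ae_eq_integral => //; try exact/measurable_EFinP.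
by apply: ae_imp gh => x -> _.
Qed.

Lemma rintegrable_ae g h : measurable_fun setT g -> rintegrable h -> {ae m, forall x, g x = h x} -> rintegrable g.
Proof.
move=> mg ih gh; apply/integrableP; split; first exact/measurable_EFinP.
have [_] := integrableP _ _ _ ih; apply: le_lt_trans; rewrite le_eqVlt; apply/orP; left; apply/eqP.
have mh := rintegrable_meas ih.
apply: ae_eq_integral => //.
- by apply: measurableT_comp => //; exact/measurable_EFinP.
- by apply: measurableT_comp => //; exact/measurable_EFinP.
- by apply: ae_imp gh => x /= -> _.
Qed.

Lemma rint_ge0_eq0 g : rintegrable g -> {ae m, forall x, 0 <= g x} -> rint g <= 0 -> {ae m, forall x, g x = 0}.
Proof.
move=> ig g0 g00; have mg := rintegrable_meas ig.
have a0 : (\int[m]_x `|(EFin \o g) x| = 0)%E.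
  have e : (\int[m]_x `|(EFin \o g) x| = \int[m]_x (g x)%:E)%E.
    apply: ae_eq_integral => //.
    - by apply: measurableT_comp => //; exact/measurable_EFinP.
    - exact/measurable_EFinP.
    - by apply: ae_imp g0 => x h _; rewrite gee0_abs// lee_fin.
  apply/eqP; rewrite eq_le; apply/andP; split; last exact: integral_ge0.
  by rewrite e rintE// lee_fin.
have := ae_eq_integral_abs m measurableT (measurable_int _ ig).
by move=> [/(_ a0) + _]; apply: ae_imp => x /(_ I) /= [].
Qed.

End real_integral.
Arguments rintegrable {d T R} m g.
Arguments rint {d T R} m g.

Section powR_convexity.
Context {R : realType}.

(** Young's inequality for the exponents $p$ and $p/(p-1)$; it serves as the tangent line inequality
    for the power [p] and also covers [b = 0]. *)
Lemma powR_young (p a b : R) : 1 < p -> 0 <= a -> 0 <= b ->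
  p * (b `^ (p - 1) * a) <= a `^ p + (p - 1) * b `^ p.
Proof.
move=> p1 a0 b0.
have p0 : 0 < p by lra.
have q0 : 0 < p / (p - 1) by rewrite divr_gt0//; lra.
have := @conjugate_powR R a (b `^ (p - 1)) p (p / (p - 1)) a0 (powR_ge0 _ _) p0 q0.
rewrite -powRrM (_ : (p - 1) * (p / (p - 1)) = p); last by field; lra.
have -> : p^-1 + (p / (p - 1))^-1 = 1 by field; apply/andP; split; lra.
move=> /(_ erefl) h.
have := ler_wpM2l (ltW p0) h; rewrite mulrDr.
have -> : p * (a `^ p / p) = a `^ p by field; lra.
have -> : p * (b `^ p / (p / (p - 1))) = (p - 1) * b `^ p by field; apply/andP; split; lra.
by rewrite (mulrC a).
Qed.

Lemma powR_split (p b : R) : 1 < p -> 0 <= b -> b `^ p = b `^ (p - 1) * b.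
Proof.
move=> p1 b0; have [->|b1] := eqVneq b 0; first by rewrite mulr0 powR0// gt_eqF; lra.
by rewrite -{3}(powRr1 b0) -powRD ?subrK// b1 implybT.
Qed.

Lemma powR_tangent (p a b : R) : 1 < p -> 0 <= a -> 0 <= b ->
  b `^ p - a `^ p <= p * (b `^ (p - 1) * (b - a)).
Proof.
move=> p1 a0 b0; have := powR_young p1 a0 b0.
by rewrite mulrBr -powR_split// mulrBr; lra.
Qed.

End powR_convexity.

Section powR_limit.
Context {R : realType}.

Lemma cvg_powR (s b : R) (u : nat -> R) : 0 < s -> (forall n, 0 <= u n) ->
  u @ \oo --> b -> (fun n => u n `^ s) @ \oo --> b `^ s.
Proof.
move=> s0 u0 ub.
have b0 : 0 <= b.
  rewrite -(cvg_lim _ ub)//; apply: limr_ge; first by apply: cvgP ub.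
  by near=> n; exact: u0.
have [b1|bp] := eqVneq b 0; last first.
  have bp' : 0 < b by rewrite lt_neqAle eq_sym bp.
  have cb := is_derive_continuous (is_derive1_powR s bp').
  exact: (continuous_cvg _ cb ub).
rewrite b1 powR0 ?gt_eqF//; apply/cvgrPdist_lt => eps eps0; rewrite b1 in ub.
have e1 : 0 < eps `^ s^-1 by exact: powR_gt0.
near=> n; rewrite sub0r normrN ger0_norm ?powR_ge0//.
have : `|0 - u n| < eps `^ s^-1 by near: n; move/cvgrPdist_lt : ub; exact.
rewrite sub0r normrN ger0_norm// => un.
have := gt0_ltr_powR s0 (u0 n) (ltW e1) un.
by rewrite -powRrM mulVf ?gt_eqF// powRr1// ltW.
Unshelve. all: by end_near.
Qed.

End powR_limit.

Section euler_lagrange.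
Context d (Z : measurableType d) (R : realType) (m : {sigma_finite_measure set Z -> \bar R}).
Variables (e : Z -> R) (q : Z * Z -> R) (p lam M : R).
Hypotheses (me : measurable_fun setT e) (e0 : forall z, 0 <= e z).
Hypotheses (mq : measurable_fun setT q) (q0 : forall w, 0 <= q w).
Hypothesis qsym : forall z z', q (z, z') = q (z', z).
Hypotheses (p1 : 1 < p) (M0 : 0 < M).
Notation mm := (sprod m m).

(** The class [FM] on an abstract measure space, with a kinetic weight [e] and real-valued
    integrals; [FM_admissible] identifies the two on phase space. *)
Definition admissible (h : Z -> R) := [/\ measurable_fun setT h, forall z, 0 <= h z,
  rintegrable m h /\ rint m h = M, rintegrable m (fun z => h z `^ p) & rintegrable m (fun z => e z * h z)].

Definition pairing (g h : Z -> R) (w : Z * Z) : R := g w.1 * h w.2 * q w.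

Definition energy (h : Z -> R) : R :=
  rint m (fun z => h z `^ p) + rint m (fun z => e z * h z) - lam * rint mm (pairing h h).

Hypothesis Dint : forall h, admissible h -> rintegrable mm (pairing h h).

Variable f : Z -> R.
Hypotheses (fadm : admissible f) (fmin : forall h, admissible h -> energy f <= energy h).

Let mix (t : R) (h : Z -> R) (z : Z) : R := (1 - t) * f z + t * h z.

Lemma measurable_pairing g h : measurable_fun setT g -> measurable_fun setT h ->
  measurable_fun setT (pairing g h).
Proof.
by move=> mg mh; apply: measurable_funM => //; apply: measurable_funM; exact: measurableT_comp.
Qed.

Lemma measurable_powR_fun (s : R) (h : Z -> R) : measurable_fun setT h -> measurable_fun setT (fun z => h z `^ s).
Proof. by move=> mh; exact: (measurableT_comp (measurable_powR _)). Qed.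

Let mix_ge0 t h z : 0 <= t <= 1 -> 0 <= h z -> 0 <= mix t h z.
Proof.
by have [_ f0 _ _ _] := fadm; move=> /andP[t0 t1] h0; rewrite addr_ge0// mulr_ge0// subr_ge0.
Qed.

Let mix_le t h z : 0 <= t <= 1 -> mix t h z <= Num.max (f z) (h z).
Proof.
move=> /andP[t0 t1]; have h1 : f z <= Num.max (f z) (h z) by rewrite le_max lexx.
have h2 : h z <= Num.max (f z) (h z) by rewrite le_max lexx orbT.
have := ler_wpM2l t0 h2; have t1' : 0 <= 1 - t by rewrite subr_ge0.
by have := ler_wpM2l t1' h1; rewrite /mix; lra.
Qed.

Let max_powR (a b : R) : 0 <= a -> 0 <= b -> Num.max a b `^ p <= a `^ p + b `^ p.
Proof.
by move=> a0 b0; case: (leP a b) => _; rewrite ?lerDl ?lerDr powR_ge0.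
Qed.

Lemma measurable_mix t h : admissible h -> measurable_fun setT (mix t h).
Proof.
have [mf _ _ _ _] := fadm; move=> [mh _ _ _ _].
by apply: measurable_funD; apply: measurable_funM.
Qed.

Lemma admissible_mix t h : admissible h -> 0 <= t <= 1 -> admissible (mix t h).
Proof.
have [mf f0 [i_f f1] fp fe] := fadm; move=> hadm t01; have [mh h0 [ih h1] hp he] := hadm.
have mmx := measurable_mix t hadm; split => //.
- by move=> z; exact: mix_ge0.
- have i1 := rintegrableZ (1 - t) i_f; have i2 := rintegrableZ t ih; split.
    exact: rintegrableD.
  by rewrite rintD// !rintZ// f1 h1; ring.
- apply: (rintegrable_le _ _ (rintegrableD fp hp)); first exact: measurable_powR_fun.
  move=> z; rewrite ger0_norm ?powR_ge0//; apply: le_trans (max_powR (f0 z) (h0 z)).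
  rewrite ge0_ler_powR ?nnegrE//; first by have := p1; lra.
  + exact: mix_ge0.
  + by rewrite le_max f0.
  + exact: mix_le.
- have := rintegrableD (rintegrableZ (1 - t) fe) (rintegrableZ t he).
  by congr (rintegrable m _); apply/funext => z; rewrite /mix; ring.
Qed.

(** The mixed integrands are dominated by four times the integrand of the midpoint of [f] and [h],
    itself admissible. *)
Lemma cross_integrable h : admissible h -> rintegrable mm (pairing f h) /\ rintegrable mm (pairing h f).
Proof.
have [mf f0 _ _ _] := fadm; move=> hadm; have [mh h0 _ _ _] := hadm.
have half : 0 <= (2^-1 : R) <= 1 by apply/andP; split; lra.
have i4 := rintegrableZ 4 (Dint (admissible_mix hadm half)).
have le4 (a b c e' k : R) : 0 <= a -> 0 <= b -> 0 <= c -> 0 <= e' -> 0 <= k ->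
    a * e' * k <= 4 * (((1 - 2^-1) * a + 2^-1 * b) * ((1 - 2^-1) * c + 2^-1 * e') * k).
  move=> a0 b0 c0 e0' k0.
  have -> : 4 * (((1 - 2^-1) * a + 2^-1 * b) * ((1 - 2^-1) * c + 2^-1 * e') * k) =
     (a + b) * (c + e') * k by field.
  by apply: ler_wpM2r => //; apply: ler_pM => //; rewrite ?lerDl ?lerDr.
split; apply: (rintegrable_le _ _ i4); try exact: measurable_pairing.
  by move=> w; rewrite ger0_norm ?mulr_ge0//; exact: le4.
move=> w; rewrite ger0_norm ?mulr_ge0// /pairing /mix.
rewrite (addrC (_ * f w.1)) (addrC (_ * f w.2)).
have := le4 (h w.1) (f w.1) (h w.2) (f w.2) (q w) (h0 _) (f0 _) (h0 _) (f0 _) (q0 _).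
by rewrite (_ : 1 - 2^-1 = 2^-1)//; field.
Qed.

Lemma cross_sym h : admissible h -> rint mm (pairing h f) = rint mm (pairing f h).
Proof.
move=> hadm; have [i1 i2] := cross_integrable hadm.
have [_ sw] := mscaling_integrable ler01 (mscaling_swap m m) i1.
congr fine; move: sw; rewrite mul1e => <-; apply: eq_integral => w _ /=.
by rewrite /pairing/= qsym -surjective_pairing mulrAC (mulrC (f w.2)) mulrAC; congr (_%:E); ring.
Qed.

(** The derivative in [t] of the power [p] of [mix t h]. *)
Let gvar (t : R) (h : Z -> R) (z : Z) : R := p * (mix t h z `^ (p - 1) * (h z - f z)).

Lemma measurable_gvar t h : admissible h -> measurable_fun setT (gvar t h).
Proof.
have [mf f0 _ _ _] := fadm; move=> hadm; have [mh h0 _ _ _] := hadm.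
apply: measurable_funM => //; apply: measurable_funM; last exact: measurable_funB.
by apply: measurable_powR_fun; exact: measurable_mix.
Qed.

Lemma gvar_le t h z : admissible h -> 0 <= t <= 1 -> `|gvar t h z| <= p * (f z `^ p + h z `^ p).
Proof.
have [mf f0 _ _ _] := fadm; move=> [mh h0 _ _ _] t01.
have p0 : 0 <= p by have := p1; lra.
rewrite normrM ger0_norm// ler_wpM2l//; apply: le_trans (max_powR (f0 z) (h0 z)).
have m0 : 0 <= Num.max (f z) (h z) by rewrite le_max f0.
rewrite normrM (ger0_norm (powR_ge0 _ _)) (powR_split p1 m0).
apply: ler_pM => //; first exact: powR_ge0.
  rewrite ge0_ler_powR ?nnegrE//; first by have := p1; lra.
  - exact: mix_ge0.
  - exact: mix_le.
by rewrite ler_norml; have := f0 z; have := h0 z; case: (leP (f z) (h z)) => ? ? ?; apply/andP; split; lra.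
Qed.

Lemma gvar_integrable t h : admissible h -> 0 <= t <= 1 -> rintegrable m (gvar t h).
Proof.
have [_ _ _ fp _] := fadm; move=> hadm t01; have [_ _ _ hp _] := hadm.
apply: (rintegrable_le _ _ (rintegrableZ p (rintegrableD fp hp))); first exact: measurable_gvar.
by move=> z; exact: gvar_le.
Qed.

(** This is minimality at [mix t h] divided by [t]. Convexity bounds the increment of the Casimir
    term by [t] times the integral of its derivative at the end point, so no differentiation under
    the integral occurs. *)
Lemma energy_variation t h : admissible h -> 0 < t <= 1 ->
  0 <= rint m (gvar t h) + (rint m (fun z => e z * h z) - rint m (fun z => e z * f z)) -
    lam * ((t - 2) * rint mm (pairing f f) + 2 * (1 - t) * rint mm (pairing f h) + t * rint mm (pairing h h)).
Proof.
have [mf f0 [i_f f1] fp fe] := fadm; move=> hadm /andP[t0 t1]; have [mh h0 [ih h1] hp he] := hadm.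
have t01 : 0 <= t <= 1 by rewrite ltW.
have xadm := admissible_mix hadm t01; have [mx x0 _ xp xe] := xadm.
have := fmin xadm; rewrite /energy.
have [i1 i2] := cross_integrable hadm.
have iff_ := Dint fadm; have ihh := Dint hadm.
have -> : rint mm (pairing (mix t h) (mix t h)) = (1 - t) ^+ 2 * rint mm (pairing f f) +
    (2 * t * (1 - t)) * rint mm (pairing f h) + t ^+ 2 * rint mm (pairing h h).
  have j1 := rintegrableZ ((1 - t) ^+ 2) iff_; have j2 := rintegrableZ (t * (1 - t)) i1.
  have j3 := rintegrableZ (t * (1 - t)) i2; have j4 := rintegrableZ (t ^+ 2) ihh.
  transitivity (rint mm (fun w => (1 - t) ^+ 2 * pairing f f w + (t * (1 - t) * pairing f h w +
      t * (1 - t) * pairing h f w) + t ^+ 2 * pairing h h w)).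
    by congr (rint mm _); apply/funext => w; rewrite /pairing /mix; ring.
  rewrite rintD; [|by apply: rintegrableD => //; exact: rintegrableD|exact: j4].
  rewrite rintD; [|exact: j1|exact: rintegrableD].
  by rewrite rintD// !rintZ// (cross_sym hadm); ring.
have -> : rint m (fun z => e z * mix t h z) = (1 - t) * rint m (fun z => e z * f z) + t * rint m (fun z => e z * h z).
  rewrite -!rintZ// -rintD; [|exact: rintegrableZ|exact: rintegrableZ].
  by congr (rint m _); apply/funext => z; rewrite /mix; ring.
have cx : rint m (fun z => mix t h z `^ p) - rint m (fun z => f z `^ p) <= t * rint m (gvar t h).
  have ig := gvar_integrable hadm t01.
  rewrite -rintB// -rintZ//; apply: rint_le; [exact: rintegrableB|exact: rintegrableZ|].
  move=> z; apply: (le_trans (powR_tangent p1 (f0 z) (x0 z))).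
  by rewrite /gvar /mix le_eqVlt; apply/orP; left; apply/eqP; ring.
move: cx; move: (rint m (gvar t h)) (rint m (fun z => mix t h z `^ p)) (rint m (fun z => f z `^ p)).
move: (rint m (fun z => e z * f z)) (rint m (fun z => e z * h z)) (rint mm (pairing f f)).
move: (rint mm (pairing f h)) (rint mm (pairing h h)) => a b c kf kh g cm cf cx hE.
rewrite -(@pmulr_rge0 _ t)//; lra.
Qed.

(** The limit of [energy_variation] along $t=1/(n+1)$, by dominated convergence with the bound of
    [gvar_le], which is uniform in [t]. *)
Lemma first_variation h : admissible h ->
  0 <= rint m (fun z => p * (f z `^ (p - 1) * (h z - f z))) +
    (rint m (fun z => e z * h z) - rint m (fun z => e z * f z)) +
    2 * lam * (rint mm (pairing f f) - rint mm (pairing f h)).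
Proof.
have [mf f0 [i_f f1] fp fe] := fadm; move=> hadm; have [mh h0 [ih h1] hp he] := hadm.
pose tn (n : nat) : R := n.+1%:R^-1.
have tn0 : tn @ \oo --> (0 : R) by exact: cvg_harmonic.
have tn1 n : 0 < tn n <= 1 by rewrite invr_gt0 ltr0n/= invf_le1 ?ltr0n// ler1n.
have tn1' n : 0 <= tn n <= 1 by have /andP[h1' h2'] := tn1 n; rewrite ltW.
have gE : (fun z => p * (f z `^ (p - 1) * (h z - f z))) = gvar 0 h.
  by apply/funext => z; rewrite /gvar /mix subr0 mul1r mul0r addr0.
rewrite gE.
have ib := rintegrableZ p (rintegrableD fp hp).
have z01 : 0 <= (0 : R) <= 1 by rewrite lexx ler01.
have ae1 : {ae m, forall z, setT z -> (fun n => (gvar (tn n) h z)%:E) @ \oo --> (gvar 0 h z)%:E}.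
  apply: aeW => z _; apply: cvg_EFin; first by near=> n.
  apply: cvgM; first exact: cvg_cst.
  apply: cvgM; last exact: cvg_cst.
  apply: cvg_powR; first by have := p1; lra.
    by move=> n; exact: mix_ge0.
  apply: cvgD; apply: cvgM; (try exact: cvg_cst); last exact: tn0.
  by apply: cvgB; [exact: cvg_cst|exact: tn0].
have ae2 : {ae m, forall z n, setT z -> (`|(gvar (tn n) h z)%:E| <= (p * (f z `^ p + h z `^ p))%:E)%E}.
  by apply: aeW => z n _; rewrite abse_EFin lee_fin gvar_le.
have [_ _ cv] := @dominated_convergence _ _ R m setT measurableT (fun n z => (gvar (tn n) h z)%:E)
  (fun z => (gvar 0 h z)%:E) (fun z => (p * (f z `^ p + h z `^ p))%:E)
  (fun n => (measurable_EFinP _ _).2 (measurable_gvar (tn n) hadm))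
  ((measurable_EFinP _ _).2 (measurable_gvar 0 hadm)) ae1 ib ae2.
have cvr : (fun n => rint m (gvar (tn n) h)) @ \oo --> rint m (gvar 0 h).
  by move: cv; rewrite (rintE (gvar_integrable hadm z01)) => /fine_cvgP[].
set L := (X in 0 <= X).
pose B n := rint m (gvar (tn n) h) + (rint m (fun z => e z * h z) - rint m (fun z => e z * f z)) -
    lam * ((tn n - 2) * rint mm (pairing f f) + 2 * (1 - tn n) * rint mm (pairing f h) + tn n * rint mm (pairing h h)).
have cB : B @ \oo --> rint m (gvar 0 h) + (rint m (fun z => e z * h z) - rint m (fun z => e z * f z)) -
    lam * ((0 - 2) * rint mm (pairing f f) + 2 * (1 - 0) * rint mm (pairing f h) + 0 * rint mm (pairing h h)).
  apply: cvgB; first by apply: cvgD; [exact: cvr|exact: cvg_cst].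
  apply: cvgM; first exact: cvg_cst.
  apply: cvgD; first apply: cvgD.
  - by apply: cvgM; [apply: cvgB; [exact: tn0|exact: cvg_cst]|exact: cvg_cst].
  - apply: cvgM; last exact: cvg_cst.
    by apply: cvgM; [exact: cvg_cst|apply: cvgB; [exact: cvg_cst|exact: tn0]].
  - by apply: cvgM; [exact: tn0|exact: cvg_cst].
have -> : L = lim (B @ \oo) by rewrite (cvg_lim _ cB)// /L; ring.
apply: limr_ge; first by apply: cvgP cB.
by near=> n; exact: energy_variation.
Unshelve. all: by end_near.
Qed.

Definition potential (z : Z) : R := fine (\int[m]_z' (f z' * q (z, z'))%:E)%E.

Lemma measurable_potential : measurable_fun setT potential.
Proof.
have [mf f0 _ _ _] := fadm.
have mF : measurable_fun setT (fun w : Z * Z => f w.2 * q w).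
  by apply: measurable_funM => //; exact: measurableT_comp.
by apply: (measurable_marginal m mF) => w; rewrite mulr_ge0.
Qed.

Lemma potential_ge0 z : 0 <= potential z.
Proof.
have [_ f0 _ _ _] := fadm.
by apply: fine_ge0; apply: integral_ge0 => z' _; rewrite lee_fin mulr_ge0.
Qed.

Lemma rint_potential h : admissible h -> rintegrable m (fun z => h z * potential z) /\
  rint m (fun z => h z * potential z) = rint mm (pairing f h).
Proof.
have [mf f0 _ _ _] := fadm; move=> hadm; have [mh h0 _ _ _] := hadm.
have [i1 i2] := cross_integrable hadm; rewrite -cross_sym//.
have mV := measurable_potential.
have aeF := ae_imp (fun z (H : setT z -> _) => H I) (integrable_ae measurableT (@integrable_fubini_F _ _ _ _ _ m m _ i2)).
have E : {ae m, forall z, fubini_F m (EFin \o pairing h f) z = (h z * potential z)%:E}.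
  apply: ae_imp aeF => z; rewrite /fubini_F/= /pairing/=.
  have -> : (\int[m]_z' (h z * f z' * q (z, z'))%:E = (h z)%:E * \int[m]_z' (f z' * q (z, z'))%:E)%E.
    rewrite -(ge0_integralZl_EFin m measurableT)//.
    - by apply: eq_integral => z' _; rewrite -EFinM mulrA.
    - by move=> z' _; rewrite lee_fin mulr_ge0.
    - apply/measurable_EFinP; apply: measurable_funM => //.
      exact: (measurableT_comp mq (pair1_measurable z)).
  (* The potential has the default value [0] where its integral diverges. Where [h] vanishes this
     does no harm; elsewhere the finite product excludes divergence. *)
  rewrite /potential; have [->|hz] := eqVneq (h z) 0; first by rewrite mul0e mul0r.
  have hz' : 0 < h z by rewrite lt_neqAle eq_sym hz h0.
  have : (0 <= \int[m]_z' (f z' * q (z, z'))%:E)%E.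
    by apply: integral_ge0 => z' _; rewrite lee_fin mulr_ge0.
  case: (\int[m]_z' _)%E => [r _ _|_|//]; first by rewrite EFinM.
  by rewrite gt0_muley ?lte_fin.
have iF := @integrable_fubini_F _ _ _ _ _ m m _ i2.
have mhV : measurable_fun setT (fun z => h z * potential z) by exact: measurable_funM.
have eI : (\int[m]_z (h z * potential z)%:E = \int[m]_z fubini_F m (EFin \o pairing h f) z)%E.
  apply: ae_eq_integral => //.
  - exact/measurable_EFinP.
  - exact: (measurable_int _ iF).
  - by apply: ae_imp E => z -> _.
split.
  apply: rintegrable_ge0 => //; first by move=> z; rewrite mulr_ge0// potential_ge0.
  by rewrite eI ltey_eq (integrable_fin_num _ iF).
by rewrite /rint eI (@integral12_prod_meas1 _ _ _ _ _ m m _ i2).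
Qed.

(** Fixed by the requirement that [f] times the variation [W] integrates to zero, given the mass [M]
    of [f]. *)
Definition multiplier : R :=
  (2 * lam * rint mm (pairing f f) - p * rint m (fun z => f z `^ p) - rint m (fun z => e z * f z)) / M.

Let W z := p * f z `^ (p - 1) + e z - 2 * lam * potential z + multiplier.

Let mW : measurable_fun setT W.
Proof.
have [mf _ _ _ _] := fadm.
apply: measurable_funD => //; apply: measurable_funB; last first.
  by apply: measurable_funM => //; exact: measurable_potential.
by apply: measurable_funD => //; apply: measurable_funM => //; exact: measurable_powR_fun.
Qed.

Lemma rint_W h : admissible h -> rintegrable m (fun z => h z * W z) /\ 0 <= rint m (fun z => h z * W z) /\
  (h = f -> rint m (fun z => h z * W z) = 0).
Proof.
have [mf f0 [i_f f1] fp fe] := fadm; move=> hadm; have [mh h0 [ih h1] hp he] := hadm.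
have [iV eV] := rint_potential hadm.
have z01 : 0 <= (0 : R) <= 1 by rewrite lexx ler01.
have i1 : rintegrable m (fun z => p * (f z `^ (p - 1) * (h z - f z))).
  have := gvar_integrable hadm z01; congr (rintegrable m _).
  by apply/funext => z; rewrite /gvar /mix subr0 mul1r mul0r addr0.
have i2 := rintegrableZ p fp.
have i3 := rintegrableZ (2 * lam) iV; have i4 := rintegrableZ multiplier ih.
have WE : (fun z => h z * W z) = (fun z => (p * (f z `^ (p - 1) * (h z - f z)) + p * f z `^ p + e z * h z
    - 2 * lam * (h z * potential z)) + multiplier * h z).
  by apply/funext => z; rewrite /W (powR_split p1 (f0 z)); ring.
have j1 := rintegrableD i1 i2; have j2 := rintegrableD j1 he; have j3 := rintegrableB j2 i3.
have iW := rintegrableD j3 i4.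
have rW : rint m (fun z => h z * W z) = rint m (fun z => p * (f z `^ (p - 1) * (h z - f z))) +
   p * rint m (fun z => f z `^ p) + rint m (fun z => e z * h z) - 2 * lam * rint mm (pairing f h) + multiplier * M.
  by rewrite WE rintD// rintB// rintD// rintD// (rintZ p fp) (rintZ (2 * lam) iV) (rintZ multiplier ih) eV h1.
have mM : multiplier * M = 2 * lam * rint mm (pairing f f) - p * rint m (fun z => f z `^ p) - rint m (fun z => e z * f z).
  by rewrite /multiplier mulfVK// gt_eqF.
split; first by rewrite WE.
split; first by rewrite rW mM; have := first_variation hadm; lra.
move=> hf; rewrite rW mM hf.
have -> : rint m (fun z => p * (f z `^ (p - 1) * (f z - f z))) = 0.
  rewrite (_ : (fun z => _) = fun z => 0 * f z); first by rewrite rintZ// mul0r.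
  by apply/funext => z; rewrite subrr !mulr0 mul0r.
by ring.
Qed.

(** If [W] were negative on a set of positive measure, an indicator normalized to mass [M] would be
    a competitor with a negative first variation. The set is cut down to finite measure and bounded
    [e], which makes the indicator admissible. *)
Lemma W_ge0 : {ae m, forall z, 0 <= W z}.
Proof.
have /sigma_finiteP[F [TF ndF Foo]] := sigma_finiteT m.
pose A n := F n `&` [set z | e z <= n%:R] `&` [set z | W z < 0].
have mA n : measurable (A n).
  apply: measurableI; last by rewrite -[X in measurable X]setTI; exact: measurable_fun_ltr.
  apply: measurableI; first exact: (Foo n).1.
  by rewrite -[X in measurable X]setTI; exact: measurable_fun_ler.
have A0 n : m (A n) = 0%E.
  apply/eqP; rewrite eq_le measure_ge0 andbT leNgt; apply/negP => An.
  have Afin : (m (A n) < +oo)%E.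
    apply: le_lt_trans (Foo n).2; apply: le_measure; rewrite ?inE//; first exact: (Foo n).1.
    by move=> z [[]].
  pose a := fine (m (A n)).
  have aE : m (A n) = a%:E by rewrite fineK// ge0_fin_numE.
  have a0 : 0 < a by rewrite -lte_fin -aE.
  pose h z : R := M / a * \1_(A n) z.
  have ind_int : rintegrable m (\1_(A n) : Z -> R).
    apply: rintegrable_ge0; [exact: measurable_indic|by move=> z; rewrite indicE|].
    by rewrite integral_indic// setIT.
  have ind1 : rint m (\1_(A n) : Z -> R) = a by rewrite /rint integral_indic// setIT.
  have Ma : 0 < M / a by rewrite divr_gt0.
  have h0 z : 0 <= h z by rewrite mulr_ge0 ?indicE// ltW.
  have mh : measurable_fun setT h by apply: measurable_funM => //; exact: measurable_indic.
  have hadm : admissible h.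
    split => //.
    - split; first exact: rintegrableZ.
      by rewrite rintZ// ind1 divfK// gt_eqF.
    - have := rintegrableZ ((M / a) `^ p) ind_int; congr (rintegrable m _).
      apply/funext => z; rewrite /h indicE; case: (z \in A n); rewrite ?mulr1// !mulr0.
      by rewrite powR0// gt_eqF; have := p1; lra.
    - apply: (rintegrable_le _ _ (rintegrableZ (n%:R * (M / a)) ind_int)); first exact: measurable_funM.
      move=> z; rewrite ger0_norm; last exact: mulr_ge0.
      rewrite /h !indicE; case: (boolP (z \in A n)) => [|_]; last by rewrite !mulr0.
      by rewrite inE => -[[_ /= en] _]; rewrite !mulr1 ler_wpM2r// ltW.
  have [iW [W0 _]] := rint_W hadm.
  have : {ae m, forall z, - (h z * W z) = 0}.
    apply: rint_ge0_eq0.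
    - by have := rintegrableZ (-1) iW; congr (rintegrable m _); apply/funext => z; rewrite mulN1r.
    - apply: aeW => z; rewrite /h indicE; case: (boolP (z \in A n)) => [|_]; last by rewrite mulr0 mul0r oppr0.
      by rewrite inE => -[_ /= Wn]; rewrite mulr1 -mulrN mulr_ge0 ?ltW// oppr_gt0.
    - rewrite (_ : (fun z => _) = fun z => -1 * (h z * W z)); last by apply/funext => z; rewrite mulN1r.
      by rewrite rintZ// mulN1r oppr_le0.
  move=> [N [mN N0 NA]].
  have : (m (A n) <= m N)%E.
    apply: le_measure; rewrite ?inE// => z Az; apply: NA => /= /eqP.
    rewrite oppr_eq0 /h indicE mem_set// mulr1 mulf_eq0 gt_eqF//=.
    by case: Az => _ /= /lt_eqF ->.
  by rewrite N0 leNgt An.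
exists (\bigcup_n A n); split.
- by apply: bigcup_measurable => n _.
- apply/eqP; rewrite eq_le measure_ge0 andbT.
  apply: (le_trans (measure_sigma_subadditive _ _ _ (@subset_refl _ _))) => //.
  + by apply: bigcup_measurable => n _.
  + by rewrite eseries0 => [|n _ _]; [exact: lexx|exact: A0].
- move=> z /= /negP; rewrite -ltNge => Wz.
  have : (\bigcup_n F n) z by rewrite -TF.
  move=> [k _ Fk].
  pose n := maxn k (Num.Def.archi_bound (e z)).
  exists n => //; split => //; split.
    by have /subsetPset := ndF _ _ (leq_maxl k (Num.Def.archi_bound (e z))); apply.
  rewrite /=; apply: ltW; apply: (lt_le_trans (archi_boundP (e0 z))).
  by rewrite ler_nat leq_maxr.
Qed.

(** Complementary slackness: [W] is nonnegative and [f * W] has integral zero, so [W] vanishes where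
    [f] does not. Where [f] vanishes, the sign of [W] says that the positive part is zero. *)
Lemma euler_lagrange : {ae m, forall z,
  p * f z `^ (p - 1) = Num.max (2 * lam * potential z - multiplier - e z) 0}.
Proof.
have [mf f0 [i_f f1] fp fe] := fadm.
have [iW [_ /(_ erefl) W0]] := rint_W fadm.
have fW : {ae m, forall z, f z * W z = 0}.
  apply: rint_ge0_eq0 => //; last by rewrite W0.
  by apply: ae_imp W_ge0 => z Wz; rewrite mulr_ge0.
apply: ae_imp2 W_ge0 fW => z Wz /eqP; rewrite mulf_eq0 => /orP[/eqP fz|/eqP Wz0].
  by move: Wz; rewrite /W fz powR0 ?gt_eqF ?subr_gt0// mulr0 => Wz; rewrite max_r//; lra.
move: Wz0; rewrite /W => Wz0.
have E : p * f z `^ (p - 1) = 2 * lam * potential z - multiplier - e z by lra.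
by rewrite -E max_l// mulr_ge0 ?powR_ge0//; have := p1; lra.
Qed.

End euler_lagrange.

(** * Medians, dilations and virial identities *)

Section rint_mscaling.
Context d (T : measurableType d) (R : realType) (m : {measure set T -> \bar R}).

Lemma rint_mscaling (c : R) (S : T -> T) (g : T -> R) : 0 <= c -> mscaling m m c S ->
  rintegrable m g -> rintegrable m (fun x => g (S x)) /\ rint m (fun x => g (S x)) = c * rint m g.
Proof.
move=> c0 mS ig; have [iS eS] := mscaling_integrable c0 mS ig; split => //.
by rewrite /rint eS fineM//; exact: integrable_fin_num.
Qed.

End rint_mscaling.

Lemma sg_perturb (R : realDomainType) (u x : R) : - `|u| < x -> x < `|u| -> Num.sg (u - x) = Num.sg u.
Proof.
case: (sgrP u) => [->|u0|u0] h1 h2.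
- by move: (lt_trans h1 h2); rewrite oppr0 ltxx.
- by rewrite gtr0_sg// subr_gt0 (lt_le_trans h2)// gtr0_norm.
- by rewrite ltr0_sg// subr_lt0 -(opprK u).
Qed.

Section median.
Context d (Z : measurableType d) (R : realType) (m : {measure set Z -> \bar R}).
Variables (f g : Z -> R).
Hypotheses (i_f : rintegrable m f) (f0 : forall z, 0 <= f z) (mg : measurable_fun setT g).
Hypothesis gnull : forall c, {ae m, forall z, g z != c}.

Lemma measurable_sg (h : Z -> R) : measurable_fun setT h -> measurable_fun setT (fun z => Num.sg (h z)).
Proof.
move=> mh; rewrite (_ : (fun z => _) = fun z => if 0 < h z then 1 else if h z < 0 then -1 else 0).
  by apply: measurable_fun_ifT => //; [exact: measurable_fun_ltr|apply: measurable_fun_ifT => //; exact: measurable_fun_ltr].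
by apply/funext => z; case: sgrP.
Qed.

Lemma rintegrable_sg (h : Z -> R) : measurable_fun setT h -> rintegrable m (fun z => Num.sg (h z) * f z).
Proof.
move=> mh; apply: (rintegrable_le _ _ i_f).
  by apply: measurable_funM; [exact: measurable_sg|exact: rintegrable_meas i_f].
move=> z; rewrite normrM (ger0_norm (f0 z)) ler_piMl//.
by rewrite normr_sg lern1 leq_b1.
Qed.

Let phi (c : R) := rint m (fun z => Num.sg (g z - c) * f z).

Let mgc c : measurable_fun setT (fun z => g z - c). Proof. exact: measurable_funB. Qed.

Let phi_cvg (c : nat -> R) (s : Z -> R) : measurable_fun setT s ->
  {ae m, forall z, (fun n => Num.sg (g z - c n)) @ \oo --> s z} ->
  (fun n => phi (c n)) @ \oo --> rint m (fun z => s z * f z).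
Proof.
move=> ms hs; have mf := rintegrable_meas i_f.
have ae1 : {ae m, forall z, setT z -> (fun n => (Num.sg (g z - c n) * f z)%:E) @ \oo --> (s z * f z)%:E}.
  apply: ae_imp hs => z hz _; apply: cvg_EFin; first by near=> n.
  by apply: cvgM => //; exact: cvg_cst.
have ae2 : {ae m, forall z n, setT z -> (`|(Num.sg (g z - c n) * f z)%:E| <= (f z)%:E)%E}.
  apply: aeW => z n _; rewrite abse_EFin lee_fin normrM (ger0_norm (f0 z)) ler_piMl//.
  by rewrite normr_sg lern1 leq_b1.
have msf : measurable_fun setT (fun z => (s z * f z)%:E) by apply/measurable_EFinP; exact: measurable_funM.
have [ilim _ cv] := @dominated_convergence _ _ R m setT measurableT (fun n z => (Num.sg (g z - c n) * f z)%:E)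
  (fun z => (s z * f z)%:E) (fun z => (f z)%:E)
  (fun n => measurable_int _ (rintegrable_sg (mgc (c n)))) msf ae1 i_f ae2.
by move: cv; rewrite (rintE ilim) => /fine_cvgP[].
Unshelve. all: by end_near.
Qed.

Let phi_le c c' : c <= c' -> phi c' <= phi c.
Proof.
move=> cc; apply: rint_le; [exact: rintegrable_sg|exact: rintegrable_sg|].
move=> z; apply: ler_wpM2r => //.
by case: (sgrP (g z - c)) => h; case: (sgrP (g z - c')) => h'; lra.
Qed.

(** The function [phi] is nonincreasing and runs from the mass to its opposite. The null level sets
    of [g] make it continuous, so it vanishes at the supremum of the points where it is
    nonnegative. *)
Lemma median_exists : 0 < rint m f -> exists c, rint m (fun z => Num.sg (g z - c) * f z) = 0.
Proof.
move=> fpos.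
have up : (fun n => phi (- n%:R)) @ \oo --> rint m f.
  have -> : rint m f = rint m (fun z => cst 1 z * f z).
    by congr (rint m _); apply/funext => z; rewrite mul1r.
  apply: phi_cvg => //; apply: aeW => z.
  apply: cvg_near_cst; near=> n; rewrite gtr0_sg// opprK.
  have : `|g z| < n%:R by near: n; exact: nbhs_infty_gtr.
  by rewrite ltr_norml => /andP[]; lra.
have down : (fun n => phi n%:R) @ \oo --> - rint m f.
  have -> : - rint m f = rint m (fun z => cst (-1) z * f z).
    by rewrite (rintZ (-1) i_f) mulN1r.
  apply: phi_cvg => //; apply: aeW => z.
  apply: cvg_near_cst; near=> n; rewrite ltr0_sg//.
  have : `|g z| < n%:R by near: n; exact: nbhs_infty_gtr.
  by rewrite ltr_norml => /andP[]; lra.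
have [n1 hn1] : exists n : nat, 0 < phi (- n%:R).
  have [n _ /(_ n (leqnn n))] := (cvgrPdist_lt _ _).1 up _ fpos.
  by rewrite /= ltr_norml => /andP[_ h]; exists n; lra.
have [n2 hn2] : exists n : nat, phi n%:R < 0.
  have [n _ /(_ n (leqnn n))] := (cvgrPdist_lt _ _).1 down _ fpos.
  by rewrite /= ltr_norml => /andP[h _]; exists n; lra.
pose S : set R := [set c | 0 <= phi c].
have S0 : S !=set0 by exists (- n1%:R); exact: ltW.
have Sub : has_ubound S.
  exists n2%:R => c Sc; rewrite leNgt; apply/negP => /ltW/phi_le; rewrite /S/= in Sc *; lra.
pose s := sup S.
exists s.
have step (eps : nat -> R) : (fun n => eps n) @ \oo --> (0 : R) -> (fun n => phi (s + eps n)) @ \oo --> phi s.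
  move=> e0; apply: phi_cvg; first exact: measurable_sg.
  apply: ae_imp (gnull s) => z gz; apply: cvg_near_cst.
  have d0 : 0 < `|g z - s| by rewrite normr_gt0 subr_eq0.
  near=> n.
  have : `|0 - eps n| < `|g z - s| by near: n; exact: ((cvgrPdist_lt _ _).1 e0 _ d0).
  rewrite sub0r normrN ltr_norml => /andP[h1 h2].
  rewrite (_ : g z - (s + eps n) = g z - s - eps n); last by ring.
  exact: sg_perturb h1 h2.
have hpos : (fun n : nat => n.+1%:R^-1 : R) @ \oo --> (0 : R) by exact: cvg_harmonic.
have hneg : (fun n : nat => - n.+1%:R^-1 : R) @ \oo --> (0 : R) by rewrite -oppr0; exact: cvgN.
have n0 n : 0 < (n.+1%:R^-1 : R) by rewrite invr_gt0.
apply/eqP; rewrite eq_le; apply/andP; split.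
- have cv := step _ hpos; rewrite -[X in X <= _](cvg_lim _ cv)//; apply: limr_le; first by apply: cvgP cv.
  near=> n; rewrite leNgt; apply/negP => h.
  have : s + n.+1%:R^-1 <= s by apply: ub_le_sup => //; exact: ltW.
  by have := n0 n; move: (n.+1%:R^-1) => x; lra.
- have cv := step _ hneg; rewrite -[X in _ <= X](cvg_lim _ cv)//; apply: limr_ge; first by apply: cvgP cv.
  near=> n; have [c Sc sc] := sup_adherent (n0 n) (conj S0 Sub).
  by apply: (le_trans Sc); apply: phi_le; rewrite -/s in sc; exact: ltW.
Unshelve. all: by end_near.
Qed.

End median.

Section stationary.
Context {R : realType}.

Lemma stationary_powR (A B r s : R) : 0 < r -> 0 < s ->
  (forall t : R, 0 < t -> A * 1 `^ r - B * 1 `^ s <= A * t `^ r - B * t `^ s) -> r * A = s * B.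
Proof.
move=> r0 s0 h.
pose F (t : R) := A * t `^ r - B * t `^ s.
have dF (t : R) : 0 < t -> is_derive t (1 : R) F (A * (r * t `^ (r - 1)) - B * (s * t `^ (s - 1))).
  move=> t0; exact: is_deriveB (is_deriveZ A (is_derive1_powR r t0)) (is_deriveZ B (is_derive1_powR s t0)).
have := @derive1_at_min R F 0 2 1.
have i01 : (1 : R) \in `]0, 2[ by rewrite in_itv/=; apply/andP; split; lra.
move=> /(_ _ _ i01 _) H.
have {}H : is_derive (1 : R) 1 F 0.
  apply: H; first by lra.
  - by move=> t; rewrite in_itv/= => /andP[t0 _]; have [] := dF t t0.
  - by move=> t; rewrite in_itv/= => /andP[t0 _]; exact: h.
have e1 := @derive_val _ _ _ _ _ _ _ H.
have e2 := @derive_val _ _ _ _ _ _ _ (dF 1 ltr01).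
by move: e2; rewrite e1 !powR1 !mulr1; lra.
Qed.

(** The parameters [b] and [c] dilate positions and velocities. For [c = b^-1] phase volume is
    preserved and the Casimir term drops out, which gives the first identity; [c = 1] leaves the
    kinetic term unchanged and gives the second. *)
Lemma virial_identities (C K D lam k p : R) : 0 < k -> p - 1 = k^-1 ->
  (forall b c : R, 0 < b -> 0 < c ->
    C + K - lam * D <= ((b * c) ^+ 3) `^ (p - 1) * C + c ^- 2 * K - lam * (b * D)) ->
  2 * K = lam * D /\ 3 / k * C = lam * D.
Proof.
move=> k0 pk dil; split.
  rewrite -[RHS]mul1r; apply: stationary_powR => // t t0; rewrite !powR1 !mulr1.
  have ti : 0 < t^-1 by rewrite invr_gt0.
  have := dil t t^-1 t0 ti; rewrite divff ?gt_eqF// expr1n powR1 mul1r.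
  have -> : t `^ 1 = t by rewrite powRr1// ltW.
  have -> : t `^ 2 = t ^+ 2 by rewrite -powR_mulrn// ltW.
  have -> : t^-1 ^- 2 = t ^+ 2 by rewrite -exprVn invrK.
  by move: (t ^+ 2) => u; lra.
rewrite -[RHS]mul1r; apply: stationary_powR => //; first by rewrite divr_gt0.
move=> t t0; rewrite !powR1 !mulr1.
have := dil t 1 t0 ltr01; rewrite mulr1 expr1n invr1 mul1r.
have -> : t `^ 1 = t by rewrite powRr1// ltW.
have -> : (t ^+ 3) `^ (p - 1) = t `^ (3 / k) by rewrite -(powR_mulrn 3 (ltW t0)) -powRrM pk.
by move: (t `^ _) => u; lra.
Qed.

End stationary.

Section rescaling.
Context d (Z : measurableType d) (R : realType) (m : {sigma_finite_measure set Z -> \bar R}).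
Variables (e : Z -> R) (q : Z * Z -> R) (p M : R).
Hypothesis p1 : 1 < p.
Notation mm := (sprod m m).
Notation adm := (admissible m e p M).

Definition casE (f : Z -> R) : R := rint m (fun z => f z `^ p).
Definition kinE (f : Z -> R) : R := rint m (fun z => e z * f z).
Definition potE (f : Z -> R) : R := rint mm (pairing q f f).

Lemma energyE lam f : energy m e q p lam f = casE f + kinE f - lam * potE f.
Proof. by []. Qed.

Lemma multiplierE lam f : multiplier m e q p lam M f = (2 * lam * potE f - p * casE f - kinE f) / M.
Proof. by []. Qed.

Lemma rescale (f : Z -> R) (S : Z -> Z) (a bb cc : R) : adm f -> rintegrable mm (pairing q f f) ->
  0 < a -> 0 < bb -> 0 < cc -> mscaling m m a^-1 S -> (forall z, e (S z) = cc * e z) ->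
  (forall z z', q (S z, S z') = bb * q (z, z')) ->
  [/\ adm (fun z => a * f (S z)),
     casE (fun z => a * f (S z)) = a `^ (p - 1) * casE f,
     kinE (fun z => a * f (S z)) = cc^-1 * kinE f &
     potE (fun z => a * f (S z)) = bb^-1 * potE f].
Proof.
move=> fadm iD a0 bb0 cc0 mS kS qS; have [mf f0 [i_f fM] fp fe] := fadm.
have ai : 0 <= a^-1 by rewrite invr_ge0 ltW.
have [i1 e1] := rint_mscaling ai mS i_f; have [i2 e2] := rint_mscaling ai mS fp.
have [i3 e3] := rint_mscaling ai mS fe.
have mSS : mscaling mm mm (a^-1 * a^-1) (fun w => (S w.1, S w.2)).
  exact: (@mscaling_prod R _ _ _ _ m m _ _ _ _ ai ai mS mS).
have [i4 e4] := rint_mscaling (mulr_ge0 ai ai) mSS iD.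
have pE : (fun z => (a * f (S z)) `^ p) = (fun z => a `^ p * (f (S z) `^ p)).
  by apply/funext => z; rewrite powRM// ltW.
have kE : (fun z => e z * (a * f (S z))) = (fun z => (a / cc) * (e (S z) * f (S z))).
  by apply/funext => z; rewrite kS; field; rewrite gt_eqF.
have dE : pairing q (fun z => a * f (S z)) (fun z => a * f (S z)) =
    (fun w => (a ^+ 2 / bb) * pairing q f f (S w.1, S w.2)).
  apply/funext => w; rewrite /pairing/= qS -surjective_pairing.
  by field; rewrite gt_eqF.
split.
- split.
  + by apply: measurable_funM => //; exact: (measurableT_comp mf mS.1).
  + by move=> z; rewrite mulr_ge0// ltW.
  + by split; [exact: rintegrableZ|rewrite rintZ// e1 fM mulrA divff ?mul1r// gt_eqF].
  + by rewrite pE; exact: rintegrableZ.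
  + by rewrite kE; exact: rintegrableZ.
- transitivity (a `^ p * (a^-1 * casE f)).
    by rewrite {1}/casE pE (rintZ (a `^ p) i2) e2.
  rewrite (powR_split p1 (ltW a0)); move: (a `^ _) (casE f) => x y.
  by field; rewrite gt_eqF.
- transitivity (a / cc * (a^-1 * kinE f)).
    by rewrite {1}/kinE kE (rintZ (a / cc) i3) e3.
  by move: (kinE f) => x; field; rewrite !gt_eqF.
- transitivity (a ^+ 2 / bb * (a^-1 / a * potE f)).
    by rewrite {1}/potE dE (rintZ (a ^+ 2 / bb) i4) e4.
  by move: (potE f) => x; field; rewrite !gt_eqF.
Qed.

Lemma casimir_gt0 f : 0 < M -> adm f -> 0 < casE f.
Proof.
move=> hM [mf f0 [i_f fM] fp fe].
have C0 : 0 <= casE f.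
  by apply: fine_ge0; apply: integral_ge0 => z _; rewrite lee_fin powR_ge0.
rewrite lt_neqAle C0 andbT; apply/eqP => C00.
have : {ae m, forall z, f z `^ p = 0}.
  apply: rint_ge0_eq0 => //; last by rewrite -[rint _ _]/(casE f) -C00.
  by apply: aeW => z; exact: powR_ge0.
move=> h; have : rint m f = rint m (fun z => 0 * f z).
  apply: rint_ae_eq => //; first by apply: measurable_funM.
  by apply: ae_imp h => z /powR_eq0_eq0 ->; rewrite mul0r.
by rewrite rintZ// mul0r fM => M0; move: hM; rewrite M0 ltxx.
Qed.

Lemma potE_ge0 f : (forall z, 0 <= f z) -> (forall w, 0 <= q w) -> 0 <= potE f.
Proof.
by move=> f0 q0; apply: fine_ge0; apply: integral_ge0 => w _; rewrite lee_fin !mulr_ge0.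
Qed.

End rescaling.

(** * Energy, dilations and multiplier of minimizers *)

Section vlasov_poisson.
Context {R : realType}.
Notation L3 := (@leb3 R).
Notation L6 := (@leb6 R).
Notation L66 := (sprod L6 L6).
Notation Z := (R3 R * R3 R)%type.

Definition kin (z : Z) : R := sqnorm3 z.2 / 2.
Definition ker (w : Z * Z) : R := K3 (w.1.1 - w.2.1).

Lemma measurable_kin : measurable_fun setT kin.
Proof.
apply: measurable_funM => //.
exact: (measurableT_comp (@measurable_sqnorm3 R) measurable_snd).
Qed.

Lemma kin_ge0 z : 0 <= kin z.
Proof. by rewrite divr_ge0 ?sqnorm3_ge0. Qed.

Lemma measurable_ker : measurable_fun setT ker.
Proof.
apply: (measurableT_comp measurable_K3); apply: measurable_sub3.
  exact: (measurableT_comp measurable_fst measurable_fst).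
exact: (measurableT_comp measurable_fst measurable_snd).
Qed.

Lemma ker_ge0 w : 0 <= ker w. Proof. exact: K3_ge0. Qed.

Lemma ker_sym z z' : ker (z, z') = ker (z', z).
Proof. by rewrite /ker /K3 /enorm3/=; congr (Num.sqrt _)^-1; rewrite /sqnorm3/=; ring. Qed.

Section abstract_values.
Context d (T : measurableType d) (m : {sigma_finite_measure set T -> \bar R}).

Lemma integral_casE (s : R) (h : T -> R) : rintegrable m (fun z => h z `^ s) ->
  (\int[m]_z (h z `^ s)%:E = (casE m s h)%:E)%E.
Proof. by move=> i; rewrite (rintE i). Qed.

Lemma integral_potE (q : T * T -> R) (h : T -> R) : rintegrable (sprod m m) (pairing q h h) ->
  (\int[sprod m m]_w (pairing q h h w)%:E = (potE m q h)%:E)%E.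
Proof. by move=> i; rewrite (rintE i). Qed.

End abstract_values.

Lemma DD_pairing f : (DD f = \int[L66]_w (pairing ker f f w)%:E)%E.
Proof. by []. Qed.

Variables (k M : R).
Hypotheses (hk0 : 0 < k) (hk1 : k < 3 / 2) (hM : 0 < M).
Let p := 1 + k^-1.

Let p1 : 1 < p. Proof. by rewrite ltrDl invr_gt0. Qed.

Let p2 : 2 <= 3 * (p - 1).
Proof.
rewrite /p addrC addKr ler_pdivlMr//; have := hk1; lra.
Qed.

Notation adm := (admissible L6 kin p M).

Lemma FM_admissible f : FM k M f <-> adm f.
Proof.
split.
  move=> [mf f0 fM fP].
  have C0 : (0 <= Casimir k f)%E by apply: integral_ge0 => z _; rewrite lee_fin powR_ge0.
  have I0 : (0 <= \int[L6]_z (sqnorm3 z.2 * f z)%:E)%E.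
    by apply: integral_ge0 => z _; rewrite lee_fin mulr_ge0 ?sqnorm3_ge0.
  have K0 : (0 <= Ekin f)%E by apply: mule_ge0.
  have Cf : (Casimir k f < +oo)%E by apply: le_lt_trans fP; rewrite leeDl.
  have Kf : (Ekin f < +oo)%E by apply: le_lt_trans fP; rewrite leeDr.
  have i_f : rintegrable L6 f by apply: rintegrable_ge0 => //; rewrite fM ltry.
  split => //.
  - by split => //; rewrite /rint fM.
  - apply: rintegrable_ge0; [exact: measurable_powR_fun|by move=> z; exact: powR_ge0|exact: Cf].
  - have iv : rintegrable L6 (fun z => sqnorm3 z.2 * f z).
      apply: rintegrable_ge0.
      + apply: measurable_funM => //.
        exact: (measurableT_comp (@measurable_sqnorm3 R) measurable_snd).
      + by move=> z; rewrite mulr_ge0 ?sqnorm3_ge0.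
      + move: Kf I0; rewrite /Ekin; case: (\int[L6]_z _)%E => [r _ _|h _|//]; first exact: ltry.
        by move: h; rewrite gt0_muley ?lte_fin.
    have := rintegrableZ 2^-1 iv; congr (rintegrable _ _).
    by apply/funext => z; rewrite /kin; ring.
move=> [mf f0 [i_f fM] fp fe]; split => //.
  by rewrite rintE// fM.
have iv := rintegrableZ 2 fe.
have Cf : (Casimir k f < +oo)%E by rewrite /Casimir -[X in (X < _)%E]/(\int[L6]_z (f z `^ p)%:E)%E rintE// ltry.
apply: lte_add_pinfty => //; rewrite /Ekin.
have -> : (\int[L6]_z (sqnorm3 z.2 * f z)%:E = \int[L6]_z (2 * (kin z * f z))%:E)%E.
  by apply: eq_integral => z _; rewrite /kin; congr (_%:E); field.
by rewrite (rintE iv) -EFinM ltry.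
Qed.

Lemma adm_kin_fin f : adm f -> (\int[L6]_z (sqnorm3 z.2 * f z)%:E = (2 * rint L6 (fun z => kin z * f z))%:E)%E.
Proof.
move=> [mf f0 [i_f fM] fp fe]; rewrite -(rintZ 2 fe) -(rintE (rintegrableZ 2 fe)).
by apply: eq_integral => z _; rewrite /kin; congr (_%:E); field.
Qed.

Lemma adm_DD_fin f : adm f -> (DD f < +oo)%E.
Proof.
move=> fadm; have [mf f0 [i_f fM] fp fe] := fadm.
apply: (DD_fin mf f0 _ p1 p2).
- by rewrite rintE// ltry.
- by rewrite rintE// ltry.
- by rewrite adm_kin_fin// ltry.
Qed.

Lemma adm_pairing f : adm f -> rintegrable L66 (pairing ker f f).
Proof.
move=> fadm; have [mf f0 _ _ _] := fadm.
apply: rintegrable_ge0; [exact: (measurable_pairing measurable_ker mf mf)|by move=> w; rewrite !mulr_ge0// ker_ge0|exact: adm_DD_fin].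
Qed.

Variable lam : R.
Hypothesis hlam : forall f : Z -> R, measurable_fun setT f ->
  (forall z, 0 <= f z) -> (\int[L6]_z (f z)%:E < +oo)%E -> (DD f < +oo)%E ->
  Epot f = ((- lam)%:E * DD f)%E.

Notation en := (energy L6 kin ker p lam).

Lemma HC_energy f : adm f -> HC k f = (en f)%:E.
Proof.
move=> fadm; have [mf f0 [i_f fM] fp fe] := fadm; have iD := adm_pairing fadm.
have Df := etrans (DD_pairing f) (integral_potE iD).
have Cf : (Casimir k f = (casE L6 p f)%:E)%E by exact: (integral_casE fp).
have Kf : (Ekin f = (2^-1 * (2 * kinE L6 kin f))%:E)%E by rewrite /Ekin (adm_kin_fin fadm) EFinM.
have ffin : (\int[L6]_z (f z)%:E < +oo)%E by rewrite (rintE i_f) ltry.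
have Ef := hlam mf f0 ffin (adm_DD_fin fadm).
rewrite /HC /Defs.Pfun Ef Cf Kf Df energyE -EFinM -!EFinD.
by move: (casE _ _ _) (kinE _ _ _) (potE _ _ _) => C D K; congr (_%:E); field.
Qed.

Definition vpmin (f : Z -> R) := adm f /\ forall h, adm h -> en f <= en h.

Lemma vpmin_of_HC f : FM k M f -> HC k f = ereal_inf (HC k @` FM k M) -> vpmin f.
Proof.
move=> fFM fmin; have fadm := (FM_admissible f).1 fFM; split => // h hadm.
have hle : (HC k f <= HC k h)%E.
  by rewrite fmin; apply: ereal_inf_lbound; exists h => //; exact/FM_admissible.
by move: hle; rewrite (HC_energy fadm) (HC_energy hadm) lee_fin.
Qed.

Lemma vpmin_en f g : vpmin f -> vpmin g -> en f = en g.
Proof. by move=> [fa fm] [ga gm]; apply/eqP; rewrite eq_le fm// gm. Qed.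

Lemma mscaling_dilation (b c : R) : 0 < b -> 0 < c ->
  mscaling L6 L6 ((b * c) ^+ 3)^-1 (fun z => (scale3 b z.1, scale3 c z.2)).
Proof.
move=> b0 c0.
have sc (a : R) : 0 < a -> mscaling L3 L3 (a ^- 3) (scale3 a).
  move=> a0; have := mscaling_leb3_affine (0 : R3 R) a0; congr (mscaling _ _ _ _).
  by apply/funext => x; rewrite /scale3/= !addr0.
have i (a : R) : 0 < a -> 0 <= a ^- 3 by move=> a0; rewrite invr_ge0 exprn_ge0 ?ltW.
have := @mscaling_prod R _ _ _ _ L3 L3 _ _ _ _ (i b b0) (i c c0) (sc b b0) (sc c c0).
by rewrite -invfM -exprMn.
Qed.

Notation cas := (casE L6 p).
Notation kn := (kinE L6 kin).
Notation pot := (potE L6 ker).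

(** The competitor is the dilated function multiplied by [(b * c) ^+ 3], the factor that restores
    its mass. *)
Lemma energy_dilation f (b c : R) : vpmin f -> 0 < b -> 0 < c ->
  cas f + kn f - lam * pot f <= ((b * c) ^+ 3) `^ (p - 1) * cas f + c ^- 2 * kn f - lam * (b * pot f).
Proof.
move=> [fadm fmin] b0 c0.
have a0 : 0 < (b * c) ^+ 3 by rewrite exprn_gt0// mulr_gt0.
have kS (z : Z) : kin (scale3 b z.1, scale3 c z.2) = c ^+ 2 * kin z.
  by rewrite /kin/= sqnorm3_scale3 mulrA.
have qS (z z' : Z) : ker ((scale3 b z.1, scale3 c z.2), (scale3 b z'.1, scale3 c z'.2)) = b^-1 * ker (z, z').
  by rewrite /ker/= scale3B /K3 enorm3_scale3 ?ltW// invfM.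
have bi : 0 < b^-1 by rewrite invr_gt0.
have c2 : 0 < c ^+ 2 by rewrite exprn_gt0.
have [gadm e1 e2 e3] := rescale p1 fadm (adm_pairing fadm) a0 bi c2 (mscaling_dilation b0 c0) kS qS.
have := fmin _ gadm; rewrite invrK in e3; rewrite [X in X <= _]energyE [X in _ <= X]energyE e1 e2 e3.
exact.
Qed.

Lemma virial f : vpmin f -> 2 * kn f = lam * pot f /\ 3 / k * cas f = lam * pot f.
Proof.
move=> fmin; apply: (@virial_identities _ _ _ _ _ _ p) => //; first by rewrite /p addrC addKr.
by move=> b c b0 c0; exact: energy_dilation.
Qed.

Lemma vpmin_lam f : vpmin f -> 0 < lam * pot f /\ 0 < lam.
Proof.
move=> fmin; have [_ v2] := virial fmin; have C0 := casimir_gt0 hM fmin.1.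
have [_ f0 _ _ _] := fmin.1; have D0 := potE_ge0 L6 f0 ker_ge0.
move: v2 C0 D0; move: (cas f) (pot f) => C D v2 C0 D0.
have lD : 0 < lam * D by rewrite -v2 mulr_gt0// divr_gt0.
split => //; rewrite ltNge; apply/negP => l0; move: lD; rewrite ltNge; apply/negP; rewrite negbK.
exact: mulr_le0_ge0.
Qed.

Notation beta := (multiplier L6 kin ker p lam M).

(** By the virial identities all terms are multiples of [lam * pot f]: the energy with factor
    $(2k-3)/6$, and [M * beta f] with factor $(7-2k)/6$. Eliminating [lam * pot f] leaves a
    multiplier that depends on [f] only through its energy. *)
Lemma vpmin_multiplier f : vpmin f ->
  beta f = (7 - 2 * k) / (2 * k - 3) * en f / M /\ 0 < beta f.
Proof.
move=> fmin; have [v1 v2] := virial fmin; have [lD _] := vpmin_lam fmin.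
rewrite multiplierE energyE.
move: v1 v2 lD; move: (cas f) (kn f) (pot f) => C K D v1 v2 lD.
have k3 : 2 * k - 3 < 0 by have := hk1; lra.
have kn : k != 0 by rewrite gt_eqF.
have CE : C = k * (lam * D) / 3 by rewrite -v2; field.
have KE : K = lam * D / 2 by lra.
have E1 : 2 * lam * D - p * C - K = lam * D * (7 - 2 * k) / 6.
  by rewrite CE KE /p; field.
rewrite E1; split; last by rewrite !divr_gt0// mulr_gt0//; have := hk1; lra.
by congr (_ / M); rewrite CE KE; field; rewrite lt_eqF.
Qed.

End vlasov_poisson.

(** * Symmetry of minimizers *)

Section ae_product.
Context d1 d2 (X : measurableType d1) (Y : measurableType d2) (R : realType).
Variables (mX : {sigma_finite_measure set X -> \bar R}).
Variables (mY : {sigma_finite_measure set Y -> \bar R}).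

Lemma ae_fst (P : X -> Prop) : {ae mX, forall x, P x} -> {ae (mX \x mY)%E, forall z, P z.1}.
Proof.
move=> [N [mN N0 NP]]; exists (N `*` setT); split.
- exact: measurableX.
- transitivity (mX N * mY setT)%E; first exact: product_measure1E.
  by rewrite N0 mul0e.
- by move=> z /= h; split => //; exact: NP.
Qed.

Lemma ae_snd (P : Y -> Prop) : {ae mY, forall y, P y} -> {ae (mX \x mY)%E, forall z, P z.2}.
Proof.
move=> [N [mN N0 NP]]; exists (setT `*` N); split.
- exact: measurableX.
- transitivity (mX setT * mY N)%E; first exact: product_measure1E.
  by rewrite N0 mule0.
- by move=> z /= h; split => //; exact: NP.
Qed.

End ae_product.

Section polarized_energy.
Context d (Z : measurableType d) (R : realType) (m : {sigma_finite_measure set Z -> \bar R}).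
Variables (T : Z -> Z) (l e : Z -> R) (q : Z * Z -> R) (p lam M : R).
Hypotheses (mT : mscaling m m 1 T) (TT : involutive T).
Hypotheses (ml : measurable_fun setT l) (lT : forall z, l (T z) = - l z).
Hypothesis l0 : forall z, l z = 0 -> T z = z.
Hypotheses (mq : measurable_fun setT q) (q0 : forall w, 0 <= q w).
Hypothesis qTT : forall z z', q (T z, T z') = q (z, z').
Hypotheses (me : measurable_fun setT e) (e0 : forall z, 0 <= e z) (eT : forall z, e (T z) = e z).
Hypothesis lam0 : 0 < lam.
Notation adm := (admissible m e p M).

Lemma admissible_polarize f : adm f -> [/\ adm (polarize T l f),
  casE m p (polarize T l f) = casE m p f & kinE m e (polarize T l f) = kinE m e f].
Proof.
move=> [mf f0 [i_f fM] fp fe].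
have mp := measurable_polarize mT ml mf; have p0 := polarize_ge0 T l f0.
have IE (F : R -> R) (u : Z -> R) : measurable_fun setT F -> (forall t, 0 <= t -> 0 <= F t) ->
    measurable_fun setT u -> (forall z, 0 <= u z) -> (forall z, u (T z) = u z) ->
    rintegrable m (fun z => u z * F (f z)) ->
    rintegrable m (fun z => u z * F (polarize T l f z)) /\
    rint m (fun z => u z * F (polarize T l f z)) = rint m (fun z => u z * F (f z)).
  move=> mF F0 mu u0 uT iF.
  have E := integral_polarize mT TT ml lT l0 mF F0 mu u0 uT mf f0.
  split; last by rewrite /rint E.
  apply: rintegrable_ge0; last by rewrite E rintegrable_lty// => z; rewrite mulr_ge0// F0.
    by apply: measurable_funM => //; exact: measurableT_comp.
  by move=> z; rewrite mulr_ge0// F0.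
have one (h : Z -> R) : (fun z => cst 1 z * h z) = h by apply/funext => z; rewrite mul1r.
have [i1 r1] : rintegrable m (polarize T l f) /\ rint m (polarize T l f) = rint m f.
  have := IE id (cst 1); rewrite !one; apply => //.
have [i2 r2] : rintegrable m (fun z => polarize T l f z `^ p) /\ casE m p (polarize T l f) = casE m p f.
  have := IE (fun t => t `^ p) (cst 1); rewrite !one; apply => //.
    by move=> t _; exact: powR_ge0.
have [i3 r3] := IE id e (@measurable_id _ _ _) (fun t => id) me e0 eT fe.
split; [|exact: r2|exact: r3].
split; [exact: mp|exact: p0| |exact: i2|exact: i3].
by split; [exact: i1|rewrite r1 fM].
Qed.

Hypothesis qcmp : {ae sprod m m, forall w,
  (0 < l w.1 * l w.2 -> q (w.1, T w.2) < q w) /\ (l w.1 * l w.2 < 0 -> q w < q (w.1, T w.2))}.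
Hypothesis Dint : forall h, adm h -> rintegrable (sprod m m) (pairing q h h).

Lemma minimizer_symmetric f : adm f -> (forall h, adm h -> energy m e q p lam f <= energy m e q p lam h) ->
  rint m (fun z => Num.sg (l z) * f z) = 0 -> {ae m, forall z, f (T z) = f z}.
Proof.
move=> fadm fmin fl; have [mf f0 [i_f fM] fp fe] := fadm.
have [padm cE kE] := admissible_polarize fadm.
have := fmin _ padm; rewrite !energyE cE kE => hD.
have {}hD : potE m q (polarize T l f) <= potE m q f by rewrite -(ler_pM2l lam0); lra.
apply: (polarization_rigidity mT TT ml lT l0 mq q0 qTT qcmp mf f0).
- exact: rintegrable_lty.
- by rewrite -[X in (X < _)%E]/(\int[sprod m m]_w (pairing q f f w)%:E)%E (rintE (Dint fadm)) ltry.
- rewrite -[X in (X <= _)%E]/(\int[sprod m m]_w (pairing q (polarize T l f) (polarize T l f) w)%:E)%E.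
  rewrite -[X in (_ <= X)%E]/(\int[sprod m m]_w (pairing q f f w)%:E)%E.
  by rewrite (rintE (Dint fadm)) (rintE (Dint padm)) lee_fin.
- by rewrite (rintE (rintegrable_sg i_f f0 ml)) fl.
Qed.

End polarized_energy.

Section symmetry.
Context {R : realType}.
Notation mu := (@lebesgue_measure R).
Notation L3 := (@leb3 R).
Notation L6 := (@leb6 R).
Notation L66 := (sprod L6 L6).
Notation Z := (R3 R * R3 R)%type.
Variables (k M lam : R).
Hypotheses (hk0 : 0 < k) (hk1 : k < 3 / 2) (hM : 0 < M).
Notation vmin := (vpmin k M lam).

Lemma vpmin_translate f (a : R3 R) : vmin f -> vmin (fun z => f (z.1 + a, z.2)).
Proof.
move=> [fadm fmin].
have p1 : 1 < 1 + k^-1 by rewrite ltrDl invr_gt0.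
have mS : mscaling L6 L6 1^-1 (fun z : Z => (z.1 + a, z.2)).
  by rewrite invr1; exact: (mscaling_leb6 ler01 (mscaling_leb3_translation a)).
have kS (z : Z) : kin (z.1 + a, z.2) = 1 * kin z by rewrite mul1r.
have qS (z z' : Z) : ker ((z.1 + a, z.2), (z'.1 + a, z'.2)) = 1 * ker (z, z').
  by rewrite mul1r /ker/=; congr K3; rewrite opprD addrACA subrr addr0.
have [gadm e1 e2 e3] := rescale p1 fadm (adm_pairing hk0 hk1 fadm) ltr01 ltr01 ltr01 mS kS qS.
have gE : (fun z : Z => 1 * f (z.1 + a, z.2)) = (fun z => f (z.1 + a, z.2)) by apply/funext => z; rewrite mul1r.
rewrite gE in gadm; rewrite gE powR1 mul1r in e1; rewrite gE invr1 mul1r in e2; rewrite gE invr1 mul1r in e3.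
split; [exact: gadm|move=> h hadm].
apply: le_trans (fmin h hadm); rewrite [X in X <= _]energyE [X in _ <= X]energyE e1 e2 e3.
exact: lexx.
Qed.

Section reflection.
Variables (th : R3 R -> R3 R) (l : R3 R -> R).
Hypotheses (mth : mscaling L3 L3 1 th) (thth : involutive th).
Hypotheses (ml : measurable_fun setT l) (lth : forall x, l (th x) = - l x).
Hypothesis l0 : forall x, l x = 0 -> th x = x.
Hypothesis iso : forall x y, sqnorm3 (th x - th y) = sqnorm3 (x - y).
Hypothesis refl : forall x y, sqnorm3 (x - th y) = sqnorm3 (x - y) + 4 * (l x * l y).

Lemma K3_lt (x y : R3 R) : x != 0 -> sqnorm3 x < sqnorm3 y -> K3 y < K3 x.
Proof.
move=> x0 xy; have sx : 0 < sqnorm3 x by rewrite lt_neqAle eq_sym sqnorm3_eq0 x0 sqnorm3_ge0.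
have ex : 0 < enorm3 x by rewrite sqrtr_gt0.
have ey : 0 < enorm3 y by rewrite sqrtr_gt0 (lt_trans sx).
by rewrite ltf_pV2 ?posrE// ltr_sqrt// (lt_trans sx).
Qed.

Lemma vpmin_reflect f : 0 < lam -> vmin f ->
  rint L6 (fun z => Num.sg (l z.1) * f z) = 0 -> {ae L6, forall z, f (th z.1, z.2) = f z}.
Proof.
move=> lam0 [fadm fmin] fl.
pose T (z : Z) : Z := (th z.1, z.2).
have mT : mscaling L6 L6 1 T by exact: (mscaling_leb6 ler01 mth).
have TT : involutive T by move=> z; rewrite /T/= thth -surjective_pairing.
have mlz : measurable_fun setT (fun z : Z => l z.1) by exact: (measurableT_comp ml measurable_fst).
have lT (z : Z) : l (T z).1 = - l z.1 by exact: lth.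
have lz0 (z : Z) : l z.1 = 0 -> T z = z by move=> h; rewrite /T l0// -surjective_pairing.
have qTT (z z' : Z) : ker (T z, T z') = ker (z, z') by rewrite /ker /K3 /enorm3/= iso.
have eT (z : Z) : kin (T z) = kin z by [].
have mT2 : mscaling L66 L66 1 (fun w => (w.1, T w.2)).
  by have := @mscaling_prod R _ _ _ _ L6 L6 _ _ _ _ ler01 ler01 (mscaling_id L6) mT; rewrite mul1r.
(* At coincident points [K3] has the default value [0], which would spoil the strict comparison;
   such pairs, before or after reflection of one point, form a null set. *)
have dn := @diagonal_null R; have dnT := mscaling_ae mT2 dn.
have qcmp : {ae L66, forall w, (0 < l w.1.1 * l w.2.1 -> ker (w.1, T w.2) < ker w) /\
    (l w.1.1 * l w.2.1 < 0 -> ker w < ker (w.1, T w.2))}.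
  apply: ae_imp2 dn dnT => w h1 h2; rewrite /ker/=; split => ll.
    by apply: K3_lt; rewrite ?subr_eq0// refl ltrDl mulr_gt0.
  by apply: K3_lt; rewrite ?subr_eq0// refl gtrDl pmulr_rlt0.
exact: (minimizer_symmetric mT TT mlz lT lz0 (@measurable_ker R) (@ker_ge0 R) qTT (@measurable_kin R)
  (@kin_ge0 R) eT lam0 qcmp (fun h => @adm_pairing R k M hk0 hk1 h) fadm fmin fl).
Qed.

End reflection.

Lemma refl12_data (a b : R) : a ^+ 2 + b ^+ 2 = 1 ->
  let th := refl12 a b in let l := fun x : R3 R => a * x.1.1 + b * x.1.2 in
  [/\ involutive th, forall x, l (th x) = - l x, forall x, l x = 0 -> th x = x,
    forall x y, sqnorm3 (th x - th y) = sqnorm3 (x - y) &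
    forall x y, sqnorm3 (x - th y) = sqnorm3 (x - y) + 4 * (l x * l y)].
Proof.
move=> ab /=; have b2 : b ^+ 2 = 1 - a ^+ 2 by rewrite -ab addrC addKr.
have lth (x : R3 R) : a * (refl12 a b x).1.1 + b * (refl12 a b x).1.2 = - (a * x.1.1 + b * x.1.2).
  rewrite /refl12/=; move: x.1.1 x.1.2 => s t.
  have -> : a * (s - 2 * a * (a * s + b * t)) + b * (t - 2 * b * (a * s + b * t)) =
     (a * s + b * t) * (1 - 2 * (a ^+ 2 + b ^+ 2)) by ring.
  by rewrite ab; ring.
split => //.
- move=> x; have := lth x; case: x => [[s t] u]; rewrite {1 3}/refl12/= => h.
  by rewrite h; congr ((_, _), _); rewrite /refl12/=; ring.
- by move=> x lx; rewrite /refl12 lx; case: x lx => [[s t] u] /= _; rewrite !mulr0 !subr0.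
- by move=> x y; rewrite refl12B sqnorm3_refl12.
- move=> x y; rewrite /sqnorm3 /refl12/=; move: x.1.1 x.1.2 x.2 y.1.1 y.1.2 y.2 => s t u s' t' u'.
  have -> : (s - (s' - 2 * a * (a * s' + b * t'))) ^+ 2 + (t - (t' - 2 * b * (a * s' + b * t'))) ^+ 2 + (u - u') ^+ 2 =
   (s - s') ^+ 2 + (t - t') ^+ 2 + (u - u') ^+ 2 + 4 * (a * s' + b * t') * (a * (s - s') + b * (t - t'))
   + 4 * (a ^+ 2 + b ^+ 2) * (a * s' + b * t') ^+ 2 by ring.
  by rewrite ab; ring.
Qed.

Lemma refl13_data (a b : R) : a ^+ 2 + b ^+ 2 = 1 ->
  let th := refl13 a b in let l := fun x : R3 R => a * x.1.1 + b * x.2 in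
  [/\ involutive th, forall x, l (th x) = - l x, forall x, l x = 0 -> th x = x,
    forall x y, sqnorm3 (th x - th y) = sqnorm3 (x - y) &
    forall x y, sqnorm3 (x - th y) = sqnorm3 (x - y) + 4 * (l x * l y)].
Proof.
move=> ab /=; have b2 : b ^+ 2 = 1 - a ^+ 2 by rewrite -ab addrC addKr.
have lth (x : R3 R) : a * (refl13 a b x).1.1 + b * (refl13 a b x).2 = - (a * x.1.1 + b * x.2).
  rewrite /refl13/=; move: x.1.1 x.2 => s t.
  have -> : a * (s - 2 * a * (a * s + b * t)) + b * (t - 2 * b * (a * s + b * t)) =
     (a * s + b * t) * (1 - 2 * (a ^+ 2 + b ^+ 2)) by ring.
  by rewrite ab; ring.
split => //.
- move=> x; have := lth x; case: x => [[s t] u]; rewrite {1 3}/refl13/= => h.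
  by rewrite h; congr ((_, _), _); rewrite /refl13/=; ring.
- by move=> x lx; rewrite /refl13 lx; case: x lx => [[s t] u] /= _; rewrite !mulr0 !subr0.
- by move=> x y; rewrite refl13B sqnorm3_refl13.
- move=> x y; rewrite /sqnorm3 /refl13/=; move: x.1.1 x.1.2 x.2 y.1.1 y.1.2 y.2 => s t u s' t' u'.
  have -> : (s - (s' - 2 * a * (a * s' + b * u'))) ^+ 2 + (t - t') ^+ 2 + (u - (u' - 2 * b * (a * s' + b * u'))) ^+ 2 =
   (s - s') ^+ 2 + (t - t') ^+ 2 + (u - u') ^+ 2 + 4 * (a * s' + b * u') * (a * (s - s') + b * (u - u'))
   + 4 * (a ^+ 2 + b ^+ 2) * (a * s' + b * u') ^+ 2 by ring.
  by rewrite ab; ring.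
Qed.

Lemma measurable_lin12 (a b : R) : measurable_fun setT (fun x : R3 R => a * x.1.1 + b * x.1.2).
Proof.
apply: measurable_funD; apply: measurable_funM => //.
  exact: (measurableT_comp measurable_fst measurable_fst).
exact: (measurableT_comp measurable_snd measurable_fst).
Qed.

Lemma measurable_lin13 (a b : R) : measurable_fun setT (fun x : R3 R => a * x.1.1 + b * x.2).
Proof.
apply: measurable_funD; apply: measurable_funM => //.
exact: (measurableT_comp measurable_fst measurable_fst).
Qed.

Lemma vpmin_refl12 f (a b : R) : a ^+ 2 + b ^+ 2 = 1 -> 0 < lam -> vmin f ->
  rint L6 (fun z => Num.sg (a * z.1.1.1 + b * z.1.1.2) * f z) = 0 ->
  {ae L6, forall z, f (refl12 a b z.1, z.2) = f z}.
Proof.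
move=> ab lam0 fmin; have [h1 h2 h3 h4 h5] := refl12_data ab.
exact: (vpmin_reflect (mscaling_leb3_refl12 ab) h1 (measurable_lin12 a b) h2 h3 h4 h5 lam0 fmin).
Qed.

Lemma vpmin_refl13 f (a b : R) : a ^+ 2 + b ^+ 2 = 1 -> 0 < lam -> vmin f ->
  rint L6 (fun z => Num.sg (a * z.1.1.1 + b * z.1.2) * f z) = 0 ->
  {ae L6, forall z, f (refl13 a b z.1, z.2) = f z}.
Proof.
move=> ab lam0 fmin; have [h1 h2 h3 h4 h5] := refl13_data ab.
exact: (vpmin_reflect (mscaling_leb3_refl13 ab) h1 (measurable_lin13 a b) h2 h3 h4 h5 lam0 fmin).
Qed.

Lemma coord3_null (i : 'I_3) (c : R) : {ae L6, forall z, coord3 i z.1 != c}.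
Proof.
apply: (@ae_fst _ _ _ _ R L3 L3 (fun x : R3 R => coord3 i x != c)).
have hc : {ae mu, forall t : R, t != c}.
  exists [set c]; split => //; first exact: lebesgue_measure_set1.
  by move=> t /= /negP; rewrite negbK => /eqP.
case: i => -[|[|[|//]]] i3; rewrite /coord3/=.
- apply: (@ae_fst _ _ _ _ R (sprod mu mu) mu (fun x : R * R => x.1 != c)).
  exact: (@ae_fst _ _ _ _ R mu mu (fun t : R => t != c)).
- apply: (@ae_fst _ _ _ _ R (sprod mu mu) mu (fun x : R * R => x.2 != c)).
  exact: (@ae_snd _ _ _ _ R mu mu (fun t : R => t != c)).
- exact: (@ae_snd _ _ _ _ R (sprod mu mu) mu (fun t : R => t != c)).
Qed.

Definition centered (g : Z -> R) := forall i : 'I_3, rint L6 (fun z => Num.sg (coord3 i z.1) * g z) = 0.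

Lemma vpmin_center f : vmin f -> exists a, vmin (fun z => f (z.1 + a, z.2)) /\ centered (fun z => f (z.1 + a, z.2)).
Proof.
move=> fmin; have [[mf f0 [i_f fM] _ _] _] := fmin.
have med (i : 'I_3) : exists c, rint L6 (fun z => Num.sg (coord3 i z.1 - c) * f z) = 0.
  apply: (median_exists i_f f0); last by rewrite fM.
    exact: (measurableT_comp (@measurable_coord3 R i) measurable_fst).
  by move=> c; exact: coord3_null.
have [c hc] : exists c : 'I_3 -> R, forall i, rint L6 (fun z => Num.sg (coord3 i z.1 - c i) * f z) = 0.
  by have [c hc] := choice med; exists c.
pose i0 : 'I_3 := Ordinal (isT : (0 < 3)%N); pose i1 : 'I_3 := Ordinal (isT : (1 < 3)%N).
pose i2 : 'I_3 := Ordinal (isT : (2 < 3)%N).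
pose a : R3 R := ((c i0, c i1), c i2).
have aE i : coord3 i a = c i.
  by case: i => -[|[|[|//]]] i3; rewrite /coord3/=; congr c; exact: val_inj.
exists a; split; first exact: vpmin_translate.
move=> i; have mS := mscaling_leb6 ler01 (mscaling_leb3_translation a).
have mgc : measurable_fun setT (fun z : Z => coord3 i z.1 - c i).
  apply: measurable_funB => //; exact: (measurableT_comp (@measurable_coord3 R i) measurable_fst).
have [_] := rint_mscaling ler01 mS (rintegrable_sg i_f f0 mgc).
rewrite hc mulr0 => <-; congr (rint _ _); apply/funext => z /=; congr (Num.sg _ * _).
by rewrite -(aE i); case: i {mgc} => -[|[|[|//]]] i3; rewrite /coord3/=; ring.
Qed.

Lemma centered_even f : 0 < lam -> vmin f -> centered f ->
  {ae L6, forall z, f ((((-1) * z.1.1.1, (-1) * z.1.1.2), (-1) * z.1.2), z.2) = f z}.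
Proof.
move=> lam0 fmin fc.
have e10 : (1 : R) ^+ 2 + 0 ^+ 2 = 1 by ring.
have e01 : (0 : R) ^+ 2 + 1 ^+ 2 = 1 by ring.
have m1 := mscaling_leb6 ler01 (mscaling_leb3_refl12 e10).
have m2 := mscaling_leb6 ler01 (mscaling_leb3_refl12 e01).
have sgE (l l' : Z -> R) : l =1 l' -> rint L6 (fun z => Num.sg (l z) * f z) = rint L6 (fun z => Num.sg (l' z) * f z).
  by move=> ll; congr (rint _ _); apply/funext => z; rewrite ll.
have h1 : {ae L6, forall z, f (refl12 1 0 z.1, z.2) = f z}.
  apply: vpmin_refl12 => //; apply: etrans (fc (Ordinal (isT : (0 < 3)%N))); apply: sgE => z.
  by rewrite /coord3/=; ring.
have h2 : {ae L6, forall z, f (refl12 0 1 z.1, z.2) = f z}.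
  apply: vpmin_refl12 => //; apply: etrans (fc (Ordinal (isT : (1 < 3)%N))); apply: sgE => z.
  by rewrite /coord3/=; ring.
have h3 : {ae L6, forall z, f (refl13 0 1 z.1, z.2) = f z}.
  apply: vpmin_refl13 => //; apply: etrans (fc (Ordinal (isT : (2 < 3)%N))); apply: sgE => z.
  by rewrite /coord3/=; ring.
(* Each almost-everywhere identity is transported along the reflections applied before it, which
   preserve null sets. *)
have h32 := mscaling_ae m2 h3; have h321 := mscaling_ae m1 h32; have h21 := mscaling_ae m1 h2.
apply: ae_imp2 h321 (ae_imp2 (fun z a b => conj a b) h21 h1) => z e1 [e2 e3].
have E (x : R3 R) : (((-1) * x.1.1, (-1) * x.1.2), (-1) * x.2) = refl13 0 1 (refl12 0 1 (refl12 1 0 x)).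
  by case: x => [[a b] c]; rewrite /refl12 /refl13/=; congr ((_, _), _); ring.
by rewrite E; exact: (etrans e1 (etrans e2 e3)).
Qed.

(** The sign of an odd function times the even function [f] is carried to its opposite by the
    central symmetry, which preserves the measure. *)
Lemma even_balanced f (l : R3 R -> R) : 0 < lam -> vmin f -> centered f -> measurable_fun setT l ->
  (forall x, l (((-1) * x.1.1, (-1) * x.1.2), (-1) * x.2) = - l x) ->
  rint L6 (fun z => Num.sg (l z.1) * f z) = 0.
Proof.
have N0 (x : R) : 1 * x = -1 * x -> x = 0 by lra.
move=> lam0 fmin fc ml lN; have ev := centered_even lam0 fmin fc.
have [[mf f0 [i_f fM] _ _] _] := fmin.
have mlz : measurable_fun setT (fun z : Z => l z.1) by exact: (measurableT_comp ml measurable_fst).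
have n1 : `|(-1 : R)| = 1 by rewrite normrN1.
have mS := mscaling_leb6 ler01 (@mscaling_leb3_flip R (((-1), (-1)), (-1)) n1 n1 n1).
have isg := rintegrable_sg i_f f0 mlz.
have [iS eS] := rint_mscaling ler01 mS isg.
have hN := rint_ae_eq (rintegrable_meas iS) (rintegrable_meas (rintegrableZ (-1) isg)).
have aeN : {ae L6, forall z : Z, Num.sg (l (((-1) * z.1.1.1, (-1) * z.1.1.2), (-1) * z.1.2)) *
    f ((((-1) * z.1.1.1, (-1) * z.1.1.2), (-1) * z.1.2), z.2) = -1 * (Num.sg (l z.1) * f z)}.
  by apply: ae_imp ev => z ->; rewrite lN sgrN; ring.
exact: (N0 _ (etrans (esym eS) (etrans (hN _ aeN) (rintZ (-1) isg)))).
Qed.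

(** Although [f] is invariant only almost everywhere, an integral of it is invariant at every point.
    This pointwise form is required by [radial_of_reflections]. *)
Lemma field_invariant (f : Z -> R) (th : R3 R -> R3 R) : measurable_fun setT f -> (forall z, 0 <= f z) ->
  mscaling L3 L3 1 th -> (forall x y, sqnorm3 (th x - th y) = sqnorm3 (x - y)) ->
  {ae L6, forall z, f (th z.1, z.2) = f z} ->
  forall x, field f (@K3 R) (th x) = field f (@K3 R) x.
Proof.
move=> mf f0 mth iso hf x; have [mT iT] := mscaling_leb6 ler01 mth.
have ms y : measurable_fun setT (fun z : Z => (f z * K3 (y - z.1))%:E).
  apply/measurable_EFinP; apply: measurable_funM => //.
  by apply: (measurableT_comp measurable_K3); apply: measurable_sub3.
have s0 y (z : Z) : (0 <= (f z * K3 (y - z.1))%:E :> \bar R)%E by rewrite lee_fin mulr_ge0// K3_ge0.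
have := iT _ (ms (th x)) (s0 (th x)); rewrite mul1e /field => <- /=.
apply: ge0_ae_eq_integral => //.
- exact: (measurableT_comp (ms (th x)) mT).
- exact: (ms x).
- by apply: ae_imp hf => z /= -> _; rewrite /K3 /enorm3 iso.
Qed.

Lemma field_radial f : 0 < lam -> vmin f -> centered f ->
  forall x, field f (@K3 R) x = field f (@K3 R) ((0, 0), enorm3 x).
Proof.
move=> lam0 fmin fc; have [[mf f0 _ _ _] _] := fmin.
apply: radial_of_reflections => a b x ab.
  apply: field_invariant => //; first exact: mscaling_leb3_refl12.
    by move=> u v; rewrite refl12B sqnorm3_refl12.
  apply: vpmin_refl12 => //; apply: (even_balanced lam0 fmin fc (measurable_lin12 a b)).
  by move=> u /=; ring.
apply: field_invariant => //; first exact: mscaling_leb3_refl13.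
  by move=> u v; rewrite refl13B sqnorm3_refl13.
apply: vpmin_refl13 => //; apply: (even_balanced lam0 fmin fc (measurable_lin13 a b)).
by move=> u /=; ring.
Qed.

End symmetry.

(** * Uniqueness of radial solutions *)

Section shell_uniqueness.
Context d (X : measurableType d) (R : realType) (m : {sigma_finite_measure set X -> \bar R}).

(** The operator with kernel [T] contracts the norm with weight [w] by the factor one half, so a
    function bounded by its own image and of finite norm has norm zero. *)
Lemma volterra_null (u w : X -> R) (T : X * X -> R) :
  measurable_fun setT u -> measurable_fun setT w -> measurable_fun setT T ->
  (forall x, 0 <= u x) -> (forall x, 0 <= w x) -> (forall z, 0 <= T z) ->
  (forall x, ((u x)%:E <= \int[m]_y (T (x, y) * u y)%:E)%E) ->
  (forall y, (\int[m]_x (w x * T (x, y))%:E <= (2^-1 * w y)%:E)%E) ->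
  (\int[m]_x (w x * u x)%:E < +oo)%E -> (\int[m]_x (w x * u x)%:E = 0)%E.
Proof.
move=> mu_ mw mT u0 w0 T0 uT wT wfin.
have I0 : (0 <= \int[m]_x (w x * u x)%:E)%E by apply: integral_ge0 => x _; rewrite lee_fin mulr_ge0.
have mF : measurable_fun setT (fun z : X * X => (w z.1 * T z * u z.2)%:E).
  apply/measurable_EFinP; apply: measurable_funM; first apply: measurable_funM => //.
    exact: (measurableT_comp mw measurable_fst).
  exact: (measurableT_comp mu_ measurable_snd).
have F0 (z : X * X) : (0 <= (w z.1 * T z * u z.2)%:E :> \bar R)%E by rewrite lee_fin !mulr_ge0.
have mTu x : measurable_fun setT (fun y => (T (x, y) * u y)%:E).
  by apply/measurable_EFinP; apply: measurable_funM => //; exact: (measurableT_comp mT (pair1_measurable x)).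
have mwT y : measurable_fun setT (fun x => (w x * T (x, y))%:E).
  by apply/measurable_EFinP; apply: measurable_funM => //; exact: (measurableT_comp mT (pair2_measurable y)).
have h1 : (\int[m]_x (w x * u x)%:E <= \int[m]_x \int[m]_y (w x * T (x, y) * u y)%:E)%E.
  apply: ge0_le_integral; [exact: measurableT| | | |].
  - by move=> x _; rewrite lee_fin mulr_ge0.
  - by apply/measurable_EFinP; exact: measurable_funM.
  - exact: (@measurable_fun_fubini_tonelli_F _ _ _ _ _ m _ mF F0).
  - move=> x _; under eq_integral do rewrite -mulrA EFinM.
    rewrite (ge0_integralZl_EFin _ measurableT) ?w0//; last by move=> y _; rewrite lee_fin mulr_ge0.
    by rewrite EFinM lee_wpmul2l// lee_fin.
have h2 : (\int[m]_x \int[m]_y (w x * T (x, y) * u y)%:E = \int[m]_y \int[m]_x (w x * T (x, y) * u y)%:E)%E.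
  exact: (@fubini_tonelli _ _ _ _ _ m m _ mF F0).
have h3 : (\int[m]_y \int[m]_x (w x * T (x, y) * u y)%:E <= \int[m]_y (2^-1 * (w y * u y))%:E)%E.
  apply: ge0_le_integral; [exact: measurableT| | | |].
  - by move=> y _; apply: integral_ge0 => x _; exact: (F0 (x, y)).
  - exact: (@measurable_fun_fubini_tonelli_G _ _ _ _ _ m _ mF F0).
  - by apply/measurable_EFinP; apply: measurable_funM => //; exact: measurable_funM.
  - move=> y _; under eq_integral do rewrite mulrC EFinM.
    rewrite (ge0_integralZl_EFin _ measurableT) ?u0//; last by move=> x _; rewrite lee_fin mulr_ge0.
    by rewrite mulrA mulrC EFinM lee_wpmul2l// lee_fin.
have h4 : (\int[m]_y (2^-1 * (w y * u y))%:E = (2^-1)%:E * \int[m]_x (w x * u x)%:E)%E.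
  under eq_integral do rewrite EFinM.
  rewrite (ge0_integralZl_EFin _ measurableT)//; first by move=> y _; rewrite lee_fin mulr_ge0.
  by apply/measurable_EFinP; exact: measurable_funM.
have : (\int[m]_x (w x * u x)%:E <= (2^-1)%:E * \int[m]_x (w x * u x)%:E)%E.
  by rewrite -h4; apply: le_trans h1 _; rewrite h2.
move: wfin I0; case: (\int[m]_x (w x * u x)%:E)%E => [r _|//|//]; rewrite -EFinM !lee_fin => r0 r1.
by congr (_%:E); lra.
Qed.

(** The contraction gives [u = 0] almost everywhere; the integral inequality, used once more,
    extends this to every point. *)
Lemma volterra_eq0 (u w : X -> R) (T : X * X -> R) :
  measurable_fun setT u -> measurable_fun setT w -> measurable_fun setT T ->
  (forall x, 0 <= u x) -> (forall x, 0 < w x) -> (forall z, 0 <= T z) ->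
  (forall x, ((u x)%:E <= \int[m]_y (T (x, y) * u y)%:E)%E) ->
  (forall y, (\int[m]_x (w x * T (x, y))%:E <= (2^-1 * w y)%:E)%E) ->
  (\int[m]_x (w x * u x)%:E < +oo)%E -> forall x, u x = 0.
Proof.
move=> mu_ mw mT u0 w0 T0 uT wT wfin x.
have w0' y : 0 <= w y by exact: ltW.
have mwu : measurable_fun setT (fun x => w x * u x) by exact: measurable_funM.
have iwu : rintegrable m (fun x => w x * u x).
  by apply: rintegrable_ge0 => // y; rewrite mulr_ge0.
have wu0 : rint m (fun x => w x * u x) <= 0 by rewrite /rint (volterra_null mu_ mw mT u0 w0' T0 uT wT wfin).
have ae0 : {ae m, forall y, u y = 0}.
  have aeW0 : {ae m, forall y, 0 <= w y * u y} by apply: aeW => y; rewrite mulr_ge0.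
  apply: ae_imp (rint_ge0_eq0 iwu aeW0 wu0) => y /eqP.
  by rewrite mulf_eq0 gt_eqF//= => /eqP.
apply/eqP; rewrite eq_le u0 andbT -lee_fin; apply: le_trans (uT x) _.
rewrite (@ge0_ae_eq_integral _ _ _ m setT _ (cst 0%E))//; first by rewrite integral0.
- by apply/measurable_EFinP; apply: measurable_funM => //; exact: (measurableT_comp mT (pair1_measurable x)).
- by move=> y _; rewrite lee_fin mulr_ge0.
- by apply: ae_imp ae0 => y -> _; rewrite mulr0.
Qed.

Variables (r : X -> R) (M s0 : R) (G : R -> R).
Hypotheses (mr : measurable_fun setT r) (M0 : 0 < M) (s00 : 0 < s0).
Hypothesis G0 : forall s, s <= s0 -> G s = 0.
Hypothesis Glip : forall S, exists2 L, 0 < L & forall s t, s <= S -> t <= S -> `|G s - G t| <= L * `|s - t|.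
Hypothesis rfin : forall W, (m [set x | (r x < W)%R] < +oo)%E.
Hypothesis weight : forall C W, 0 < C -> 0 < W -> exists w : X -> R, [/\ measurable_fun setT w,
  forall x, 0 < w x, exists B, forall x, r x < W -> w x <= B &
  forall y, r y < W -> (\int[m]_x (w x * (C * (r x < r y)%R%:R))%:E <= (2^-1 * w y)%:E)%E].

(** Newton's theorem read as an integral equation, on an abstract space with a radius [r]. Points of
    radius zero are left out, since the junk value of the inverse would distort the kernel there. *)
Definition shell_solution (rh V : X -> R) := [/\ rintegrable m rh /\ rint m rh = M,
  measurable_fun setT V, forall y, 0 <= rh y, forall y, 0 < r y -> rh y = G (V y) &
  forall x, 0 < r x -> V x = rint m (fun y => rh y * (Num.max (r x) (r y))^-1)].

Lemma shell_integrable rh V x : shell_solution rh V -> 0 < r x ->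
  rintegrable m (fun y => rh y * (Num.max (r x) (r y))^-1).
Proof.
move=> [[ir _] mV rh0 _ _] rx.
have le y : 0 <= (Num.max (r x) (r y))^-1 <= (r x)^-1.
  have mx : 0 < Num.max (r x) (r y) by rewrite lt_max rx.
  by rewrite invr_ge0 (ltW mx)/= lef_pV2 ?posrE// le_max lexx.
apply: (@rintegrable_le _ _ _ _ _ (fun y => (r x)^-1 * rh y)); last exact: rintegrableZ.
  apply: measurable_funM; first exact: (rintegrable_meas ir).
  by apply: (measurableT_comp measurable_invr); exact: measurable_maxr.
move=> y; have /andP[l1 l2] := le y; rewrite ger0_norm ?mulr_ge0// mulrC.
exact: ler_wpM2r.
Qed.

Lemma shell_bound rh V x : shell_solution rh V -> 0 < r x -> 0 <= V x <= M / r x.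
Proof.
move=> S rx; have iS := shell_integrable S rx; have [[ir rM] mV rh0 _ VE] := S.
have mx y : 0 < Num.max (r x) (r y) by rewrite lt_max rx.
rewrite (VE x rx); apply/andP; split.
  by apply: fine_ge0; apply: integral_ge0 => y _; rewrite lee_fin mulr_ge0// invr_ge0 ltW.
rewrite mulrC -rM -(rintZ (r x)^-1 ir); apply: rint_le => //; first exact: rintegrableZ.
move=> y; rewrite mulrC; apply: ler_wpM2r; first exact: rh0.
by rewrite lef_pV2 ?posrE// le_max lexx.
Qed.

(** The equal masses allow $M/r$ to be subtracted from both potentials: the kernel
    $1/\max(r(x),r(y))-1/r(x)$ vanishes unless $r(y)>r(x)$. The equation for the difference thus
    runs inwards from the region where both densities vanish. *)
Lemma shell_unique rh0 V0 rh1 V1 : shell_solution rh0 V0 -> shell_solution rh1 V1 ->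
  forall x, 0 < r x -> V0 x = V1 x.
Proof.
move=> S0 S1 x rx.
have [[ir0 rM0] mV0 rh00 rG0 VE0] := S0; have [[ir1 rM1] mV1 rh10 rG1 VE1] := S1.
(* From radius [W] on, the bound $V\le M/r$ puts both potentials below [s0], so the densities
   vanish; the summand [r x] keeps [x] inside. At radii at least [eps], both the potentials and the
   kernel are bounded. *)
pose W := M / s0 + r x; pose eps := r x.
have W0 : 0 < W by rewrite addr_gt0// divr_gt0.
have [L L0 HL] := Glip (M / eps).
have [C C0 CE] : exists2 C, 0 < C & C = L / eps by exists (L / eps) => //; rewrite divr_gt0.
have [w [mw w0 [B hB] hw]] := weight C0 W0.
pose T (z : X * X) : R := C * (r z.1 < r z.2)%R%:R * (r z.2 < W)%R%:R.
pose u (y : X) : R := (eps <= r y)%R%:R * `|V0 y - V1 y|.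
have mT : measurable_fun setT T.
  have m1 : measurable_fun setT (fun z : X * X => r z.1) by exact: (measurableT_comp mr measurable_fst).
  have m2 : measurable_fun setT (fun z : X * X => r z.2) by exact: (measurableT_comp mr measurable_snd).
  apply: measurable_funM; first apply: measurable_funM => //.
    by apply: (measurableT_comp (f := fun b : bool => b%:R : R)) => //; exact: measurable_fun_ltr.
  by apply: (measurableT_comp (f := fun b : bool => b%:R : R)) => //; exact: measurable_fun_ltr.
have mH : measurable_fun setT (fun y => `|V0 y - V1 y|).
  by apply: measurableT_comp => //; exact: measurable_funB.
have mu_ : measurable_fun setT u.
  apply: measurable_funM => //.
  by apply: (measurableT_comp (f := fun b : bool => b%:R : R)) => //; exact: measurable_fun_ler.
have u0 y : 0 <= u y by rewrite mulr_ge0.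
have T0 z : 0 <= T z by rewrite /T !mulr_ge0// ltW.
have eps0 : 0 < eps by [].
have Me0 : 0 <= M / eps by rewrite divr_ge0// ltW.
have Vle y : eps <= r y -> [/\ V0 y <= M / eps, V1 y <= M / eps & `|V0 y - V1 y| <= M / eps].
  move=> ey; have ry : 0 < r y by exact: lt_le_trans ey.
  have /andP[a0 a1] := shell_bound S0 ry; have /andP[b0 b1] := shell_bound S1 ry.
  have le : M / r y <= M / eps by rewrite ler_pM2l// lef_pV2 ?posrE.
  split; [exact: le_trans le|exact: le_trans le|].
  rewrite ler_norml; apply/andP; split; lra.
have rh_out y : W <= r y -> rh0 y = 0 /\ rh1 y = 0.
  move=> Wy; have ry : 0 < r y by exact: lt_le_trans Wy.
  have /andP[_ a1] := shell_bound S0 ry; have /andP[_ b1] := shell_bound S1 ry.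
  have le : M / r y <= s0.
    rewrite ler_pdivrMr// -ler_pdivrMl// mulrC; apply: le_trans Wy; rewrite /W lerDl.
    exact: ltW.
  by rewrite rG0// rG1// !G0//; [exact: le_trans le|exact: le_trans le].
have iTu z : rintegrable m (fun y => T (z, y) * u y).
  have fW : rintegrable m (fun y => C * (M / eps) * \1_[set x | (r x < W)%R] y).
    apply: rintegrableZ; apply: rintegrable_ge0 => //.
      apply: measurable_indic; rewrite -[X in measurable X]setTI.
      exact: measurable_fun_ltr.
    rewrite integral_indic// ?setIT; first exact: rfin.
    by rewrite -[X in measurable X]setTI; exact: measurable_fun_ltr.
  apply: rintegrable_le fW.
    by apply: measurable_funM => //; exact: (measurableT_comp mT (pair1_measurable z)).
  move=> y; have Tu0 : 0 <= T (z, y) * u y by exact: mulr_ge0.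
  rewrite (ger0_norm Tu0) /T /u indicE/=.
  have [ey|ey] := leP eps (r y); last by rewrite mul0r mulr0; apply: mulr_ge0 => //; apply: mulr_ge0 => //; exact: ltW.
  have [_ _ Hy] := Vle y ey.
  rewrite mul1r; have [Wy|Wy] := ltP (r y) W; last first.
    by rewrite mulr0 mul0r; apply: mulr_ge0 => //; apply: mulr_ge0 => //; exact: ltW.
  by rewrite mem_set//= !mulr1 -mulrA ler_pM2l//; case: (r z < r y)%R; rewrite ?mul1r ?mul0r.
have uT z : ((u z)%:E <= \int[m]_y (T (z, y) * u y)%:E)%E.
  rewrite (rintE (iTu z)) lee_fin /u; have [ez|ez] := leP eps (r z); last first.
    by rewrite mul0r; apply: fine_ge0; apply: integral_ge0 => y _; rewrite lee_fin mulr_ge0.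
  have rz : 0 < r z by exact: lt_le_trans ez.
  have i0 := shell_integrable S0 rz; have i1 := shell_integrable S1 rz.
  have j0 := rintegrableZ (r z)^-1 ir0; have j1 := rintegrableZ (r z)^-1 ir1.
  (* The subtracted terms contribute [(r z)^-1] times the difference of the masses, which is
     zero. *)
  have E : V0 z - V1 z = rint m (fun y => (rh0 y * (Num.max (r z) (r y))^-1 - rh1 y * (Num.max (r z) (r y))^-1) -
      ((r z)^-1 * rh0 y - (r z)^-1 * rh1 y)).
    rewrite rintB; [|exact: rintegrableB|exact: rintegrableB].
    by rewrite (rintB i0 i1) (rintB j0 j1) (rintZ _ ir0) (rintZ _ ir1) rM0 rM1 subrr subr0 -VE0// -VE1.
  have iD := rintegrableB (rintegrableB i0 i1) (rintegrableB j0 j1).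
  have Dle y : `|(rh0 y * (Num.max (r z) (r y))^-1 - rh1 y * (Num.max (r z) (r y))^-1) -
      ((r z)^-1 * rh0 y - (r z)^-1 * rh1 y)| <= T (z, y) * ((eps <= r y)%R%:R * `|V0 y - V1 y|).
    have -> : (rh0 y * (Num.max (r z) (r y))^-1 - rh1 y * (Num.max (r z) (r y))^-1) -
      ((r z)^-1 * rh0 y - (r z)^-1 * rh1 y) = (rh0 y - rh1 y) * ((Num.max (r z) (r y))^-1 - (r z)^-1).
      by move: (Num.max _ _)^-1 (r z)^-1 (rh0 y) (rh1 y) => a b c e; ring.
    rewrite /T /=; have [zy|zy] := ltP (r z) (r y); last first.
      by rewrite subrr mulr0 normr0 mulr0 !mul0r.
    have ry : 0 < r y by exact: lt_trans zy.
    have ey : eps <= r y by apply: le_trans ez (ltW zy).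
    have [Wy|Wy] := ltP (r y) W; last first.
      by have [-> ->] := rh_out y Wy; rewrite subrr mul0r normr0 mulr0 mul0r.
    rewrite ey mul1r !mulr1 normrM.
    have [v0 v1 _] := Vle y ey; have := HL _ _ v0 v1; rewrite -rG0// -rG1// => hL.
    have k1 : `|(r y)^-1 - (r z)^-1| <= eps^-1.
      have h1 : (r y)^-1 <= (r z)^-1 by rewrite lef_pV2 ?posrE// ltW.
      have h2 : 0 <= (r y)^-1 by rewrite invr_ge0 ltW.
      have h3 : (r z)^-1 <= eps^-1 by rewrite lef_pV2 ?posrE.
      rewrite ler_norml; apply/andP; split; lra.
    have -> : C * `|V0 y - V1 y| = L * `|V0 y - V1 y| * eps^-1.
      by rewrite CE; move: `|_| => a; rewrite mulrAC.
    exact: ler_pM.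
  rewrite mul1r E ler_norml; apply/andP; split.
    have iN := rintegrableZ (-1) (iTu z).
    have := rintZ (-1) (iTu z); rewrite mulN1r => <-; apply: rint_le => // y.
    by have := Dle y; rewrite ler_norml mulN1r => /andP[].
  by apply: rint_le => // y; have := Dle y; rewrite ler_norml => /andP[].
have wT y : (\int[m]_x (w x * T (x, y))%:E <= (2^-1 * w y)%:E)%E.
  rewrite /T/=; have [Wy|Wy] := ltP (r y) W; last first.
    rewrite integral0_eq ?lee_fin ?mulr_ge0 ?(ltW (w0 y))// => z _.
    by rewrite !mulr0.
  by under eq_integral do rewrite mulr1; exact: hw.
(* The weight is controlled only where [r] is less than [W]; the vanishing of [u] beyond makes
   [w * u] integrable. *)
have uW y : W <= r y -> u y = 0.
  move=> Wy; apply/eqP; rewrite eq_le u0 andbT -lee_fin; apply: le_trans (uT y) _.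
  rewrite integral0_eq// => z _; rewrite /T/=.
  have [yz|yz] := ltP (r y) (r z); last by rewrite mulr0 !mul0r.
  by rewrite ltNge (le_trans Wy (ltW yz)) mulr0 mul0r.
have wufin : (\int[m]_x (w x * u x)%:E < +oo)%E.
  have xW : r x < W by rewrite /W ltrDr divr_gt0.
  have B0 : 0 <= B by exact: (le_trans (ltW (w0 x)) (hB x xW)).
  have fW : rintegrable m (fun y => B * (M / eps) * \1_[set x | (r x < W)%R] y).
    apply: rintegrableZ; apply: rintegrable_ge0 => //.
      apply: measurable_indic; rewrite -[X in measurable X]setTI.
      exact: measurable_fun_ltr.
    rewrite integral_indic// ?setIT; first exact: rfin.
    by rewrite -[X in measurable X]setTI; exact: measurable_fun_ltr.
  apply: rintegrable_lty; first by move=> y; rewrite mulr_ge0// ltW.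
  apply: rintegrable_le fW; first exact: measurable_funM.
  move=> y; have wu0 : 0 <= w y * u y by rewrite mulr_ge0// ltW.
  rewrite (ger0_norm wu0) indicE.
  have [Wy|Wy] := ltP (r y) W; last first.
    by rewrite uW// mulr0; apply: mulr_ge0 => //; exact: mulr_ge0.
  rewrite mem_set//= mulr1; apply: ler_pM => //; [exact: ltW|exact: hB|rewrite /u].
  have [ey|ey] := leP eps (r y); last by rewrite mul0r.
  by have [_ _ Hy] := Vle y ey; rewrite mul1r.
have := volterra_eq0 mu_ mw mT u0 w0 T0 uT wT wufin x.
by rewrite /u lexx mul1r => /eqP; rewrite normr_eq0 subr_eq0 => /eqP.
Qed.

End shell_uniqueness.

Section exponential_weight.
Context {R : realType}.
Notation mu := (@lebesgue_measure R).
Notation L3 := (@leb3 R).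

Lemma enorm3_lt (x y : R3 R) : (enorm3 x < enorm3 y) = (sqnorm3 x < sqnorm3 y).
Proof.
have [y0|y0] := ltP 0 (sqnorm3 y); first exact: ltr_sqrt.
rewrite /enorm3 [in LHS](ler0_sqrtr y0) !ltNge sqrtr_ge0/=.
by rewrite (le_trans y0 (sqnorm3_ge0 x)).
Qed.

Lemma enorm3_ball_fin (W : R) : (L3 [set x | (enorm3 x < W)%R] < +oo)%E.
Proof.
apply: (le_lt_trans _ (cube3_fin W)); apply: le_measure.
- by rewrite inE -[X in measurable X]setTI; apply: measurable_fun_ltr => //; exact: measurable_enorm3.
- by rewrite inE; exact: measurable_cube3.
move=> x /= xW; rewrite /cube3/= norm3_le.
have W0 : 0 <= W by exact: (le_trans (enorm3_ge0 x) (ltW xW)).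
have le (t : R) : t ^+ 2 <= sqnorm3 x -> `|t| <= W.
  move=> h; apply: le_trans (ltW xW); rewrite -sqrtr_sqr /enorm3; exact: ler_wsqrtr.
by apply/and3P; split; apply: le; rewrite /sqnorm3; have := sqr_ge0 x.1.1; have := sqr_ge0 x.1.2;
  have := sqr_ge0 x.2; move: (_ ^+ 2) (_ ^+ 2) (_ ^+ 2) => a b c; lra.
Qed.

Lemma integral_exp_le (N W s : R) : 0 < N -> 0 < W -> 0 <= s -> s <= W ^+ 2 ->
  (\int[mu]_q ((2 * Num.sqrt q)%:E * (expR (N * q) * (q < s)%R%:R)%:E) <= (2 * W / N * expR (N * s))%:E)%E.
Proof.
move=> N0 W0 s0 sW.
have me : measurable_fun setT (fun q : R => expR (N * q)).
  by apply: (measurableT_comp (@measurable_expR R)); exact: measurable_funM.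
have mlt : measurable_fun setT (fun q : R => (q < s)%R%:R : R).
  by apply: (measurableT_comp (f := fun b : bool => b%:R : R)) => //; exact: measurable_fun_ltr.
have der (q : R) : is_derive q (1 : R) (fun q => 2 * W / N * expR (N * q)) (2 * W * expR (N * q)).
  have h1 := is_derive_affine 0 N q.
  have h2 : is_derive q (1 : R) (fun t => 0 + N * t) N by [].
  have h3 := @is_derive1_comp R (@expR R) (fun t => 0 + N * t) q _ _ (is_derive_expR _) h2.
  have h4 := @is_deriveZ R R^o R^o _ (2 * W / N) q 1 _ h3.
  have -> : (fun q => 2 * W / N * expR (N * q)) = (2 * W / N) \*: (expR \o (fun t => 0 + N * t)).
    by apply/funext => t /=; rewrite add0r.
  apply: is_derive_eq; rewrite /GRing.scale/= add0r.
  by move: (expR _) => E; field; rewrite gt_eqF.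
have cont (q : R) : {for q, continuous (fun q : R => 2 * W * expR (N * q))}.
  have := is_derive_continuous (der q) => h.
  have -> : (fun q : R => 2 * W * expR (N * q)) = (fun q : R => N * (2 * W / N * expR (N * q))).
    by apply/funext => t; move: (expR _) => E; field; rewrite gt_eqF.
  by apply: cvgM => //; exact: cvg_cst.
have FE : (\int[mu]_(q in `[0%R, s]) (2 * W * expR (N * q))%:E = (2 * W / N * expR (N * s) - 2 * W / N * expR (N * 0))%:E)%E.
  exact: (FTC2_is_derive s0 (fun q _ => der q) (fun q _ => cont q)).
apply: (@le_trans _ _ (\int[mu]_(q in `[0%R, s]) (2 * W * expR (N * q))%:E)%E); last first.
  by rewrite FE lee_fin gerBl mulr_ge0 ?expR_ge0// divr_ge0 ?mulr_ge0// ltW.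
rewrite [leRHS]integral_mkcond; apply: ge0_le_integral => //.
- apply: emeasurable_funM; apply/measurable_EFinP; apply: measurable_funM => //.
  exact: measurable_sqrtr.
- apply/(measurable_restrictT _ _).1 => //; apply: measurable_funTS; apply/measurable_EFinP.
  exact: measurable_funM.
- move=> q _; rewrite patchE -EFinM.
  have [qs|qs] := ltP q s; last first.
    by rewrite !mulr0; case: ifP => // _; rewrite lee_fin !mulr_ge0 ?expR_ge0// ltW.
  have [q0|q0] := ltP 0 q; last first.
    rewrite (ler0_sqrtr q0) mulr0 mul0r; case: ifP => // _; rewrite lee_fin !mulr_ge0 ?expR_ge0//.
    exact: ltW.
  rewrite mem_set; last by rewrite /= in_itv/= !ltW.
  rewrite lee_fin mulr1; apply: ler_wpM2r; first exact: expR_ge0.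
  apply: ler_wpM2l => //; rewrite -[leRHS]ger0_norm ?(ltW W0)// -sqrtr_sqr; apply: ler_wsqrtr.
  exact: (le_trans (ltW qs)).
Qed.

(** The weight grows like $\exp(N|x|^2)$. In the variable $q=|x|^2$ the volume density is at most a
    multiple of [W], and integrating the exponential gains a factor $1/N$. *)
Lemma radial_weight (C W : R) : 0 < C -> 0 < W -> exists w : R3 R -> R, [/\ measurable_fun setT w,
  forall x, 0 < w x, exists B, forall x, enorm3 x < W -> w x <= B &
  forall y, enorm3 y < W -> (\int[L3]_x (w x * (C * (enorm3 x < enorm3 y)%R%:R))%:E <= (2^-1 * w y)%:E)%E].
Proof.
(* The value of [N] makes [C * disc_area * (2 * W / N)] equal to one half. *)
move=> C0 W0; have c0 := @disc_area_gt0 R; pose N := 4 * C * disc_area * W.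
have N0 : 0 < N by rewrite !mulr_gt0.
exists (fun x => expR (N * sqnorm3 x)); split.
- apply: (measurableT_comp (@measurable_expR R)); apply: measurable_funM => //; exact: measurable_sqnorm3.
- by move=> x; exact: expR_gt0.
- exists (expR (N * W ^+ 2)) => x xW; rewrite ler_expR ler_pM2l// -enorm3_sqr.
  by rewrite ler_sqr ?nnegrE ?enorm3_ge0 ?ltW.
move=> y yW.
pose H (q : R) : \bar R := (expR (N * q) * (q < sqnorm3 y)%R%:R)%:E.
have mH : measurable_fun setT H.
  apply/measurable_EFinP; apply: measurable_funM.
    by apply: (measurableT_comp (@measurable_expR R)); exact: measurable_funM.
  by apply: (measurableT_comp (f := fun b : bool => b%:R : R)) => //; exact: measurable_fun_ltr.
have H0 t : (0 <= H t)%E by rewrite lee_fin mulr_ge0 ?expR_ge0.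
have -> : (\int[L3]_x (expR (N * sqnorm3 x) * (C * (enorm3 x < enorm3 y)%R%:R))%:E =
    C%:E * \int[L3]_x H (sqnorm3 x))%E.
  rewrite -(ge0_integralZl_EFin _ measurableT) ?(ltW C0)//.
    by apply: eq_integral => x _; rewrite enorm3_lt /H -EFinM mulrCA.
  exact: (measurableT_comp mH (@measurable_sqnorm3 R)).
rewrite (integral_radial mH H0).
have yW2 : sqnorm3 y <= W ^+ 2 by rewrite -enorm3_sqr ler_sqr ?nnegrE ?enorm3_ge0 ?ltW.
have h := integral_exp_le N0 W0 (sqnorm3_ge0 y) yW2.
apply: (@le_trans _ _ (C%:E * (disc_area%:E * (2 * W / N * expR (N * sqnorm3 y))%:E))%E).
  by rewrite lee_wpmul2l ?lee_fin ?(ltW C0)// lee_wpmul2l ?lee_fin ?(ltW c0).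
rewrite -!EFinM lee_fin; move: (expR _) => E.
rewrite le_eqVlt; apply/orP; left; apply/eqP; rewrite /N; field.
by rewrite !gt_eqF.
Qed.

End exponential_weight.

(** * The density as a function of the potential *)

Section velocity_integral.
Context {R : realType}.
Notation L3 := (@leb3 R).
Variables (k p : R).
Hypotheses (k0 : 0 < k) (p1 : 1 < p).

(** The Euler-Lagrange relation solved for [f], at a point where the potential part [2 lam V - beta]
    equals [s]. *)
Definition vprofile (s : R) (v : R3 R) : R := (Num.max (s - sqnorm3 v / 2) 0 / p) `^ k.

Definition vintegral (s : R) : R := fine (\int[L3]_v (vprofile s v)%:E)%E.

Lemma measurable_vprofile s : measurable_fun setT (vprofile s).
Proof.
apply: measurable_powR_fun; apply: measurable_funM => //; apply: measurable_maxr => //.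
apply: measurable_funB => //; apply: measurable_funM => //; exact: measurable_sqnorm3.
Qed.

Lemma vprofile_ge0 s v : 0 <= vprofile s v. Proof. exact: powR_ge0. Qed.

Lemma vprofile0 s v : s <= sqnorm3 v / 2 -> vprofile s v = 0.
Proof.
move=> sv; rewrite /vprofile max_r; last by rewrite subr_le0.
by rewrite mul0r powR0// gt_eqF.
Qed.

Lemma vintegral_fin1 : (\int[L3]_v (vprofile 1 v)%:E < +oo)%E.
Proof.
have mW : measurable [set v : R3 R | (enorm3 v < 2)%R].
  by rewrite -[X in measurable X]setTI; apply: measurable_fun_ltr => //; exact: measurable_enorm3.
apply: (le_lt_trans _ (@enorm3_ball_fin R 2)).
rewrite -[X in (_ <= _ X)%E]setIT -(integral_indic _ measurableT)//.
apply: ge0_le_integral => //.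
- by move=> v _; rewrite lee_fin vprofile_ge0.
- by apply/measurable_EFinP; exact: measurable_vprofile.
- by apply/measurable_EFinP; exact: measurable_indic.
move=> v _; rewrite lee_fin indicE; have [v2|v2] := ltP (enorm3 v) 2; last first.
  rewrite vprofile0//; have : 2 ^+ 2 <= enorm3 v ^+ 2 by rewrite ler_sqr ?nnegrE ?enorm3_ge0.
  by rewrite enorm3_sqr; lra.
have one : 1 `^ k = 1 :> R by rewrite powR1.
rewrite mem_set//= /vprofile -[leRHS]one; apply: ge0_ler_powR; rewrite ?nnegrE ?(ltW k0)//.
  by rewrite divr_ge0 ?le_max ?lexx ?orbT//; have := p1; lra.
rewrite ler_pdivrMr; last by have := p1; lra.
by rewrite mul1r ge_max; apply/andP; split; have := p1; have := sqnorm3_ge0 v; lra.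
Qed.

(** The substitution $v=\sqrt s\,w$ scales the profile by $s^k$ and the volume by $s^{3/2}$. The
    exponent exceeds one, which is what [vintegral_lip] rests on. *)
Lemma vintegralE s : vintegral s = vintegral 1 * Num.max s 0 `^ (k + 3 / 2).
Proof.
have conv (b : R) (x y : \bar R) : b != 0 -> (y = (b^-1)%:E * x -> x = b%:E * y)%E.
  by move=> b0 ->; rewrite muleA -EFinM divff// mul1e.
have q0 : k + 3 / 2 != 0 by rewrite gt_eqF// addr_gt0.
have [s0|s0] := ltP 0 s; last first.
  rewrite powR0// mulr0 /vintegral integral0_eq// => v _; rewrite vprofile0//.
  by apply: le_trans s0 _; rewrite divr_ge0 ?sqnorm3_ge0.
pose a := Num.sqrt s; have a0 : 0 < a by rewrite sqrtr_gt0.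
have a2 : a ^+ 2 = s by rewrite sqr_sqrtr// ltW.
have mS : mscaling L3 L3 (a ^- 3) (scale3 a).
  have := mscaling_leb3_affine (0 : R3 R) a0; congr (mscaling _ _ _ _).
  by apply/funext => x; rewrite /scale3/= !addr0.
have mv1 : measurable_fun setT (fun v => (vprofile 1 v)%:E) by apply/measurable_EFinP; exact: measurable_vprofile.
have mvs : measurable_fun setT (fun v => (vprofile s v)%:E) by apply/measurable_EFinP; exact: measurable_vprofile.
have E := mS.2 (fun v => (vprofile s v)%:E) mvs (fun v => vprofile_ge0 s v).
have vE v : vprofile s (scale3 a v) = s `^ k * vprofile 1 v.
  have n0 : 0 <= Num.max (1 - sqnorm3 v / 2) 0 / p.
    by rewrite divr_ge0 ?le_max ?lexx ?orbT//; have := p1; lra.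
  rewrite /vprofile -powRM ?(ltW s0)// sqnorm3_scale3 a2; congr (_ `^ _).
  rewrite mulrA maxr_pMr ?(ltW s0)// mulr0; congr (Num.max _ _ / _).
  by rewrite mulrBr mulr1 mulrA.
have E2 : (\int[L3]_v (vprofile s (scale3 a v))%:E = (s `^ k)%:E * \int[L3]_v (vprofile 1 v)%:E)%E.
  under eq_integral do rewrite vE EFinM.
  apply: (ge0_integralZl_EFin L3 measurableT); [|exact: mv1|exact: powR_ge0].
  by move=> v _; rewrite lee_fin vprofile_ge0.
have f1 : (\int[L3]_v (vprofile 1 v)%:E = (vintegral 1)%:E)%E.
  rewrite fineK// ge0_fin_numE ?vintegral_fin1//.
  by apply: integral_ge0 => v _; rewrite lee_fin vprofile_ge0.
have a3 : a ^+ 3 = s `^ (3 / 2).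
  by rewrite -powR_mulrn ?(ltW a0)// /a -powR12_sqrt ?(ltW s0)// -powRrM mulrC.
have a3n : a ^+ 3 != 0 by rewrite expf_neq0// gt_eqF.
have Is : (\int[L3]_v (vprofile s v)%:E = (vintegral 1 * s `^ (k + 3 / 2))%:E)%E.
  rewrite (conv (a ^+ 3) _ _ a3n E) E2 f1 -!EFinM a3 powRD; last by apply/implyP => _; rewrite gt_eqF.
  by congr (_%:E); rewrite [RHS]mulrC mulrA; congr (_ * _); rewrite mulrC.
by rewrite {1}/vintegral Is.
Qed.

Lemma vintegral1_ge0 : 0 <= vintegral 1.
Proof. by apply: fine_ge0; apply: integral_ge0 => v _; rewrite lee_fin vprofile_ge0. Qed.

Lemma powR_lip (q S : R) : 1 < q -> 0 <= S -> forall a b : R, 0 <= a <= S -> 0 <= b <= S ->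
  `|b `^ q - a `^ q| <= q * S `^ (q - 1) * `|b - a|.
Proof.
move=> q1 S0; have q0 : 0 < q by lra.
have one (a b : R) : 0 <= a -> a <= b -> b <= S -> `|b `^ q - a `^ q| <= q * S `^ (q - 1) * `|b - a|.
  move=> a0 ab bS; have b0 : 0 <= b by exact: le_trans ab.
  rewrite [`|b - a|]ger0_norm ?subr_ge0// ger0_norm; last first.
    by rewrite subr_ge0; apply: ge0_ler_powR; rewrite ?nnegrE// ltW.
  apply: le_trans (powR_tangent q1 a0 b0) _; rewrite -mulrA ler_pM2l//.
  apply: ler_wpM2r; first by rewrite subr_ge0.
  by apply: ge0_ler_powR; rewrite ?nnegrE//; lra.
move=> a b /andP[a0 aS] /andP[b0 bS]; have [ab|ab] := leP a b; first exact: one.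
by rewrite distrC [`|b - a|]distrC; apply: one => //; exact: ltW.
Qed.

Lemma vintegral_lip (S : R) : exists2 L, 0 < L & forall s t, s <= S -> t <= S ->
  `|vintegral s - vintegral t| <= L * `|s - t|.
Proof.
have q1 : 1 < k + 3 / 2 by have := k0; lra.
pose S' := Num.max S 0; have S0 : 0 <= S' by rewrite le_max lexx orbT.
have c0 := vintegral1_ge0.
have l0 : 0 <= (k + 3 / 2) * S' `^ (k + 3 / 2 - 1) by rewrite mulr_ge0 ?powR_ge0//; lra.
exists (vintegral 1 * ((k + 3 / 2) * S' `^ (k + 3 / 2 - 1)) + 1).
  by rewrite ltr_wpDl// mulr_ge0.
move=> s t sS tS; rewrite (vintegralE s) (vintegralE t) -mulrBr normrM (ger0_norm c0).
have bnd u : u <= S -> 0 <= Num.max u 0 <= S'.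
  by move=> uS; rewrite le_max lexx orbT/= /S' ge_max !le_max uS lexx orbT.
have h := powR_lip q1 S0 (bnd t tS) (bnd s sS).
have mx : `|Num.max s 0 - Num.max t 0| <= `|s - t|.
  have [s0|s0] := leP s 0; have [t0|t0] := leP t 0 => //.
  - by rewrite subrr normr0.
  - by rewrite sub0r normrN distrC !ger0_norm//; lra.
  - by rewrite subr0 !ger0_norm//; lra.
apply: (@le_trans _ _ (vintegral 1 * ((k + 3 / 2) * S' `^ (k + 3 / 2 - 1)) * `|s - t|)).
  by rewrite -mulrA ler_wpM2l//; apply: le_trans h _; rewrite ler_wpM2l.
by rewrite ler_wpM2r// lerDl.
Qed.

Lemma vintegral_le0 s : s <= 0 -> vintegral s = 0.
Proof. by move=> s0; rewrite vintegralE max_r// powR0 ?mulr0// gt_eqF// addr_gt0. Qed.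

End velocity_integral.

Section radial_shells.
Context {R : realType}.
Notation mu := (@lebesgue_measure R).
Notation L3 := (@leb3 R).
Notation L6 := (@leb6 R).
Notation Z := (R3 R * R3 R)%type.

Lemma origin_null : {ae L3, forall y, y != 0 :> R3 R}.
Proof.
have h : {ae mu, forall t : R, t != 0}.
  exists [set 0]; split => //; first exact: lebesgue_measure_set1.
  by move=> t /= /negP; rewrite negbK => /eqP.
have := @ae_snd _ _ _ _ R (sprod mu mu) mu (fun t : R => t != 0) h.
by apply: ae_imp => y; apply: contra_neq => ->.
Qed.

Lemma field_shell (f : Z -> R) (u : R -> R) : measurable_fun setT f -> (forall z, 0 <= f z) ->
  (\int[L6]_z (f z)%:E < +oo)%E -> measurable_fun setT u -> (forall t, 0 <= u t) ->
  (forall y, rho f y = u (sqnorm3 y)) -> forall h : R, 0 < h ->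
  field f (@K3 R) ((0, 0), h) = (\int[L3]_y (rho f y * (Num.max h (enorm3 y))^-1)%:E)%E.
Proof.
move=> mf f0 ffin mu_ u0 ru h h0.
have -> : field f (@K3 R) ((0, 0), h) = (\int[L3]_y (rho f y * K3 (((0, 0), h) - y))%:E)%E.
  apply: (integral_rho mf f0 ffin (g := fun y => K3 (((0, 0), h) - y))).
    by apply: (measurableT_comp measurable_K3); apply: measurable_sub3.
  by move=> y; exact: K3_ge0.
have mphi : measurable_fun setT (fun t => (u t)%:E) by exact/measurable_EFinP.
have N := newton_shell mphi (fun t => u0 t) h0.
transitivity (\int[L3]_y ((u (sqnorm3 y))%:E * ((enorm3 (((0, 0), h) - y))^-1)%:E))%E.
  by apply: eq_integral => y _; rewrite ru EFinM.
rewrite N; have mrho := measurable_rho mf f0.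
have me := @measurable_enorm3 R.
apply: ge0_ae_eq_integral => //.
- apply: emeasurable_funM; apply/measurable_EFinP.
    exact: (measurableT_comp mu_ (@measurable_sqnorm3 R)).
  apply: measurable_minr => //; exact: (measurableT_comp measurable_invr).
- apply/measurable_EFinP; apply: measurable_funM => //.
  by apply: (measurableT_comp measurable_invr); exact: measurable_maxr.
- by move=> y _; rewrite -EFinM lee_fin mulr_ge0// le_min !invr_ge0 enorm3_ge0 ltW.
- by move=> y _; rewrite lee_fin mulr_ge0 ?rho_ge0// invr_ge0 le_max ltW.
(* The minimum of the inverses is the inverse of the maximum except at the origin, where the inverse
   has its default value. *)
apply: ae_imp origin_null => y; rewrite -enorm3_gt0 => y0 _.
rewrite ru -EFinM; congr (_ * _)%:E.
have [hy|hy] := leP h (enorm3 y).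
  by rewrite min_r// lef_pV2 ?posrE.
by rewrite min_l// lef_pV2 ?posrE// ltW.
Qed.

Variables (k M lam : R).
Hypotheses (hk0 : 0 < k) (hk1 : k < 3 / 2) (hM : 0 < M).
Notation p := (1 + k^-1).
Notation vmin := (vpmin k M lam).
Notation beta := (multiplier L6 kin ker p lam M).

Definition local_density (b s : R) : R := vintegral k p (2 * lam * s - b).

Let p1 : 1 < p. Proof. by rewrite ltrDl invr_gt0. Qed.

Lemma powR_solve (a c : R) : 0 <= a -> p * a `^ (p - 1) = c -> a = (c / p) `^ k.
Proof.
move=> a0 <-; rewrite mulrC mulKf; last by rewrite gt_eqF// (lt_trans _ p1).
have -> : p - 1 = k^-1 by rewrite addrC addKr.
by rewrite -powRrM mulVf ?gt_eqF// powRr1.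
Qed.

Lemma vpmin_profile f : vmin f -> {ae L6, forall z,
  f z = vprofile k p (2 * lam * fine (field f (@K3 R) z.1) - beta f) z.2}.
Proof.
move=> fmin; have [fadm fm] := fmin; have [mf f0 _ _ _] := fadm.
have EL := euler_lagrange (m := L6) (q := ker) (@measurable_kin R) (@kin_ge0 R) (@measurable_ker R) (@ker_ge0 R) (@ker_sym R)
  p1 hM (fun h => @adm_pairing R k M hk0 hk1 h) fadm fm.
apply: ae_imp EL => z; exact: powR_solve.
Qed.

Lemma centered_shell f : 0 < lam -> vmin f -> centered f ->
  exists rh, shell_solution L3 (@enorm3 R) M (local_density (beta f)) rh (fun x => fine (field f (@K3 R) x)).
Proof.
move=> lam0 fmin fc; have [fadm fm] := fmin; have [mf f0 [i_f fM] _ _] := fadm.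
have ffin : (\int[L6]_z (f z)%:E < +oo)%E by rewrite (rintE i_f) ltry.
pose V x := fine (field f (@K3 R) x).
have mV : measurable_fun setT V.
  exact: (measurable_fine_field mf (@measurable_K3 R)).
(* [F] agrees with [f] almost everywhere and generates the same field, but its density is a function
   of [V] at every point, as a radial integral equation needs. *)
pose F (z : Z) := vprofile k p (2 * lam * V z.1 - beta f) z.2.
have F0 z : 0 <= F z by exact: vprofile_ge0.
have mF : measurable_fun setT F.
  apply: measurable_powR_fun; apply: measurable_funM => //; apply: measurable_maxr => //.
  apply: measurable_funB; last exact: (measurable_kin (R := R)).
  have mV1 : measurable_fun setT (fun z : Z => 2 * lam * V z.1).
    exact: (measurable_funM (measurable_cst _) (measurableT_comp mV measurable_fst)).
  exact: (measurable_funB mV1 (measurable_cst _)).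
have fF : {ae L6, forall z, f z = F z} := vpmin_profile fmin.
have Ff : {ae L6, forall z, F z = f z} by apply: ae_imp fF => z ->.
have iF : rintegrable L6 F by exact: (@rintegrable_ae _ _ R L6 F f mF i_f Ff).
have FM : rint L6 F = M by rewrite -fM; exact: (@rint_ae_eq _ _ R L6 F f mF mf Ff).
have Ffin : (\int[L6]_z (F z)%:E < +oo)%E by rewrite (rintE iF) ltry.
have VF x : field f (@K3 R) x = field F (@K3 R) x.
  have ms (h : Z -> R) : measurable_fun setT h -> measurable_fun setT (fun z : Z => (h z * K3 (x - z.1))%:E).
    move=> mh; apply/measurable_EFinP; apply: measurable_funM => //.
    by apply: (measurableT_comp measurable_K3); apply: measurable_sub3.
  apply: ge0_ae_eq_integral; [exact: measurableT|exact: ms|exact: ms| | |].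
  - by move=> z _; rewrite lee_fin mulr_ge0// K3_ge0.
  - by move=> z _; rewrite lee_fin mulr_ge0// K3_ge0.
  - by apply: ae_imp fF => z -> _.
have rE y : rho F y = local_density (beta f) (V y) by [].
have Vr x : field f (@K3 R) x = field f (@K3 R) ((0, 0), enorm3 x) by exact: (field_radial hk0 hk1 lam0 fmin fc).
have mr := measurable_rho mF F0.
pose u (t : R) := rho F ((0, 0), Num.sqrt t).
have mu_ : measurable_fun setT u.
  apply: (measurableT_comp mr); apply/measurable_fun_pair => //; exact: measurable_sqrtr.
have u0 t : 0 <= u t by exact: rho_ge0.
have ru y : rho F y = u (sqnorm3 y) by rewrite /u !rE /V Vr.
have I1 := integral_rho1 mF F0 Ffin.
have rfin : (\int[L3]_x (rho F x)%:E < +oo)%E by rewrite I1.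
have ir := @rintegrable_ge0 _ _ R L3 (rho F) mr (rho_ge0 F0) rfin.
have rM : rint L3 (rho F) = M by rewrite -FM; exact: (congr1 fine I1).
exists (rho F); split.
- exact: (conj ir rM).
- exact: mV.
- exact: (rho_ge0 F0).
- by move=> y _; exact: rE.
move=> x rx; rewrite Vr VF.
exact: (congr1 fine (field_shell mF F0 Ffin mu_ u0 ru rx)).
Qed.

(** A common [beta] gives both potentials the same nonlinearity, which vanishes below
    [beta f / (2 * lam)]. Equal potentials away from the origin then yield equal functions through
    [vpmin_profile]. *)
Lemma centered_unique f g : vmin f -> vmin g -> centered f -> centered g -> {ae L6, forall z, f z = g z}.
Proof.
move=> fmin gmin fc gc.
have [_ lam0] := vpmin_lam hk0 hk1 hM fmin.
have [bf b0] := vpmin_multiplier hk0 hk1 hM fmin; have [bg _] := vpmin_multiplier hk0 hk1 hM gmin.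
have bE : beta f = beta g by rewrite bf bg (vpmin_en fmin gmin).
have [r0 S0] := centered_shell lam0 fmin fc; have [r1 S1] := centered_shell lam0 gmin gc.
rewrite -bE in S1.
have l2 : 0 < 2 * lam by rewrite mulr_gt0.
have G0 s : s <= beta f / (2 * lam) -> local_density (beta f) s = 0.
  by move=> sb; apply: vintegral_le0 => //; rewrite subr_le0 mulrC -ler_pdivlMr.
have Glip S : exists2 L, 0 < L & forall s t, s <= S -> t <= S ->
    `|local_density (beta f) s - local_density (beta f) t| <= L * `|s - t|.
  have [L L0 HL] := vintegral_lip hk0 p1 (2 * lam * S - beta f).
  exists (L * (2 * lam)); first exact: mulr_gt0.
  move=> s t sS tS; apply: le_trans (HL _ _ _ _) _; rewrite ?lerD2r ?ler_pM2l//.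
  by rewrite opprB addrA subrK -mulrBr normrM (gtr0_norm l2) mulrA.
have VE := shell_unique (m := L3) (@measurable_enorm3 R) hM (divr_gt0 b0 l2) G0 Glip (@enorm3_ball_fin R)
  (@radial_weight R) S0 S1.
have on := @ae_fst _ _ _ _ R L3 L3 (fun x => x != 0) origin_null.
apply: ae_imp2 on (ae_imp2 (fun z a b => conj a b) (vpmin_profile fmin) (vpmin_profile gmin)) => z z0 [-> ->].
by rewrite bE VE// enorm3_gt0.
Qed.

Lemma vpmin_unique f g : vmin f -> vmin g -> exists a : R3 R, {ae L6, forall z, g z = f (z.1 + a, z.2)}.
Proof.
move=> fmin gmin.
have [a [fa fac]] := vpmin_center hk0 hk1 hM fmin; have [b [gb gbc]] := vpmin_center hk0 hk1 hM gmin.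
exists (- b + a).
have mS := mscaling_leb6 ler01 (@mscaling_leb3_translation R (- b)).
apply: ae_imp (mscaling_ae mS (centered_unique fa gb fac gbc)) => -[x v] /=.
by rewrite addrNK addrA => ->.
Qed.

End radial_shells.

Theorem theorem3 (R : realType) (k M : R) (hk0 : 0 < k) (hk1 : k < 3 / 2)
  (hM : 0 < M) (f0 f1 : R3 R * R3 R -> R) :
  f0 \in FM k M -> f1 \in FM k M ->
  HC k f0 = ereal_inf (HC k @` FM k M) ->
  HC k f1 = ereal_inf (HC k @` FM k M) ->
  exists a : R3 R,
    {ae @leb6 R, forall z, f1 z = f0 (z.1 + a, z.2)}.
Proof.
move=> /set_mem F0 /set_mem F1 H0 H1; have [lam hlam] := @Epot_DD R.
exact: (vpmin_unique hk0 hk1 hM (vpmin_of_HC hk0 hk1 hlam F0 H0) (vpmin_of_HC hk0 hk1 hlam F1 H1)).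
Qed.
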